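(* Let $\mathcal{B}(\Omega)$ be an $\ell^2$-valued Bergman-type space and let $T\in\mathcal{T}_{\mathrm{BUCO}}$. Then $$\limsup_{\mathfrak{d}(z,0)\to\infty}\left|\left\langle\widetilde{T}(z)e_k,e_i\right\rangle_{\ell^2}\right|=0\quad\text{for all }i,k\in\mathbb{N}$$ if and only if $$\limsup_{\mathfrak{d}(z,0)\to\infty}\|T^zf\|_{\mathcal{B}(\Omega)}=0\quad\text{for every }f\in\mathcal{B}(\Omega).$$ In particular, if the Berezin transform $\widetilde{T}(z)$ vanishes at the boundary of $\Omega$ (that is, $\langle\widetilde{T}(z)e_k,e_i\rangle_{\ell^2}\to0$ as $\mathfrak{d}(z,0)\to\infty$ for all $i,k\in\mathbb{N}$), then $T$ must be compact.
   Context: Notation: $A\lesssim B$ means $A\le CB$ for some constant $C$, and $A\simeq B$ means $A\lesssim B$ and $B\lesssim A$. $\{e_k\}_{k\ge1}$ is the standard orthonormal basis of $\ell^2$. A function $f:\Omega\to\ell^2$ is measurable (analytic) if every $\langle f(\cdot),e_k\rangle_{\ell^2}$ is. $L^2(\Omega,\ell^2;d\sigma)$ has inner product $\int_\Omega\langle f,g\rangle_{\ell^2}d\sigma$. An $\ell^2$-valued Bergman-type space $\mathcal{B}(\Omega)$ is given by the following data and assumptions. (A.1) $\Omega\subset\mathbb{C}^n$ is a connected open set containing $0$; for each $z\in\Omega$ there is an involution $\varphi_z\in\mathrm{Aut}(\Omega)$ with $\varphi_z(0)=z$. (A.2) $\mathfrak{d}$ is a metric on $\Omega$ that is quasi-invariant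 under $\varphi_z$: $\mathfrak{d}(u,v)\simeq\mathfrak{d}(\varphi_z(u),\varphi_z(v))$ with implied constants independent of $u,v\in\Omega$; $(\Omega,\mathfrak{d})$ is separable and its closed balls are compact. $D(z,r)$ is the $\mathfrak{d}$-ball of center $z$ and radius $r$. (A.3) $\sigma$ is a finite Borel measure on $\Omega$. $\mathcal{B}(\Omega)$ is the space of analytic $f:\Omega\to\ell^2$ in $L^2(\Omega,\ell^2;d\sigma)$, and $\mathcal{B}(\Omega,\mathbb{C})$ the space of scalar analytic functions in $L^2(\Omega,\mathbb{C};d\sigma)$, with the inherited norms and inner products. They are reproducing kernel Hilbert spaces: there are $K_z\in\mathcal{B}(\Omega,\mathbb{C})$ with $f(z)=\int_\Omega\overline{K_z(w)}f(w)\,d\sigma(w)$ for all $z\in\Omega$ and all $f$ in $\mathcal{B}(\Omega,\mathbb{C})$ or in $\mathcal{B}(\Omega)$ (coordinatewise integral). $k_z:=K_z/\|K_z\|_{\mathcal{B}(\Omega,\mathbb{C})}$, and $z\mapsto\|K_z\|_{\mathcal{B}(\Omega,\mathbb{C})}$ is continuous on $(\Omega,\mathfrak{d})$. (A.4) $d\lambda(z):=\|K_z\|^2_{\mathcal{B}(\Omega,\mathbb{C})}d\sigma(z)$ satisfies $\lambda(E)\simeq\lambda(\varphi_z(E))$ for every Borel $E\subset\Omega$ with implied constants independent of $z\in\Omega$, and is doubling: $\lambda(D(z,2r))\le C\lambda(D(z,r))$ for all $z\in\Omega$, $r>0$, for some $C>1$. (A.5) $|\langle k_z,k_w\rangle_{\mathcal{B}(\Omega,\mathbb{C})}|\simeq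 1/\|K_{\varphi_z(w)}\|_{\mathcal{B}(\Omega,\mathbb{C})}$ with implied constants independent of $z,w\in\Omega$. (A.6) Either there is $0<\kappa<2$ such that $$\int_\Omega\frac{|\langle K_z,K_w\rangle|^{(r+s)/2}}{\|K_z\|^s\|K_w\|^r}\,d\lambda(w)\le C(r,s)<\infty\quad\text{for all }z\in\Omega$$ (norms and inner products in $\mathcal{B}(\Omega,\mathbb{C})$) for all $r>\kappa>s>0$; or this holds for all $r=s>0$, in which case one sets $\kappa=0$. (A.7) $\|K_z\|_{\mathcal{B}(\Omega,\mathbb{C})}\to\infty$ as $\mathfrak{d}(z,0)\to\infty$. For $e\in\ell^2$, $k_ze$ denotes the function $w\mapsto k_z(w)e$. The translation operator $U_z$ on $\mathcal{B}(\Omega)$ is $U_zf(w)=f(\varphi_z(w))k_z(w)$, and $T^z:=U_zTU_z^*$. The Berezin transform of an operator $T$ on $\mathcal{B}(\Omega)$ is the operator-valued function $\widetilde{T}$ on $\Omega$ with $\langle\widetilde{T}(z)e_k,e_i\rangle_{\ell^2}:=\langle T(k_ze_k),k_ze_i\rangle_{\mathcal{B}(\Omega)}$. $\mathrm{BUCO}$ is the set of bounded, uniformly continuous functions $u:(\Omega,\mathfrak{d})\to(\mathcal{L}(\ell^2),\|\cdot\|_{\mathcal{L}(\ell^2)})$ that are finite: there is $d\in\mathbb{N}$ such that for all $z$, $\langle u(z)e_i,e_k\rangle_{\ell^2}=0$ whenever $i>d$ or $k>d$. $T_u=PM_u$ with $(M_uf)(z)=u(z)f(z)$ and $P$ the orthogonal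 projection of $L^2(\Omega,\ell^2;d\sigma)$ onto $\mathcal{B}(\Omega)$. $\mathcal{T}_{\mathrm{BUCO}}$ is the algebra generated by the Toeplitz operators $T_u$, $u\in\mathrm{BUCO}$, i.e. the operator-norm closure in $\mathcal{L}(\mathcal{B}(\Omega))$ of the set of finite sums of finite products of such $T_u$. *)

(* Defs.v *)
From HB Require Import structures.
From mathcomp Require Import all_boot all_order all_algebra.
From mathcomp Require Import all_classical all_reals all_analysis.
From mathcomp Require Import complex.

Set Implicit Arguments.
Unset Strict Implicit.
Unset Printing Implicit Defensive.

Import Order.TTheory GRing.Theory Num.Theory.
Import numFieldNormedType.Exports.

Local Open Scope classical_set_scope.
Local Open Scope ring_scope.

(* Naming [R[i]] at type [numClosedFieldType] makes its topological and normed
   structures available to unification. *)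
Definition Cplx (R : realType) : numClosedFieldType := R[i].

(* The [R]-valued modulus; the generic [`|x|] would be [Cplx R]-valued. *)
Definition cabs (R : realType) (x : Cplx R) : R := Normc.normc x.

Definition Cspace (R : realType) (n : nat) : normedModType (Cplx R) :=
  'rV[Cplx R]_n.

Definition borel (R : realType) (n : nat) :=
  g_sigma_algebraType (@open (Cspace R n)).

(* A function [d] on an ambient type [X], regarded as a metric on [S] only. *)
Section MetricOnSet.
Context (R : realType) (X : Type) (S : set X) (d : X -> X -> R).

Definition is_metric : Prop :=
  [/\ forall x y, S x -> S y -> 0 <= d x y,
      forall x y, S x -> S y -> (d x y = 0 <-> x = y),
      forall x y, S x -> S y -> d x y = d y x &
      forall x y z, S x -> S y -> S z -> d x z <= d x y + d y z].

Definition mball (x : X) (r : R) : set X := [set y | S y /\ d x y < r].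

Definition mclosed_ball (x : X) (r : R) : set X := [set y | S y /\ d x y <= r].

Definition mopen (U : set X) : Prop :=
  U `<=` S /\ forall x, U x -> exists2 r : R, 0 < r & mball x r `<=` U.

Definition mcompact (A : set X) : Prop :=
  A `<=` S /\
  forall F : set (set X), F `<=` mopen -> A `<=` \bigcup_(U in F) U ->
    exists G : set (set X),
      [/\ finite_set G, G `<=` F & A `<=` \bigcup_(U in G) U].

Definition mseparable : Prop :=
  exists A : set X, [/\ countable A, A `<=` S &
    forall x (r : R), S x -> 0 < r -> exists2 a, A a & d x a < r].

Definition mcomplete : Prop :=
  forall u : nat -> X, (forall k, S (u k)) ->
    (forall e : R, 0 < e -> exists N, forall i j,
       (N <= i)%N -> (N <= j)%N -> d (u i) (u j) < e) ->
    exists2 x, S x & forall e : R, 0 < e -> exists N, forall i,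
       (N <= i)%N -> d (u i) x < e.

End MetricOnSet.

(* Operators on a space [H] (a subspace of an ambient module [E]) with norm
   [nrm] and inner product [ip].  An operator is a function on [E] of which only
   the values on [H] matter. *)
Section Operators.
Context (R : realType) (E : lmodType (Cplx R)) (H : set E).
Context (nrm : E -> R) (ip : E -> E -> Cplx R).

Definition opnorm (A : E -> E) : \bar R :=
  ereal_sup [set (nrm (A x))%:E | x in [set x | H x /\ nrm x <= 1]].

Definition bounded_operator (A : E -> E) : Prop :=
  [/\ forall x, H x -> H (A x),
      forall (c : Cplx R) x y, H x -> H y -> A (c *: x + y) = c *: A x + A y &
      (opnorm A < +oo)%E].

(* The closure in [H] of the image of the unit ball is compact. *)
Definition compact_operator (A : E -> E) : Prop :=
  mcompact H (fun x y => nrm (x - y))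
    [set y | H y /\ forall e : R, 0 < e ->
       exists x, [/\ H x, nrm x <= 1 & nrm (y - A x) < e]].

(* [xget 0 P] is an element satisfying [P]; in the next two definitions it is
   unique as soon as [ip] is definite on [H]. *)
Definition adjoint (A : E -> E) : E -> E := fun y =>
  xget 0 [set p | H p /\ forall x, H x -> ip (A x) y = ip x p].

Definition orthogonal_projection : E -> E := fun g =>
  xget 0 [set p | H p /\ forall h, H h -> ip (g - p) h = 0].

End Operators.

Section EllTwo.
Context (R : realType).
Local Notation C := (Cplx R).

Definition sqnorm_l2 (a : nat -> C) : \bar R :=
  (\sum_(k <oo) ((cabs (a k)) ^+ 2)%:E)%E.

Definition l2 : set (nat -> C) := [set a | (sqnorm_l2 a < +oo)%E].

Definition norm_l2 (a : nat -> C) : R := Num.sqrt (fine (sqnorm_l2 a)).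

Definition ip_l2 (a b : nat -> C) : C :=
  limn (series (fun k => a k * Num.conj (b k))).

(* The standard basis, indexed from 0. *)
Definition e_ (k : nat) : nat -> C := fun j => (j == k)%:R.

End EllTwo.

Arguments e_ {R} k.

(* Analyticity is complex (Frechet) differentiability at every point of the
   open set. *)
Definition analytic (R : realType) (n : nat) (W : normedModType (Cplx R))
    (Om : set (Cspace R n)) (f : Cspace R n -> W) : Prop :=
  forall z, Om z -> differentiable f z.

Definition automorphism (R : realType) (n : nat) (Om : set (Cspace R n))
    (f : Cspace R n -> Cspace R n) : Prop :=
  [/\ forall z, Om z -> Om (f z), analytic Om f &
      exists g : Cspace R n -> Cspace R n,
        [/\ forall z, Om z -> Om (g z), analytic Om g,
            forall z, Om z -> g (f z) = z & forall z, Om z -> f (g z) = z]].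

(* [sigma] is a finite Borel measure on C^n of which only the restriction to the
   open set [Om] is ever used; [K z] is the kernel function [K_z]. *)
Record bergman_data (R : realType) (n : nat) := BergmanData {
  Om : set (Cspace R n);
  phi : Cspace R n -> Cspace R n -> Cspace R n;
  dist : Cspace R n -> Cspace R n -> R;
  sigma : {finite_measure set (borel R n) -> \bar R};
  K : Cspace R n -> Cspace R n -> Cplx R
}.

Section Spaces.
Context (R : realType) (n : nat) (B : bergman_data R n).
Local Notation C := (Cplx R).
Local Notation V := (Cspace R n).
Local Notation Om := (Om B).
Local Notation dist := (dist B).
Local Notation sigma := (sigma B).
Local Notation K := (K B).

Definition cintegral (h : V -> C) : C :=
  Complex (\int[sigma]_(z in Om) complex.Re (h z))
          (\int[sigma]_(z in Om) complex.Im (h z)).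

Definition cmeasurable (h : V -> C) : Prop :=
  measurable_fun (Om : set (borel R n))
    ((fun z => complex.Re (h z)) : borel R n -> R) /\
  measurable_fun (Om : set (borel R n))
    ((fun z => complex.Im (h z)) : borel R n -> R).

(* A function on [Om] is represented by its extension by zero to C^n, so that
   equality of functions on [Om] is equality. *)

Definition L2C : set (V -> C) := [set f |
  cmeasurable f /\ (\int[sigma]_(z in Om) ((cabs (f z)) ^+ 2)%:E < +oo)%E].

Definition bergC : set (V -> C) := [set f |
  [/\ forall z, ~ Om z -> f z = 0, analytic (W := C) Om f & L2C f]].

Definition normC (f : V -> C) : R :=
  Num.sqrt (fine (\int[sigma]_(z in Om) ((cabs (f z)) ^+ 2)%:E)%E).

Definition ipC (f g : V -> C) : C :=
  cintegral (fun z => f z * Num.conj (g z)).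

Definition L2 : set (V -> nat -> C) := [set f |
  [/\ forall z, Om z -> l2 (f z),
      forall k, cmeasurable (fun z => ip_l2 (f z) (e_ k)) &
      (\int[sigma]_(z in Om) sqnorm_l2 (f z) < +oo)%E]].

Definition berg : set (V -> nat -> C) := [set f |
  [/\ forall z, ~ Om z -> f z = 0,
      forall k, analytic (W := C) Om (fun z => ip_l2 (f z) (e_ k)) &
      L2 f]].

Definition normB (f : V -> nat -> C) : R :=
  Num.sqrt (fine (\int[sigma]_(z in Om) sqnorm_l2 (f z))%E).

Definition ipB (f g : V -> nat -> C) : C :=
  cintegral (fun z => ip_l2 (f z) (g z)).

Definition normK (z : V) : R := normC (K z).

Definition k_ (z : V) : V -> C := fun w => K z w / Complex (normK z) 0.

Definition lambda (E : set V) : \bar R :=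
  (\int[sigma]_(z in E) ((normK z) ^+ 2)%:E)%E.

Definition D (z : V) (r : R) : set V := mball Om dist z r.

(* The integral with respect to [lambda], written out as
   [d lambda = normK ^ 2 d sigma]. *)
Definition rudin_forelli (r s : R) (z : V) : \bar R :=
  (\int[sigma]_(w in Om)
     ((cabs (ipC (K z) (K w)) `^ ((r + s) / 2))
        / (normK z `^ s * normK w `^ r) * (normK w) ^+ 2)%:E)%E.

Definition rudin_forelli_bounded (r s : R) : Prop :=
  exists M : R, forall z, Om z -> (rudin_forelli r s z <= M%:E)%E.

End Spaces.

(* The fields [bt_normK_gt0] and [bt_ball_measurable] are implicit in writing
   [k_z = K_z / ||K_z||] and [lambda (D (z, r))]. *)
Record bergman_type (R : realType) (n : nat) (B : bergman_data R n) : Prop := {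
  bt_open : open (Om B);
  bt_connected : connected (Om B);
  bt_0 : Om B 0;
  bt_phi_aut : forall z, Om B z -> automorphism (Om B) (phi B z);
  bt_phi_invol : forall z w, Om B z -> Om B w -> phi B z (phi B z w) = w;
  bt_phi_0 : forall z, Om B z -> phi B z 0 = z;

  bt_metric : is_metric (Om B) (dist B);
  bt_quasi_inv : exists2 c : R, 0 < c & forall z u v,
    Om B z -> Om B u -> Om B v ->
    dist B u v <= c * dist B (phi B z u) (phi B z v) /\
    dist B (phi B z u) (phi B z v) <= c * dist B u v;
  bt_separable : mseparable (Om B) (dist B);
  bt_proper : forall z r, Om B z ->
    mcompact (Om B) (dist B) (mclosed_ball (Om B) (dist B) z r);

  bt_completeC : mcomplete (bergC B) (fun f g => normC B (f - g));
  bt_complete : mcomplete (berg B) (fun f g => normB B (f - g));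
  bt_K : forall z, Om B z -> bergC B (K B z);
  bt_reproC : forall f z, bergC B f -> Om B z ->
    f z = cintegral B (fun w => Num.conj (K B z w) * f w);
  bt_repro : forall f z k, berg B f -> Om B z ->
    f z k = cintegral B (fun w => Num.conj (K B z w) * f w k);
  bt_normK_gt0 : forall z, Om B z -> 0 < normK B z;
  bt_normK_cont : forall z (e : R), Om B z -> 0 < e ->
    exists2 r : R, 0 < r &
    forall w, Om B w -> dist B z w < r -> `|normK B z - normK B w| < e;

  bt_ball_measurable : forall z r, Om B z ->
    measurable (D B z r : set (borel R n));
  bt_lambda_inv : exists2 c : R, 0 < c & forall z (E : set (borel R n)),
    Om B z -> measurable E -> E `<=` Om B ->
    (lambda B E <= c%:E * lambda B (phi B z @` E))%E /\
    (lambda B (phi B z @` E) <= c%:E * lambda B E)%E;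
  bt_doubling : exists2 c : R, 1 < c & forall z (r : R), Om B z -> 0 < r ->
    (lambda B (D B z (2 * r)) <= c%:E * lambda B (D B z r))%E;

  bt_kernel : exists2 c : R, 0 < c & forall z w, Om B z -> Om B w ->
    cabs (ipC B (k_ B z) (k_ B w)) <= c * (normK B (phi B z w))^-1 /\
    (normK B (phi B z w))^-1 <= c * cabs (ipC B (k_ B z) (k_ B w));

  bt_rudin_forelli :
    (exists kappa : R, [/\ 0 < kappa, kappa < 2 &
       forall r s : R, kappa < r -> s < kappa -> 0 < s ->
         rudin_forelli_bounded B r s]) \/
    (forall r : R, 0 < r -> rudin_forelli_bounded B r r);

  bt_normK_infty : forall M : R, exists r : R, forall z,
    Om B z -> r < dist B z 0 -> M < normK B z
}.

Section OperatorsOnBergman.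
Context (R : realType) (n : nat) (B : bergman_data R n).
Local Notation C := (Cplx R).
Local Notation V := (Cspace R n).
Local Notation ell2 := (nat -> Cplx R).
Local Notation E := (V -> nat -> Cplx R).
Local Notation Om := (Om B).
Local Notation dist := (dist B).

(* The filter of [dist z 0 --> +oo] in [Om]. *)
Definition at_infty : set_system V :=
  [set A | exists r : R, forall z, Om z -> r < dist z 0 -> A z].

Definition bounded_on_berg : (E -> E) -> Prop :=
  bounded_operator (berg B) (normB B).

Definition opnorm_berg : (E -> E) -> \bar R := opnorm (berg B) (normB B).

Definition compact_on_berg : (E -> E) -> Prop :=
  compact_operator (berg B) (normB B).

(* The function [k_z a], for [a] in ell^2. *)
Definition kvec (z : V) (a : ell2) : E := fun w j => k_ B z w * a j.

Definition U_ (z : V) : E -> E := fun f w j => f (phi B z w) j * k_ B z w.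

Definition translate (T : E -> E) (z : V) : E -> E :=
  U_ z \o T \o adjoint (berg B) (ipB B) (U_ z).

(* The operator on ell^2 whose matrix entries are
   [<T~(z) e_k, e_i> = <T (k_z e_k), k_z e_i>]. *)
Definition berezin (T : E -> E) (z : V) : ell2 -> ell2 := fun a i =>
  ipB B (T (kvec z a)) (kvec z (e_ i)).

Definition BUCO : set (V -> ell2 -> ell2) := [set u |
  [/\ forall z, Om z -> bounded_operator (@l2 R) (@norm_l2 R) (u z),
      exists M : R, forall z, Om z ->
        (opnorm (@l2 R) (@norm_l2 R) (u z) <= M%:E)%E,
      forall e : R, 0 < e -> exists2 r : R, 0 < r & forall z w,
        Om z -> Om w -> dist z w < r ->
        (opnorm (@l2 R) (@norm_l2 R) (fun a => (u z a - u w a)%R) < e%:E)%E &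
      exists d : nat, forall z i k, Om z -> (d <= i)%N || (d <= k)%N ->
        ip_l2 (u z (e_ i)) (e_ k) = 0]].

Definition toeplitz (u : V -> ell2 -> ell2) : E -> E := fun f =>
  orthogonal_projection (berg B) (ipB B) (fun z => u z (f z)).

Inductive toeplitz_product : (E -> E) -> Prop :=
| ToeplitzProduct1 u : BUCO u -> toeplitz_product (toeplitz u)
| ToeplitzProductM u S : BUCO u -> toeplitz_product S ->
    toeplitz_product (toeplitz u \o S).

Inductive toeplitz_polynomial : (E -> E) -> Prop :=
| ToeplitzPolynomial1 S : toeplitz_product S -> toeplitz_polynomial S
| ToeplitzPolynomialD S S' : toeplitz_product S -> toeplitz_polynomial S' ->
    toeplitz_polynomial (fun f => S f + S' f).

Definition T_BUCO : set (E -> E) := [set T | bounded_on_berg T /\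
  forall e : R, 0 < e -> exists2 S, toeplitz_polynomial S &
    (opnorm_berg (fun f => (T f - S f)%R) < e%:E)%E].

End OperatorsOnBergman.

(* Main.v *)
Require Import Defs.
From HB Require Import structures.
From mathcomp Require Import all_boot all_order all_algebra.
From mathcomp Require Import all_classical all_reals all_analysis.
From mathcomp Require Import complex measurable_realfun.
From mathcomp Require Import ring lra.

Set Implicit Arguments.
Unset Strict Implicit.
Unset Printing Implicit Defensive.

Import Order.TTheory GRing.Theory Num.Theory.
Import numFieldNormedType.Exports.

Local Open Scope classical_set_scope.
Local Open Scope ring_scope.

(* For z near infinity the matrix entries <T^z K_a e_k, K_b e_i> are controlled by the
   Berezin transform: along an ultrafilter they converge to a bounded sesquilinear form,
   which vanishes on the pairs (K_a e_k, K_a e_i) because <T^z K_a e_k, K_a e_i> is a bounded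
   multiple of an entry of the Berezin transform at phi_z a; such a form is zero, by
   analyticity in the two points separately.

   Toeplitz operators almost commute with multiplication by functions that vary slowly for
   the metric, by a Schur test based on the Rudin-Forelli estimates.  This property passes
   to products, sums and norm limits, so it holds for T.  It keeps the mass of T^z K_a e_k in
   a fixed ball, uniformly in z, and in the first d coordinates, which turns weak
   convergence of the translates into norm convergence.

   For compactness, cut f into slowly varying pieces supported in balls of radius 3r around
   an r-net, with overlaps bounded by the doubling property.  By almost commutation |T f|^2 is
   essentially the sum of the |T P (psi_j f)|^2, and a piece around a far point x is small,
   because it is an average of functions K_w e_k with w near x, and the norms of T K_w e_k are
   small relative to |K_w|.  Up to a small multiple of |f|^2, |T f|^2 is therefore bounded by
   the integral of finitely many coordinates of f over one ball, and T maps the unit ball to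
   a totally bounded set. *)

(** * The complex modulus and complex-valued integrals *)

(** Three features of the setting shape the argument. The operators [U_ B z] are only bounded above
    and below, uniformly in [z], and [translate] is not multiplicative in the operator; almost
    commutation is therefore proved for T itself and reaches the translates through the formula for
    [Uadj] on kernels. No relation between [dist] and the topology of C^n is assumed beyond
    measurability of balls, so continuity of [normK] for [dist] gives no Euclidean bound; a Baire
    argument yields one box where [normK] is bounded, and connectedness of [Om] carries the
    vanishing of the form from there to all points. Multiplication by a cutoff leaves [berg B], so T
    is studied on all of [L2 B] as [T \o bproj B]. The vanishing of the form needs Taylor expansions
    of the kernels in norm, with explicit remainders; this is the reason for the one-variable theory
    starting from Goursat's theorem. Errors of commutation are measured in square sums over a family
    of cutoffs, because compactness uses a number of pieces that has no bound. *)

Section ComplexModulus.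
Context (R : realType).
Local Notation C := (Cplx R).
Implicit Types (x y : C) (a b : R).

Definition toC (a : R) : C := Complex a 0.

Lemma toCD a b : toC (a + b) = toC a + toC b.
Proof. by apply/eqP; rewrite eq_complex /= addr0 !eqxx. Qed.

Lemma toCN a : toC (- a) = - toC a.
Proof. by apply/eqP; rewrite eq_complex /= oppr0 !eqxx. Qed.

Lemma toCM a b : toC (a * b) = toC a * toC b.
Proof. by apply/eqP; rewrite eq_complex /= !mulr0 !mul0r subr0 addr0 !eqxx. Qed.

Lemma toC0 : toC 0 = 0. Proof. by []. Qed.
Lemma toC1 : toC 1 = 1. Proof. by []. Qed.

Lemma toC_inj : injective toC. Proof. by move=> a b []. Qed.

Lemma toCV a : toC a^-1 = (toC a)^-1.
Proof.
have [->|a0] := eqVneq a 0; first by rewrite toC0 !invr0.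
apply: (@mulfI _ (toC a)); first by apply/eqP => /(@toC_inj _ 0)/eqP; apply/negP.
rewrite -toCM !divff ?toC1//; by apply/eqP => /(@toC_inj _ 0)/eqP; apply/negP.
Qed.

Lemma toCX a n : toC (a ^+ n) = toC a ^+ n.
Proof. by elim: n => [|n IH]; rewrite ?expr0 ?toC1// !exprS toCM IH. Qed.

Lemma toC_sum (I : Type) (r : seq I) (P : pred I) (F : I -> R) :
  toC (\sum_(i <- r | P i) F i) = \sum_(i <- r | P i) toC (F i).
Proof. by elim/big_rec2: _ => [|i x y _ <-]; rewrite ?toC0 ?toCD. Qed.

Lemma cReD x y : complex.Re (x + y) = complex.Re x + complex.Re y.
Proof. by case: x y => [a b] [c d]. Qed.
Lemma cImD x y : complex.Im (x + y) = complex.Im x + complex.Im y.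
Proof. by case: x y => [a b] [c d]. Qed.
Lemma cReN x : complex.Re (- x) = - complex.Re x. Proof. by case: x. Qed.
Lemma cImN x : complex.Im (- x) = - complex.Im x. Proof. by case: x. Qed.
Lemma cReM x y : complex.Re (x * y) =
  complex.Re x * complex.Re y - complex.Im x * complex.Im y.
Proof. by case: x y => [a b] [c d]. Qed.
Lemma cImM x y : complex.Im (x * y) =
  complex.Re x * complex.Im y + complex.Im x * complex.Re y.
Proof. by case: x y => [a b] [c d]. Qed.
Lemma cRe_sum (I : Type) (r : seq I) (P : pred I) (F : I -> C) :
  complex.Re (\sum_(i <- r | P i) F i) = \sum_(i <- r | P i) complex.Re (F i).
Proof. by elim/big_rec2: _ => // i x y _ <-; rewrite cReD. Qed.
Lemma cIm_sum (I : Type) (r : seq I) (P : pred I) (F : I -> C) :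
  complex.Im (\sum_(i <- r | P i) F i) = \sum_(i <- r | P i) complex.Im (F i).
Proof. by elim/big_rec2: _ => // i x y _ <-; rewrite cImD. Qed.

Lemma conj_complex x : Num.conj x = Complex (complex.Re x) (- complex.Im x).
Proof. by case: x. Qed.

Lemma complexP x y :
  complex.Re x = complex.Re y -> complex.Im x = complex.Im y -> x = y.
Proof. by case: x y => [a b] [c d] /= -> ->. Qed.

Lemma norm_cabs x : `|x| = toC (cabs x). Proof. by case: x. Qed.

Lemma cabsE x : cabs x = Num.sqrt (complex.Re x ^+ 2 + complex.Im x ^+ 2).
Proof. by case: x. Qed.

Lemma cabs_sqr x : cabs x ^+ 2 = complex.Re x ^+ 2 + complex.Im x ^+ 2.
Proof. by rewrite cabsE sqr_sqrtr// addr_ge0// sqr_ge0. Qed.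

Lemma cabs_ge0 x : 0 <= cabs x. Proof. by rewrite cabsE sqrtr_ge0. Qed.
Hint Resolve cabs_ge0 : core.

Lemma cabs0 : cabs (0 : C) = 0. Proof. exact: Normc.normc0. Qed.
Lemma cabs1 : cabs (1 : C) = 1. Proof. exact: Normc.normc1. Qed.
Lemma cabsM x y : cabs (x * y) = cabs x * cabs y. Proof. exact: Normc.normcM. Qed.
Lemma cabsN x : cabs (- x) = cabs x. Proof. exact: normcN. Qed.
Lemma cabsV x : cabs x^-1 = (cabs x)^-1. Proof. exact: Normc.normcV. Qed.
Lemma cabsX x n : cabs (x ^+ n) = cabs x ^+ n.
Proof. by elim: n => [|n IH]; rewrite ?expr0 ?cabs1// !exprS cabsM IH. Qed.
Lemma cabsD x y : cabs (x + y) <= cabs x + cabs y. Proof. exact: le_normcD. Qed.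
Lemma cabsB x y : cabs (x - y) <= cabs x + cabs y.
Proof. by rewrite (le_trans (cabsD _ _))// cabsN. Qed.
Lemma cabsC x y : cabs (x - y) = cabs (y - x). Proof. by rewrite -cabsN opprB. Qed.
Lemma cabs0_eq0 x : cabs x = 0 -> x = 0. Proof. exact: Normc.eq0_normc. Qed.
Lemma cabs_eq0 x : (cabs x == 0) = (x == 0).
Proof. by apply/eqP/eqP => [/cabs0_eq0|->]; rewrite ?cabs0. Qed.
Lemma cabs_gt0 x : (0 < cabs x) = (x != 0).
Proof. by rewrite lt_def cabs_ge0 andbT cabs_eq0. Qed.
Lemma cabs_toC a : cabs (toC a) = `|a|.
Proof. by rewrite cabsE /= expr0n addr0 sqrtr_sqr. Qed.
Lemma cabs_conj x : cabs (Num.conj x) = cabs x.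
Proof. by rewrite conj_complex !cabsE /= sqrrN. Qed.

Lemma cabs_sum (I : Type) (r : seq I) (P : pred I) (F : I -> C) :
  cabs (\sum_(i <- r | P i) F i) <= \sum_(i <- r | P i) cabs (F i).
Proof.
elim/big_rec2: _ => [|i x y _ IH]; first by rewrite cabs0.
by rewrite (le_trans (cabsD _ _))// lerD2l.
Qed.

Lemma cabs_distD z x y : cabs (x - y) <= cabs (x - z) + cabs (z - y).
Proof. by rewrite (le_trans _ (cabsD _ _))// addrA subrK. Qed.

Lemma ler_Re_cabs x : `|complex.Re x| <= cabs x.
Proof. by rewrite cabsE -sqrtr_sqr ler_wsqrtr// lerDl sqr_ge0. Qed.
Lemma ler_Im_cabs x : `|complex.Im x| <= cabs x.
Proof. by rewrite cabsE -sqrtr_sqr ler_wsqrtr// lerDr sqr_ge0. Qed.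
Lemma cabs_le_ReIm x : cabs x <= `|complex.Re x| + `|complex.Im x|.
Proof.
rewrite -(@ler_pXn2r _ 2)// ?nnegrE ?addr_ge0// cabs_sqr sqrrD !real_normK ?num_real//.
by rewrite addrAC lerDl mulrn_wge0// mulr_ge0.
Qed.

Lemma mul_conj x : x * Num.conj x = toC (cabs x ^+ 2).
Proof.
rewrite cabs_sqr conj_complex; apply: complexP; rewrite ?cReM ?cImM /=; ring.
Qed.

Lemma conj_toC a : Num.conj (toC a) = toC a.
Proof. by rewrite conj_complex /= oppr0. Qed.

Lemma cabs_triangle_sub x y : cabs x - cabs y <= cabs (x - y).
Proof. by rewrite lerBlDr (le_trans _ (cabsD _ _))// subrK. Qed.

Lemma cabs_distB x y : `|cabs x - cabs y| <= cabs (x - y).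
Proof.
rewrite ler_norml cabs_triangle_sub andbT lerNl opprB cabsC.
exact: cabs_triangle_sub.
Qed.

Lemma ltC_toC a b : (toC a < toC b) = (a < b). Proof. exact: ltcR. Qed.

Lemma pos_toC (e : C) : 0 < e -> exists2 a : R, 0 < a & e = toC a.
Proof.
case: e => a b; rewrite ltcE /= => /andP[/eqP -> a0]; by exists a.
Qed.

End ComplexModulus.
#[global] Hint Extern 0 (is_true (0 <= cabs _)) => solve [apply: cabs_ge0] : core.

Section ComplexTopology.
Context (R : realType).
Local Notation C := (Cplx R).

Lemma cvg_cabsP (T : Type) (F : set_system T) {FF : Filter F} (f : T -> C) (l : C) :
  f x @[x --> F] --> l <-> forall e : R, 0 < e -> \forall x \near F, cabs (f x - l) < e.
Proof.
split => [/cvgrPdist_lt H e e0|H].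
  have /H : 0 < toC e by rewrite -toC0 ltC_toC.
  by apply: filterS => x; rewrite norm_cabs ltC_toC cabsC.
apply/cvgrPdist_lt => _ /pos_toC[e e0 ->].
by apply: filterS (H _ e0) => x; rewrite norm_cabs ltC_toC cabsC.
Qed.

Lemma nbhs_cabsP (x : C) (A : set C) :
  nbhs x A <-> exists2 e : R, 0 < e & forall y, cabs (y - x) < e -> A y.
Proof.
split=> [/nbhs_ballP[_ /= /pos_toC[e e0 ->]] H|[e e0 H]].
  exists e => // y yx; apply: H.
  by rewrite -ball_normE /= norm_cabs ltC_toC cabsC.
apply/nbhs_ballP; exists (toC e); first by rewrite /= -toC0 ltC_toC.
by move=> y; rewrite -ball_normE /= norm_cabs ltC_toC cabsC; exact: H.
Qed.

(** Differentiability as a first order estimate with real constants, valid at [h = 0] as well, so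
    that later estimates add inequalities and never divide by the increment. *)
Definition cdiff (g : C -> C) (t : C) : Prop := exists L : C,
  forall e : R, 0 < e -> exists2 d : R, 0 < d &
    forall h, cabs h < d -> cabs (g (t + h) - g t - L * h) <= e * cabs h.

Lemma derivable_cdiff (g : C -> C) (t : C) : derivable g t 1 -> cdiff g t.
Proof.
move=> /cvg_ex[/= L /cvg_cabsP H]; exists L => e e0.
have /nbhs_cabsP[d d0 {}H] := H _ e0.
exists d => // h hd; have [->|h0] := eqVneq h 0.
  by rewrite addr0 mulr0 subrr subr0 cabs0 mulr0.
have := H h; rewrite subr0 => /(_ hd h0) /=.
rewrite [h *: 1]mulr1 (addrC h t) => /ltW.
have -> : g (t + h) - g t - L * h = (h^-1 *: (g (t + h) - g t) - L) * h.
  by rewrite mulrBl /GRing.scale /= mulrAC mulVf// mul1r.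
by move=> H1; rewrite cabsM ler_wpM2r.
Qed.

End ComplexTopology.

Section ComplexIntegral.
Context d (T : measurableType d) (R : realType)
  (mu : {measure set T -> \bar R}) (D : set T) (mD : measurable D).
Local Notation C := (Cplx R).
Implicit Types (h k : T -> C) (g : T -> R) (c : C).

(** [cmeas] and [cint] are [cmeasurable] and [cintegral] over an arbitrary measure space, and are
    convertible to them on [borel R n]. *)
Definition cmeas h :=
  measurable_fun D (fun x => complex.Re (h x)) /\
  measurable_fun D (fun x => complex.Im (h x)).

Definition cint h : C :=
  Complex (\int[mu]_(x in D) complex.Re (h x)) (\int[mu]_(x in D) complex.Im (h x)).

Definition cintegrable h :=
  mu.-integrable D (EFin \o (fun x => complex.Re (h x))) /\
  mu.-integrable D (EFin \o (fun x => complex.Im (h x))).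

Lemma eq_cmeas h k : {in D, h =1 k} -> cmeas h -> cmeas k.
Proof.
move=> hk [mr mi]; split.
  by apply: eq_measurable_fun mr => x xD; rewrite hk.
by apply: eq_measurable_fun mi => x xD; rewrite hk.
Qed.

Lemma cmeas_cst c : cmeas (cst c).
Proof. by split; exact: measurable_cst. Qed.

Lemma cmeasD h k : cmeas h -> cmeas k -> cmeas (fun x => h x + k x).
Proof.
move=> [hr hi] [kr ki]; split.
  by under eq_fun do rewrite cReD; exact: measurable_funD.
by under eq_fun do rewrite cImD; exact: measurable_funD.
Qed.

Lemma cmeasM h k : cmeas h -> cmeas k -> cmeas (fun x => h x * k x).
Proof.
move=> [hr hi] [kr ki]; split.
  by under eq_fun do rewrite cReM; apply: measurable_funB; exact: measurable_funM.
by under eq_fun do rewrite cImM; apply: measurable_funD; exact: measurable_funM.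
Qed.

Lemma cmeasN h : cmeas h -> cmeas (fun x => - h x).
Proof.
move=> [hr hi]; split.
  by under eq_fun do rewrite cReN; apply: measurableT_comp.
by under eq_fun do rewrite cImN; apply: measurableT_comp.
Qed.

Lemma cmeasB h k : cmeas h -> cmeas k -> cmeas (fun x => h x - k x).
Proof. by move=> mh mk; apply: cmeasD => //; exact: cmeasN. Qed.

Lemma cmeas_toC g : measurable_fun D g -> cmeas (fun x => toC (g x)).
Proof. by move=> mg; split => //=; exact: measurable_cst. Qed.

Lemma cmeas_conj h : cmeas h -> cmeas (fun x => Num.conj (h x)).
Proof.
move=> [hr hi]; split.
  by under eq_fun do rewrite conj_complex.
by under eq_fun do rewrite conj_complex; apply: measurableT_comp.
Qed.

Lemma cmeas_sum I (r : seq I) (F : I -> T -> C) : (forall i, cmeas (F i)) ->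
  cmeas (fun x => \sum_(i <- r) F i x).
Proof.
move=> mF; elim: r => [|i r IH].
  by apply: eq_cmeas (cmeas_cst 0) => x _; rewrite big_nil.
by apply: eq_cmeas (cmeasD (mF i) IH) => x _; rewrite big_cons.
Qed.

Lemma measurable_cabs_sqr h : cmeas h -> measurable_fun D (fun x => cabs (h x) ^+ 2).
Proof.
move=> [hr hi]; under eq_fun do rewrite cabs_sqr.
by apply: measurable_funD; exact: measurable_funX.
Qed.

Lemma measurable_cabs h : cmeas h -> measurable_fun D (fun x => cabs (h x)).
Proof.
move=> mh; rewrite (_ : (fun _ => _) = Num.sqrt \o (fun x => cabs (h x) ^+ 2)).
  apply: measurableT_comp; last exact: measurable_cabs_sqr.
  by apply: continuous_measurable_fun; exact: sqrt_continuous.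
by apply/funext => x /=; rewrite sqrtr_sqr ger0_norm ?cabs_ge0.
Qed.

Lemma cmeas_cvg (F : nat -> T -> C) h : (forall n, cmeas (F n)) ->
  (forall x, D x -> forall e : R, 0 < e -> \forall n \near \oo, cabs (F n x - h x) < e) ->
  cmeas h.
Proof.
move=> mF Fh; split.
- apply: (@measurable_fun_cvg _ _ _ _ (fun n x => complex.Re (F n x))).
    by move=> n; case: (mF n).
  move=> x Dx; apply/cvgrPdist_lt => e e0; have := Fh x Dx e e0.
  apply: filterS => n; apply: le_lt_trans; rewrite distrC -cReN -cReD.
  exact: ler_Re_cabs.
- apply: (@measurable_fun_cvg _ _ _ _ (fun n x => complex.Im (F n x))).
    by move=> n; case: (mF n).
  move=> x Dx; apply/cvgrPdist_lt => e e0; have := Fh x Dx e e0.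
  apply: filterS => n; apply: le_lt_trans; rewrite distrC -cImN -cImD.
  exact: ler_Im_cabs.
Qed.

Lemma cintegrable_meas h : cintegrable h -> cmeas h.
Proof.
by move=> [/integrableP[/measurable_EFinP ? _] /integrableP[/measurable_EFinP ? _]].
Qed.

Lemma cintegrable_le h g : cmeas h -> mu.-integrable D (EFin \o g) ->
  (forall x, D x -> cabs (h x) <= g x) -> cintegrable h.
Proof.
move=> [hr hi] ig hg; split; apply: le_integrable ig => //.
- exact/measurable_EFinP.
- move=> x Dx /=; rewrite lee_fin (le_trans (ler_Re_cabs _))//.
  by rewrite (le_trans (hg _ Dx))// ler_norm.
- exact/measurable_EFinP.
- move=> x Dx /=; rewrite lee_fin (le_trans (ler_Im_cabs _))//.
  by rewrite (le_trans (hg _ Dx))// ler_norm.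
Qed.

Lemma integrable_cabs h : cintegrable h ->
  mu.-integrable D (EFin \o (fun x => cabs (h x))).
Proof.
move=> ih; have mh := cintegrable_meas ih; case: ih => hr hi.
have := integrableD mD (integrable_abse hr) (integrable_abse hi).
apply: le_integrable => //.
  by apply/measurable_EFinP; exact: measurable_cabs.
move=> x Dx /=; rewrite lee_fin ger0_norm// (le_trans (cabs_le_ReIm _))//.
by rewrite ler_norm.
Qed.

Lemma eq_cint h k : (forall x, D x -> h x = k x) -> cint h = cint k.
Proof.
move=> hk; rewrite /cint; congr Complex;
  by apply: eq_Rintegral => x /set_mem Dx; rewrite hk.
Qed.

Lemma eq_cintegrable h k : (forall x, D x -> h x = k x) -> cintegrable h -> cintegrable k.
Proof.
move=> hk [hr hi]; split.
- by apply: eq_integrable hr => // x /set_mem Dx /=; rewrite hk.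
- by apply: eq_integrable hi => // x /set_mem Dx /=; rewrite hk.
Qed.

Lemma cintegrableD h k : cintegrable h -> cintegrable k ->
  cintegrable (fun x => h x + k x).
Proof.
move=> [hr hi] [kr ki]; split.
- apply: eq_integrable (integrableD mD hr kr) => // x _ /=.
  by rewrite cReD EFinD.
- apply: eq_integrable (integrableD mD hi ki) => // x _ /=.
  by rewrite cImD EFinD.
Qed.

Lemma cintegrableZ c h : cintegrable h -> cintegrable (fun x => c * h x).
Proof.
move=> ih; have mh := cintegrable_meas ih.
apply: (@cintegrable_le _ (fun x => cabs c * cabs (h x))).
- by apply: cmeasM => //; exact: cmeas_cst.
- apply: eq_integrable (integrableZl mD (cabs c) (integrable_cabs ih)) => //.
- by move=> x _; rewrite cabsM.
Qed.

Lemma cintegrableN h : cintegrable h -> cintegrable (fun x => - h x).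
Proof.
move=> ih; apply: eq_cintegrable (cintegrableZ (-1) ih) => x _.
by rewrite mulN1r.
Qed.

Lemma cintegrableB h k : cintegrable h -> cintegrable k ->
  cintegrable (fun x => h x - k x).
Proof. by move=> ih ik; apply: cintegrableD => //; exact: cintegrableN. Qed.

Lemma cintegrable0 : cintegrable (fun=> 0).
Proof. by split; exact: integrable0. Qed.

Lemma cintegrable_sum I (r : seq I) (F : I -> T -> C) : (forall i, cintegrable (F i)) ->
  cintegrable (fun x => \sum_(i <- r) F i x).
Proof.
move=> mF; elim: r => [|i r IH].
  by apply: eq_cintegrable cintegrable0 => x _; rewrite big_nil.
by apply: eq_cintegrable (cintegrableD (mF i) IH) => x _; rewrite big_cons.
Qed.

Lemma cintD h k : cintegrable h -> cintegrable k ->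
  cint (fun x => h x + k x) = cint h + cint k.
Proof.
move=> [hr hi] [kr ki]; rewrite /cint; apply: complexP; rewrite ?cReD ?cImD /=.
  by rewrite -RintegralD//; apply: eq_Rintegral => x _; rewrite cReD.
by rewrite -RintegralD//; apply: eq_Rintegral => x _; rewrite cImD.
Qed.

Lemma cintZ c h : cintegrable h -> cint (fun x => c * h x) = c * cint h.
Proof.
move=> [hr hi]; rewrite /cint; apply: complexP; rewrite ?cReM ?cImM /=.
  rewrite -!RintegralZl// -RintegralB//.
  - by apply: eq_Rintegral => x _; rewrite cReM.
  - exact: eq_integrable (integrableZl mD (complex.Re c) hr).
  - exact: eq_integrable (integrableZl mD (complex.Im c) hi).
rewrite -!RintegralZl// -RintegralD//.
- by apply: eq_Rintegral => x _; rewrite cImM.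
- exact: eq_integrable (integrableZl mD (complex.Re c) hi).
- exact: eq_integrable (integrableZl mD (complex.Im c) hr).
Qed.

Lemma cintN h : cintegrable h -> cint (fun x => - h x) = - cint h.
Proof.
move=> ih; rewrite -mulN1r -cintZ//; apply: eq_cint => x _.
by rewrite mulN1r.
Qed.

Lemma cintB h k : cintegrable h -> cintegrable k ->
  cint (fun x => h x - k x) = cint h - cint k.
Proof.
by move=> ih ik; rewrite cintD ?cintN//; exact: cintegrableN.
Qed.

Lemma cint_conj h : cintegrable h -> cint (fun x => Num.conj (h x)) = Num.conj (cint h).
Proof.
move=> [hr hi]; rewrite conj_complex /cint /=; congr Complex.
  by apply: eq_Rintegral => x _; rewrite conj_complex.
rewrite -mulN1r -RintegralZl//.
by apply: eq_Rintegral => x _; rewrite conj_complex mulN1r.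
Qed.

Lemma cint0 : cint (fun=> 0) = 0.
Proof.
by rewrite /cint /= /Rintegral integral0.
Qed.

Lemma cint_sum I (r : seq I) (F : I -> T -> C) : (forall i, cintegrable (F i)) ->
  cint (fun x => \sum_(i <- r) F i x) = \sum_(i <- r) cint (F i).
Proof.
move=> mF; elim: r => [|i r IH].
  by rewrite big_nil -[RHS]cint0; apply: eq_cint => x _; rewrite big_nil.
rewrite big_cons -IH -cintD//; last exact: cintegrable_sum.
by apply: eq_cint => x _; rewrite big_cons.
Qed.

Lemma cabs_cint h g : cmeas h -> mu.-integrable D (EFin \o g) ->
  (forall x, D x -> cabs (h x) <= g x) -> cabs (cint h) <= \int[mu]_(x in D) g x.
Proof.
move=> mh ig hg; have ih := cintegrable_le mh ig hg.
have [->|c0] := eqVneq (cint h) 0.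
  rewrite cabs0; apply: Rintegral_ge0 => x Dx.
  by apply: le_trans (hg _ Dx); exact: cabs_ge0.
(* [u] is unimodular and rotates the integral to its modulus, which is then the integral of a real
   part. *)
pose u : C := Num.conj (cint h) / toC (cabs (cint h)).
have n0 : cabs (cint h) != 0 by rewrite cabs_eq0.
have u1 : cabs u = 1.
  by rewrite /u cabsM cabs_conj cabsV cabs_toC ger0_norm ?cabs_ge0// divff.
have -> : cabs (cint h) = complex.Re (u * cint h).
  have -> : u * cint h = toC (cabs (cint h)).
    rewrite /u mulrAC -[_ * cint h]mulrC mul_conj expr2 toCM mulfK//.
    by apply/eqP => /(@toC_inj _ _ 0)/eqP; apply/negP.
  by [].
rewrite -cintZ//.
apply: le_Rintegral => //; first by case: (cintegrableZ u ih).
move=> x Dx; apply: le_trans (hg _ Dx).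
apply: le_trans (ler_norm _) _; apply: le_trans (ler_Re_cabs _) _.
by rewrite cabsM u1 mul1r.
Qed.

Lemma cint_dominated (F : nat -> T -> C) h g : (forall n, cmeas (F n)) ->
  mu.-integrable D (EFin \o g) -> (forall n x, D x -> cabs (F n x) <= g x) ->
  (forall x, D x -> forall e : R, 0 < e -> \forall n \near \oo, cabs (F n x - h x) < e) ->
  forall e : R, 0 < e -> \forall n \near \oo, cabs (cint (F n) - cint h) < e.
Proof.
move=> mF ig Fg Fh.
have mh := cmeas_cvg mF Fh.
have hg x : D x -> cabs (h x) <= g x.
  move=> Dx; apply/ler_addgt0Pr => e e0.
  near \oo => n.
  have H : cabs (F n x - h x) < e by near: n; exact: Fh.
  have := cabs_distD (F n x) (h x) 0; rewrite !subr0 => /le_trans; apply.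
  by rewrite addrC lerD ?Fg// cabsC ltW.
have iF n := cintegrable_le (mF n) ig (Fg n).
have ih := cintegrable_le mh ig hg.
have mFh n := cmeasB (mF n) mh.
have iFh n := cintegrableB (iF n) ih.
have bd n : cabs (cint (F n) - cint h) <= \int[mu]_(x in D) cabs (F n x - h x).
  by rewrite -cintB//; apply: cabs_cint => //; exact: (integrable_cabs (iFh n)).
have [] := @dominated_convergence _ T R mu D mD (fun n x => (cabs (F n x - h x))%:E)
   (cst 0%E) (fun x => (g x + g x)%:E).
- by move=> n; apply/measurable_EFinP; exact: measurable_cabs.
- exact: measurable_cst.
- apply: aeW => x Dx; apply/fine_cvgP; split; first exact: nearW.
  apply/cvgr0Pnorm_lt => e e0; apply: filterS (Fh x Dx e e0) => n /=.
  by rewrite ger0_norm.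
- exact: eq_integrable (integrableD mD ig ig).
- apply: aeW => x n Dx; rewrite abse_EFin lee_fin ger0_norm//.
  by rewrite (le_trans (cabsB _ _))// lerD ?Fg ?hg.
move=> _ _; rewrite integral0 => /fine_cvgP[_ /cvgr0Pnorm_lt H] e e0.
have := H e e0; apply: filterS => n /=.
apply: le_lt_trans; apply: le_trans (bd n) _.
exact: ler_norm.
Unshelve. all: by end_near. Qed.

End ComplexIntegral.

(** * Goursat's theorem and Taylor expansion on a disc *)

Section Goursat.
Context (R : realType).
Local Notation C := (Cplx R).
Local Notation leb := (@lebesgue_measure R).
Implicit Types (f : R -> C) (H : R -> R -> C).

Definition segint (a b : R) f : C := cint leb `[a, b]%classic f.

Definition ccont f (x : R) := forall e : R, 0 < e -> exists2 d : R, 0 < d &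
  forall y, `|y - x| < d -> cabs (f y - f x) < e.

Lemma ccontB f g x : ccont f x -> ccont g x -> ccont (fun y => f y - g y) x.
Proof.
move=> cf cg e e0; have e2 : 0 < e / 2 by rewrite divr_gt0.
have [d d0 Hd] := cf _ e2; have [d' d'0 Hd'] := cg _ e2.
exists (Num.min d d'); first by rewrite lt_min d0.
move=> y; rewrite lt_min => /andP[/Hd h1 /Hd' h2].
have -> : f y - g y - (f x - g x) = (f y - f x) - (g y - g x) by ring.
by rewrite (le_lt_trans (cabsB _ _))// (splitr e) ltrD.
Qed.

Lemma ccontM f g x : ccont f x -> ccont g x -> ccont (fun y => f y * g y) x.
Proof.
move=> cf cg e e0.
pose A := 1 + cabs (f x) + cabs (g x).
have A1 : 1 <= A by rewrite /A -addrA lerDl addr_ge0.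
have A0 : 0 < A by exact: lt_le_trans A1.
have e2 : 0 < Num.min 1 (e / (3 * A)) by rewrite lt_min ltr01 divr_gt0// mulr_gt0.
have [d d0 Hd] := cf _ e2; have [d' d'0 Hd'] := cg _ e2.
exists (Num.min d d'); first by rewrite lt_min d0.
move=> y; rewrite lt_min => /andP[/Hd h1 /Hd' h2].
move: h1 h2; rewrite !lt_min => /andP[h1 h1'] /andP[h2 h2'].
have -> : f y * g y - f x * g x =
  (f y - f x) * (g y - g x) + (f x * (g y - g x) + (f y - f x) * g x) by ring.
apply: le_lt_trans (cabsD _ _) _.
apply: le_lt_trans (lerD (lexx _) (cabsD _ _)) _.
rewrite !cabsM.
set u := cabs (f y - f x) in h1 h1' *; set v := cabs (g y - g x) in h2 h2' *.
have u0 : 0 <= u by exact: cabs_ge0.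
have v0 : 0 <= v by exact: cabs_ge0.
have ue : u * A < e / 3.
  move: h1'; rewrite ltr_pdivlMr ?mulr_gt0// => ?.
  have := mulrCA u 3 A; lra.
have ve : v * A < e / 3.
  move: h2'; rewrite ltr_pdivlMr ?mulr_gt0// => ?.
  have := mulrCA v 3 A; lra.
have h3 : u * v <= u * A by rewrite ler_wpM2l// (le_trans (ltW h2)).
have h4 : cabs (f x) * v <= v * A.
  by rewrite mulrC ler_wpM2l// /A addrAC lerDr addr_ge0.
have h5 : u * cabs (g x) <= u * A.
  by rewrite ler_wpM2l// /A lerDr addr_ge0.
lra.
Qed.

Lemma ccont_Re f x : ccont f x -> {for x, continuous (fun y => complex.Re (f y))}.
Proof.
move=> cf; apply/cvgrPdist_lt => e e0; have [d d0 H] := cf e e0.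
near=> y; rewrite distrC -cReN -cReD; apply: le_lt_trans (ler_Re_cabs _) _.
apply: H; near: y; exists d => //= y; by rewrite /ball_ /= distrC.
Unshelve. all: by end_near. Qed.

Lemma ccont_Im f x : ccont f x -> {for x, continuous (fun y => complex.Im (f y))}.
Proof.
move=> cf; apply/cvgrPdist_lt => e e0; have [d d0 H] := cf e e0.
near=> y; rewrite distrC -cImN -cImD; apply: le_lt_trans (ler_Im_cabs _) _.
apply: H; near: y; exists d => //= y; by rewrite /ball_ /= distrC.
Unshelve. all: by end_near. Qed.

Lemma ccont_integrable f a b : (forall x, a <= x <= b -> ccont f x) ->
  cintegrable leb `[a, b]%classic f.
Proof.
move=> cf; split; apply: continuous_compact_integrable;
  try exact: segment_compact; apply: continuous_in_subspaceT => x /set_mem/=;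
  rewrite in_itv/= => /cf; [exact: ccont_Re|exact: ccont_Im].
Qed.

Lemma segint_cat f a m b : a <= m -> m <= b -> (forall x, a <= x <= b -> ccont f x) ->
  segint a b f = segint a m f + segint m b f.
Proof.
move=> am mb cf; have [ir ii] := ccont_integrable cf.
have sub : `]m, b]%classic `<=` `[a, b]%classic.
  by apply: subset_itv => //; rewrite ?bnd_simp.
apply: complexP; rewrite ?cReD ?cImD /=; apply/eqP; rewrite addrC -subr_eq; apply/eqP.
  rewrite Rintegral_itvB ?bnd_simp// Rintegral_itv_obnd_cbnd//.
  exact: integrableS ir.
rewrite Rintegral_itvB ?bnd_simp// Rintegral_itv_obnd_cbnd//.
exact: integrableS ii.
Qed.

Lemma segint_cst a b (c : C) : a <= b -> segint a b (fun=> c) = toC (b - a) * c.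
Proof.
move=> ab; apply: complexP; rewrite ?cReM ?cImM /= Rintegral_cst//=;
  rewrite lebesgue_measure_itv/= lte_fin; case: ltgtP ab => // [ab|->] _ /=;
  rewrite ?subrr; ring.
Qed.

Lemma eq_segint f g a b : (forall x, a <= x <= b -> f x = g x) ->
  segint a b f = segint a b g.
Proof. by move=> fg; apply: eq_cint => x /=; rewrite in_itv/=; exact: fg. Qed.

Lemma cabs_segint f a b M : a <= b -> (forall x, a <= x <= b -> ccont f x) ->
  (forall x, a <= x <= b -> cabs (f x) <= M) -> cabs (segint a b f) <= M * (b - a).
Proof.
move=> ab cf fM.
have -> : M * (b - a) = \int[leb]_(x in `[a, b]) M.
  rewrite Rintegral_cst//= lebesgue_measure_itv/= lte_fin.
  by move: ab; rewrite le_eqVlt => /predU1P[->|->]; rewrite ?ltxx ?subrr /=.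
apply: cabs_cint => //.
- exact: (cintegrable_meas (ccont_integrable cf)).
- apply: continuous_compact_integrable; first exact: segment_compact.
  by apply: continuous_subspaceT => ?; exact: cvg_cst.
Qed.

(** The integral of H dz along the counterclockwise boundary of the rectangle [a, b] x [c, d],
    opposite sides being grouped. *)
Definition rectint H a b c d : C :=
  segint a b (fun x => H x c - H x d) +
  Complex 0 1 * segint c d (fun y => H b y - H a y).

(** Complex differentiability of a function of x + iy, in real coordinates: the rectangles of
    interest lie in logarithmic polar coordinates, where [H] is a composite with the exponential. *)
Definition holo2 H x y := exists L : C, forall e : R, 0 < e -> exists2 r : R, 0 < r &
  forall x' y', `|x' - x| < r -> `|y' - y| < r ->
    cabs (H x' y' - H x y - L * Complex (x' - x) (y' - y)) <=
    e * (`|x' - x| + `|y' - y|).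

Lemma holo2_cont H x y : holo2 H x y -> forall e : R, 0 < e -> exists2 r : R, 0 < r &
  forall x' y', `|x' - x| < r -> `|y' - y| < r -> cabs (H x' y' - H x y) < e.
Proof.
move=> [L /(_ 1 ltr01)[r r0 Hr]] e e0.
pose A := cabs L + 2.
have A0 : 0 < A by rewrite ltr_wpDl.
exists (Num.min r (e / (3 * A))); first by rewrite lt_min r0 divr_gt0// mulr_gt0.
move=> x' y'; rewrite !lt_min => /andP[h1 h1'] /andP[h2 h2'].
have := Hr _ _ h1 h2; rewrite mul1r => h3.
have := cabs_le_ReIm (Complex (x' - x) (y' - y)) => /= h4.
have := cabs_triangle_sub (H x' y' - H x y) (L * Complex (x' - x) (y' - y)).
rewrite cabsM => h5.
have h6 : cabs L * cabs (Complex (x' - x) (y' - y)) <= cabs L * (`|x' - x| + `|y' - y|).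
  by rewrite ler_wpM2l.
have h7 : (cabs L + 1) * (`|x' - x| + `|y' - y|) <= A * (`|x' - x| + `|y' - y|).
  by rewrite ler_wpM2r ?addr_ge0// /A lerD2l ler1n.
have h8 : A * (`|x' - x| + `|y' - y|) < e.
  move: h1' h2'; rewrite !ltr_pdivlMr ?mulr_gt0// => h9 h10.
  have := mulrCA `|x' - x| 3 A; have := mulrCA `|y' - y| 3 A.
  have := mulrDr A `|x' - x| `|y' - y|; have := mulrC A `|x' - x|.
  have := mulrC A `|y' - y|; lra.
lra.
Qed.

Lemma holo2_ccontx H x y : holo2 H x y -> ccont (H ^~ y) x.
Proof.
move=> /holo2_cont cH e e0; have [r r0 h] := cH e e0; exists r => // x' x'x.
by apply: h => //; rewrite subrr normr0.
Qed.

Lemma holo2_cconty H x y : holo2 H x y -> ccont (H x) y.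
Proof.
move=> /holo2_cont cH e e0; have [r r0 h] := cH e e0; exists r => // x' x'x.
by apply: h => //; rewrite subrr normr0.
Qed.

Lemma rectint_catx H a m b c d : a <= m -> m <= b -> c <= d ->
  (forall x y, a <= x <= b -> c <= y <= d -> holo2 H x y) ->
  rectint H a b c d = rectint H a m c d + rectint H m b c d.
Proof.
move=> am mb cd hH; rewrite /rectint (segint_cat am mb); last first.
  move=> x xab; apply: ccontB.
    by apply: holo2_ccontx; apply: hH; rewrite // lexx.
  by apply: holo2_ccontx; apply: hH; rewrite // lexx andbT.
have -> : segint c d (fun y => H b y - H a y) =
  segint c d (fun y => H m y - H a y) + segint c d (fun y => H b y - H m y).
  have hy x : a <= x <= b -> forall y, c <= y <= d -> ccont (H x) y.
    by move=> xab y ycd; apply: holo2_cconty; exact: hH.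
  have hm := hy m; have ha := hy a; have hb := hy b.
  rewrite am mb lexx (le_trans am mb) /= in hm ha hb.
  rewrite /segint -cintD//.
  - by apply: eq_cint => y _; ring.
  - by apply: ccont_integrable => y ycd; apply: ccontB; [apply: hm|apply: ha].
  - by apply: ccont_integrable => y ycd; apply: ccontB; [apply: hb|apply: hm].
ring.
Qed.

Lemma rectint_caty H a b c m d : c <= m -> m <= d -> a <= b ->
  (forall x y, a <= x <= b -> c <= y <= d -> holo2 H x y) ->
  rectint H a b c d = rectint H a b c m + rectint H a b m d.
Proof.
move=> cm md ab hH; rewrite /rectint (segint_cat cm md); last first.
  move=> y ycd; apply: ccontB.
    by apply: holo2_cconty; apply: hH; rewrite // lexx andbT.
  by apply: holo2_cconty; apply: hH; rewrite // lexx.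
have -> : segint a b (fun x => H x c - H x d) =
  segint a b (fun x => H x c - H x m) + segint a b (fun x => H x m - H x d).
  have hy y : c <= y <= d -> forall x, a <= x <= b -> ccont (H ^~ y) x.
    by move=> ycd x xab; apply: holo2_ccontx; exact: hH.
  have hm := hy m; have ha := hy c; have hb := hy d.
  rewrite cm md lexx (le_trans cm md) /= in hm ha hb.
  rewrite /segint -cintD//.
  - by apply: eq_cint => y _; ring.
  - by apply: ccont_integrable => y ycd; apply: ccontB; [apply: ha|apply: hm].
  - by apply: ccont_integrable => y ycd; apply: ccontB; [apply: hm|apply: hb].
ring.
Qed.

End Goursat.

Section GoursatTheorem.
Context (R : realType).
Local Notation C := (Cplx R).
Implicit Types (H : R -> R -> C).

Lemma rectint_split H a b c d m p : a <= m -> m <= b -> c <= p -> p <= d ->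
  (forall x y, a <= x <= b -> c <= y <= d -> holo2 H x y) ->
  rectint H a b c d = rectint H a m c p + rectint H m b c p +
    (rectint H a m p d + rectint H m b p d).
Proof.
move=> am mb cp pd hH.
rewrite (rectint_caty cp pd (le_trans am mb))//.
rewrite (rectint_catx am mb cp); last first.
  move=> x y xab /andP[y1 y2]; apply: hH => //.
  by rewrite y1 (le_trans y2 pd).
rewrite (rectint_catx am mb pd)//.
move=> x y xab /andP[y1 y2]; apply: hH => //.
by rewrite y2 (le_trans cp y1).
Qed.

Lemma nested_limit (u : nat -> R) (w : R) : 0 <= w ->
  (forall k, u k <= u k.+1) ->
  (forall k, u k.+1 + w / 2 ^+ k.+1 <= u k + w / 2 ^+ k) ->
  exists x, forall k, u k <= x <= u k + w / 2 ^+ k.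
Proof.
move=> w0 u1 u2.
have inc : {homo u : m n / (m <= n)%N >-> m <= n}.
  by apply: homo_leq => //; exact: le_trans.
have dec n m : (n <= m)%N -> u m + w / 2 ^+ m <= u n + w / 2 ^+ n.
  elim: m n => [|m IH] n; first by rewrite leqn0 => /eqP->.
  by rewrite leq_eqVlt => /predU1P[->//|/IH]; exact: le_trans.
have ub k j : u j <= u k + w / 2 ^+ k.
  have [jk|/ltnW kj] := leqP j k.
    by rewrite (le_trans (inc _ _ jk))// lerDl divr_ge0// exprn_ge0.
  by rewrite (le_trans _ (dec _ _ kj))// lerDl divr_ge0// exprn_ge0.
have hs : has_sup (range u).
  by split; [exists (u 0%N); exists 0%N|exists (u 0%N + w / 2 ^+ 0) => _ [j _ <-]].
exists (sup (range u)) => k; apply/andP; split.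
  by apply: ub_le_sup; [case: hs|exists k].
by apply: ge_sup; [case: hs|move=> _ [j _ <-]].
Qed.

(** The affine part of [H] at (x, y) contributes nothing to the contour integral. What is left is at
    most e(b - a + d - c) at each point of the boundary, hence twice that on each pair of opposite
    sides, and this is integrated over the lengths b - a and d - c. *)
Lemma rectint_small H (L : C) x y a b c d e : a <= x <= b -> c <= y <= d ->
  0 <= e ->
  (forall x y, a <= x <= b -> c <= y <= d -> holo2 H x y) ->
  (forall x' y', a <= x' <= b -> c <= y' <= d ->
    cabs (H x' y' - H x y - L * Complex (x' - x) (y' - y)) <=
    e * (`|x' - x| + `|y' - y|)) ->
  cabs (rectint H a b c d) <= 2 * e * (b - a + (d - c)) ^+ 2.
Proof.
move=> /andP[ax xb] /andP[cy yd] e0 hH hE.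
have ab := le_trans ax xb; have cd := le_trans cy yd.
pose S := b - a + (d - c).
have bnd x' y' : a <= x' <= b -> c <= y' <= d -> e * (`|x' - x| + `|y' - y|) <= e * S.
  move=> /andP[h1 h2] /andP[h3 h4]; rewrite ler_wpM2l// /S lerD// ler_norml; lra.
have ccx y' : c <= y' <= d -> forall x', a <= x' <= b -> ccont (H ^~ y') x'.
  by move=> ? ? ?; apply: holo2_ccontx; exact: hH.
have ccy x' : a <= x' <= b -> forall y', c <= y' <= d -> ccont (H x') y'.
  by move=> ? ? ?; apply: holo2_cconty; exact: hH.
have cst_cont (k : C) z : ccont (fun _ : R => k) z.
  by move=> r r0; exists 1 => // ? _; rewrite subrr cabs0.
have ca : a <= a <= b by rewrite lexx.
have cb : a <= b <= b by rewrite lexx andbT.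
have cc : c <= c <= d by rewrite lexx.
have cdd : c <= d <= d by rewrite lexx andbT.
pose f1 x' := H x' c - H x' d - L * Complex 0 (c - d).
pose f2 y' := H b y' - H a y' - L * Complex (b - a) 0.
(* The constants subtracted in [f1] and [f2] integrate to iL(b - a)(c - d) and iL(b - a)(d - c),
   which cancel. *)
have -> : rectint H a b c d = segint a b f1 + Complex 0 1 * segint c d f2.
  have i1 : cintegrable (@lebesgue_measure R) `[a, b]%classic (fun x' => H x' c - H x' d).
    by apply: ccont_integrable => x' ?; apply: ccontB; apply: ccx.
  have i2 : cintegrable (@lebesgue_measure R) `[c, d]%classic (fun y' => H b y' - H a y').
    by apply: ccont_integrable => x' ?; apply: ccontB; apply: ccy.
  have ic x1 x2 (k : C) : cintegrable (@lebesgue_measure R) `[x1, x2]%classic (fun=> k).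
    by apply: ccont_integrable => ? _; exact: cst_cont.
  have -> : segint a b f1 = segint a b (fun x' => H x' c - H x' d) -
      segint a b (fun=> L * Complex 0 (c - d)) by exact: cintB.
  have -> : segint c d f2 = segint c d (fun y' => H b y' - H a y') -
      segint c d (fun=> L * Complex (b - a) 0) by exact: cintB.
  rewrite /rectint.
  have -> := @segint_cst R a b (L * Complex 0 (c - d)) ab.
  have -> := @segint_cst R c d (L * Complex (b - a) 0) cd.
  have -> : Complex 0 (c - d) = Complex 0 1 * toC (c - d) :> C.
    by apply: complexP; rewrite ?cReM ?cImM /=; ring.
  rewrite -[Complex (b - a) 0]/(toC (b - a)).
  by rewrite !toCD !toCN; ring.
have n1 x' : a <= x' <= b -> cabs (f1 x') <= 2 * (e * S).
  move=> x'ab; rewrite /f1.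
  have -> : Complex 0 (c - d) = Complex (x' - x) (c - y) - Complex (x' - x) (d - y) :> C.
    by apply: complexP; rewrite ?cReD ?cImD ?cReN ?cImN /=; ring.
  have -> : H x' c - H x' d - L * (Complex (x' - x) (c - y) - Complex (x' - x) (d - y)) =
     (H x' c - H x y - L * Complex (x' - x) (c - y)) -
     (H x' d - H x y - L * Complex (x' - x) (d - y)) by ring.
  apply: le_trans (cabsB _ _) _; rewrite mulr2n mulrDl mul1r lerD//.
    by rewrite (le_trans (hE _ _ _ _))// bnd.
  by rewrite (le_trans (hE _ _ _ _))// bnd.
have n2 y' : c <= y' <= d -> cabs (f2 y') <= 2 * (e * S).
  move=> x'ab; rewrite /f2.
  have -> : Complex (b - a) 0 = Complex (b - x) (y' - y) - Complex (a - x) (y' - y) :> C.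
    by apply: complexP; rewrite ?cReD ?cImD ?cReN ?cImN /=; ring.
  have -> : H b y' - H a y' - L * (Complex (b - x) (y' - y) - Complex (a - x) (y' - y)) =
     (H b y' - H x y - L * Complex (b - x) (y' - y)) -
     (H a y' - H x y - L * Complex (a - x) (y' - y)) by ring.
  apply: le_trans (cabsB _ _) _; rewrite mulr2n mulrDl mul1r lerD//.
    by rewrite (le_trans (hE _ _ _ _))// bnd.
  by rewrite (le_trans (hE _ _ _ _))// bnd.
apply: le_trans (cabsD _ _) _; rewrite cabsM.
have -> : cabs (Complex 0 1 : C) = 1 by rewrite cabsE /= expr0n add0r expr1n sqrtr1.
rewrite mul1r.
have -> : 2 * e * (b - a + (d - c)) ^+ 2 = 2 * (e * S) * (b - a) + 2 * (e * S) * (d - c).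
  by rewrite /S; ring.
apply: lerD.
  apply: cabs_segint => // x' ?; rewrite /f1; apply: ccontB; last exact: cst_cont.
  by apply: ccontB; apply: ccx.
apply: cabs_segint => // x' ?; rewrite /f2; apply: ccontB; last exact: cst_cont.
by apply: ccontB; apply: ccy.
Qed.

(** Repeated quartering keeps at least 4^-k of the modulus of the integral in a rectangle whose
    sides are divided by 2^k, while differentiability at the common point bounds that integral by a
    small multiple of 4^-k. *)
Theorem goursat H a b c d : a <= b -> c <= d ->
  (forall x y, a <= x <= b -> c <= y <= d -> holo2 H x y) ->
  rectint H a b c d = 0.
Proof.
move=> ab cd hH; apply/eqP; rewrite -cabs_eq0.
apply: contraT => Dn0; exfalso.
set Dl := cabs _ in Dn0.
have {Dn0} D0 : 0 < Dl by rewrite lt_def cabs_ge0 andbT; apply: contra Dn0 => /eqP ->.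
pose W := b - a; pose V := d - c.
have W0 : 0 <= W by rewrite subr_ge0.
have V0 : 0 <= V by rewrite subr_ge0.
pose De k (p : R * R) := rectint H p.1 (p.1 + W / 2 ^+ k) p.2 (p.2 + V / 2 ^+ k).
pose In k (p : R * R) := [/\ a <= p.1, p.1 + W / 2 ^+ k <= b, c <= p.2 & p.2 + V / 2 ^+ k <= d].
pose St k (p q : R * R) := [/\ p.1 <= q.1, q.1 + W / 2 ^+ k.+1 <= p.1 + W / 2 ^+ k,
   p.2 <= q.2 & q.2 + V / 2 ^+ k.+1 <= p.2 + V / 2 ^+ k].
(* The claim is made for every corner, with membership as a premise inside, so that choice returns a
   total function to iterate. *)
have step (kp : nat * (R * R)) : exists q, In kp.1 kp.2 ->
    St kp.1 kp.2 q /\ cabs (De kp.1 kp.2) <= 4 * cabs (De kp.1.+1 q).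
  case: kp => k [x y] /=.
  have [[/= ax xb cy yd]|nI] := pselect (In k (x, y)); last by exists (0, 0).
  have hW : W / 2 ^+ k = W / 2 ^+ k.+1 + W / 2 ^+ k.+1.
    by rewrite exprSr invfM mulrA -splitr.
  have hV : V / 2 ^+ k = V / 2 ^+ k.+1 + V / 2 ^+ k.+1.
    by rewrite exprSr invfM mulrA -splitr.
  have w0 : 0 <= W / 2 ^+ k.+1 by rewrite divr_ge0// exprn_ge0.
  have v0 : 0 <= V / 2 ^+ k.+1 by rewrite divr_ge0// exprn_ge0.
  rewrite hW in xb; rewrite hV in yd.
  have e1 (u v : R) : 0 <= v -> u + v <= u + (v + v) by rewrite addrA lerDl.
  have e2 (u v : R) : u + v + v <= u + (v + v) by rewrite addrA.
  have e3 (u v : R) : 0 <= v -> u <= u + v by rewrite lerDl.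
  have {}e1 := (e1 _ _ w0, e1 _ _ v0); have {}e3 := (e3 _ _ w0, e3 _ _ v0).
  have /(congr1 (@cabs R)) : De k (x, y) =
      De k.+1 (x, y) + De k.+1 (x + W / 2 ^+ k.+1, y) +
     (De k.+1 (x, y + V / 2 ^+ k.+1) + De k.+1 (x + W / 2 ^+ k.+1, y + V / 2 ^+ k.+1)).
    rewrite /De /= hW hV [x + (_ + _)]addrA [y + (_ + _)]addrA; apply: rectint_split; rewrite ?lerDl//.
    by move=> x' y' /andP[? ?] /andP[? ?]; apply: hH; apply/andP; split; lra.
  set d1 := De _.+1 (x, y); set d2 := De _.+1 (_, y); set d3 := De _ (x, y + _); set d4 := De _.+1 (x + _, y + _) => dE.
  have [q [Sq Dq]] : exists q, St k (x, y) q /\ cabs (De k (x, y)) <= 4 * cabs (De k.+1 q).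
    have : cabs (De k (x, y)) <= cabs d1 + cabs d2 + (cabs d3 + cabs d4).
      by rewrite dE; apply: le_trans (cabsD _ _) _; apply: lerD; exact: cabsD.
    have [h1 _|h1] := leP (cabs (De k (x, y))) (4 * cabs d1).
      by exists (x, y); split => //; split; rewrite //= ?hW ?hV ?lexx ?e1 ?e2 ?e3.
    have [h2 _|h2] := leP (cabs (De k (x, y))) (4 * cabs d2).
      by exists (x + W / 2 ^+ k.+1, y); split => //; split; rewrite //= ?hW ?hV ?lexx ?e1 ?e2 ?e3.
    have [h3 _|h3] := leP (cabs (De k (x, y))) (4 * cabs d3).
      by exists (x, y + V / 2 ^+ k.+1); split => //; split; rewrite //= ?hW ?hV ?lexx ?e1 ?e2 ?e3.
    have [h4 _|h4] := leP (cabs (De k (x, y))) (4 * cabs d4).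
      by exists (x + W / 2 ^+ k.+1, y + V / 2 ^+ k.+1); split => //; split; rewrite //= ?hW ?hV ?lexx ?e1 ?e2 ?e3.
    by lra.
  by exists q.
have [f Hf] := choice step.
pose s := fix s k := if k is k'.+1 then f (k', s k') else (a, c).
have sS k : s k.+1 = f (k, s k) by [].
have Is k : In k (s k) /\ Dl <= 4 ^+ k * cabs (De k (s k)).
  elim: k => [|k [Ik Dk]].
    rewrite expr0 mul1r /De /In /= expr0 !divr1 /W /V.
    by rewrite !subrKC; split.
  have [[/= s1 s2 s3 s4] DD] := Hf (k, s k) Ik.
  case: Ik => i1 i2 i3 i4.
  split.
    split; [exact: le_trans i1 s1|exact: le_trans s2 i2|exact: le_trans i3 s3|exact: le_trans s4 i4].
  apply: le_trans Dk _; rewrite exprSr -mulrA ler_wpM2l// exprn_ge0//.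
have SSk k : St k (s k) (s k.+1) by have [] := Hf (k, s k) (proj1 (Is k)).
have [x hx] : exists x, forall k, (s k).1 <= x <= (s k).1 + W / 2 ^+ k.
  by apply: (@nested_limit (fun k => (s k).1)) => // k; case: (SSk k).
have [y hy] : exists y, forall k, (s k).2 <= y <= (s k).2 + V / 2 ^+ k.
  by apply: (@nested_limit (fun k => (s k).2)) => // k; case: (SSk k).
have hxy : holo2 H x y.
  apply: hH; first by have := hx 0%N; rewrite /= expr0 divr1 /W subrKC.
  by have := hy 0%N; rewrite /= expr0 divr1 /V subrKC.
case: hxy => L hL.
(* The summand 1 keeps [S] positive for a degenerate rectangle. With the tolerance
   [Dl / (4 * S ^+ 2)] the final bound is at most half of [Dl]. *)
pose S := W + V + 1.
have S0 : 0 < S by rewrite ltr_wpDl// addr_ge0.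
have [r r0 Hr] := hL (Dl / (4 * S ^+ 2)) ltac:(by rewrite divr_gt0// mulr_gt0// exprn_gt0).
have [k hk] : exists k, S / 2 ^+ k < r.
  have := @cvg_geometric R S (2^-1).
  rewrite ger0_norm ?invr_ge0// invf_lt1// ltr1n => /(_ isT) /cvgrPdist_lt/(_ _ r0)[k _ hk].
  exists k; have := hk k (leqnn k); rewrite /geometric /= sub0r normrN.
  rewrite ger0_norm ?exprVn//.
  by rewrite mulr_ge0 ?exprn_ge0 ?invr_ge0// ltW.
have [[i1 i2 i3 i4] Dk] := Is k.
have p0 : 0 < (2 : R) ^+ k by rewrite exprn_gt0.
have hWr : W / 2 ^+ k < r.
  by apply: le_lt_trans hk; rewrite ler_pdivrMr// divfK ?gt_eqF// /S -addrA lerDl addr_ge0.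
have hVr : V / 2 ^+ k < r.
  by apply: le_lt_trans hk; rewrite ler_pdivrMr// divfK ?gt_eqF// /S addrAC lerDr addr_ge0.
have e0 : 0 <= Dl / (4 * S ^+ 2) by rewrite divr_ge0 ?ltW// mulr_gt0// exprn_gt0.
have hxk := hx k; have hyk := hy k.
have D1 : cabs (De k (s k)) <= 2 * (Dl / (4 * S ^+ 2)) *
    ((s k).1 + W / 2 ^+ k - (s k).1 + ((s k).2 + V / 2 ^+ k - (s k).2)) ^+ 2.
  apply: (@rectint_small H L x y) => //.
    move=> x' y' /andP[x1 x2] /andP[y1 y2]; apply: hH; apply/andP; split.
    - exact: le_trans x1.
    - exact: le_trans x2 _.
    - exact: le_trans y1.
    - exact: le_trans y2 _.
  move=> x' y' /andP[x1 x2] /andP[y1 y2].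
  move: hxk hyk => /andP[x3 x4] /andP[y3 y4].
  by apply: Hr; rewrite ltr_norml; apply/andP; split; lra.
have D2 : Dl <= 4 ^+ k * (2 * (Dl / (4 * S ^+ 2)) * ((W + V) / 2 ^+ k) ^+ 2).
  have aK (u v : R) : u + v - u = v by rewrite addrAC subrr add0r.
  rewrite !aK -mulrDl in D1.
  by apply: le_trans Dk _; rewrite ler_wpM2l ?exprn_ge0.
have e4 : (4 : R) ^+ k = 2 ^+ k * 2 ^+ k by rewrite -exprMn -natrM.
have E : 4 ^+ k * (2 * (Dl / (4 * S ^+ 2)) * ((W + V) / 2 ^+ k) ^+ 2) =
   Dl / 2 * ((W + V) ^+ 2 / S ^+ 2).
  rewrite e4; field; rewrite !gt_eqF//.
have : (W + V) ^+ 2 / S ^+ 2 <= 1.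
  rewrite ler_pdivrMr ?exprn_gt0// mul1r; apply: lerXn2r.
  - by rewrite nnegrE addr_ge0.
  - by rewrite nnegrE ltW.
  - by rewrite /S lerDl.
rewrite E in D2 => h; have : Dl / 2 * ((W + V) ^+ 2 / S ^+ 2) <= Dl / 2 * 1.
  by rewrite ler_wpM2l// divr_ge0// ltW.
by rewrite mulr1; lra.
Qed.

End GoursatTheorem.

(** * Complex differentiability in one variable *)

Section CDiff.
Context (R : realType).
Local Notation C := (Cplx R).
Implicit Types (g q : C -> C) (t : C).

Lemma cdiffP g t : cdiff g t <-> derivable g t 1.
Proof.
split; last exact: derivable_cdiff.
move=> [L H]; apply/cvg_ex; exists L; apply/cvg_cabsP => e e0.
have [d d0 {}H] := H (e / 2) ltac:(by rewrite divr_gt0).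
apply/nbhs_cabsP; exists d => // h hd h0.
rewrite subr0 in hd.
have -> : h^-1 *: ((g \o shift t) (h *: 1) - g t) - L = (g (t + h) - g t - L * h) / h.
  by rewrite /= [h *: 1]mulr1 (addrC h t) mulrBl mulfK// [_ / h]mulrC.
rewrite cabsM cabsV ltr_pdivrMr ?cabs_gt0//.
apply: le_lt_trans (H h hd) _.
by rewrite ltr_pM2r ?cabs_gt0// ltr_pdivrMr// ltr_pMr// ltr1n.
Qed.

Lemma cdiff_cst (c : C) t : cdiff (cst c) t.
Proof. apply/cdiffP; exact: derivable_cst. Qed.

Lemma cdiff_id t : cdiff id t.
Proof. apply/cdiffP; exact: derivable_id. Qed.

Lemma cdiffB g q t : cdiff g t -> cdiff q t -> cdiff (fun s => g s - q s) t.
Proof. by move=> /cdiffP dg /cdiffP dq; apply/cdiffP; exact: derivableB. Qed.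

Lemma cdiffM g q t : cdiff g t -> cdiff q t -> cdiff (fun s => g s * q s) t.
Proof. by move=> /cdiffP dg /cdiffP dq; apply/cdiffP; have := @derivableM _ _ g q t 1 dg dq. Qed.

Lemma cdiffV g t : g t != 0 -> cdiff g t -> cdiff (fun s => (g s)^-1) t.
Proof. by move=> g0 /cdiffP dg; apply/cdiffP; have := @derivableV _ _ g t 1 g0 dg. Qed.

Lemma cdiffX g t n : cdiff g t -> cdiff (fun s => g s ^+ n) t.
Proof.
move=> dg; elim: n => [|n IH]; first exact: (cdiff_cst 1).
by have := cdiffM dg IH; under eq_fun do rewrite -exprS.
Qed.

Lemma cdiffD g q t : cdiff g t -> cdiff q t -> cdiff (fun s => g s + q s) t.
Proof. by move=> /cdiffP dg /cdiffP dq; apply/cdiffP; exact: derivableD. Qed.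

Lemma cdiff_sum I (r : seq I) (F : I -> C -> C) t : (forall i, cdiff (F i) t) ->
  cdiff (fun s => \sum_(i <- r) F i s) t.
Proof.
move=> dF; elim: r => [|i r IH].
  by under eq_fun do rewrite big_nil; exact: (cdiff_cst 0).
by under eq_fun do rewrite big_cons; exact: cdiffD.
Qed.

Lemma near_cdiff g q t (r : R) : 0 < r -> (forall s, cabs (s - t) < r -> g s = q s) ->
  cdiff g t -> cdiff q t.
Proof.
move=> r0 gq [L H]; exists L => e e0; have [d d0 {}H] := H e e0.
exists (Num.min d r); first by rewrite lt_min d0.
move=> h; rewrite lt_min => /andP[hd hr].
by rewrite -!gq ?subrr ?cabs0 ?(addrC t h) ?addrK// addrC H.
Qed.

Definition ccont1 g t := forall e : R, 0 < e -> exists2 d : R, 0 < d &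
  forall s, cabs (s - t) < d -> cabs (g s - g t) < e.

Lemma cdiff_cont g t : cdiff g t -> ccont1 g t.
Proof.
move=> [L /(_ 1 ltr01)[d d0 H]] e e0.
have A0 : 0 < cabs L + 1 by rewrite ltr_wpDl.
exists (Num.min d (e / (cabs L + 1))); first by rewrite lt_min d0 divr_gt0.
move=> s; rewrite lt_min => /andP[hd]; rewrite ltr_pdivlMr// => he.
have := H (s - t) hd; rewrite (addrC t) subrK mul1r => h1.
apply: le_lt_trans he.
rewrite mulrDr mulr1 mulrC -cabsM -lerBlDl; apply: le_trans h1.
exact: cabs_triangle_sub.
Qed.

End CDiff.

(** * The exponential and integrals over circles *)

Section Circle.
Context (R : realType).
Local Notation C := (Cplx R).

Definition cexp (x y : R) : C := Complex (expR x * cos y) (expR x * sin y).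

Lemma cexpD x y a b : cexp (x + a) (y + b) = cexp x y * cexp a b.
Proof.
by apply: complexP; rewrite ?cReM ?cImM /= expRD ?cosD ?sinD; ring.
Qed.

Lemma cabs_cexp x y : cabs (cexp x y) = expR x.
Proof.
rewrite cabsE /= !exprMn -mulrDr cos2Dsin2 mulr1 sqrtr_sqr ger0_norm ?expR_ge0//.
Qed.

Lemma small_deriv (f : R -> R) l : is_derive (0 : R) 1 f l -> forall e : R, 0 < e ->
  exists2 d : R, 0 < d & forall h, `|h| < d -> `|f h - f 0 - l * h| <= e * `|h|.
Proof.
move=> fl e e0; have df : derivable f 0 1 by [].
have /cvgrPdist_lt/(_ e e0) : h^-1 *: ((f \o shift 0) h - f 0) @[h --> 0^'] --> l.
  move: df => /derivable1P => df.
  have -> : l = 'D_1 f 0 by rewrite derive_val.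
  rewrite /derive; have -> : (fun h : R => h^-1 *: ((f \o shift 0) h - f 0)) =
    (fun h : R => h^-1 *: ((f \o shift 0) (h *: 1) - f 0)).
    by apply/funext => h; rewrite [h *: 1]mulr1.
  exact: ex_derive.
move=> [d /= d0 H]; exists d => // h hd.
have [->|h0] := eqVneq h 0; first by rewrite subrr mulr0 subrr normr0 mulr0.
have := H h; rewrite /ball_ /= sub0r normrN => /(_ hd h0) /ltW; rewrite addr0.
have -> : f h - f 0 - l * h = - ((l - h^-1 *: (f h - f 0)) * h).
  by rewrite mulrBl /GRing.scale /= mulrAC mulVf// mul1r opprB.
by move=> hh; rewrite normrN normrM ler_wpM2r.
Qed.

(** Multiplicativity moves the question to the origin, where the first order expansions of [expR],
    [cos] and [sin] suffice. *)
Lemma holo2_cexp x y : holo2 cexp x y.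
Proof.
exists (cexp x y) => e e0.
pose K := expR x; have K0 : 0 < K by exact: expR_gt0.
pose e' := Num.min 1 (e / (8 * K)).
have e'0 : 0 < e' by rewrite lt_min ltr01 divr_gt0// mulr_gt0.
have e'1 : e' <= 1 by rewrite ge_min lexx.
have e'2 : e' <= e / (8 * K) by rewrite ge_min lexx orbT.
clearbody e'.
have [d1 d10 H1] := small_deriv (is_derive_expR 0) e'0.
have [d2 d20 H2] := small_deriv (is_derive_cos 0) e'0.
have [d3 d30 H3] := small_deriv (is_derive_sin 0) e'0.
exists (Num.min (Num.min d1 e') (Num.min d2 d3)); first by rewrite !lt_min d10 d20 d30 e'0.
move=> x' y'; rewrite !lt_min => /andP[/andP[a1 a2] _] /andP[/andP[_ b0] /andP[b2 b3]].
rewrite -{1}(subrKC x x') -{1}(subrKC y y') cexpD.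
move: a1 a2 b0 b2 b3; set a := x' - x; set b := y' - y => a1 a2 b0 b2 b3.
have -> : cexp x y * cexp a b - cexp x y - cexp x y * Complex a b =
  cexp x y * (cexp a b - 1 - Complex a b) by ring.
rewrite cabsM cabs_cexp -/K.
have := H1 a a1; have := H2 b b2; have := H3 b b3.
rewrite expR0 cos0 sin0 oppr0 mul0r !subr0 !mul1r ?addr0 => h3 h2 h1.
have {}h2 : `|cos b - 1| <= e' * `|b| by [].
suff : cabs (cexp a b - 1 - Complex a b) <= 8 * e' * (`|a| + `|b|).
  move=> h; rewrite mulrC -ler_pdivlMr//; apply: le_trans h _.
  rewrite [leRHS]mulrAC ler_wpM2r ?addr_ge0//.
  move: e'2; by rewrite ler_pdivlMr ?mulr_gt0// ler_pdivlMr// => h; lra.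
apply: le_trans (cabs_le_ReIm _) _.
rewrite !cReD !cImD !cReN !cImN /= oppr0 addr0.
have -> : expR a * cos b - 1 - a = (expR a - 1 - a) * cos b + (1 + a) * (cos b - 1) by ring.
have -> : expR a * sin b - b = (expR a - 1) * sin b + (sin b - b) by ring.
have n1 : `|(expR a - 1 - a) * cos b| <= e' * `|a|.
  by rewrite normrM (le_trans _ h1)// ler_piMr// cos_max.
have n2 : `|(1 + a) * (cos b - 1)| <= 2 * (e' * `|b|).
  rewrite normrM ler_pM//; apply: le_trans (ler_normD _ _) _; rewrite normr1.
  lra.
have n3 : `|expR a - 1| <= 2 * `|a|.
  have := ler_normD (expR a - 1 - a) a; rewrite subrK.
  have : e' * `|a| <= 1 * `|a| by rewrite ler_wpM2r.
  lra.
have n4 : `|sin b| <= 2 * `|b|.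
  have := ler_normD (sin b - b) b; rewrite subrK.
  have : e' * `|b| <= 1 * `|b| by rewrite ler_wpM2r.
  lra.
have n5 : `|(expR a - 1) * sin b| <= 4 * (e' * `|a|).
  rewrite normrM; apply: le_trans (ler_pM _ _ n3 n4) _ => //.
  have : `|a| * `|b| <= `|a| * e' by rewrite ler_wpM2l// ltW.
  by have := mulrC e' `|a|; lra.
have := ler_normD ((expR a - 1 - a) * cos b) ((1 + a) * (cos b - 1)).
have := ler_normD ((expR a - 1) * sin b) (sin b - b).
have : 0 <= e' * `|a| by rewrite mulr_ge0// ltW.
have : 0 <= e' * `|b| by rewrite mulr_ge0// ltW.
have := mulrDr e' `|a| `|b|.
lra.
Qed.

Lemma holo2_comp (H : R -> R -> C) (q : C -> C) x y : holo2 H x y -> cdiff q (H x y) ->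
  holo2 (fun x y => q (H x y)) x y.
Proof.
move=> hH dq; have cH := holo2_cont hH.
move: hH dq => [L hL] [M hM]; exists (M * L) => e e0.
pose A := cabs M + cabs L + 2.
have A2 : 2 <= A by rewrite /A lerDr addr_ge0.
have A0 : 0 < A by exact: lt_le_trans A2.
pose e' := Num.min 1 (e / A).
have e'0 : 0 < e' by rewrite lt_min ltr01 divr_gt0.
have [d d0 {}hM] := hM e' e'0.
have [r1 r10 {}cH] := cH d d0.
have [r2 r20 {}hL] := hL e' e'0.
exists (Num.min r1 r2); first by rewrite lt_min r10.
move=> x' y'; rewrite !lt_min => /andP[a1 a2] /andP[b1 b2].
have h1 := hM _ (cH _ _ a1 b1); rewrite subrKC in h1.
have h2 := hL _ _ a2 b2.
set S := `|x' - x| + `|y' - y| in h2 *.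
set z := Complex (x' - x) (y' - y) in h2 *.
have S0 : 0 <= S by rewrite addr_ge0.
have zS : cabs z <= S by exact: cabs_le_ReIm.
set D := H x' y' - H x y in h1 h2 *.
have -> : q (H x' y') - q (H x y) - M * L * z =
  (q (H x' y') - q (H x y) - M * D) + M * (D - L * z) by ring.
apply: le_trans (cabsD _ _) _; rewrite [cabs (M * _)]cabsM.
have h3 : cabs M * cabs (D - L * z) <= cabs M * (e' * S) by rewrite ler_wpM2l.
have h4 : cabs D <= (1 + cabs L) * S.
  have := cabs_triangle_sub D (L * z); rewrite cabsM.
  have : cabs L * cabs z <= cabs L * S by rewrite ler_wpM2l.
  have : e' * S <= 1 * S by rewrite ler_wpM2r// ge_min lexx.
  by rewrite mulrDl; lra.
have h5 : e' * cabs D <= e' * ((1 + cabs L) * S) by rewrite ler_wpM2l// ltW.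
have h6 : e' * A * S <= e * S.
  by rewrite ler_wpM2r// -ler_pdivlMr// ge_min lexx orbT.
have h7 : e' * A * S = e' * ((1 + cabs L) * S) + cabs M * (e' * S) + e' * S by rewrite /A; ring.
have h8 : 0 <= e' * S by rewrite mulr_ge0// ltW.
lra.
Qed.

Definition circ (r th : R) : C := Complex (r * cos th) (r * sin th).

Lemma circE r th : circ r th = toC r * cexp 0 th.
Proof. by apply: complexP; rewrite ?cReM ?cImM /= expR0; ring. Qed.

Lemma cabs_circ r th : 0 <= r -> cabs (circ r th) = r.
Proof. by move=> r0; rewrite circE cabsM cabs_toC cabs_cexp expR0 mulr1 ger0_norm. Qed.

Lemma cexp_circ x y : cexp x y = circ (expR x) y. Proof. by []. Qed.

(** The integral in the angle, that is of q(t) dt / (it); with this normalization Cauchy's formula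
    is a statement about means. *)
Definition circint (r : R) (q : C -> C) : C := segint 0 (2 * pi) (fun th => q (circ r th)).

Lemma ccont_comp (f : R -> C) q x : ccont f x -> ccont1 q (f x) -> ccont (fun y => q (f y)) x.
Proof.
move=> cf cq e e0; have [d d0 H] := cq e e0; have [d' d'0 H'] := cf d d0.
by exists d' => // y /H' /H.
Qed.

Lemma ccont_cexp x th : ccont (cexp x) th.
Proof. exact: (holo2_cconty (holo2_cexp x th)). Qed.

Lemma ccont_cst (c : C) x : ccont (fun=> c) x.
Proof. by move=> r r0; exists 1 => // ? _; rewrite subrr cabs0. Qed.

Lemma ccont_circ r th : ccont (circ r) th.
Proof.
rewrite (_ : circ r = fun th => toC r * cexp 0 th); last by apply/funext => ?; exact: circE.
by apply: ccontM; [exact: ccont_cst|exact: ccont_cexp].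
Qed.

Lemma twopi_ge0 : 0 <= 2 * pi :> R. Proof. by rewrite mulr_ge0// pi_ge0. Qed.

(** Goursat's theorem for q composed with the exponential on [ln r1, ln r2] x [0, 2 pi]: the
    horizontal sides cancel by periodicity, and the vertical sides are the two circle integrals. *)
Lemma circint_const q r1 r2 : 0 < r1 -> r1 <= r2 ->
  (forall t, r1 <= cabs t <= r2 -> cdiff q t) -> circint r1 q = circint r2 q.
Proof.
move=> r10 r12 dq; have r20 := lt_le_trans r10 r12.
have x12 : ln r1 <= ln r2 by rewrite ler_ln.
pose H x y := q (cexp x y).
have hH x y : ln r1 <= x <= ln r2 -> 0 <= y <= 2 * pi -> holo2 H x y.
  move=> /andP[x1 x2] _; apply: holo2_comp; first exact: holo2_cexp.
  by apply: dq; rewrite cabs_cexp -(@lnK _ r1) ?posrE// -(@lnK _ r2) ?posrE// !ler_expR x1.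
have := goursat x12 twopi_ge0 hH; rewrite /rectint.
have -> : segint (ln r1) (ln r2) (fun x => H x 0 - H x (2 * pi)) = 0.
  rewrite (@eq_segint _ _ (fun=> 0)) ?segint_cst ?mulr0// => x _.
  have -> : H x (2 * pi) = H x 0; last by rewrite subrr.
  by rewrite /H /cexp mulr_natl cos2pi sin2pi cos0 sin0.
rewrite add0r => /eqP; rewrite mulf_eq0 => /orP[/eqP[] /eqP|]; first by rewrite oner_eq0.
have cH x y : ln r1 <= x <= ln r2 -> 0 <= y <= 2 * pi -> ccont (H x) y.
  by move=> ? ?; apply: holo2_cconty; exact: hH.
rewrite /segint cintB//; last 2 first.
- by apply: ccont_integrable => y ?; apply: cH => //; rewrite x12 lexx.
- by apply: ccont_integrable => y ?; apply: cH => //; rewrite x12 lexx.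
rewrite subr_eq0 => /eqP E; rewrite /circint /segint.
have -> : (fun th => q (circ r1 th)) = H (ln r1) by apply/funext => th; rewrite /H cexp_circ lnK// posrE.
by rewrite -E; congr cint; apply/funext => th; rewrite /H cexp_circ lnK// posrE.
Qed.

End Circle.

(** * Cauchy's formula and the Taylor remainder *)

Section Cauchy.
Context (R : realType).
Local Notation C := (Cplx R).
Implicit Types (g q : C -> C).

Lemma circ_dist r th r' th' :
  cabs (circ r' th' - circ r th) <= `|r' - r| + `|r| * cabs (cexp 0 th' - cexp 0 th : C).
Proof.
have -> : circ r' th' - circ r th =
  toC (r' - r) * cexp 0 th' + toC r * (cexp 0 th' - cexp 0 th) :> C.
  by rewrite !circE toCD toCN; ring.
by apply: le_trans (cabsD _ _) _; rewrite !cabsM !cabs_toC cabs_cexp expR0 mulr1.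
Qed.

(** The closed disc is the image of a compact rectangle under polar coordinates, so compactness of
    segments is enough. *)
Lemma polar_bounded q (rho : R) : (forall t, cabs t <= rho -> ccont1 q t) ->
  exists2 M : R, 0 <= M & forall r th, 0 <= r <= rho -> 0 <= th <= 2 * pi ->
    cabs (q (circ r th)) <= M.
Proof.
move=> cq; pose f (p : R * R) := cabs (q (circ p.1 p.2)).
pose A := (`[0, rho] `*` `[0, 2 * pi] : set (R * R))%classic.
have cA : compact (f @` A).
  apply: continuous_compact; last by apply: compact_setX; exact: segment_compact.
  apply: continuous_in_subspaceT => -[r th] /set_mem [/=].
  rewrite !in_itv/= => /andP[r0 r1] _; apply/cvgrPdist_lt => e e0.
  have [d d0 H] := cq (circ r th) ltac:(by rewrite cabs_circ) _ e0.
  have r10 : 0 < `|r| + 1 by rewrite ltr_wpDl.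
  have d2 : 0 < d / 2 by rewrite divr_gt0.
  have d3 : 0 < d / 2 / (`|r| + 1) by rewrite divr_gt0.
  have [d' d'0 H'] := ccont_cexp 0 th d3.
  have c1 : (fun p : R * R => p.1) @ (r, th) --> r by exact: cvg_fst.
  have c2 : (fun p : R * R => p.2) @ (r, th) --> th by exact: cvg_snd.
  move/cvgrPdist_lt : c1 => /(_ _ d2) c1.
  move/cvgrPdist_lt : c2 => /(_ _ d'0) c2.
  near=> p; rewrite /f /= distrC; apply: le_lt_trans (cabs_distB _ _) _.
  apply: H; apply: le_lt_trans (circ_dist _ _ _ _) _.
  rewrite (splitr d) ltr_leD//.
    by rewrite distrC; near: p.
  have : cabs (cexp 0 p.2 - cexp 0 th : C) < d / 2 / (`|r| + 1).
    by apply: H'; rewrite distrC; near: p.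
  rewrite ltr_pdivlMr// => /ltW; apply: le_trans.
  by rewrite mulrC ler_wpM2l// lerDl.
have [M [_ HM]] := compact_bounded cA.
exists (`|M| + 1) => // r th rr tt.
have Af : (f @` A) (f (r, th)) by exists (r, th) => //; split; rewrite /= in_itv/=.
have := HM (`|M| + 1) ltac:(by rewrite ltr_pwDr// ler_norm) _ Af.
by rewrite /= ger0_norm// /f cabs_ge0.
Unshelve. all: by end_near. Qed.

Lemma circint_integrable q (r : R) : 0 <= r -> (forall t, cabs t = r -> ccont1 q t) ->
  cintegrable (@lebesgue_measure R) `[0, 2 * pi]%classic (fun th => q (circ r th)).
Proof.
move=> r0 cq; apply: ccont_integrable => th _; apply: ccont_comp; first exact: ccont_circ.
by apply: cq; rewrite cabs_circ.
Qed.

Lemma circintB q q' (r : R) : 0 <= r -> (forall t, cabs t = r -> cdiff q t) ->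
  (forall t, cabs t = r -> cdiff q' t) ->
  circint r (fun t => q t - q' t) = circint r q - circint r q'.
Proof.
by move=> r0 cq cq'; apply: cintB => //; apply: circint_integrable => // t tr;
  apply: cdiff_cont; [apply: cq|apply: cq'].
Qed.

Lemma circintD q q' (r : R) : 0 <= r -> (forall t, cabs t = r -> cdiff q t) ->
  (forall t, cabs t = r -> cdiff q' t) ->
  circint r (fun t => q t + q' t) = circint r q + circint r q'.
Proof.
by move=> r0 cq cq'; apply: cintD => //; apply: circint_integrable => // t tr;
  apply: cdiff_cont; [apply: cq|apply: cq'].
Qed.

Lemma circintZ c q (r : R) : 0 <= r -> (forall t, cabs t = r -> cdiff q t) ->
  circint r (fun t => c * q t) = c * circint r q.
Proof.
move=> r0 cq; apply: cintZ => //; apply: circint_integrable => // t tr.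
by apply/cdiff_cont/cq.
Qed.

Lemma circint_sum n (q : nat -> C -> C) (r : R) : 0 <= r ->
  (forall i t, cabs t = r -> cdiff (q i) t) ->
  circint r (fun t => \sum_(i < n) q i t) = \sum_(i < n) circint r (q i).
Proof.
move=> r0 cq.
rewrite /circint /segint -cint_sum//= => i; apply: circint_integrable => // t tr.
by apply/cdiff_cont/cq.
Qed.

(** [circint_const] applies only to positive radii and where the function is differentiable.
    Continuity in the radius reaches radius 0 and the circle through an exceptional point. *)
Lemma circint_cvg q (rho : R) (r : nat -> R) (l : R) :
  (forall t, cabs t <= rho -> ccont1 q t) ->
  (forall n, 0 <= r n <= rho) -> 0 <= l <= rho ->
  r @ \oo --> l ->
  forall e : R, 0 < e -> \forall n \near \oo, cabs (circint (r n) q - circint l q) < e.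
Proof.
move=> cq r0 /andP[l0 l1] rl.
have [M M0 HM] := polar_bounded cq.
have H := @cint_dominated _ _ R (@lebesgue_measure R) `[0, 2 * pi]%classic
  (measurable_itv _) (fun n th => q (circ (r n) th)) (fun th => q (circ l th)) (fun=> M).
apply: H.
- move=> n; have /andP[rn0 rn1] := r0 n.
  apply/cintegrable_meas/circint_integrable => // t tr.
  by apply: cq; rewrite tr.
- apply: continuous_compact_integrable; first exact: segment_compact.
  by apply: continuous_subspaceT => ?; exact: cvg_cst.
- by move=> n th /=; rewrite in_itv/= => ?; apply: HM.
- move=> th /= _ e e0.
  have [d d0 H] := cq (circ l th) ltac:(by rewrite cabs_circ) _ e0.
  move/cvgrPdist_lt : rl => /(_ _ d0); apply: filterS => n; rewrite distrC => h.
  apply: H; apply: le_lt_trans (circ_dist _ _ _ _) _.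
  by rewrite subrr cabs0 mulr0 addr0.
Qed.

Section CauchyFormula.
Variables (g : C -> C) (Rr : R).
Hypothesis dg : forall t, cabs t < Rr -> cdiff g t.

(** The difference quotient of [g] at [w], continued at [w] by its limit and multiplied by t to
    compensate the dt / (it) in [circint]. The factor also makes the function vanish at 0 when [w]
    is not 0, so that its integral at radius 0 is 0. *)
Let slope (w L t : C) := if t == w then L * w else t * (g t - g w) / (t - w).

Let slope_cdiff w L t : cabs t < Rr -> t != w -> cdiff (slope w L) t.
Proof.
move=> tR tw.
have tw0 : 0 < cabs (t - w) by rewrite cabs_gt0 subr_eq0.
apply: (@near_cdiff _ (fun s => s * (g s - g w) / (s - w)) _ t _ tw0).
  move=> s hs; rewrite /slope; case: eqVneq => // sw; move: hs.
  by rewrite sw cabsC ltxx.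
apply: cdiffM.
  apply: cdiffM; first exact: cdiff_id.
  by apply: cdiffB; [exact: dg|exact: cdiff_cst].
apply: cdiffV; first by rewrite subr_eq0.
by apply: cdiffB; [exact: cdiff_id|exact: cdiff_cst].
Qed.

Let slope_cont w : cabs w < Rr -> exists L, forall t, cabs t < Rr -> ccont1 (slope w L) t.
Proof.
move=> wR; have [L HL] := dg wR; exists L => t tR.
have [->|tw] := eqVneq t w; last exact/cdiff_cont/slope_cdiff.
move=> e e0.
pose A := cabs w + cabs L + 2.
have A2 : 1 <= A by rewrite /A; have := cabs_ge0 w; have := cabs_ge0 L; lra.
have A0 : 0 < A by exact: lt_le_trans A2.
have eA : 0 < e / (2 * A) by rewrite divr_gt0// mulr_gt0.
have [d d0 H] := HL _ eA.
exists (Num.min 1 (Num.min d (e / (2 * A)))); first by rewrite !lt_min ltr01 d0.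
move=> s; rewrite !lt_min => /and3P[s1 sd se].
rewrite /slope eqxx; case: eqVneq => [_|sw]; first by rewrite subrr cabs0.
have sw0 : s - w != 0 by rewrite subr_eq0.
have csw : 0 < cabs (s - w) by rewrite cabs_gt0.
have -> : s * (g s - g w) / (s - w) - L * w =
   s * ((g s - g w - L * (s - w)) / (s - w)) + (s - w) * L by field.
apply: le_lt_trans (cabsD _ _) _; rewrite !cabsM cabsV.
have := H (s - w) sd; rewrite subrKC -ler_pdivrMr// => h.
have h1 : cabs s <= cabs w + 1.
  by rewrite -lerBlDl; apply: le_trans (cabs_triangle_sub _ _) _; exact: ltW.
have h2 : cabs s * (cabs (g s - g w - L * (s - w)) / cabs (s - w)) <=
   (cabs w + 1) * (e / (2 * A)) by rewrite ler_pM// divr_ge0.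
have h3 : cabs (s - w) * cabs L <= cabs L * (e / (2 * A)).
  by rewrite mulrC ler_wpM2l// ltW.
have h4 : A * (e / (2 * A)) = e / 2 by field; rewrite gt_eqF.
have h5 : A * (e / (2 * A)) = (cabs w + 1) * (e / (2 * A)) + cabs L * (e / (2 * A)) + e / (2 * A).
  by rewrite /A; ring.
lra.
Qed.

Let geo : (2^-1 : R) ^+ n @[n --> \oo] --> 0.
Proof.
have := @cvg_geometric R 1 (2^-1).
rewrite ger0_norm ?invr_ge0// invf_lt1// ltr1n => /(_ isT).
by rewrite /geometric /=; under eq_fun do rewrite mul1r.
Qed.

(** The integral is 0 at radius 0, constant in the radius away from |w|, and continuous in the
    radius, hence it stays 0 across the circle through [w]. *)
Lemma circint_slope w L r : cabs w < Rr -> (forall t, cabs t < Rr -> ccont1 (slope w L) t) ->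
  0 <= r -> r < Rr -> circint r (slope w L) = 0.
Proof.
move=> wR cS r0 rR.
(* Propagates the value 0 outwards from a radius [l] where differentiability may fail, through radii
   decreasing to [l]. *)
have zero l r1 : 0 <= l -> l <= r1 -> r1 < Rr -> circint l (slope w L) = 0 ->
    (forall t, l < cabs t <= r1 -> t != w) -> circint r1 (slope w L) = 0.
  move=> l0 lr1 r1R J0 tw.
  move: lr1; rewrite le_eqVlt => /predU1P[<-//|lr1].
  pose u n := l + (r1 - l) / 2 ^+ n.
  have u1 n : l < u n by rewrite ltrDl divr_gt0 ?subr_gt0// exprn_gt0.
  have u2 n : u n <= r1.
    rewrite -lerBrDl ler_pdivrMr ?exprn_gt0//; apply: ler_peMr.
      by rewrite subr_ge0 ltW.
    by rewrite exprn_ege1// ler1n.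
  have Ju n : circint (u n) (slope w L) = circint r1 (slope w L).
    apply: circint_const; [exact: le_lt_trans (u1 n)|exact: u2|].
    move=> t /andP[t1 t2]; apply: slope_cdiff; first exact: le_lt_trans t2 _.
    by apply: tw; rewrite t2 andbT; apply: lt_le_trans t1.
  have ul : u @ \oo --> l.
    rewrite -[X in _ --> X]addr0; apply: cvgD; first exact: cvg_cst.
    under eq_fun do rewrite -exprVn.
    rewrite -(mulr0 (r1 - l)); apply: cvgMl_tmp.
    exact: geo.
  have hh := @circint_cvg (slope w L) r1 u l.
  apply: cabs0_eq0; apply/eqP; rewrite eq_le cabs_ge0 andbT.
  apply/ler_addgt0Pr => e e0; rewrite add0r.
  have : \forall n \near \oo, cabs (circint (u n) (slope w L) - circint l (slope w L)) < e.
    apply: hh => //.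
    - by move=> t tr; apply: cS; exact: le_lt_trans tr _.
    - by move=> n; rewrite u2 andbT (le_trans l0)// ltW.
    - by rewrite l0 ltW.
  move=> [N _ HN].
  have : cabs (circint (u N) (slope w L) - circint l (slope w L)) < e := HN N (leqnn N).
  by rewrite Ju J0 subr0; exact: ltW.
have J0 : circint 0 (slope w L) = 0.
  rewrite /circint (@eq_segint _ _ (fun=> 0)) ?segint_cst ?mulr0// ?twopi_ge0// => th _.
  rewrite /circ !mul0r -[Complex 0 0]/(0 : C) /slope; case: eqVneq => [<-|_]; first by rewrite mulr0.
  by rewrite !mul0r.
have Jlt s : 0 <= s -> s < cabs w -> circint s (slope w L) = 0.
  move=> s0 sw; apply: (zero 0) => //; first exact: lt_trans sw _.
  by move=> t /andP[_ ts]; apply: contraTneq ts => ->; rewrite -ltNge.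
(* The exceptional radius is approached from below, where the integral is already known to
   vanish. *)
have Jw : circint (cabs w) (slope w L) = 0.
  have [w0|w0] := leP (cabs w) 0.
    by rewrite (_ : cabs w = 0) //; apply/eqP; rewrite eq_le w0 cabs_ge0.
  pose u n := cabs w - cabs w / 2 ^+ n.+1.
  have ul : u @ \oo --> cabs w.
    rewrite -[X in _ --> X]subr0; apply: cvgB; first exact: cvg_cst.
    under eq_fun do rewrite -exprVn.
    rewrite -(mulr0 (cabs w)); apply: cvgMl_tmp.
    by rewrite (cvg_shiftS (fun n => (2^-1 : R) ^+ n)); exact: geo.
  have u1 n : 0 <= u n.
    rewrite subr_ge0 ler_pdivrMr ?exprn_gt0// ler_peMr// exprn_ege1//.
    by rewrite ler1n.
  have u2 n : u n < cabs w by rewrite ltrBlDr ltrDl divr_gt0// exprn_gt0.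
  apply: cabs0_eq0; apply/eqP; rewrite eq_le cabs_ge0 andbT.
  apply/ler_addgt0Pr => e e0; rewrite add0r.
  have : \forall n \near \oo, cabs (circint (u n) (slope w L) - circint (cabs w) (slope w L)) < e.
    apply: (@circint_cvg (slope w L) (cabs w)) => //.
    - by move=> t tr; apply: cS; exact: le_lt_trans tr _.
    - by move=> n; rewrite u1 ltW.
    - by rewrite lexx ltW.
  move=> [N _ HN].
  have : cabs (circint (u N) (slope w L) - circint (cabs w) (slope w L)) < e := HN N (leqnn N).
  by rewrite Jlt// sub0r cabsN; exact: ltW.
have [rw|wr] := leP r (cabs w).
  by move: rw; rewrite le_eqVlt => /predU1P[->//|/Jlt]; apply.
apply: (zero (cabs w)) => //; first exact: ltW.
by move=> t /andP[wt _]; apply: contraTneq wt => ->; rewrite ltxx.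
Qed.

(** Cauchy's integral for the Taylor coefficient of order [n] at 0, taken over the circle of radius
    [rho]. *)
Definition tcoef (rho : R) (n : nat) : C :=
  toC ((2 * pi)^-1) * circint rho (fun t => g t * t^-1 ^+ n).

Lemma cdiff_invX (t : C) n : t != 0 -> cdiff (fun s : C => s^-1 ^+ n) t.
Proof. by move=> t0; apply: cdiffX; apply: cdiffV => //; exact: cdiff_id. Qed.

(** By homogeneity the integral at radius s is s^-n times the one at radius 1, yet it does not
    depend on the radius; the radii 1 and 2 then force it to be 0 for n > 0. *)
Lemma circint_invX (r : R) n : 0 < r ->
  circint r (fun t : C => t^-1 ^+ n) = if n is 0 then toC (2 * pi) else 0.
Proof.
move=> r0.
have scal (s : R) : 0 < s -> circint s (fun t : C => t^-1 ^+ n) =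
    toC (s^-1 ^+ n) * circint 1 (fun t : C => t^-1 ^+ n).
  move=> s0; rewrite /circint /segint -cintZ//; last first.
    apply: (@circint_integrable (fun t : C => t^-1 ^+ n)) => // t t1.
    by apply/cdiff_cont/cdiff_invX; rewrite -cabs_gt0 t1.
  apply: eq_cint => th _; rewrite !circE toC1 mul1r toCX toCV invfM exprMn.
  by [].
rewrite scal//.
case: n scal => [|n] scal.
  rewrite expr0 mul1r /circint (@eq_segint _ _ (fun=> 1)); last by move=> th _; rewrite expr0.
  by rewrite segint_cst ?twopi_ge0// mulr1 subr0.
have : circint 1 (fun t : C => t^-1 ^+ n.+1) = circint 2 (fun t : C => t^-1 ^+ n.+1).
  apply: circint_const => //; first by rewrite ler1n.
  by move=> t /andP[t1 _]; apply: cdiff_invX; rewrite -cabs_gt0 (lt_le_trans ltr01).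
rewrite [in RHS]scal// => /eqP; rewrite -subr_eq0 -{1}(mul1r (circint 1 _)) -mulrBl.
rewrite mulf_eq0 => /orP[|/eqP ->]; last by rewrite mulr0.
rewrite subr_eq0 => /eqP/esym/(@toC_inj _ _ 1) h.
have : (2^-1 : R) ^+ n.+1 < 1 by rewrite exprn_ilt1// ?invr_ge0// invf_lt1// ltr1n.
by rewrite h ltxx.
Qed.

Lemma circint_le q (r M : R) : 0 <= r -> (forall t, cabs t = r -> ccont1 q t) ->
  (forall th, 0 <= th <= 2 * pi -> cabs (q (circ r th)) <= M) ->
  cabs (circint r q) <= M * (2 * pi).
Proof.
move=> r0 cq qM; rewrite -[X in M * X]subr0; apply: cabs_segint => //.
- exact: twopi_ge0.
- move=> th _; apply: ccont_comp; first exact: ccont_circ.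
  by apply: cq; rewrite cabs_circ.
Qed.

Lemma cabs_tcoef (rho M : R) n : 0 < rho -> rho < Rr ->
  (forall th, 0 <= th <= 2 * pi -> cabs (g (circ rho th)) <= M) ->
  cabs (tcoef rho n) <= M / rho ^+ n.
Proof.
move=> r0 rR gM; have pi2 : 0 < 2 * pi :> R by rewrite mulr_gt0// pi_gt0.
rewrite /tcoef cabsM cabs_toC ger0_norm; last by rewrite invr_ge0 ltW.
rewrite mulrC ler_pdivrMr//.
apply: circint_le; first exact: ltW.
  move=> t tr; apply: cdiff_cont; apply: cdiffM; first by apply: dg; rewrite tr.
  by apply: cdiff_invX; rewrite -cabs_gt0 tr.
move=> th h; rewrite cabsM cabsX cabsV cabs_circ ?(ltW r0)// exprVn.
by rewrite ler_wpM2r ?gM// invr_ge0 exprn_ge0// ltW.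
Qed.

Lemma geom_kernel (t w : C) N : t != 0 -> t != w ->
  t / (t - w) = \sum_(n < N) (w / t) ^+ n + (w / t) ^+ N * (t / (t - w)).
Proof.
move=> t0 tw; have tw0 : t - w != 0 by rewrite subr_eq0.
elim: N => [|N IH]; first by rewrite big_ord0 add0r expr0 mul1r.
rewrite big_ord_recr /= {1}IH -addrA; congr (_ + _).
rewrite exprSr -mulrA -{2}[(w / t) ^+ N]mulr1 -mulrDr; congr (_ * _).
by field; rewrite t0 tw0.
Qed.

Theorem taylor (rho M : R) (w : C) (N : nat) : cabs w < rho -> rho < Rr ->
  (forall th, 0 <= th <= 2 * pi -> cabs (g (circ rho th)) <= M) ->
  cabs (g w - \sum_(n < N) tcoef rho n * w ^+ n) <=
  (M + cabs (g w)) * (cabs w / rho) ^+ N * (rho / (rho - cabs w)).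
Proof.
move=> wr rR gM; have r0 : 0 < rho by exact: le_lt_trans (cabs_ge0 w) wr.
have wR : cabs w < Rr by exact: lt_trans rR.
have pi2 : 0 < 2 * pi :> R by rewrite mulr_gt0// pi_gt0.
have rw0 : 0 < rho - cabs w by rewrite subr_gt0.
have M0 : 0 <= M.
  by apply: le_trans (cabs_ge0 _) (gM 0 _); rewrite lexx ltW.
(* The case N = 0 is apart because the term [b 0], the only one with nonzero integral, is what
   reproduces [g w] below. *)
case: N => [|N].
  rewrite big_ord0 subr0 expr0 mulr1.
  rewrite mulrA ler_pdivlMr//; apply: ler_pM => //; first exact: ltW.
    by rewrite lerDr.
  by rewrite gerBl.
have [L HL] := slope_cont wR.
have J0 := circint_slope wR HL (ltW r0) rR.
pose a n (t : C) := w ^+ n * (g t * t^-1 ^+ n).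
pose b n (t : C) := w ^+ n * t^-1 ^+ n.
(* Computed termwise, its integral is 2 pi times the Taylor remainder; computed pointwise on the
   circle, it is the remainder of the geometric series. *)
pose rem t := slope w L t - \sum_(n < N.+1) a n t + g w * \sum_(n < N.+1) b n t.
have ct t : cabs t = rho -> cdiff (slope w L) t.
  move=> tr; apply: slope_cdiff; first by rewrite tr.
  by apply: contraTneq wr => <-; rewrite tr ltxx.
have t0 t : cabs t = rho -> t != 0 by move=> tr; rewrite -cabs_gt0 tr.
have da n t : cabs t = rho -> cdiff (a n) t.
  move=> tr; apply: cdiffM; first exact: cdiff_cst.
  apply: cdiffM; first by apply: dg; rewrite tr.
  by apply: cdiff_invX; exact: t0.
have db n t : cabs t = rho -> cdiff (b n) t.
  by move=> tr; apply: cdiffM; [exact: cdiff_cst|apply: cdiff_invX; exact: t0].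
have Ja n : circint rho (a n) = w ^+ n * (toC (2 * pi) * tcoef rho n).
  have -> : toC (2 * pi) * tcoef rho n = circint rho (fun t => g t * t^-1 ^+ n).
    by rewrite /tcoef mulrA -toCM divff ?gt_eqF// toC1 mul1r.
  rewrite /circint /segint -cintZ//.
  apply: (@circint_integrable (fun t => g t * t^-1 ^+ n)); first exact: ltW.
  move=> t tr; apply/cdiff_cont/cdiffM; first by apply: dg; rewrite tr.
  by apply: cdiff_invX; exact: t0.
have Jb n : circint rho (b n) = w ^+ n * (if n is 0 then toC (2 * pi) else 0).
  rewrite -(circint_invX n r0) /circint /segint -cintZ//.
  apply: (@circint_integrable (fun t => t^-1 ^+ n)); first exact: ltW.
  by move=> t tr; apply/cdiff_cont/cdiff_invX; exact: t0.
have Jrem : circint rho rem = toC (2 * pi) * (g w - \sum_(n < N.+1) tcoef rho n * w ^+ n).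
  have r0' := ltW r0.
  have dsa t : cabs t = rho -> cdiff (fun s => \sum_(n < N.+1) a n s) t.
    by move=> tr; apply: cdiff_sum => i; exact: da.
  have dsb t : cabs t = rho -> cdiff (fun s => \sum_(n < N.+1) b n s) t.
    by move=> tr; apply: cdiff_sum => i; exact: db.
  rewrite /rem circintD//; last first.
  - by move=> t tr; apply: cdiffM; [exact: cdiff_cst|exact: dsb].
  - by move=> t tr; apply: cdiffB; [exact: ct|exact: dsa].
  rewrite circintB// circintZ// !circint_sum//.
  rewrite J0 sub0r (eq_bigr _ (fun (i : 'I_N.+1) _ => Ja i)).
  have -> : \sum_(i < N.+1) circint rho (b i) = toC (2 * pi).
    rewrite big_ord_recl big1 => [|i _]; first by rewrite Jb expr0 mul1r addr0.
    by rewrite Jb mulr0.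
  rewrite mulrBr addrC; congr (_ - _); first by rewrite mulrC.
  by rewrite mulr_sumr; apply: eq_bigr => i _; rewrite mulrCA [w ^+ _ * _]mulrC.
have remE t : cabs t = rho -> rem t = (g t - g w) * ((w / t) ^+ N.+1 * (t / (t - w))).
  move=> tr; have tw : t != w by apply: contraTneq wr => <-; rewrite tr ltxx.
  rewrite /rem /slope (negbTE tw).
  have -> : \sum_(n < N.+1) a n t = g t * \sum_(n < N.+1) (w / t) ^+ n.
    by rewrite mulr_sumr; apply: eq_bigr => i _; rewrite /a exprMn mulrCA.
  have -> : \sum_(n < N.+1) b n t = \sum_(n < N.+1) (w / t) ^+ n.
    by apply: eq_bigr => i _; rewrite /b exprMn.
  rewrite [t * _]mulrC -[_ * t / _]mulrA {1}(geom_kernel N.+1 (t0 t tr) tw).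
  ring.
set B := (X in _ <= X).
suff : cabs (circint rho rem) <= B * (2 * pi).
  by rewrite Jrem cabsM cabs_toC (ger0_norm (ltW pi2)) [X in X <= _]mulrC ler_pM2r.
rewrite /B {B}; apply: circint_le; first exact: ltW.
  move=> t tr; rewrite /rem.
  apply: cdiff_cont; apply: cdiffD; last apply: cdiffM.
  - by apply: cdiffB; [exact: ct|apply: cdiff_sum => i; exact: da].
  - exact: cdiff_cst.
  - by apply: cdiff_sum => i; exact: db.
move=> th h; have cr : cabs (circ rho th) = rho by rewrite cabs_circ// ltW.
rewrite remE// !cabsM cabsX !cabsM !cabsV cr -mulrA.
apply: ler_pM => //.
- by rewrite !mulr_ge0// ?exprn_ge0// ?mulr_ge0// ?invr_ge0// ltW.
- by apply: le_trans (cabsB _ _) _; rewrite lerD2r gM.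
- rewrite ler_wpM2l ?exprn_ge0 ?mulr_ge0 ?invr_ge0 ?(ltW r0)// ler_wpM2l ?(ltW r0)//.
  rewrite lef_pV2 ?posrE//; first by rewrite -{1}cr; exact: cabs_triangle_sub.
  by apply: lt_le_trans rw0 _; rewrite -{1}cr; exact: cabs_triangle_sub.
Qed.

End CauchyFormula.
End Cauchy.

(** * Hilbert spaces *)

Section Hilbert.
Context (R : realType) (E : lmodType (Cplx R)).
Local Notation C := (Cplx R).
Implicit Types (X H Y : set E) (nrm : E -> R) (ip : E -> E -> C).

Definition is_subspace X := X 0 /\ forall (c : C) x y, X x -> X y -> X (c *: x + y).

(** Definiteness is left out: [L2 B] consists of functions rather than classes, and a nonzero
    function may have norm 0. Where definiteness matters it is a separate assumption, satisfied by
    [berg B]. *)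
Record prehilbert X nrm ip : Prop := {
  ph_sub : is_subspace X;
  ph_lin : forall (c : C) x y z, X x -> X y -> X z ->
    ip (c *: x + y) z = c * ip x z + ip y z;
  ph_conj : forall x y, X x -> X y -> ip y x = Num.conj (ip x y);
  ph_nrm_ge0 : forall x, X x -> 0 <= nrm x;
  ph_nrm : forall x, X x -> ip x x = toC (nrm x ^+ 2) }.

Lemma subspaceD X x y : is_subspace X -> X x -> X y -> X (x + y).
Proof. by move=> [_ s] Xx Xy; have := s 1 x y Xx Xy; rewrite scale1r. Qed.

Lemma subspaceZ X c x : is_subspace X -> X x -> X (c *: x).
Proof. by move=> [X0 s] Xx; have := s c x 0 Xx X0; rewrite addr0. Qed.

Lemma subspaceN X x : is_subspace X -> X x -> X (- x).
Proof. by move=> s Xx; rewrite -scaleN1r; exact: subspaceZ. Qed.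

Lemma subspaceB X x y : is_subspace X -> X x -> X y -> X (x - y).
Proof. by move=> s Xx Xy; apply: subspaceD => //; exact: subspaceN. Qed.

Lemma subspace_sum X I (r : seq I) (F : I -> E) : is_subspace X ->
  (forall i, X (F i)) -> X (\sum_(i <- r) F i).
Proof.
move=> sX XF; elim: r => [|i r IH]; first by rewrite big_nil; case: sX.
by rewrite big_cons; exact: subspaceD.
Qed.

Lemma prehilbert_sub X Y nrm ip : is_subspace Y -> Y `<=` X ->
  prehilbert X nrm ip -> prehilbert Y nrm ip.
Proof.
move=> sY YX [s1 s2 s3 s4 s5]; split => //.
- by move=> *; apply: s2; exact: YX.
- by move=> *; apply: s3; exact: YX.
- by move=> *; apply: s4; exact: YX.
- by move=> *; apply: s5; exact: YX.
Qed.

Section PreHilbert.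
Variables (X : set E) (nrm : E -> R) (ip : E -> E -> C).
Hypothesis ph : prehilbert X nrm ip.
Let sX := ph_sub ph.

Lemma ipDl x y z : X x -> X y -> X z -> ip (x + y) z = ip x z + ip y z.
Proof. by move=> Xx Xy Xz; rewrite -{1}(scale1r x) (ph_lin ph)// mul1r. Qed.

Lemma ip0l z : X z -> ip 0 z = 0.
Proof.
case: (sX) => X0 _ Xz; have := ipDl X0 X0 Xz; rewrite addr0 => /eqP.
by rewrite -subr_eq0 opprD addrA subrr sub0r oppr_eq0 => /eqP.
Qed.

Lemma ipZl c x z : X x -> X z -> ip (c *: x) z = c * ip x z.
Proof.
move=> Xx Xz; case: (sX) => X0 _.
by rewrite -[c *: x]addr0 (ph_lin ph)// ip0l// addr0.
Qed.

Lemma ipDr x y z : X x -> X y -> X z -> ip z (x + y) = ip z x + ip z y.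
Proof.
move=> Xx Xy Xz; have Xxy := subspaceD sX Xx Xy.
by rewrite !(ph_conj ph _ Xz)// ipDl// rmorphD.
Qed.

Lemma ipZr c x z : X x -> X z -> ip z (c *: x) = Num.conj c * ip z x.
Proof.
move=> Xx Xz; have Xcx := subspaceZ c sX Xx.
by rewrite !(ph_conj ph _ Xz)// ipZl// rmorphM.
Qed.

Lemma ipNr x z : X x -> X z -> ip z (- x) = - ip z x.
Proof.
by move=> Xx Xz; rewrite -scaleN1r ipZr// rmorphN rmorph1 mulN1r.
Qed.

Lemma ipBr x y z : X x -> X y -> X z -> ip z (x - y) = ip z x - ip z y.
Proof. by move=> Xx Xy Xz; rewrite ipDr// ?ipNr//; exact: subspaceN. Qed.

Lemma ip0r z : X z -> ip z 0 = 0.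
Proof. by move=> Xz; rewrite (ph_conj ph) ?ip0l ?rmorph0//; case: sX. Qed.

Lemma nrmZ c x : X x -> nrm (c *: x) = cabs c * nrm x.
Proof.
move=> Xx; have Xcx := subspaceZ c sX Xx.
have : toC (nrm (c *: x) ^+ 2) = toC ((cabs c * nrm x) ^+ 2).
  rewrite -(ph_nrm ph)// ipZl// ipZr// mulrA mul_conj (ph_nrm ph)//.
  by rewrite -toCM exprMn.
move=> /(@toC_inj _ _ _)/eqP; rewrite eqrXn2 ?mulr_ge0 ?(ph_nrm_ge0 ph)//.
by move=> /eqP.
Qed.

Lemma nrmN x : X x -> nrm (- x) = nrm x.
Proof. by move=> Xx; rewrite -scaleN1r nrmZ// cabsN cabs1 mul1r. Qed.

Lemma nrm_distC x y : X x -> X y -> nrm (x - y) = nrm (y - x).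
Proof. by move=> Xx Xy; rewrite -opprB nrmN//; exact: subspaceB. Qed.

Lemma nrm0 : nrm 0 = 0.
Proof. by have := @nrmZ 0 0; rewrite scaler0 cabs0 mul0r; apply; case: sX. Qed.

Lemma sqnrmD x y : X x -> X y ->
  nrm (x + y) ^+ 2 = nrm x ^+ 2 + 2 * complex.Re (ip x y) + nrm y ^+ 2.
Proof.
move=> Xx Xy; have Xxy := subspaceD sX Xx Xy.
have := ph_nrm ph Xxy; rewrite ipDl// !ipDr// !(ph_nrm ph)// => /(congr1 (@complex.Re R)).
rewrite !cReD /= (ph_conj ph Xx Xy) conj_complex /= => <-; ring.
Qed.

Lemma sqnrmB x y : X x -> X y ->
  nrm (x - y) ^+ 2 = nrm x ^+ 2 - 2 * complex.Re (ip x y) + nrm y ^+ 2.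
Proof.
move=> Xx Xy; rewrite sqnrmD//; last exact: subspaceN.
by rewrite nrmN// ipNr// cReN mulrN.
Qed.

Lemma cauchy_schwarz x y : X x -> X y -> cabs (ip x y) <= nrm x * nrm y.
Proof.
move=> Xx Xy; have [->|d0] := eqVneq (ip x y) 0.
  by rewrite cabs0 mulr_ge0 ?(ph_nrm_ge0 ph).
set d := ip x y; pose u : C := d / toC (cabs d).
have cd : cabs d != 0 by rewrite cabs_eq0.
have tcd : toC (cabs d) != 0 :> C.
  by apply/eqP => /(@toC_inj _ _ 0)/eqP; apply/negP.
have u1 : cabs u = 1 by rewrite cabsM cabsV cabs_toC ger0_norm// divff.
(* The unimodular [u] makes the inner product real, so that a quadratic in one real variable
   remains. *)
have Re (s : R) : 0 <= nrm x ^+ 2 - 2 * s * cabs d + s ^+ 2 * nrm y ^+ 2.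
  have Xz := subspaceZ (toC s * u) sX Xy.
  have := sqr_ge0 (nrm (x - (toC s * u) *: y)).
  rewrite sqnrmB// nrmZ// ipZr// -/d exprMn cabsM u1 mulr1 cabs_toC real_normK ?num_real//.
  suff -> : complex.Re (Num.conj (toC s * u) * d) = s * cabs d by rewrite mulrA.
  have -> : Num.conj (toC s * u) * d = toC (s * cabs d).
    rewrite rmorphM /= conj_toC /u rmorphM /= -toCV conj_toC toCV.
    rewrite -[_ * _ * d]mulrA -[_ / _ * d]mulrA [_^-1 * d]mulrC mulrA mulrA -[_ * _ * d]mulrA [Num.conj d * d]mulrC.
    by rewrite mul_conj expr2 !toCM -!mulrA mulfV// mulr1.
  by [].
have nx := ph_nrm_ge0 ph Xx; have ny := ph_nrm_ge0 ph Xy.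
have [y0|y0] := eqVneq (nrm y) 0.
  (* If [y] has norm 0 the quadratic is affine in [s], and this value of [s] would make it equal to
     -1. *)
  have := Re ((nrm x ^+ 2 + 1) / (2 * cabs d)).
  rewrite y0 mulr0 expr0n mulr0 addr0.
  have -> : 2 * ((nrm x ^+ 2 + 1) / (2 * cabs d)) * cabs d = nrm x ^+ 2 + 1 by field.
  by lra.
have := Re (cabs d / nrm y ^+ 2).
have -> : nrm x ^+ 2 - 2 * (cabs d / nrm y ^+ 2) * cabs d + (cabs d / nrm y ^+ 2) ^+ 2 * nrm y ^+ 2
   = nrm x ^+ 2 - cabs d ^+ 2 / nrm y ^+ 2 by field.
rewrite subr_ge0 ler_pdivrMr ?exprn_gt0 ?lt_def ?y0//.
by rewrite -exprMn ler_pXn2r ?nnegrE ?mulr_ge0 ?cabs_ge0.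
Qed.

Lemma nrm_triangle x y : X x -> X y -> nrm (x + y) <= nrm x + nrm y.
Proof.
move=> Xx Xy; have Xxy := subspaceD sX Xx Xy.
have nx := ph_nrm_ge0 ph Xx; have ny := ph_nrm_ge0 ph Xy; have nxy := ph_nrm_ge0 ph Xxy.
rewrite -(@ler_pXn2r _ 2%N) ?nnegrE ?addr_ge0//.
rewrite sqnrmD// sqrrD lerD2r lerD2l [leLHS]mulr_natl lerMn2r /=.
by apply: le_trans (ler_norm _) _; apply: le_trans (ler_Re_cabs _) _; exact: cauchy_schwarz.
Qed.

Lemma nrm_triangleB x y : X x -> X y -> nrm (x - y) <= nrm x + nrm y.
Proof.
by move=> Xx Xy; rewrite -(nrmN Xy); apply: nrm_triangle => //; exact: subspaceN.
Qed.

Lemma nrm_dist z x y : X x -> X y -> X z -> nrm (x - y) <= nrm (x - z) + nrm (z - y).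
Proof.
move=> Xx Xy Xz; rewrite -(subrKA z x (- y)); apply: nrm_triangle; exact: subspaceB.
Qed.

Lemma sqnrmD_le x y : X x -> X y -> nrm (x + y) ^+ 2 <= 2 * nrm x ^+ 2 + 2 * nrm y ^+ 2.
Proof.
move=> Xx Xy; have := sqnrmB Xx Xy; have := sqnrmD Xx Xy.
have := sqr_ge0 (nrm (x - y)); lra.
Qed.

Lemma opnorm_le_bound (A : E -> E) (M : R) :
  (forall x, X x -> X (A x)) ->
  (forall (c : C) x y, X x -> X y -> A (c *: x + y) = c *: A x + A y) ->
  (opnorm X nrm A <= M%:E)%E -> forall x, X x -> nrm (A x) <= M * nrm x.
Proof.
move=> AX Alin AM x Xx.
have A0 : A 0 = 0.
  have X0 : X 0 by case: sX.
  have := Alin 0 0 0 X0 X0; rewrite !scale0r addr0 add0r.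
  by have := Alin (-1) 0 0 X0 X0; rewrite scaler0 addr0 scaleN1r addNr.
have AZ c y : X y -> A (c *: y) = c *: A y.
  by move=> Xy; have := Alin c y 0 Xy (proj1 sX); rewrite !addr0 A0 addr0.
have nx := ph_nrm_ge0 ph Xx.
(* Normalizing by some [s] larger than the norm, rather than by the norm, also covers vectors of
   norm 0. *)
have b s : nrm x < s -> nrm (A x) <= M * s.
  move=> xs; have s0 : 0 < s by exact: le_lt_trans xs.
  have Xsx : X (toC s^-1 *: x) by exact: subspaceZ.
  have : ((nrm (A (toC s^-1 *: x)))%:E <= M%:E)%E.
    apply: le_trans AM; apply: ereal_sup_ubound; exists (toC s^-1 *: x) => //; split => //.
    rewrite nrmZ// cabs_toC ger0_norm ?invr_ge0 ?(ltW s0)//.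
    by rewrite mulrC ler_pdivrMr// mul1r ltW.
  rewrite lee_fin AZ// nrmZ; last exact: AX.
  rewrite cabs_toC ger0_norm ?invr_ge0 ?(ltW s0)//.
  by rewrite mulrC ler_pdivrMr.
have M0 : 0 <= M.
  have := b (nrm x + 1) ltac:(by rewrite ltrDl) => h.
  have := le_trans (ph_nrm_ge0 ph (AX _ Xx)) h.
  by rewrite pmulr_lge0// ltr_wpDl.
apply/ler_addgt0Pr => e e0.
have := b (nrm x + e / (M + 1)) ltac:(by rewrite ltrDl divr_gt0// ltr_wpDl).
rewrite mulrDr => /le_trans; apply; rewrite lerD2l mulrCA -[leRHS]mulr1 ler_wpM2l ?(ltW e0)//.
by rewrite ler_pdivrMr ?ltr_wpDl// mul1r lerDl.
Qed.

Lemma bounded_operator_bound (A : E -> E) : bounded_operator X nrm A ->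
  exists2 M : R, 0 <= M & forall x, X x -> nrm (A x) <= M * nrm x.
Proof.
move=> [AX Alin An].
have [M M0 HM] : exists2 M : R, 0 <= M & (opnorm X nrm A <= M%:E)%E.
  have : (0 <= opnorm X nrm A)%E.
    apply: (@le_trans _ _ (nrm (A 0))%:E).
      by rewrite lee_fin; apply: (ph_nrm_ge0 ph); apply: AX; case: sX.
    apply: ereal_sup_ubound; exists 0 => //; split; first by case: sX.
    by rewrite nrm0.
  case: (opnorm X nrm A) An => [r|//|//] _ r0; exists r => //; by rewrite lee_fin in r0.
by exists M => //; exact: opnorm_le_bound.
Qed.

End PreHilbert.

Section Riesz.
Variables (X H : set E) (nrm : E -> R) (ip : E -> E -> C).
Hypothesis phX : prehilbert X nrm ip.
Hypothesis sH : is_subspace H.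
Hypothesis HX : H `<=` X.
Hypothesis cH : mcomplete H (fun x y => nrm (x - y)).
Hypothesis defH : forall x, H x -> nrm x = 0 -> x = 0.
Let ph := prehilbert_sub sH HX phX.

(** The representing vector minimizes |x|^2 - 2 Re l(x), which for l = < . , p> is |x - p|^2 -
    |p|^2. Completeness gives the minimizer, and the first order condition at it is the
    representation. *)
Theorem riesz (l : E -> C) (M : R) :
  (forall (c : C) x y, H x -> H y -> l (c *: x + y) = c * l x + l y) ->
  (forall x, H x -> cabs (l x) <= M * nrm x) ->
  exists2 p, H p & forall x, H x -> l x = ip x p.
Proof.
move=> llin lM.
have H0 : H 0 by case: sH.
have l0 : l 0 = 0.
  by have := llin (-1) 0 0 H0 H0; rewrite scaler0 addr0 mulN1r addNr.
have lZ c x : H x -> l (c *: x) = c * l x.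
  by move=> Hx; have := llin c x 0 Hx H0; rewrite addr0 l0 addr0.
have lD x y : H x -> H y -> l (x + y) = l x + l y.
  by move=> Hx Hy; have := llin 1 x y Hx Hy; rewrite scale1r mul1r.
pose ph_ x := nrm x ^+ 2 - 2 * complex.Re (l x).
have lb x : H x -> - (M ^+ 2) <= ph_ x.
  move=> Hx; have := lM x Hx; have := ler_Re_cabs (l x); rewrite ler_norml => /andP[_ h1 h2].
  rewrite /ph_; have := sqr_ge0 (nrm x - M); rewrite sqrrB; lra.
pose S := [set ph_ x | x in H].
have hS : has_inf S.
  by split; [exists (ph_ 0); exists 0|exists (- M ^+ 2) => _ [x Hx <-]; exact: lb].
have near n : exists x, H x /\ ph_ x < inf S + n.+1%:R^-1.
  have n0 : (0 : R) < n.+1%:R^-1 by rewrite invr_gt0.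
  by have [_ [x Hx <-] h] := inf_adherent n0 hS; exists x.
have [u hu] := choice near.
have infS x : H x -> inf S <= ph_ x by move=> Hx; apply: ge_inf; [case: hS|exists x].
(* The parallelogram identity: the value at the midpoint is at least the infimum, so minimizing
   sequences are Cauchy. *)
have mid x y : H x -> H y -> nrm (x - y) ^+ 2 = 2 * (ph_ x + ph_ y - 2 * ph_ (toC 2^-1 *: (x + y))).
  move=> Hx Hy; have Hxy := subspaceD sH Hx Hy.
  rewrite /ph_ lZ// lD// (nrmZ ph)// cabs_toC ger0_norm ?invr_ge0// exprMn.
  rewrite (sqnrmB ph)// (sqnrmD ph)// cReM /= cReD mul0r subr0; by field.
have cauchy : forall e : R, 0 < e -> exists N, forall i j,
    (N <= i)%N -> (N <= j)%N -> nrm (u i - u j) < e.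
  move=> e e0.
  have e2 : 0 < e ^+ 2 / 4 by rewrite divr_gt0// exprn_gt0.
  have [N HN] : exists N, N.+1%:R^-1 < e ^+ 2 / 4.
    have /cvgrPdist_lt/(_ _ e2)[N _ HN] := @cvg_harmonic R.
    by exists N; have := HN N (leqnn N); rewrite /= sub0r normrN ger0_norm.
  exists N => i j Ni Nj; have [Hi hi] := hu i; have [Hj hj] := hu j.
  have dN k : (N <= k)%N -> k.+1%:R^-1 < e ^+ 2 / 4.
    move=> Nk; apply: le_lt_trans HN.
    by rewrite lef_pV2 ?posrE// ler_nat.
  have hij := infS _ (subspaceZ (toC 2^-1) sH (subspaceD sH Hi Hj)).
  rewrite -(@ltr_pXn2r _ 2%N) ?nnegrE ?(ph_nrm_ge0 ph) ?(ltW e0)//; last exact: subspaceB.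
  rewrite mid//; move: hi hj hij (dN i Ni) (dN j Nj).
  move: (ph_ (u i)) (ph_ (u j)) (ph_ _) (inf S) (i.+1%:R^-1) (j.+1%:R^-1).
  move: (e ^+ 2) => e' a b c d m n; lra.
have [p Hp pl] := cH (fun k => proj1 (hu k)) cauchy.
exists p => // h Hh.
have np0 := ph_nrm_ge0 ph Hh.
pose d := ip h p - l h.
(* Minimality compared with the variation [t *: h]. It is written along the sequence [u] and passed
   to the limit, up to an arbitrary [e]. *)
have var (t : C) : 0 <= 2 * complex.Re (t * d) + cabs t ^+ 2 * nrm h ^+ 2.
  apply/ler_addgt0Pr => e e0.
  pose A := 2 * cabs t * nrm h + 1.
  have A1 : 1 <= A by rewrite /A lerDr !mulr_ge0.
  have A0 : 0 < A by exact: lt_le_trans A1.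
  have e2 : 0 < e / 2 by rewrite divr_gt0.
  have eA : 0 < e / 2 / A by rewrite divr_gt0.
  have [N HN] := pl _ eA.
  have /cvgrPdist_lt/(_ _ e2)[N' _ HN'] := @cvg_harmonic R.
  pose n := maxn N N'.
  have h1 := HN n (leq_maxl _ _).
  have h2 : n.+1%:R^-1 < e / 2.
    by have := HN' n (leq_maxr _ _); rewrite /= sub0r normrN ger0_norm.
  have [Hn hn] := hu n.
  have Hth := subspaceZ t sH Hh.
  have h3 := infS _ (subspaceD sH Hn Hth).
  move: h3; rewrite /ph_ lD// lZ// (sqnrmD ph)// (nrmZ ph)// exprMn => h3.
  have h4 : complex.Re (ip (u n) (t *: h)) = complex.Re (t * ip h (u n)).
    by rewrite (ph_conj ph Hth Hn) conj_complex /= (ipZl ph).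
  have h5 : `|complex.Re (t * ip h (u n - p))| <= cabs t * (nrm h * nrm (u n - p)).
    apply: le_trans (ler_Re_cabs _) _; rewrite cabsM ler_wpM2l//.
    by apply: (cauchy_schwarz ph) => //; exact: subspaceB.
  have h6 : nrm (u n - p) * A < e / 2 by rewrite -ltr_pdivlMr.
  have h7 : 0 <= nrm (u n - p) by apply: (ph_nrm_ge0 ph); exact: subspaceB.
  have h8 : cabs t * (nrm h * nrm (u n - p)) * 2 <= nrm (u n - p) * A.
    have -> : cabs t * (nrm h * nrm (u n - p)) * 2 = nrm (u n - p) * (2 * cabs t * nrm h) by ring.
    by rewrite ler_wpM2l// /A lerDl.
  have h9 : complex.Re (t * d) = complex.Re (t * ip h (u n)) - complex.Re (t * ip h (u n - p)) - complex.Re (t * l h).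
    by rewrite /d (ipBr ph)// !mulrBr !cReD !cReN; ring.
  move: h5; rewrite ler_norml => /andP[h51 h52].
  rewrite h9; move: h3 hn h2 h6 h8 h51 h52; rewrite cReD h4 /ph_.
  move: (nrm (u n) ^+ 2) (complex.Re (l (u n))) (inf S) (n.+1%:R^-1).
  move: (nrm (u n - p) * A) (cabs t * (nrm h * nrm (u n - p))).
  move: (complex.Re (t * ip h (u n - p))) (complex.Re (t * l h)) (complex.Re (t * ip h (u n))).
  move: (cabs t ^+ 2 * nrm h ^+ 2) => x1 x2 x3 x4 x5 x6 x7 x8 x9 x10; lra.
have : d = 0.
  apply/eqP; rewrite -cabs_eq0; apply/eqP.
  pose s := (nrm h ^+ 2 + 1)^-1.
  have s0 : 0 < s by rewrite invr_gt0 ltr_wpDl// sqr_ge0.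
  (* The variation points against [d]; with [s] = 1/(|h|^2 + 1) the quadratic term cannot make up
     for the linear one unless [d] is 0. *)
  have := var (- (toC s * Num.conj d)).
  have -> : - (toC s * Num.conj d) * d = toC (- (s * cabs d ^+ 2)).
    by rewrite mulNr -mulrA [Num.conj d * d]mulrC mul_conj -toCM toCN.
  rewrite cabsN cabsM cabs_conj cabs_toC (ger0_norm (ltW s0)) /=.
  have -> : 2 * - (s * cabs d ^+ 2) + (s * cabs d) ^+ 2 * nrm h ^+ 2 =
     - (cabs d ^+ 2 * s * (2 - s * nrm h ^+ 2)) by ring.
  rewrite oppr_ge0 => h1.
  have sn : s * nrm h ^+ 2 <= 1.
    by rewrite mulrC ler_pdivrMr ?ltr_wpDl ?sqr_ge0// mul1r lerDl.
  have : cabs d ^+ 2 * s <= cabs d ^+ 2 * s * (2 - s * nrm h ^+ 2).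
    by rewrite ler_peMr ?mulr_ge0 ?sqr_ge0 ?(ltW s0)//; lra.
  move=> /le_trans/(_ h1); rewrite pmulr_lle0// => h2.
  by apply/eqP; rewrite -sqrf_eq0 eq_le h2 sqr_ge0.
by move/eqP; rewrite subr_eq0 => /eqP ->.
Qed.

Lemma ip_definite x y : H x -> H y -> (forall h, H h -> ip h x = ip h y) -> x = y.
Proof.
move=> Hx Hy xy; have Hxy := subspaceB sH Hx Hy.
apply/eqP; rewrite -subr_eq0; apply/eqP; apply: defH => //.
have : ip (x - y) (x - y) = 0 by rewrite (ipBr ph)// xy// subrr.
rewrite (ph_nrm ph)// => /(@toC_inj _ _ 0)/eqP; by rewrite sqrf_eq0 => /eqP.
Qed.

Lemma orthogonal_projectionP g : X g ->
  H (orthogonal_projection H ip g) /\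
  forall h, H h -> ip h (orthogonal_projection H ip g) = ip h g.
Proof.
move=> Xg.
have [p Hp pP] := @riesz (fun h => ip h g) (nrm g)
   (fun c x y Hx Hy => ph_lin phX c (HX Hx) (HX Hy) Xg)
   (fun x Hx => ltac:(rewrite mulrC; exact: (cauchy_schwarz phX (HX Hx) Xg))).
have : [set p | H p /\ forall h, H h -> ip (g - p) h = 0] (orthogonal_projection H ip g).
  apply: (xgetPex 0); exists p; split => // h Hh.
  have XHp := HX Hp; have XHh := HX Hh.
  rewrite (ph_conj phX XHh)//; last exact: (subspaceB (ph_sub phX)).
  by rewrite (ipBr phX)// pP// subrr rmorph0.
move=> [H1 H2]; split => // h Hh.
have XHp := HX H1; have XHh := HX Hh.
have := H2 h Hh; rewrite (ph_conj phX XHh); last exact: (subspaceB (ph_sub phX)).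
move=> /(congr1 (Num.conj)); rewrite rmorph0 conjCK (ipBr phX)// => /eqP.
by rewrite subr_eq0 => /eqP.
Qed.

Lemma adjointP (A : E -> E) : bounded_operator H nrm A -> forall y, H y ->
  H (adjoint H ip A y) /\ forall x, H x -> ip (A x) y = ip x (adjoint H ip A y).
Proof.
move=> bA y Hy; have [M M0 AM] := bounded_operator_bound ph bA.
case: bA => AH Alin _.
have [] := @riesz (fun h => ip (A h) y) (M * nrm y).
- by move=> c x z Hx Hz; rewrite Alin// (ph_lin ph)//; exact: AH.
- move=> x Hx; apply: le_trans (cauchy_schwarz ph (AH _ Hx) Hy) _.
  by rewrite mulrAC ler_wpM2r ?AM// (ph_nrm_ge0 ph).
move=> p Hp pP.
have : [set p | H p /\ forall x, H x -> ip (A x) y = ip x p] (adjoint H ip A y).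
  by apply: (xgetPex 0); exists p; split.
by [].
Qed.

End Riesz.

(** The projection onto [Y], obtained from Riesz on [Y], leaves a difference orthogonal to [Y]. It
    serves to extend properties from kernels to all of [berg B]: the vectors with the property form
    a closed subspace, and only 0 is orthogonal to enough kernels. *)
Lemma dense_of_trivial_perp X H Y nrm ip : prehilbert X nrm ip ->
  is_subspace H -> H `<=` X -> mcomplete H (fun x y => nrm (x - y)) ->
  is_subspace Y -> Y `<=` H ->
  (forall x, H x -> (forall e : R, 0 < e -> exists2 y, Y y & nrm (x - y) < e) -> Y x) ->
  (forall x, H x -> (forall y, Y y -> ip y x = 0) -> x = 0) -> H `<=` Y.
Proof.
move=> ph sH HX cH sY YH clY perp x Hx.
have YX := subset_trans YH HX.
have cY : mcomplete Y (fun x y => nrm (x - y)).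
  move=> u Yu cu; have [p Hp pl] := cH u (fun k => YH _ (Yu k)) cu.
  exists p => //; apply: clY => // e e0; have [N HN] := pl e e0.
  exists (u N) => //; rewrite (nrm_distC ph); [exact: HN|exact: HX|exact: YX].
have [p Yp pP] := @riesz X Y nrm ip ph sY YX cY (fun h => ip h x) (nrm x)
   (fun c y z Yy Yz => ph_lin ph c (YX _ Yy) (YX _ Yz) (HX _ Hx))
   (fun y Yy => ltac:(rewrite mulrC; exact: (cauchy_schwarz ph (YX _ Yy) (HX _ Hx)))).
suff : x - p = 0 by move/eqP; rewrite subr_eq0 => /eqP ->.
have Hp := YH _ Yp.
apply: perp; first exact: subspaceB.
move=> y Yy; rewrite (ipBr ph) ?pP ?subrr//; [exact: HX|exact: YX|exact: YX].
Qed.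

End Hilbert.

(** * The sequence space *)

Section EllTwoTheory.
Context (R : realType).
Local Notation C := (Cplx R).
Implicit Types (a b : nat -> C).

Lemma sqnorm_l2_ge0 a : (0 <= sqnorm_l2 a)%E.
Proof. by apply: nneseries_ge0 => k _ _; rewrite lee_fin sqr_ge0. Qed.

Lemma sqnorm_l2_fin a : l2 a -> sqnorm_l2 a \is a fin_num.
Proof. by move=> la; rewrite ge0_fin_numE// sqnorm_l2_ge0. Qed.

Lemma sqnorm_l2_le a b (c : R) : (forall k, cabs (a k) <= c * cabs (b k)) -> 
  (sqnorm_l2 a <= (c ^+ 2)%:E * sqnorm_l2 b)%E.
Proof.
move=> ab; rewrite /sqnorm_l2 -nneseriesZl; last by move=> k _; rewrite lee_fin sqr_ge0.
apply: lee_nneseries => [k _ _|k _]; first by rewrite lee_fin sqr_ge0.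
rewrite -EFinM lee_fin -exprMn lerXn2r// nnegrE ?cabs_ge0//.
by apply: le_trans (ab k); rewrite cabs_ge0.
Qed.

Lemma sqnorm_l2D a b : (sqnorm_l2 (fun k => (a k + b k)%R) <= 2%:E * sqnorm_l2 a + 2%:E * sqnorm_l2 b)%E.
Proof.
have p (x : nat -> C) k : (0 <= ((cabs (x k)) ^+ 2)%:E)%E by rewrite lee_fin sqr_ge0.
rewrite /sqnorm_l2 -!nneseriesZl//; [|by move=> k _..].
rewrite -nneseriesD//; [|by move=> k _ _; rewrite mule_ge0..].
apply: lee_nneseries => [k _ _|k _]; first by rewrite lee_fin sqr_ge0.
rewrite -!EFinM -EFinD lee_fin.
have h : cabs (a k + b k) ^+ 2 <= (cabs (a k) + cabs (b k)) ^+ 2.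
  by rewrite lerXn2r ?nnegrE ?addr_ge0 ?cabsD.
by apply: le_trans h _; have := sqr_ge0 (cabs (a k) - cabs (b k)); rewrite sqrrB sqrrD; lra.
Qed.

Lemma l2_0 : l2 (0 : nat -> C).
Proof.
rewrite /l2 /= /sqnorm_l2 eseries0 // => k _ _.
by have -> : (0 : nat -> C) k = 0 by []; rewrite cabs0 expr0n.
Qed.

Lemma l2D a b : l2 a -> l2 b -> l2 (fun k => a k + b k).
Proof.
move=> la lb; apply: le_lt_trans (sqnorm_l2D a b) _.
by rewrite lte_add_pinfty ?lte_mul_pinfty ?lee_fin// sqnorm_l2_fin.
Qed.

Lemma l2Z (c : C) a : l2 a -> l2 (fun k => c * a k).
Proof.
move=> la; have h : forall k, cabs (c * a k) <= cabs c * cabs (a k).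
  by move=> k; rewrite cabsM.
apply: le_lt_trans (sqnorm_l2_le h) _.
by rewrite lte_mul_pinfty ?lee_fin ?sqr_ge0.
Qed.

Lemma l2_subspace : is_subspace (@l2 R).
Proof.
split; first exact: l2_0.
by move=> c a b la lb; apply: l2D => //; exact: l2Z.
Qed.

Lemma norm_l2_ge0 a : 0 <= norm_l2 a. Proof. exact: sqrtr_ge0. Qed.

Lemma norm_l2_sqr a : l2 a -> ((norm_l2 a ^+ 2)%:E = sqnorm_l2 a)%E.
Proof.
by move=> la; rewrite sqr_sqrtr ?fine_ge0 ?sqnorm_l2_ge0// fineK// sqnorm_l2_fin.
Qed.

Lemma l2_series_cvg a : l2 a ->
  series (fun k => cabs (a k) ^+ 2) @ \oo --> norm_l2 a ^+ 2.
Proof.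
move=> la; have : cvgn (fun n => \sum_(0 <= i < n) (cabs (a i) ^+ 2)%:E)%E.
  by apply: is_cvg_nneseries => k _ _; rewrite lee_fin sqr_ge0.
move=> /cvg_ex[l hl].
have lE : l = (norm_l2 a ^+ 2)%:E by rewrite norm_l2_sqr// /sqnorm_l2; apply/esym/cvg_lim.
rewrite lE in hl; move/fine_cvgP : hl => [_].
apply: cvg_trans; apply: near_eq_cvg; near=> n.
by rewrite /= sumEFin /=.
Unshelve. all: by end_near. Qed.

Lemma l2_cabs_le a k : l2 a -> cabs (a k) <= norm_l2 a.
Proof.
move=> la; rewrite -(@ler_pXn2r _ 2)// ?nnegrE ?cabs_ge0 ?norm_l2_ge0//.
rewrite -lee_fin norm_l2_sqr//.
have := @nneseries_lim_ge R (fun k => (cabs (a k) ^+ 2)%:E) xpredT 0%N k.+1.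
move=> /(_ (fun n _ _ => ltac:(by rewrite lee_fin sqr_ge0))); apply: le_trans.
rewrite big_nat_recr//= leeDr// sume_ge0// => i _; by rewrite lee_fin sqr_ge0.
Qed.

Lemma real_series_cvg (u v : nat -> R) : (forall k, `|u k| <= v k) -> cvgn (series v) ->
  cvgn (series u).
Proof.
move=> uv cv; apply: normed_cvg; apply: (series_le_cvg _ _ uv cv) => k //.
by apply: le_trans (uv k).
Qed.

Lemma l2_cauchy_cvg a b : l2 a -> l2 b ->
  cvgn (series (fun k => (cabs (a k) ^+ 2 + cabs (b k) ^+ 2))).
Proof.
move=> la lb; rewrite (_ : series _ = series (fun k => cabs (a k) ^+ 2) \+ series (fun k => cabs (b k) ^+ 2)).
  by apply: is_cvgD; [apply/cvg_ex; eexists; exact: l2_series_cvg la|apply/cvg_ex; eexists; exact: l2_series_cvg lb].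
by apply/funext => n; rewrite /series /= big_split.
Qed.

Lemma cabsM_le (x y : C) : cabs (x * Num.conj y) <= cabs x ^+ 2 + cabs y ^+ 2.
Proof.
rewrite cabsM cabs_conj; have := sqr_ge0 (cabs x - cabs y).
rewrite sqrrB => h; have := mulr_ge0 (cabs_ge0 x) (cabs_ge0 y).
have := sqr_ge0 (cabs x); have := sqr_ge0 (cabs y); lra.
Qed.

Lemma ip_l2_cvg a b : l2 a -> l2 b ->
  series (fun k => a k * Num.conj (b k)) @ \oo --> ip_l2 a b.
Proof.
move=> la lb; have cab := l2_cauchy_cvg la lb.
have cr : cvgn (series (fun k => complex.Re (a k * Num.conj (b k)))).
  by apply: real_series_cvg cab => k; apply: le_trans (ler_Re_cabs _) _; exact: cabsM_le.
have ci : cvgn (series (fun k => complex.Im (a k * Num.conj (b k)))).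
  by apply: real_series_cvg cab => k; apply: le_trans (ler_Im_cabs _) _; exact: cabsM_le.
have c : series (fun k => a k * Num.conj (b k)) @ \oo -->
    (Complex (limn (series (fun k => complex.Re (a k * Num.conj (b k)))))
      (limn (series (fun k => complex.Im (a k * Num.conj (b k))))) : C).
  apply/cvg_cabsP => e e0.
  have e2 : 0 < e / 2 by rewrite divr_gt0.
  move/cvgrPdist_lt : cr => /(_ _ e2) cr; move/cvgrPdist_lt : ci => /(_ _ e2) ci.
  near=> n; apply: le_lt_trans (cabs_le_ReIm _) _.
  rewrite cReD cImD cReN cImN /= (splitr e) ltrD//.
    by rewrite /series cRe_sum distrC; near: n.
  by rewrite /series cIm_sum distrC; near: n.
by apply/cvg_ex; eexists; exact: c.
Unshelve. all: by end_near. Qed.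

Lemma ip_l2_unique a b (l : C) : series (fun k => a k * Num.conj (b k)) @ \oo --> l ->
  ip_l2 a b = l.
Proof. by apply: cvg_lim; exact: norm_hausdorff. Qed.

Lemma ip_l2_e a k : ip_l2 a (e_ k) = a k.
Proof.
apply: ip_l2_unique; apply/cvg_cabsP => e e0; exists k.+1 => //= n kn.
rewrite /series /= (bigD1_seq k) ?mem_index_iota ?iota_uniq//=.
rewrite /e_ eqxx rmorph1 mulr1 big1 ?addr0 ?subrr ?cabs0// => i ik.
by rewrite (negbTE ik) rmorph0 mulr0.
Qed.

Lemma l2_prehilbert : prehilbert (@l2 R) (@norm_l2 R) (@ip_l2 R).
Proof.
split; first exact: l2_subspace.
- move=> c a b z la lb lz; apply: ip_l2_unique.
  rewrite (_ : series _ = fun n => c * series (fun k => a k * Num.conj (z k)) n +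
    series (fun k => b k * Num.conj (z k)) n).
    by apply: cvgD; [apply: cvgM; [exact: cvg_cst|exact: ip_l2_cvg]|exact: ip_l2_cvg].
  apply/funext => n; rewrite /series /= mulr_sumr -big_split.
  by apply: eq_bigr => k _; rewrite /= mulrDl mulrA.
- move=> a b la lb; apply: ip_l2_unique; apply/cvg_cabsP => e e0.
  have /cvg_cabsP/(_ e e0) := ip_l2_cvg la lb; apply: filterS => n.
  rewrite -cabs_conj rmorphB /= rmorph_sum /=; congr (cabs (_ - _) < _).
  by apply: eq_bigr => k _; rewrite rmorphM /= conjCK mulrC.
- by move=> a _; exact: norm_l2_ge0.
- move=> a la; apply: ip_l2_unique; apply/cvg_cabsP => e e0.
  have /cvgrPdist_lt/(_ e e0) := l2_series_cvg la; apply: filterS => n.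
  rewrite distrC -cabs_toC toCD toCN; congr (cabs (_ - _) < _).
  by rewrite /series toC_sum; apply: eq_bigr => k _; rewrite mul_conj.
Qed.

Lemma cabs_ip_l2 a b : l2 a -> l2 b -> cabs (ip_l2 a b) <= norm_l2 a * norm_l2 b.
Proof. exact: (cauchy_schwarz l2_prehilbert). Qed.

Lemma sqnorm_l2_finite a d : (forall k, (d <= k)%N -> a k = 0) ->
  sqnorm_l2 a = ((\sum_(k < d) cabs (a k) ^+ 2)%R%:E)%E.
Proof.
move=> ad; rewrite /sqnorm_l2 (@nneseries_split _ _ 0 d); last by move=> k _; rewrite lee_fin sqr_ge0.
rewrite add0n eseries0 ?adde0 ?sumEFin ?big_mkord// => k dk _.
by rewrite ad// cabs0 expr0n.
Qed.

Lemma l2_finite a d : (forall k, (d <= k)%N -> a k = 0) -> l2 a.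
Proof. by move=> ad; rewrite /l2 /= (sqnorm_l2_finite ad) ltry. Qed.

Lemma l2_e k : l2 (e_ k : nat -> C).
Proof.
by apply: (@l2_finite _ k.+1) => j kj; rewrite /e_ gtn_eqF.
Qed.

End EllTwoTheory.

(** * Square integrable and analytic functions with values in sequences *)

Section L2Theory.
Context (R : realType) (n : nat) (B : bergman_data R n).
Local Notation C := (Cplx R).
Local Notation V := (Cspace R n).
Local Notation E := (V -> nat -> C).
Local Notation Om := (Om B).
Local Notation sigma := (sigma B).
Local Notation bOm := (Om : set (borel R n)).
Implicit Types (f g : E).

Local Notation bcmeas h := (@cmeas _ (borel R n) R bOm h).

Hypothesis mOm : measurable bOm.

Lemma L2P f : L2 B f <-> [/\ forall z, Om z -> l2 (f z),
  forall k, bcmeas (fun z => f z k) & (\int[sigma]_(z in Om) sqnorm_l2 (f z) < +oo)%E].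
Proof.
have eqf k : (fun z => ip_l2 (f z) (e_ k)) = (fun z => f z k).
  by apply/funext => z; rewrite ip_l2_e.
split => -[h1 h2 h3]; split => // k; have := h2 k; rewrite ?eqf//.
Qed.

Lemma measurable_sqnorm f : (forall k, bcmeas (fun z => f z k)) ->
  measurable_fun bOm ((fun z => sqnorm_l2 (f z)) : borel R n -> \bar R).
Proof.
move=> mf; apply: ge0_emeasurable_sum => //.
  by move=> k z _ _; rewrite lee_fin sqr_ge0.
by move=> k _; apply/measurable_EFinP; apply: measurable_cabs_sqr.
Qed.

Lemma int_sqnorm_ge0 f : (0 <= \int[sigma]_(z in Om) sqnorm_l2 (f z))%E.
Proof. by apply: integral_ge0 => z _; exact: sqnorm_l2_ge0. Qed.

Lemma normB_ge0 f : 0 <= normB B f. Proof. exact: sqrtr_ge0. Qed.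

Lemma normB_sqr f : L2 B f ->
  ((normB B f ^+ 2)%:E = \int[sigma]_(z in Om) sqnorm_l2 (f z))%E.
Proof.
move=> /L2P[_ _ h]; rewrite sqr_sqrtr ?fine_ge0 ?int_sqnorm_ge0// fineK//.
by rewrite ge0_fin_numE// int_sqnorm_ge0.
Qed.

Lemma L2_le f (M : R) : (forall k, bcmeas (fun z => f z k)) -> 
  (forall z, Om z -> l2 (f z)) -> 0 <= M ->
  (\int[sigma]_(z in Om) sqnorm_l2 (f z) <= (M ^+ 2)%:E)%E ->
  L2 B f /\ normB B f <= M.
Proof.
move=> mf lf M0 h; have Lf : L2 B f.
  by apply/L2P; split => //; apply: le_lt_trans h _; rewrite ltry.
split => //; rewrite -(@ler_pXn2r _ 2)// ?nnegrE ?normB_ge0//.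
by rewrite -lee_fin normB_sqr.
Qed.

Lemma L2_scale f g (M : R) : L2 B f -> (forall k, bcmeas (fun z => g z k)) -> 0 <= M ->
  (forall z, Om z -> (sqnorm_l2 (g z) <= (M ^+ 2)%:E * sqnorm_l2 (f z))%E) ->
  L2 B g /\ normB B g <= M * normB B f.
Proof.
move=> Lf mg M0 fg; have /L2P[l2f mf If] := Lf.
apply: L2_le => //.
- move=> z Oz; apply: le_lt_trans (fg z Oz) _.
  by rewrite lte_mul_pinfty ?lee_fin ?sqr_ge0//; exact: l2f.
- by rewrite mulr_ge0// normB_ge0.
rewrite exprMn EFinM normB_sqr// -ge0_integralZl//; first last.
- by rewrite lee_fin sqr_ge0.
- by move=> z _; exact: sqnorm_l2_ge0.
- exact: measurable_sqnorm.
apply: ge0_le_integral => //.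
- by move=> z _; exact: sqnorm_l2_ge0.
- exact: measurable_sqnorm.
- by apply: measurable_funeM; exact: measurable_sqnorm.
Qed.

Lemma L2_cmeas_ip f g : L2 B f -> L2 B g -> bcmeas (fun z => ip_l2 (f z) (g z)).
Proof.
move=> /L2P[l2f mf If] /L2P[l2g mg Ig].
have H := @cmeas_cvg _ (borel R n) R bOm (fun m z => series (fun k => f z k * Num.conj (g z k)) m); apply: H.
  move=> m; apply: cmeas_sum => // k; apply: cmeasM => //; exact: cmeas_conj.
move=> z Oz e e0.
by have /cvg_cabsP/(_ e e0) := ip_l2_cvg (l2f _ Oz) (l2g _ Oz).
Qed.

Lemma integrable_norm_l2 f : L2 B f ->
  sigma.-integrable bOm (EFin \o ((fun z => norm_l2 (f z) ^+ 2) : borel R n -> R)).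
Proof.
move=> /[dup] Lf /L2P[l2f mf If].
have -> : (sigma.-integrable bOm (EFin \o ((fun z => norm_l2 (f z) ^+ 2) : borel R n -> R)))
  = (sigma.-integrable bOm ((fun z => sqnorm_l2 (f z)) : borel R n -> \bar R)) :> Prop.
  apply/propext; split; apply: eq_integrable => // z /set_mem Oz /=.
    by rewrite norm_l2_sqr//; exact: l2f.
  by rewrite norm_l2_sqr//; exact: l2f.
apply/integrableP; split; first exact: measurable_sqnorm.
under eq_integral do rewrite gee0_abs ?sqnorm_l2_ge0//.
exact: If.
Qed.

Lemma L2_ip_integrable f g : L2 B f -> L2 B g ->
  @cintegrable _ (borel R n) R sigma bOm (fun z => ip_l2 (f z) (g z)).
Proof.
move=> Lf Lg; have /L2P[l2f _ _] := Lf; have /L2P[l2g _ _] := Lg.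
apply: (@cintegrable_le _ _ _ _ _ mOm _ (fun z => norm_l2 (f z) ^+ 2 + norm_l2 (g z) ^+ 2)).
- exact: L2_cmeas_ip.
- by apply: eq_integrable (integrableD mOm (integrable_norm_l2 Lf) (integrable_norm_l2 Lg)).
- move=> z Oz; apply: le_trans (cabs_ip_l2 (l2f _ Oz) (l2g _ Oz)) _.
  have := sqr_ge0 (norm_l2 (f z) - norm_l2 (g z)); rewrite sqrrB.
  have := mulr_ge0 (norm_l2_ge0 (f z)) (norm_l2_ge0 (g z)); lra.
Qed.

Lemma ipBE f g : ipB B f g = @cint _ (borel R n) R sigma bOm (fun z => ip_l2 (f z) (g z)).
Proof. by []. Qed.

Lemma L2_subspace : is_subspace (L2 B).
Proof.
split.
  apply/L2P; split.
  - by move=> z _; exact: l2_0.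
  - by move=> k; exact: (cmeas_cst _ 0).
  - rewrite integral0_eq ?ltry// => z _; rewrite (@sqnorm_l2_finite _ _ 0) ?big_ord0//.
move=> c f g Lf Lg; have /L2P[l2f mf If] := Lf; have /L2P[l2g mg Ig] := Lg.
have mcf k : bcmeas (fun z => c * f z k) by apply: cmeasM => //; exact: cmeas_cst.
have [Lcf _] : L2 B (fun z k => c * f z k) /\
    normB B (fun z k => c * f z k) <= cabs c * normB B f.
  apply: L2_scale => //.
  by move=> z _; apply: sqnorm_l2_le => k; rewrite cabsM.
have /L2P[l2cf _ Icf] := Lcf.
apply/L2P; split.
- by move=> z Oz; apply: l2D; [exact: l2cf|exact: l2g].
- by move=> k; exact: (cmeasD (mcf k) (mg k)).
- have ms := measurable_sqnorm mcf; have mg' := measurable_sqnorm mg.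
  apply: (@le_lt_trans _ _ (\int[sigma]_(z in Om) (2%:E * sqnorm_l2 (fun k => c * f z k)%R + 2%:E * sqnorm_l2 (g z)))%E).
    apply: ge0_le_integral => //.
    + by move=> z _; exact: sqnorm_l2_ge0.
    + by apply: (@measurable_sqnorm (fun z k => c * f z k + g z k)) => k; exact: cmeasD.
    + by apply: emeasurable_funD; exact: measurable_funeM.
    + by move=> z _; exact: sqnorm_l2D.
  rewrite ge0_integralD//; first last.
  - exact: measurable_funeM.
  - by move=> z _; rewrite mule_ge0// sqnorm_l2_ge0.
  - exact: measurable_funeM.
  - by move=> z _; rewrite mule_ge0// sqnorm_l2_ge0.
  rewrite !ge0_integralZl//; first last.
  - by move=> z _; exact: sqnorm_l2_ge0.
  - by move=> z _; exact: sqnorm_l2_ge0.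
  by rewrite lte_add_pinfty// lte_mul_pinfty.
Qed.

Lemma L2_prehilbert : prehilbert (L2 B) (normB B) (ipB B).
Proof.
split; first exact: L2_subspace.
- move=> c f g h Lf Lg Lh; rewrite !ipBE -cintZ//; last exact: L2_ip_integrable.
  rewrite -cintD//; last 2 first.
  + by apply: cintegrableZ => //; exact: L2_ip_integrable.
  + exact: L2_ip_integrable.
  apply: eq_cint => z Oz.
  have /L2P[/(_ z Oz) lf _ _] := Lf; have /L2P[/(_ z Oz) lg _ _] := Lg.
  have /L2P[/(_ z Oz) lh _ _] := Lh.
  exact: (ph_lin (l2_prehilbert R) c lf lg lh).
- move=> f g Lf Lg; rewrite !ipBE -cint_conj//; last exact: L2_ip_integrable.
  apply: eq_cint => z Oz.
  have /L2P[/(_ z Oz) lf _ _] := Lf; have /L2P[/(_ z Oz) lg _ _] := Lg.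
  exact: (ph_conj (l2_prehilbert R) lf lg).
- by move=> f _; exact: normB_ge0.
- move=> f Lf; have /L2P[lf _ If] := Lf; apply: complexP => /=.
    apply: EFin_inj; rewrite normB_sqr// -[RHS]fineK ?ge0_fin_numE ?int_sqnorm_ge0//.
    congr (_%:E); rewrite /Rintegral; congr fine; apply: eq_integral => z /set_mem Oz.
    by rewrite (ph_nrm (l2_prehilbert R) (lf z Oz))/= norm_l2_sqr//; exact: lf.
  rewrite /Rintegral integral0_eq// => z Oz.
  by rewrite (ph_nrm (l2_prehilbert R) (lf z Oz)).
Qed.

Lemma L2_ext f g : (forall z, Om z -> f z = g z) -> L2 B f -> L2 B g.
Proof.
move=> fg /L2P[lf mf If]; apply/L2P; split.
- by move=> z Oz; rewrite -fg//; exact: lf.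
- by move=> k; apply: eq_cmeas (mf k) => z /set_mem Oz; rewrite fg.
- suff -> : (\int[sigma]_(z in Om) sqnorm_l2 (g z) = \int[sigma]_(z in Om) sqnorm_l2 (f z))%E by [].
  by apply: eq_integral => z /set_mem Oz; rewrite fg.
Qed.

Lemma normB_ext f g : (forall z, Om z -> f z = g z) -> normB B f = normB B g.
Proof.
move=> fg; rewrite /normB; congr (Num.sqrt (fine _)).
by apply: eq_integral => z /set_mem Oz; rewrite fg.
Qed.

Lemma ipB_ext f g f' g' : (forall z, Om z -> f z = f' z) ->
  (forall z, Om z -> g z = g' z) -> ipB B f g = ipB B f' g'.
Proof. by move=> ff gg; apply: eq_cint => z Oz; rewrite ff// gg. Qed.

Lemma berg_L2 : berg B `<=` L2 B.
Proof. by move=> f []. Qed.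

Lemma berg_subspace : is_subspace (berg B).
Proof.
have [L0 LD] := L2_subspace.
split.
  split => //; move=> k.
  have -> : (fun z => ip_l2 ((0 : E) z) (e_ k)) = cst (0 : C).
    by apply/funext => z; rewrite ip_l2_e.
  by move=> z _; exact: differentiable_cst.
move=> c f g [f0 fa Lf] [g0 ga Lg]; split => //; last exact: LD.
  move=> z Oz; apply/funext => k; change (c * f z k + g z k = 0).
  by rewrite f0// g0//; change (c * 0 + 0 = 0 :> C); rewrite mulr0 addr0.
move=> k z Oz.
have -> : (fun z => ip_l2 ((c *: f + g) z) (e_ k)) =
  (c *: (fun z => ip_l2 (f z) (e_ k))) + (fun z => ip_l2 (g z) (e_ k)).
  apply/funext => w; rewrite ip_l2_e.
  by change (c * f w k + g w k = c * ip_l2 (f w) (e_ k) + ip_l2 (g w) (e_ k)); rewrite !ip_l2_e.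
by apply: differentiableD; [apply: differentiableZ; exact: fa|exact: ga].
Qed.

Lemma berg_prehilbert : prehilbert (berg B) (normB B) (ipB B).
Proof. exact: (prehilbert_sub berg_subspace berg_L2 L2_prehilbert). Qed.

Lemma ip_l2_scale_e (a : nat -> C) (c : C) k :
  ip_l2 a (fun j => c * e_ k j) = a k * Num.conj c.
Proof.
apply: ip_l2_unique; apply/cvg_cabsP => e e0; exists k.+1 => //= m kn.
rewrite /series /= (bigD1_seq k) ?mem_index_iota ?iota_uniq//=.
rewrite /e_ eqxx mulr1 big1 ?addr0 ?subrr ?cabs0// => i ik.
by rewrite (negbTE ik) mulr0 rmorph0 mulr0.
Qed.

(** The elementary tensor of [h] and [e_ k]. For [h] a kernel it represents evaluation of the k-th
    coordinate at a point. *)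
Definition embed (h : V -> C) (k : nat) : E := fun w j => h w * e_ k j.

Lemma sqnorm_embed h k z : sqnorm_l2 (embed h k z) = ((cabs (h z) ^+ 2)%:E).
Proof.
rewrite (@sqnorm_l2_finite _ _ k.+1); last first.
  by move=> j kj; rewrite /embed /e_ gtn_eqF// mulr0.
rewrite big_ord_recr /= big1 ?add0r; first by rewrite /embed /e_ eqxx mulr1.
move=> i _; rewrite /embed /e_ ltn_eqF// mulr0 cabs0 expr0n//.
Qed.

Lemma embed_L2 h k : L2C B h -> L2 B (embed h k).
Proof.
move=> [mh Ih]; apply/L2P; split.
- move=> z _; rewrite /l2 /= sqnorm_embed ltry//.
- move=> j; apply: cmeasM => //; exact: cmeas_cst.
- by under eq_integral do rewrite sqnorm_embed.
Qed.

Lemma embed_berg h k : bergC B h -> berg B (embed h k).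
Proof.
move=> [h0 ha Lh]; split; last exact: embed_L2.
  by move=> z Oz; apply/funext => j; rewrite /embed h0// mul0r.
move=> j z Oz.
have -> : (fun z => ip_l2 (embed h k z) (e_ j)) = (e_ k j *: h : V -> C).
  by apply/funext => w; rewrite ip_l2_e /embed mulrC.
by apply: differentiableZ; exact: ha.
Qed.

Lemma normB_embed h k : normB B (embed h k) = normC B h.
Proof.
rewrite /normB /normC; congr (Num.sqrt (fine _)).
by apply: eq_integral => z _; rewrite sqnorm_embed.
Qed.

Lemma ipB_embed f h k : ipB B f (embed h k) = cintegral B (fun w => f w k * Num.conj (h w)).
Proof.
by apply: eq_cint => w _; rewrite /embed ip_l2_scale_e.
Qed.

End L2Theory.

(** * The Bergman space and its translations *)

Section ChangeOfVariables.
Context d (T : measurableType d) (R : realType) (mu : {measure set T -> \bar R}).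
Variables (D : set T) (phi : T -> T) (h : T -> R) (c : R).
Hypothesis mD : measurable D.
Hypothesis phiD : forall x, D x -> D (phi x).
Hypothesis mphi : forall A, measurable A -> measurable (D `&` phi @^-1` A).
Hypothesis h0 : forall x, D x -> 0 <= h x.
Hypothesis mh : measurable_fun D h.
Hypothesis c0 : 0 <= c.
Hypothesis Hc : forall A, measurable A -> A `<=` D ->
  (\int[mu]_(x in D `&` phi @^-1` A) (h x)%:E <= c%:E * \int[mu]_(x in A) (h x)%:E)%E.

Import HBNNSimple.
Local Open Scope ereal_scope.

Let simple_change (f : {nnsfun T >-> R}) :
  \int[mu]_(x in D) ((f (phi x))%:E * (h x)%:E) <=
  c%:E * \int[mu]_(x in D) ((f x)%:E * (h x)%:E).
Proof.
have mhE : measurable_fun D (fun x => (h x)%:E) by exact/measurable_EFinP.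
have mf r : measurable (f @^-1` [set r]) by [].
have fk0 k x : f x = k -> 0 <= k%:E by move=> <-; rewrite lee_fin.
(* Stated for a general map so that it expands both sides of the inequality, with [phi] and with the
   identity. *)
have expand (g : T -> T) : (forall A, measurable A -> measurable (D `&` g @^-1` A)) ->
    \int[mu]_(x in D) ((f (g x))%:E * (h x)%:E) =
    \sum_(k \in range f) k%:E * \int[mu]_(x in D `&` g @^-1` (f @^-1` [set k])) (h x)%:E.
  move=> mg; pose P k := D `&` g @^-1` (f @^-1` [set k]).
  have mP k : measurable (P k) by exact: mg.
  have mhP k : measurable_fun D ((EFin \o h) \_ (P k)).
    apply/measurable_restrict => //; apply: measurable_funS mhE => //.
  have hP k x : D x -> 0 <= ((EFin \o h) \_ (P k)) x.
    by move=> Dx; apply: erestrict_ge0 => y [Dy _]; rewrite lee_fin; exact: h0.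
  transitivity (\sum_(k \in range f) \int[mu]_(x in D) (k%:E * ((EFin \o h) \_ (P k)) x)).
    rewrite -ge0_integral_fsum//.
    - apply: eq_integral => x /set_mem Dx; rewrite fimfunE -fsumEFin// ge0_mule_fsuml.
        apply: eq_fsbigr => k _; rewrite EFinM -muleA; congr (_ * _).
        rewrite patchE indicE; case: ifPn => hk.
          rewrite (_ : (g x \in _) = true) ?mul1e//.
          by case: (set_mem hk) => _ gx; exact: mem_set.
        rewrite (_ : (g x \in _) = false) ?mul0e//; apply: contraNF hk => gx.
        by apply: mem_set; split => //; exact: set_mem gx.
      by move=> k; rewrite EFinM nnfun_muleindic_ge0.
    - by move=> k; exact: measurable_funeM.
    - move=> k x Dx; rewrite patchE; case: ifPn => hk; last by rewrite mule0.
      by rewrite mule_ge0 ?lee_fin ?h0//; move: hk => /set_mem[_ /fk0]; rewrite lee_fin.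
  apply: eq_fsbigr => k kf; rewrite ge0_integralZl//.
  - by rewrite -integral_mkcondr /P setIA setIid.
  - by move=> x; exact: hP.
  - by move: kf => /set_mem[x _]; exact: fk0.
rewrite (expand phi mphi) (expand id); last by move=> A mA; exact: measurableI.
rewrite ge0_mule_fsumr; last first.
  move=> k; have [k0|k0] := leP 0%R k.
    by rewrite mule_ge0 ?lee_fin// integral_ge0// => x [Dx _]; rewrite lee_fin h0.
  rewrite (_ : D `&` _ = set0) ?integral_set0 ?mule0//.
  apply/seteqP; split => // x /= [_ /fk0]; rewrite lee_fin => h1.
  by move: (lt_le_trans k0 h1); rewrite ltxx.
apply: lee_fsum => // k [x _ /fk0 k0]; rewrite muleCA; apply: lee_wpmul2l => //.
have -> : D `&` phi @^-1` (f @^-1` [set k]) = D `&` phi @^-1` (D `&` f @^-1` [set k]).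
  by apply/seteqP; split => y /= [Dy]; [move=> ?; do 2 split => //; exact: phiD|move=> [_ ?]].
by apply: Hc; [exact: measurableI|move=> y []].
Qed.

(** Passes quasi-invariance of the weighted measure h dmu from sets to nonnegative functions: level
    set by level set for simple functions, then by monotone convergence. *)
Lemma ge0_change_of_variables (q : T -> \bar R) : (forall x, D x -> 0 <= q x) ->
  measurable_fun D q ->
  \int[mu]_(x in D) (q (phi x) * (h x)%:E) <= c%:E * \int[mu]_(x in D) (q x * (h x)%:E).
Proof.
move=> q0 mq.
have mhE : measurable_fun D (fun x => (h x)%:E) by exact/measurable_EFinP.
pose f := nnsfun_approx mD mq.
have mcomp (g : T -> \bar R) : measurable_fun D g -> measurable_fun D (g \o phi).
  move=> mg _ A mA.
  have -> : D `&` (g \o phi) @^-1` A = D `&` phi @^-1` (D `&` g @^-1` A).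
    by apply/seteqP; split => x /= [Dx]; [move=> ?; do 2 split => //; exact: phiD|move=> [_ ?]].
  by apply: mphi; exact: mg.
have mfn n : measurable_fun D (fun x => (f n x)%:E).
  by apply/measurable_EFinP; apply: measurable_funTS.
have lef n x : D x -> (f n x)%:E <= q x.
  move=> Dx; have h1 := @cvg_nnsfun_approx _ _ _ _ mD _ mq q0 x Dx.
  have h2 : nondecreasing_seq (fun n => (f n x)%:E).
    by move=> m k mk; rewrite lee_fin; exact/lefP/nd_nnsfun_approx.
  have /cvg_lim h3 := ereal_nondecreasing_cvgn h2.
  rewrite -(cvg_lim (@ereal_hausdorff R) h1) [leRHS]h3//.
  by apply: ereal_sup_ubound; exists n.
have -> : \int[mu]_(x in D) (q (phi x) * (h x)%:E) =
  limn (fun n => \int[mu]_(x in D) ((f n (phi x))%:E * (h x)%:E)).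
  rewrite -monotone_convergence//.
  - apply: eq_integral => x /set_mem Dx; apply/esym/cvg_lim => //.
    apply: cvgeZr => //.
    by apply: cvg_nnsfun_approx => //; exact: phiD.
  - by move=> n; apply: emeasurable_funM => //; apply: (mcomp _ (mfn n)).
  - by move=> n x Dx; rewrite mule_ge0// lee_fin ?h0.
  - move=> x Dx m n mn; rewrite lee_wpmul2r ?lee_fin ?h0//.
    by exact/lefP/nd_nnsfun_approx.
apply: lime_le.
  apply: ereal_nondecreasing_is_cvgn => m n mn; apply: ge0_le_integral => //.
  - by move=> x Dx; rewrite mule_ge0// lee_fin ?h0.
  - by apply: emeasurable_funM => //; apply: (mcomp _ (mfn m)).
  - by apply: emeasurable_funM => //; apply: (mcomp _ (mfn n)).
  - move=> x Dx; rewrite lee_wpmul2r ?lee_fin ?h0//.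
    by exact/lefP/nd_nnsfun_approx.
near=> n; apply: le_trans (simple_change (f n)) _.
rewrite lee_wpmul2l ?lee_fin//; apply: ge0_le_integral => //.
- by move=> x Dx; rewrite mule_ge0// lee_fin ?h0.
- exact: emeasurable_funM.
- exact: emeasurable_funM.
- by move=> x Dx; rewrite lee_wpmul2r ?lee_fin ?h0// lef.
Unshelve. all: by end_near. Qed.

End ChangeOfVariables.

Lemma measurable_fun_gt d (T : measurableType d) (R : realType) (D : set T) (f : T -> R) :
  (forall c, measurable (D `&` [set x | c < f x])) -> measurable_fun D f.
Proof.
move=> H mD; apply: (measurability _ (RGenOInfty.measurableE R)) => //.
by move=> /= _ [_ [a ->] <-]; rewrite preimage_itvoy; exact: H.
Qed.

(** * Measurability, the metric, and the reproducing kernel *)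

Section BergmanBasics.
Context (R : realType) (n : nat) (B : bergman_data R n).
Hypothesis hB : bergman_type B.
Local Notation C := (Cplx R).
Local Notation V := (Cspace R n).
Local Notation E := (V -> nat -> C).
Local Notation Om := (Om B).
Local Notation sigma := (sigma B).
Local Notation K := (K B).
Local Notation dist := (dist B).
Local Notation phi := (phi B).
Local Notation normK := (normK B).
Local Notation D := (D B).
Local Notation bOm := (Om : set (borel R n)).
Implicit Types (f g : E).

Local Notation bcmeas h := (@cmeas _ (borel R n) R bOm h).

Lemma open_borel (A : set V) : open A -> measurable (A : set (borel R n)).
Proof. by move=> oA; exact: sub_sigma_algebra. Qed.

Lemma mOm : measurable bOm. Proof. by apply: open_borel; exact: bt_open. Qed.

Lemma analytic_continuous (W : normedModType C) (h : V -> W) : analytic Om h ->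
  forall z, Om z -> {for z, continuous h}.
Proof. by move=> ah z Oz; apply: differentiable_continuous; exact: ah. Qed.

Lemma phiOm z w : Om z -> Om w -> Om (phi z w).
Proof. by move=> Oz Ow; have [h _ _] := bt_phi_aut hB Oz; exact: h. Qed.

Lemma phi_self z : Om z -> phi z z = 0.
Proof.
by move=> Oz; rewrite -{2}(bt_phi_0 hB Oz) (bt_phi_invol hB)//; exact: (bt_0 hB).
Qed.

Lemma phi_measurable z (A : set (borel R n)) : Om z -> measurable A ->
  measurable (bOm `&` (phi z : borel R n -> borel R n) @^-1` A).
Proof.
move=> Oz mA; suff : measurable_fun bOm (phi z : borel R n -> borel R n).
  by apply => //; exact: mOm.
apply: (@measurability _ _ (borel R n) (borel R n) bOm (phi z) (@open V) erefl) => // _ [U oU <-].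
apply: open_borel; suff : open (Om `&` phi z @^-1` U : set V) by [].
rewrite openE => w [Ow Uw].
have [_ ha _] := bt_phi_aut hB Oz.
apply: filterI; first by apply: open_nbhs_nbhs; split => //; exact: (bt_open hB).
by apply: (analytic_continuous ha Ow); apply: open_nbhs_nbhs.
Qed.

Let metric := bt_metric hB.

Lemma dist_ge0 x y : Om x -> Om y -> 0 <= dist x y.
Proof. by case: metric => h _ _ _; exact: h. Qed.
Lemma distC x y : Om x -> Om y -> dist x y = dist y x.
Proof. by case: metric => _ _ h _; exact: h. Qed.
Lemma dist_tri y x z : Om x -> Om y -> Om z -> dist x z <= dist x y + dist y z.
Proof. by case: metric => _ _ _ h Ox Oy Oz; exact: h. Qed.

Lemma dense_seq : exists2 a : nat -> V, (forall i, Om (a i)) &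
  forall x (r : R), Om x -> 0 < r -> exists i, dist x (a i) < r.
Proof.
have [A [/countable_injP[f finj] AOm dA]] := bt_separable hB.
pose a i := xget 0 [set x | A x /\ f x = i].
exists a.
  by move=> i; rewrite /a; case: xgetP => [x _ [/AOm]//|_]; exact: (bt_0 hB).
move=> x r Ox r0; have [y Ay xy] := dA x r Ox r0; exists (f y).
rewrite /a; case: xgetP => [w _ [Aw fw]|/(_ y)]; last by case.
suff -> : w = y by [].
by apply: finj => //; exact: mem_set.
Qed.

(** A superlevel set is a countable union of [dist]-balls centred on a dense sequence with radii
    1/(m + 1), and balls are measurable. This is the bridge from the metric to the Borel sets. *)
Lemma metric_continuous_measurable (f : V -> R) :
  (forall z (e : R), Om z -> 0 < e -> exists2 r : R, 0 < r &
    forall w, Om w -> dist z w < r -> `|f z - f w| < e) ->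
  measurable_fun bOm (f : borel R n -> R).
Proof.
move=> cf; apply: measurable_fun_gt => c.
have [a aOm da] := dense_seq.
pose S := [set z | Om z /\ c < f z].
pose P i := `[< D (a i.1) i.2.+1%:R^-1 `<=` S >].
have -> : bOm `&` [set x | c < f x] =
    \bigcup_(i : nat * nat) (if P i then D (a i.1) i.2.+1%:R^-1 else set0).
  apply/seteqP; split => [z [Oz cz]|z [i _]]; last first.
    by case: ifPn => // /asboolP h /h[].
  have e0 : 0 < f z - c by rewrite subr_gt0.
  have [r r0 Hr] := cf z _ Oz e0.
  have r2 : 0 < r / 2 by rewrite divr_gt0.
  have [m _ Hm] : \forall m \near \oo, m.+1%:R^-1 < r / 2.
    have /cvgrPdist_lt/(_ _ r2) := @cvg_harmonic R; apply: filterS => m.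
    by rewrite /= sub0r normrN ger0_norm.
  have m0 : (0 : R) < m.+1%:R^-1 by rewrite invr_gt0.
  have mr := Hm m (leqnn m).
  have [i za] := da z _ Oz m0; have Oa := aOm i.
  exists (i, m) => //=; rewrite (_ : P (i, m) = true) /=.
    by split => //; rewrite distC.
  apply/asboolP => w [Ow aw]; split => //.
  have : dist z w < r.
    apply: le_lt_trans (dist_tri Oz Oa Ow) _; rewrite (splitr r).
    by apply: ltrD; [exact: lt_trans za mr|exact: lt_trans aw mr].
  by move=> /(Hr _ Ow); rewrite ltr_distlC => /andP[]; lra.
apply: countable_bigcupT_measurable; first exact: countableP.
by move=> i; case: ifPn => // _; apply: (bt_ball_measurable hB).
Qed.

Lemma normK_gt0 z : Om z -> 0 < normK z. Proof. exact: (bt_normK_gt0 hB). Qed.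

Lemma normK_measurable : measurable_fun bOm (normK : borel R n -> R).
Proof. by apply: metric_continuous_measurable => z e; exact: (bt_normK_cont hB). Qed.

Lemma dist_measurable a : Om a -> measurable_fun bOm (dist a : borel R n -> R).
Proof.
move=> Oa; apply: metric_continuous_measurable => z e Oz e0; exists e => // w Ow.
apply: le_lt_trans; rewrite ler_norml; apply/andP; split.
  by have := dist_tri Oa Oz Ow; lra.
by have := dist_tri Oa Ow Oz; rewrite (distC Ow Oz); lra.
Qed.

Lemma K_berg z : Om z -> bergC B (K z). Proof. exact: (bt_K hB). Qed.

Lemma K_cmeas z : Om z -> bcmeas (K z).
Proof. by move=> /K_berg[_ _ []]. Qed.

Lemma ipC_K z w : Om z -> Om w -> ipC B (K z) (K w) = K z w.
Proof.
move=> Oz Ow; rewrite (bt_reproC hB (K_berg Oz) Ow); apply: eq_cint => u _.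
by rewrite mulrC.
Qed.

Definition Ke z k : E := embed (K z) k.

Lemma Ke_berg z k : Om z -> berg B (Ke z k).
Proof. by move=> Oz; apply: embed_berg; exact: K_berg. Qed.

Lemma repro f z k : berg B f -> Om z -> f z k = ipB B f (Ke z k).
Proof.
move=> bf Oz; rewrite (bt_repro hB k bf Oz) ipB_embed; apply: eq_cint => w _.
by rewrite mulrC.
Qed.

Let phb := berg_prehilbert mOm.

Lemma normB_Ke z k : normB B (Ke z k) = normK z. Proof. exact: normB_embed. Qed.

Lemma berg_pointwise f z k : berg B f -> Om z -> cabs (f z k) <= normK z * normB B f.
Proof.
move=> bf Oz; rewrite (repro k bf Oz) mulrC -(normB_Ke z k).
by apply: (cauchy_schwarz phb) => //; exact: Ke_berg.
Qed.

Lemma berg_definite f : berg B f -> normB B f = 0 -> f = 0.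
Proof.
move=> bf f0; apply/funext => z; have [Oz|nOz] := pselect (Om z); last first.
  by case: bf => h _ _; rewrite h.
apply/funext => k; apply: cabs0_eq0; apply/eqP; rewrite eq_le cabs_ge0 andbT.
by have := berg_pointwise k bf Oz; rewrite f0 mulr0.
Qed.

Lemma Kconj z w : Om z -> Om w -> K w z = Num.conj (K z w).
Proof.
move=> Oz Ow.
have e1 : K z w = ipB B (Ke z 0) (Ke w 0).
  by rewrite -repro//; [rewrite /Ke /embed /e_ eqxx mulr1|exact: Ke_berg].
have e2 : K w z = ipB B (Ke w 0) (Ke z 0).
  by rewrite -repro//; [rewrite /Ke /embed /e_ eqxx mulr1|exact: Ke_berg].
by rewrite e1 e2 (ph_conj phb)//; exact: Ke_berg.
Qed.

Lemma cabsK_sym z w : Om z -> Om w -> cabs (K w z) = cabs (K z w).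
Proof. by move=> Oz Ow; rewrite (Kconj Oz Ow) cabs_conj. Qed.

Lemma Kzz z : Om z -> K z z = toC (normK z ^+ 2).
Proof.
move=> Oz; have bK := Ke_berg 0 Oz.
have := ph_nrm phb bK; rewrite normB_Ke -repro// => <-.
by rewrite /Ke /embed /e_ eqxx mulr1.
Qed.

Lemma cabsK_le z w : Om z -> Om w -> cabs (K z w) <= normK z * normK w.
Proof.
move=> Oz Ow; have := berg_pointwise 0 (Ke_berg 0 Oz) Ow.
by rewrite normB_Ke /Ke /embed /e_ eqxx mulr1 mulrC.
Qed.

Lemma ipC_k z w : Om z -> Om w ->
  cabs (ipC B (k_ B z) (k_ B w)) = cabs (K z w) / (normK z * normK w).
Proof.
move=> Oz Ow.
have nz := normK_gt0 Oz; have nw := normK_gt0 Ow.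
have -> : ipC B (k_ B z) (k_ B w) = toC (normK z * normK w)^-1 * ipC B (K z) (K w).
  have iK : @cintegrable _ (borel R n) R sigma bOm (fun u => K z u * Num.conj (K w u)).
    have := L2_ip_integrable mOm (berg_L2 (Ke_berg 0 Oz)) (berg_L2 (Ke_berg 0 Ow)).
    apply: (eq_cintegrable mOm) => u _.
    by rewrite /Ke {2}/embed ip_l2_scale_e /embed /e_ eqxx mulr1.
  rewrite /ipC -[cintegral B (fun z0 => K z z0 * _)]/(@cint _ (borel R n) R sigma bOm _).
  rewrite -(cintZ mOm)//; apply: eq_cint => u _.
  rewrite /k_ rmorphM /= -[Complex (normK w) 0]/(toC _) -[Complex (normK z) 0]/(toC _).
  rewrite -!toCV conj_toC invfM toCM; ring.
rewrite cabsM ipC_K// cabs_toC ger0_norm; first by rewrite mulrC.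
by rewrite invr_ge0 mulr_ge0// ltW.
Qed.

(** The estimate for normalized kernels, multiplied out. Nearly all control of the kernel comes from
    this comparison with [normK (phi z w)]. *)
Lemma K_two_sided : exists2 c : R, 0 < c & forall z w, Om z -> Om w ->
  cabs (K z w) <= c * (normK z * normK w / normK (phi z w)) /\
  normK z * normK w / normK (phi z w) <= c * cabs (K z w).
Proof.
have [c c0 H] := bt_kernel hB; exists c => // z w Oz Ow.
have nz := normK_gt0 Oz; have nw := normK_gt0 Ow.
have nn : 0 < normK z * normK w by rewrite mulr_gt0.
have [h1 h2] := H z w Oz Ow; rewrite ipC_k// in h1 h2.
split.
  move: h1; rewrite ler_pdivrMr// => /le_trans; apply.
  have -> : c / normK (phi z w) * (normK z * normK w) =
     c * (normK z * normK w / normK (phi z w)) by ring.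
  exact: lexx.
by rewrite mulrA in h2; move: h2; rewrite ler_pdivlMr// mulrC.
Qed.

End BergmanBasics.

(** * The projection and the translation operators *)

Section BergmanOperators.
Context (R : realType) (n : nat) (B : bergman_data R n).
Hypothesis hB : bergman_type B.
Local Notation C := (Cplx R).
Local Notation V := (Cspace R n).
Local Notation E := (V -> nat -> C).
Local Notation Om := (Om B).
Local Notation sigma := (sigma B).
Local Notation K := (K B).
Local Notation phi := (phi B).
Local Notation normK := (normK B).
Local Notation bOm := (Om : set (borel R n)).
Local Notation bcmeas h := (@cmeas _ (borel R n) R bOm h).
Local Notation mOm := (mOm hB).
Implicit Types (f g : E).

Let ph : prehilbert (L2 B) (normB B) (ipB B).
Proof. exact: L2_prehilbert mOm. Qed.
Let phb : prehilbert (berg B) (normB B) (ipB B).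
Proof. exact: berg_prehilbert mOm. Qed.
Let sb : is_subspace (berg B).
Proof. exact: berg_subspace mOm. Qed.

Definition bproj : E -> E := orthogonal_projection (berg B) (ipB B).

Lemma bprojP f : L2 B f -> berg B (bproj f) /\
  forall h, berg B h -> ipB B h (bproj f) = ipB B h f.
Proof.
by move=> Lf; apply: (orthogonal_projectionP ph sb (@berg_L2 _ _ B) (bt_complete hB)).
Qed.

Lemma bproj_berg f : L2 B f -> berg B (bproj f).
Proof. by move=> /bprojP[]. Qed.

Lemma bproj_kernel f z k : L2 B f -> Om z -> bproj f z k = ipB B f (Ke B z k).
Proof.
move=> Lf Oz; have [bf H] := bprojP Lf; have bK := Ke_berg hB k Oz.
have LK := berg_L2 bK.
by rewrite (repro hB k bf Oz) (ph_conj ph LK (berg_L2 bf)) (H _ bK) -(ph_conj ph LK Lf).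
Qed.

Lemma bproj_norm f : L2 B f -> normB B (bproj f) <= normB B f.
Proof.
move=> Lf; have [bf H] := bprojP Lf; have Lp := berg_L2 bf.
have := cauchy_schwarz ph Lp Lf; rewrite -(H _ bf) (ph_nrm ph Lp) cabs_toC (ger0_norm (sqr_ge0 _)).
have [->|p0] := eqVneq (normB B (bproj f)) 0; first by move=> _; exact: normB_ge0.
by rewrite expr2 ler_pM2l// lt_def p0 normB_ge0.
Qed.

Lemma berg_ext f g : berg B f -> berg B g -> (forall z k, Om z -> f z k = g z k) -> f = g.
Proof.
move=> [f0 _ _] [g0 _ _] fg; apply/funext => z; have [Oz|nOz] := pselect (Om z).
  by apply/funext => k; exact: fg.
by rewrite f0// g0.
Qed.

Lemma bproj_id f : berg B f -> bproj f = f.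
Proof.
move=> bf; have Lf := berg_L2 bf; apply: berg_ext => //; first exact: bproj_berg.
by move=> z k Oz; rewrite bproj_kernel// (repro hB k bf Oz).
Qed.

Lemma bproj_ext f g : L2 B f -> (forall z, Om z -> f z = g z) -> bproj f = bproj g.
Proof.
move=> Lf fg; have Lg := L2_ext fg Lf.
apply: berg_ext; [exact: bproj_berg|exact: bproj_berg|].
move=> z k Oz; rewrite !bproj_kernel//.
by apply: ipB_ext.
Qed.

Lemma cabs_k z w : Om z -> cabs (k_ B z w) = cabs (K z w) / normK z.
Proof.
move=> Oz; rewrite /k_ cabsM cabsV -[Complex _ 0]/(toC _) cabs_toC ger0_norm//.
exact/ltW/(normK_gt0 hB).
Qed.

Lemma k_cmeas z : Om z -> bcmeas (k_ B z).
Proof.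
move=> Oz; apply: cmeasM; first exact: (K_cmeas hB).
exact: cmeas_cst.
Qed.

Lemma comp_phi_measurable d (T : measurableType d) z (h : V -> T) : Om z ->
  measurable_fun bOm (h : borel R n -> T) ->
  measurable_fun bOm ((fun w => h (phi z w)) : borel R n -> T).
Proof.
move=> Oz mh _ A mA.
have -> : bOm `&` (fun w => h (phi z w)) @^-1` A =
    bOm `&` (phi z : borel R n -> borel R n) @^-1` (bOm `&` (h : borel R n -> T) @^-1` A).
  by apply/seteqP; split => x /= [Dx]; [move=> ?; do 2 split => //; exact: (phiOm hB)|move=> [_ ?]].
by apply: (phi_measurable hB) => //; apply: mh => //; exact: mOm.
Qed.

Lemma comp_phi_cmeas z (h : V -> C) : Om z -> bcmeas h -> bcmeas (fun w => h (phi z w)).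
Proof.
by move=> Oz [mr mi]; split;
  [exact: (@comp_phi_measurable _ _ z (fun w => complex.Re (h w)) Oz mr)
  |exact: (@comp_phi_measurable _ _ z (fun w => complex.Im (h w)) Oz mi)].
Qed.

(** |k_z(w)|^2 is at most a multiple of normK(w)^2 / normK(phi_z w)^2, the Jacobian factor that
    quasi-invariance of [lambda] would give [sigma] under phi_z. *)
Lemma translated_integral : exists2 c : R, 0 < c & forall z (q : V -> \bar R), Om z ->
  (forall w, Om w -> (0 <= q w)%E) -> measurable_fun bOm (q : borel R n -> \bar R) ->
  (\int[sigma]_(w in Om) (q (phi z w) * ((cabs (k_ B z w)) ^+ 2)%:E) <=
   c%:E * \int[sigma]_(w in Om) q w)%E.
Proof.
have [c c0 Hk] := K_two_sided hB.
have [c' c'0 Hl] := bt_lambda_inv hB.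
exists (c ^+ 2 * c'); first by rewrite mulr_gt0// exprn_gt0.
move=> z q Oz q0 mq.
have mn := normK_measurable hB.
have mn2 : measurable_fun bOm ((fun w => normK w ^+ 2) : borel R n -> R) by exact: measurable_funX.
have mV : measurable_fun bOm ((fun w => (normK w ^+ 2)^-1) : borel R n -> R).
  apply: (@eq_measurable_fun _ _ (borel R n) _ bOm ((fun w => (normK w) `^ (-2)) : borel R n -> R)).
    move=> w /set_mem Ow; rewrite -[-2]/(- (2%:R)) powRN powR_mulrn//.
    exact/ltW/(normK_gt0 hB).
  by apply: (measurableT_comp (measurable_powR _ )).
(* Dividing by the density of [lambda] turns the integral of [q] for [sigma] into one of [q'] for
   [lambda]. *)
pose q' : V -> \bar R := fun w => (q w * ((normK w ^+ 2)^-1)%:E)%E.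
have mq' : measurable_fun bOm (q' : borel R n -> \bar R).
  by apply: emeasurable_funM => //; exact/measurable_EFinP.
have q'0 w : Om w -> (0 <= q' w)%E.
  by move=> Ow; rewrite mule_ge0 ?q0// lee_fin invr_ge0 sqr_ge0.
have Hc (A : set (borel R n)) : measurable A -> A `<=` Om ->
  (\int[sigma]_(x in bOm `&` (phi z : borel R n -> borel R n) @^-1` A) (normK x ^+ 2)%:E <=
   c'%:E * \int[sigma]_(x in A) (normK x ^+ 2)%:E)%E.
  move=> mA AO; have [_] := Hl z A Oz mA AO.
  (* Since [phi z] is an involution of [Om], its images are preimages. *)
  rewrite /lambda; suff -> : phi z @` A = Om `&` phi z @^-1` A by [].
  apply/seteqP; split => [_ [w Aw <-]|w [Ow pA]].
    by have Ow := AO _ Aw; split; [exact: (phiOm hB)|rewrite /= (bt_phi_invol hB)].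
  by exists (phi z w) => //; rewrite (bt_phi_invol hB).
have n2 w : Om w -> 0 <= normK w ^+ 2 by rewrite sqr_ge0.
have := @ge0_change_of_variables _ (borel R n) R sigma bOm (phi z)
  (fun w => normK w ^+ 2) c' mOm (fun w Ow => phiOm hB Oz Ow)
  (fun A mA => phi_measurable hB Oz mA) n2 mn2 (ltW c'0) Hc q' q'0 mq'.
have -> : (\int[sigma]_(x in Om) (q' x * (normK x ^+ 2)%:E) = \int[sigma]_(w in Om) q w)%E.
  apply: eq_integral => w /set_mem Ow; rewrite /q' -muleA -EFinM mulVf ?mule1//.
  by rewrite expf_neq0// gt_eqF// (normK_gt0 hB).
move=> H.
have H' := lee_wpmul2l (x := (c ^+ 2)%:E) ltac:(by rewrite lee_fin sqr_ge0) H.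
rewrite EFinM -muleA; apply: le_trans H'.
rewrite -ge0_integralZl//.
- apply: ge0_le_integral => //.
  + exact: mOm.
  + by move=> w Ow; rewrite mule_ge0 ?q0 ?lee_fin ?sqr_ge0//; exact: (phiOm hB).
  + apply: emeasurable_funM; first exact: comp_phi_measurable.
    by apply/measurable_EFinP; apply: measurable_cabs_sqr; exact: k_cmeas.
  + apply: measurable_funeM; apply: emeasurable_funM; first exact: comp_phi_measurable.
    exact/measurable_EFinP.
  + move=> w Ow; have Op := phiOm hB Oz Ow.
    have regroup (Q : \bar R) (x y t : R) : (x%:E * (Q * y%:E * t%:E) = Q * (x * (y * t))%:E)%E.
      by rewrite -[(Q * _ * _)%E]muleA [LHS]muleCA.
    rewrite /q' regroup.
    rewrite lee_wpmul2l ?q0// lee_fin cabs_k//.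
    have nz := normK_gt0 hB Oz; have nw := normK_gt0 hB Ow; have np := normK_gt0 hB Op.
    have -> : c ^+ 2 * ((normK (phi z w) ^+ 2)^-1 * normK w ^+ 2) =
      (c * (normK w / normK (phi z w))) ^+ 2 by rewrite !exprMn exprVn; ring.
    rewrite lerXn2r ?nnegrE ?divr_ge0 ?mulr_ge0 ?invr_ge0 ?(ltW nz) ?(ltW nw) ?(ltW np) ?(ltW c0)//.
    rewrite ler_pdivrMr//; have [h _] := Hk z w Oz Ow; apply: le_trans h _.
    have -> : c * (normK w / normK (phi z w)) * normK z = c * (normK z * normK w / normK (phi z w)) by ring.
    exact: lexx.
- exact: mOm.
- apply: emeasurable_funM; first exact: comp_phi_measurable.
  exact/measurable_EFinP.
- by move=> w Ow; rewrite mule_ge0 ?q'0 ?lee_fin ?sqr_ge0//; exact: (phiOm hB).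
- by rewrite lee_fin sqr_ge0.
Qed.

Lemma sqnorm_l2Zr (a : nat -> C) (x : C) : l2 a ->
  sqnorm_l2 (fun j => a j * x) = (sqnorm_l2 a * ((cabs x) ^+ 2)%:E)%E.
Proof.
move=> la; rewrite muleC /sqnorm_l2 -nneseriesZl; last by move=> k _; rewrite lee_fin sqr_ge0.
by apply: eq_eseriesr => k _; rewrite cabsM exprMn -EFinM mulrC.
Qed.

Lemma U_bounded : exists2 c : R, 0 < c & forall z f, Om z -> L2 B f ->
  L2 B (U_ B z f) /\ normB B (U_ B z f) <= c * normB B f.
Proof.
have [c c0 H] := translated_integral.
exists (Num.sqrt c); first by rewrite sqrtr_gt0.
move=> z f Oz Lf; have /L2P[lf mf If] := Lf.
have l2U w : Om w -> l2 (U_ B z f w).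
  move=> Ow; have Op := phiOm hB Oz Ow.
  rewrite (_ : U_ B z f w = (fun j => k_ B z w * f (phi z w) j)); first exact: l2Z (lf _ Op).
  by apply/funext => j; rewrite /U_ mulrC.
apply: L2_le => //.
- move=> k; apply: cmeasM; last exact: k_cmeas.
  exact: (@comp_phi_cmeas z (fun w => f w k) Oz (mf k)).
- by rewrite mulr_ge0 ?sqrtr_ge0// normB_ge0.
rewrite exprMn sqr_sqrtr ?(ltW c0)// EFinM normB_sqr//.
apply: le_trans (H z (fun w => sqnorm_l2 (f w)) Oz _ _).
- rewrite le_eqVlt; apply/orP; left; apply/eqP; apply: eq_integral => w /set_mem Ow.
  by rewrite /U_ sqnorm_l2Zr//; apply: lf; exact: (phiOm hB).
- by move=> w _; exact: sqnorm_l2_ge0.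
- exact: measurable_sqnorm.
Qed.

Lemma U_berg z f : Om z -> berg B f -> berg B (U_ B z f).
Proof.
move=> Oz bf; have [c c0 H] := U_bounded; case: (bf) => f0 fa Lf.
have [LU _] := H z f Oz Lf.
have [K0 Ka _] := K_berg hB Oz.
split => //.
  by move=> w nOw; apply/funext => j; rewrite /U_ /k_ K0// mul0r mulr0.
move=> k w Ow; have [_ pa _] := bt_phi_aut hB Oz.
have fk : (fun z => ip_l2 (f z) (e_ k)) = (fun z => f z k).
  by apply/funext => u; rewrite ip_l2_e.
have -> : (fun w => ip_l2 (U_ B z f w) (e_ k)) =
    (fun w => (normK z)%:C%C^-1 * f (phi z w) k * K z w).
  by apply/funext => u; rewrite ip_l2_e /U_ /k_ [K z u / _]mulrC mulrA [_ * _^-1]mulrC.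
have d1 : differentiable (fun u => f u k) (phi z w).
  by rewrite -fk; apply: fa; exact: (phiOm hB).
have d2 : differentiable ((fun u => f u k) \o phi z) w.
  have := @differentiable_comp _ _ _ _ (phi z) (fun u => f u k : C) w (pa w Ow) d1.
  by [].
have d3 := differentiableZ ((normK z)%:C%C^-1 : C) d2.
have d4 : differentiable (K z : V -> C) w := Ka w Ow.
have := @differentiableM _ _ _ _ w d3 d4.
by [].
Qed.

Lemma U_lin z (c : C) f g : U_ B z (c *: f + g) = c *: U_ B z f + U_ B z g.
Proof.
apply/funext => w; apply/funext => j.
change ((c * f (phi z w) j + g (phi z w) j) * k_ B z w =
  c * (f (phi z w) j * k_ B z w) + g (phi z w) j * k_ B z w).
ring.
Qed.

Lemma U_bop z : Om z -> bounded_on_berg B (U_ B z).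
Proof.
move=> Oz; have [c c0 H] := U_bounded; split.
- by move=> f; exact: U_berg.
- by move=> a f g _ _; exact: U_lin.
- apply: (@le_lt_trans _ _ c%:E); last exact: ltry.
  apply: ge_ereal_sup => _ [f [bf f1] <-]; rewrite lee_fin.
  have [_ h] := H z f Oz (berg_L2 bf); apply: le_trans h _.
  by rewrite -[leRHS]mulr1 ler_wpM2l// ltW.
Qed.

Definition Uadj z := adjoint (berg B) (ipB B) (U_ B z).

Lemma UadjP z g : Om z -> berg B g -> berg B (Uadj z g) /\
  forall f, berg B f -> ipB B (U_ B z f) g = ipB B f (Uadj z g).
Proof.
move=> Oz bg.
exact: (adjointP ph sb (@berg_L2 _ _ B) (bt_complete hB) (U_bop Oz) bg).
Qed.

Lemma Uadj_bounded : exists2 c : R, 0 < c & forall z g, Om z -> berg B g ->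
  normB B (Uadj z g) <= c * normB B g.
Proof.
have [c c0 H] := U_bounded; exists c => // z g Oz bg.
have [ba Ha] := UadjP Oz bg.
have := Ha _ ba; rewrite (ph_nrm phb ba) => h1.
have [LU hU] := H z _ Oz (berg_L2 ba).
have := cauchy_schwarz phb (U_berg Oz ba) bg.
rewrite h1 cabs_toC (ger0_norm (sqr_ge0 _)) => h2.
have [->|p0] := eqVneq (normB B (Uadj z g)) 0.
  by rewrite mulr_ge0 ?normB_ge0// ltW.
rewrite -(@ler_pM2l _ (normB B (Uadj z g))) ?lt_def ?p0 ?normB_ge0// -expr2.
apply: le_trans h2 _; rewrite mulrA [_ * c]mulrC ler_wpM2r ?normB_ge0//.
Qed.

(** Pairing with any [h] evaluates [U_ B z h] at [a], that is [h] at [phi z a] times k_z(a). Thus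
    the adjoint maps kernels to multiples of kernels, and translates become computable on them. *)
Lemma Uadj_Ke z a k : Om z -> Om a ->
  Uadj z (Ke B a k) = Num.conj (k_ B z a) *: Ke B (phi z a) k.
Proof.
move=> Oz Oa; have Op := phiOm hB Oz Oa.
have bK := Ke_berg hB k Oa; have bK' := Ke_berg hB k Op.
have [bU HU] := UadjP Oz bK.
have bcK := subspaceZ (Num.conj (k_ B z a)) sb bK'.
refine (@ip_definite R _ (L2 B) (berg B) (normB B) (ipB B) ph sb (@berg_L2 _ _ B)
  (berg_definite hB) _ _ bU bcK _) => h bh.
have e1 := HU h bh; have e2 := repro hB k (U_berg Oz bh) Oa; have e3 := repro hB k bh Op.
by rewrite -e1 -e2 (ipZr phb _ bK' bh) conjCK -e3 /U_ mulrC.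
Qed.

(** Applying [U_ B z] twice multiplies by k_z(phi_z w) k_z(w). The two-sided kernel estimate bounds
    the factors below by multiples of normK(phi_z w)/normK(w) and of its inverse, so the product
    stays away from 0. *)
Lemma U_lower : exists2 c : R, 0 < c & forall z f, Om z -> berg B f ->
  normB B f <= c * normB B (U_ B z f).
Proof.
have [c c0 H] := U_bounded; have [c' c'0 Hk] := K_two_sided hB.
exists (c' ^+ 2 * c); first by rewrite mulr_gt0// exprn_gt0.
move=> z f Oz bf; have bU := U_berg Oz bf; have bUU := U_berg Oz bU.
have [_ h] := H z _ Oz (berg_L2 bU).
rewrite -mulrA; apply: le_trans (ler_wpM2l _ h); last by rewrite sqr_ge0.
have mf k : bcmeas (fun w => f w k) by case: bf => _ _ /L2P[_ mf _].
suff H1 w : Om w -> (sqnorm_l2 (f w) <= ((c' ^+ 2) ^+ 2)%:E * sqnorm_l2 (U_ B z (U_ B z f) w))%E.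
  by have [_ ->] := L2_scale mOm (berg_L2 bUU) mf (sqr_ge0 c') H1.
move=> Ow; apply: sqnorm_l2_le => k; rewrite /U_ (bt_phi_invol hB)//.
have Op := phiOm hB Oz Ow.
have nz := normK_gt0 hB Oz; have nw := normK_gt0 hB Ow; have np := normK_gt0 hB Op.
have -> : cabs (f w k * k_ B z (phi z w) * k_ B z w) =
   cabs (f w k) * (cabs (K z (phi z w)) / normK z) * (cabs (K z w) / normK z).
  by rewrite -!(cabs_k _ Oz) -!cabsM.
have [_ h1] := Hk z w Oz Ow; have [_ h2] := Hk z _ Oz Op.
rewrite (bt_phi_invol hB)// in h2.
have h3 : normK w / normK (phi z w) <= c' * (cabs (K z w) / normK z).
  rewrite mulrA ler_pdivlMr//; apply: le_trans h1.
  have -> : normK w / normK (phi z w) * normK z = normK z * normK w / normK (phi z w) by ring.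
  exact: lexx.
have h4 : normK (phi z w) / normK w <= c' * (cabs (K z (phi z w)) / normK z).
  rewrite mulrA ler_pdivlMr//; apply: le_trans h2.
  have -> : normK (phi z w) / normK w * normK z = normK z * normK (phi z w) / normK w by ring.
  exact: lexx.
have := ler_pM _ _ h3 h4; rewrite !divr_ge0 ?(ltW nw) ?(ltW np)// => /(_ isT isT).
have -> : normK w / normK (phi z w) * (normK (phi z w) / normK w) = 1.
  by field; rewrite !gt_eqF.
move=> h5; rewrite -{1}[cabs (f w k)]mulr1.
apply: le_trans (ler_wpM2l (cabs_ge0 _) h5) _.
rewrite le_eqVlt; apply/orP; left; apply/eqP; ring.
Qed.

End BergmanOperators.

(** * Sesquilinear forms vanishing on the diagonal of the kernels *)

Section PowerSeriesFacts.
Context (R : realType).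
Local Notation C := (Cplx R).

Lemma poly_coef_eq0 (c : nat -> C) N (A d : R) : 0 < d -> 0 <= A ->
  (forall s : R, 0 < s -> s < d -> cabs (\sum_(n < N) c n * toC s ^+ n) <= A * s ^+ N) ->
  forall n, (n < N)%N -> c n = 0.
Proof.
move=> d0 A0 H n; elim/ltn_ind: n => m IH mN.
apply: cabs0_eq0; apply/eqP; rewrite eq_le cabs_ge0 andbT.
pose S := A + \sum_(n < N) cabs (c n).
have S0 : 0 <= S by rewrite addr_ge0// sumr_ge0.
apply/ler_addgt0Pr => e e0; rewrite add0r.
pose s := Num.min (Num.min (d / 2) (1 / 2)) (e / (S + 1)).
have S1 : 0 < S + 1 by rewrite ltr_wpDl.
have s0 : 0 < s by rewrite !lt_min !divr_gt0.
have sd : s < d by rewrite !gt_min; apply/orP; left; apply/orP; left; rewrite ltr_pdivrMr// ltr_pMr// ltr1n.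
have s1 : s <= 1 by rewrite !ge_min; apply/orP; left; apply/orP; right; rewrite ler_pdivrMr// mul1r ler1n.
have se : s * S <= e.
  have : s <= e / (S + 1) by rewrite ge_min lexx orbT.
  rewrite ler_pdivlMr// => h; apply: le_trans h; rewrite ler_wpM2l ?(ltW s0)// lerDl//.
clearbody s.
have := H s s0 sd.
have -> : \sum_(n < N) c n * toC s ^+ n =
   c m * toC s ^+ m + \sum_(n < N | (m < n)%N) c n * toC s ^+ n.
  rewrite (bigID (fun n : 'I_N => (n <= m)%N)) /=; congr (_ + _); last first.
    by apply: eq_bigl => i; rewrite ltnNge.
  rewrite (bigD1 (Ordinal mN)) //= big1 ?addr0// => i /andP[im /eqP inm].
  rewrite IH ?mul0r// ltn_neqAle im andbT; apply/eqP => im'; apply: inm; exact/val_inj.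
move=> h1.
have h2 : cabs (\sum_(n < N | (m < n)%N) c n * toC s ^+ n) <= (\sum_(n < N) cabs (c n)) * s ^+ m.+1.
  apply: le_trans (cabs_sum _ _ _) _; rewrite mulr_suml big_mkcond /=; apply: ler_sum => i _.
  case: ifPn => mi; last by rewrite mulr_ge0// exprn_ge0// ltW.
  rewrite cabsM cabsX cabs_toC (ger0_norm (ltW s0)) ler_wpM2l//.
  by rewrite ler_wiXn2l ?(ltW s0).
have h3 : cabs (c m) * s ^+ m <= S * s ^+ m.+1.
  have := cabs_triangle_sub (c m * toC s ^+ m) (- \sum_(n < N | (m < n)%N) c n * toC s ^+ n).
  rewrite opprK cabsN cabsM cabsX cabs_toC (ger0_norm (ltW s0)) => h4.
  have h5 : A * s ^+ N <= A * s ^+ m.+1 by rewrite ler_wpM2l// ler_wiXn2l ?(ltW s0).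
  rewrite /S mulrDl; lra.
have h4 : cabs (c m) <= S * s by move: h3; rewrite exprS mulrA ler_pM2r ?exprn_gt0.
by apply: le_trans h4 _; rewrite mulrC.
Qed.

(** A polynomial of degree less than N with N roots. The points at angles pi/(k + 1) are distinct
    because cosine is injective on [0, pi]. *)
Lemma circle_poly_eq0 (a : nat -> C) N :
  (forall w : C, cabs w = 1 -> \sum_(n < N) a n * w ^+ n = 0) ->
  forall n, (n < N)%N -> a n = 0.
Proof.
move=> H n nN; pose p : {poly C} := \poly_(i < N) a i.
suff p0 : p = 0 by have := coef_poly N a n; rewrite nN -/p p0 coef0.
pose s := [seq circ 1 (pi / (k.+1%:R)) : C | k <- iota 0 N].
have th k : (pi : R) / k.+1%:R \in `[0, pi].
  rewrite in_itv/= divr_ge0 ?pi_ge0//= ler_pdivrMr// ler_peMr ?pi_ge0// ler1n//.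
have us : uniq s.
  rewrite map_inj_in_uniq ?iota_uniq// => i j _ _ [/= /eqP]; rewrite !mul1r => /eqP hc _.
  have := @cos_inj R _ _ (th i) (th j) hc.
  move=> /(mulfI (lt0r_neq0 (pi_gt0 R)))/invr_inj/eqP; rewrite eqr_nat eqSS => /eqP//.
have rs : all (root p) s.
  apply/allP => _ /mapP[k _ ->]; rewrite /root horner_poly; apply/eqP; apply: H.
  by rewrite cabs_circ.
apply/eqP; apply: contraT => pn0.
have := max_poly_roots pn0 rs us; rewrite size_map size_iota => h.
by have := leq_trans h (size_poly N a); rewrite ltnn.
Qed.

Lemma geometric_small (q A e : R) : 0 <= q -> q < 1 -> 0 <= A -> 0 < e ->
  exists N, A * q ^+ N < e.
Proof.
move=> q0 q1 A0 e0; have := @cvg_geometric R A q.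
rewrite ger0_norm// => /(_ q1) /cvgrPdist_lt/(_ e e0)[N _ HN]; exists N.
have := HN N (leqnn N); rewrite /geometric /= sub0r normrN ger0_norm//.
by rewrite mulr_ge0// exprn_ge0.
Qed.

(** Vanishing near 0 kills all Taylor coefficients on a circle beyond |t|, and the remainder at t
    tends to 0 geometrically. *)
Lemma zero_disc (g : C -> C) (Rr d : R) : 0 < d ->
  (forall t, cabs t < Rr -> cdiff g t) ->
  (forall t, cabs t < d -> g t = 0) -> forall t, cabs t < Rr -> g t = 0.
Proof.
move=> d0 dg g0 t tR.
pose rho := (cabs t + Rr) / 2.
have tr : cabs t < rho by rewrite /rho ltr_pdivlMr// mulr_natr mulr2n ltrD2l.
have rR : rho < Rr by rewrite /rho ltr_pdivrMr// mulr_natr mulr2n ltrD2r.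
have r0 : 0 < rho by exact: le_lt_trans (cabs_ge0 t) tr.
have [M M0 HM] : exists2 M : R, 0 <= M & forall r th, 0 <= r <= rho -> 0 <= th <= 2 * pi ->
    cabs (g (circ r th)) <= M.
  by apply: polar_bounded => s sr; apply: cdiff_cont; apply: dg; exact: le_lt_trans sr rR.
have gM th : 0 <= th <= 2 * pi -> cabs (g (circ rho th)) <= M.
  by move=> h; apply: HM => //; rewrite lexx ltW.
(* Where [g] is 0 the remainder estimate bounds the Taylor polynomial itself by a multiple of
   s^(n+1). *)
have c0 n : tcoef g rho n = 0.
  have d'0 : 0 < Num.min d (rho / 2) by rewrite lt_min d0 divr_gt0.
  apply: (@poly_coef_eq0 (tcoef g rho) n.+1 (2 * M / rho ^+ n.+1) _ d'0) => //.
    by rewrite divr_ge0 ?mulr_ge0// exprn_ge0// ltW.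
  move=> s s0; rewrite lt_min => /andP[sd sr].
  have cs : cabs (toC s : C) = s by rewrite cabs_toC ger0_norm// ltW.
  have := taylor dg n.+1 (w := toC s) (rho := rho) (M := M) _ rR gM.
  rewrite cs => /(_ ltac:(by apply: lt_trans sr _; rewrite ltr_pdivrMr// ltr_pMr// ltr1n)).
  rewrite g0 ?cs// sub0r cabsN cabs0 addr0 => h; apply: le_trans h _.
  have h1 : rho / (rho - s) <= 2.
    by rewrite ler_pdivrMr; lra.
  rewrite expr_div_n; apply: le_trans (ler_wpM2l _ h1) _.
    by rewrite mulr_ge0// divr_ge0// exprn_ge0// ltW.
  by rewrite le_eqVlt; apply/orP; left; apply/eqP; ring.
apply: cabs0_eq0; apply/eqP; rewrite eq_le cabs_ge0 andbT.
apply/ler_addgt0Pr => e e0; rewrite add0r.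
have q0 : 0 <= cabs t / rho by rewrite divr_ge0// ltW.
have q1 : cabs t / rho < 1 by rewrite ltr_pdivrMr// mul1r.
pose A := (M + cabs (g t)) * (rho / (rho - cabs t)).
have A0 : 0 <= A by rewrite mulr_ge0 ?addr_ge0// divr_ge0// ?subr_ge0 ltW.
have [N hN] := geometric_small q0 q1 A0 e0.
have := taylor dg N tr rR gM; rewrite big1 ?subr0 => [h|i _]; last by rewrite c0 mul0r.
by apply: le_trans h _; apply: ltW; move: hN; rewrite /A mulrAC.
Qed.

End PowerSeriesFacts.

(** * Polydiscs and the identity theorem in several variables *)

Section Boxes.
Context (R : realType) (n : nat).
Local Notation C := (Cplx R).
Local Notation V := (Cspace R n).

Definition box (z : V) (d : R) : set V :=
  [set w : V | forall j, cabs ((w : 'rV[C]_n) ord0 j - (z : 'rV[C]_n) ord0 j) < d].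

Lemma nbhs_boxP (z : V) (A : set V) : nbhs z A <-> exists2 d : R, 0 < d & box z d `<=` A.
Proof.
split=> [/nbhs_ballP[_ /= /pos_toC[e e0 ->]] H|[e e0 H]].
  exists e => // w wz; apply: H; split; first by rewrite -toC0 ltC_toC.
  move=> i j; rewrite (ord1 i) -ball_normE /= norm_cabs ltC_toC cabsC.
  exact: wz.
apply/nbhs_ballP; exists (toC e); first by rewrite /= -toC0 ltC_toC.
move=> w [_ wz]; apply: H => j; have := wz ord0 j.
by rewrite -ball_normE /= norm_cabs ltC_toC cabsC.
Qed.

Lemma box_line (z v : V) (a b : R) (t : C) : (forall j, cabs ((v : 'rV[C]_n) ord0 j) <= a) ->
  cabs t * a < b -> box z b (z + t *: v).
Proof.
move=> va tb j; have -> : ((z + t *: v : V) : 'rV[C]_n) ord0 j - (z : 'rV[C]_n) ord0 j =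
   t * (v : 'rV[C]_n) ord0 j by rewrite !mxE addrAC subrr add0r.
by rewrite cabsM; apply: le_lt_trans tb; rewrite ler_wpM2l.
Qed.

Lemma slice_cdiff (f : V -> C) (z v : V) (t : C) : differentiable f (z + t *: v) ->
  cdiff (fun s => f (z + s *: v)) t.
Proof.
move=> /(@diff_derivable _ _ _ f (z + t *: v) v) /cvg_ex[/= L /cvg_cabsP H]; exists L => e e0.
have /nbhs_cabsP[d d0 {}H] := H _ e0.
exists d => // h hd; have [->|h0] := eqVneq h 0.
  by rewrite addr0 mulr0 subrr subr0 cabs0 mulr0.
have := H h; rewrite subr0 => /(_ hd h0) /=.
have -> : h *: v + (z + t *: v) = z + (t + h) *: v by rewrite scalerDl [h *: v + _]addrC addrA.
move=> /ltW.
have -> : f (z + (t + h) *: v) - f (z + t *: v) - L * h =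
   (h^-1 *: (f (z + (t + h) *: v) - f (z + t *: v)) - L) * h.
  by rewrite mulrBl /GRing.scale /= mulrAC mulVf// mul1r.
by move=> H1; rewrite cabsM ler_wpM2r.
Qed.

(** The points near which [f] vanishes identically form an open set. It is closed in [Om]: a limit
    point has such a point z' nearby, and the one-variable result on the complex lines through z'
    covers a whole neighbourhood of the limit point. *)
Theorem identity_theorem (Om : set V) (f : V -> C) (z0 : V) (d0 : R) : open Om -> connected Om ->
  analytic (W := C) Om f -> Om z0 -> 0 < d0 -> (forall w, box z0 d0 w -> f w = 0) ->
  forall w, Om w -> f w = 0.
Proof.
move=> oOm cOm af Oz0 d00 fz0.
pose Z := [set z : V | exists2 d : R, 0 < d & forall w, box z d w -> f w = 0].
have oZ : open Z.
  rewrite openE => z [d dp fz]; apply/nbhs_boxP; exists (d / 2); first by rewrite divr_gt0.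
  move=> w wz; exists (d / 2); first by rewrite divr_gt0.
  move=> u uw; apply: fz => j; apply: le_lt_trans (cabs_distD ((w : 'rV[C]_n) ord0 j) _ _) _.
  by rewrite (splitr d); apply: ltrD; [exact: uw|exact: wz].
suff OZ : Om `&` Z = Om.
  move=> w; rewrite -OZ => -[_ [d dp fw]]; apply: fw => j; by rewrite subrr cabs0.
apply: cOm.
- by exists z0; split => //; exists d0.
- by exists Z.
- exists (closure Z); first exact: closed_closure.
  apply/seteqP; split => z [Oz Zz]; split => //; first exact: subset_closure.
  have /nbhs_boxP[r r0 rOm] : nbhs z Om by apply: open_nbhs_nbhs.
  have r4 : 0 < r / 4 by rewrite divr_gt0.
  have /Zz[z' [[d dp fz'] z'z]] : nbhs z (box z (r / 4)) by apply/nbhs_boxP; exists (r / 4).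
  exists (r / 4) => // w wz.
  pose v : V := w - z'.
  have va j : cabs ((v : 'rV[C]_n) ord0 j) <= r / 2.
    rewrite !mxE; apply: ltW; apply: le_lt_trans (cabs_distD ((z : 'rV[C]_n) ord0 j) _ _) _.
    have := wz j; have := z'z j; rewrite (cabsC ((z' : 'rV[C]_n) ord0 j)); lra.
  have -> : w = z' + (1 : C) *: v by rewrite scale1r /v subrKC.
  have d1 : 0 < d / (r / 2 + 1) by rewrite divr_gt0// addr_gt0// divr_gt0.
  (* Coordinates of [v] are at most r/2, so |t| < 3/2 keeps z' + tv within 3r/4 of z' and within r
     of z; the target [w] is at t = 1. *)
  apply: (@zero_disc _ (fun s => f (z' + s *: v)) (3 / 2) (d / (r / 2 + 1))) => //.
  + move=> t t3; apply: slice_cdiff; apply: af; apply: rOm => j.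
    have h1 : box z' (3 / 4 * r) (z' + t *: v).
      apply: (box_line _ va); have : cabs t * r < 3 / 2 * r by rewrite ltr_pM2r.
      lra.
    apply: le_lt_trans (cabs_distD ((z' : 'rV[C]_n) ord0 j) _ _) _.
    have := h1 j; have := z'z j; lra.
  + move=> t td; apply: fz'; apply: (box_line _ va).
    move: td; rewrite ltr_pdivlMr ?addr_gt0 ?divr_gt0//; apply: le_lt_trans.
    by rewrite ler_wpM2l// lerDl.
  + by rewrite cabs1; lra.
Qed.

End Boxes.

(** * A box on which the norm of the kernel is bounded *)

Section NestedBoxes.
Context (R : realType) (n : nat).
Local Notation C := (Cplx R).
Local Notation V := (Cspace R n).

(** Closed boxes in real coordinates: a decreasing sequence of them meets by nested intervals in
    each coordinate. *)
Definition rbox (z : V) (d : R) : set V :=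
  [set w : V | forall j, `|complex.Re ((w : 'rV[C]_n) ord0 j) - complex.Re ((z : 'rV[C]_n) ord0 j)| <= d /\
    `|complex.Im ((w : 'rV[C]_n) ord0 j) - complex.Im ((z : 'rV[C]_n) ord0 j)| <= d].

Lemma box_rbox z d : box z d `<=` rbox z d.
Proof.
move=> w wz j; rewrite -!cReN -!cReD -cImN -cImD.
by split; apply: le_trans (ltW (wz j)); [exact: ler_Re_cabs|exact: ler_Im_cabs].
Qed.

Lemma rbox_box z (d e : R) : d + d < e -> rbox z d `<=` box z e.
Proof.
move=> de w wz j; apply: le_lt_trans (cabs_le_ReIm _) _.
by rewrite cReD cReN cImD cImN; have [h1 h2] := wz j; lra.
Qed.

Lemma nested_intervals (x d : nat -> R) :
  (forall m p, x m - d m <= x p + d p) -> exists y, forall m, `|y - x m| <= d m.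
Proof.
move=> H; pose S := [set x m - d m | m in [set: nat]].
have hS m : ubound S (x m + d m) by move=> _ [p _ <-]; exact: H.
have S0 : S !=set0 by exists (x 0%N - d 0%N); exists 0%N.
have sS : has_sup S by split => //; exists (x 0%N + d 0%N).
exists (sup S) => m; rewrite ler_norml; apply/andP; split.
  have : x m - d m <= sup S by apply: ub_le_sup; [case: sS|exists m].
  lra.
have : sup S <= x m + d m by apply: ge_sup.
lra.
Qed.

Lemma nested_rbox (z : nat -> V) (d : nat -> R) : (forall m, 0 <= d m) ->
  (forall m, rbox (z m.+1) (d m.+1) `<=` rbox (z m) (d m)) ->
  exists w, forall m, rbox (z m) (d m) w.
Proof.
move=> d0 H.
have H' m p : (m <= p)%N -> rbox (z p) (d p) `<=` rbox (z m) (d m).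
  move=> /subnK <-; elim: (p - m)%N => [|k IH]; first by [].
  by move=> w wz; apply: IH; apply: H.
have near m p : rbox (z p) (d p) `&` rbox (z m) (d m) !=set0.
  have self q : rbox (z q) (d q) (z q) by move=> j; rewrite !subrr normr0.
  have [mp|pm] := leqP m p; [exists (z p)|exists (z m)]; split => //.
    by apply: (H' _ _ mp).
  by apply: (H' _ _ (ltnW pm)).
have cre j : exists y, forall m, `|y - complex.Re ((z m : 'rV[C]_n) ord0 j)| <= d m.
  apply: nested_intervals => m p; have [w [/(_ j)[h1 _] /(_ j)[h2 _]]] := near m p.
  by move: h1 h2; rewrite !ler_norml => /andP[? ?] /andP[? ?]; lra.
have cim j : exists y, forall m, `|y - complex.Im ((z m : 'rV[C]_n) ord0 j)| <= d m.
  apply: nested_intervals => m p; have [w [/(_ j)[_ h1] /(_ j)[_ h2]]] := near m p.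
  by move: h1 h2; rewrite !ler_norml => /andP[? ?] /andP[? ?]; lra.
have [a ha] := boolp.choice cre; have [b hb] := boolp.choice cim.
exists ((\row_j (Complex (a j) (b j) : C)) : 'rV[C]_n) => m j; rewrite !mxE /=; split; [exact: ha|exact: hb].
Qed.

End NestedBoxes.

Section LocalBound.
Context (R : realType) (n : nat) (B : bergman_data R n).
Hypothesis hB : bergman_type B.
Local Notation C := (Cplx R).
Local Notation V := (Cspace R n).
Local Notation Om := (Om B).
Local Notation K := (K B).
Local Notation normK := (normK B).

(** normK(u) is at least |K_w(u)| / normK(w), which is continuous in u for the Euclidean topology
    and equals normK(w) at u = w. *)
Lemma normK_lsc w (N : R) : Om w -> 0 <= N -> N < normK w ->
  nbhs (w : V) [set u | Om u /\ N < normK u].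
Proof.
move=> Ow N0 Nw; have nw := normK_gt0 hB Ow.
apply: filterI; first by apply: open_nbhs_nbhs; split => //; exact: (bt_open hB).
have [_ Ka _] := K_berg hB Ow.
have d0 : 0 < normK w ^+ 2 - N * normK w by rewrite expr2 -mulrBl mulr_gt0// subr_gt0.
have := analytic_continuous Ka Ow; move=> cK.
have hn : nbhs (K w w : C) [set y : C | cabs (y - K w w) < normK w ^+ 2 - N * normK w].
  by apply/nbhs_cabsP; exists (normK w ^+ 2 - N * normK w).
have h1 : nbhs (w : V) [set u : V | cabs (K w u - K w w) < normK w ^+ 2 - N * normK w] := cK _ hn.
have h2 : nbhs (w : V) Om by apply: open_nbhs_nbhs; split => //; exact: (bt_open hB).
have := @filterI _ _ (nbhs_filter (w : V)) _ _ h1 h2; apply: (@filterS _ _ (nbhs_filter (w : V))) => u [/= h Ou].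
have h3 := cabsK_le hB Ow Ou.
have h4 := cabs_triangle_sub (K w w) (K w u).
rewrite cabsC (Kzz hB Ow) cabs_toC ger0_norm ?sqr_ge0// in h4.
rewrite (Kzz hB Ow) in h.
rewrite -(ltr_pM2l nw); have := cabsC (K w u) (toC (normK w ^+ 2)).
move: h3 h4 h; move: (cabs _) (cabs _) (cabs _) => x y z'; rewrite mulrC; lra.
Qed.

(** Baire's argument. Were [normK] unbounded on every box, lower semicontinuity would give nested
    boxes with normK > m on the m-th, and a common point would have infinite norm. The assumed
    continuity is for [dist] and says nothing here. *)
Lemma locally_bounded : exists z0 rho N, [/\ Om z0, 0 < rho &
  forall w, box z0 rho w -> Om w /\ normK w <= N].
Proof.
apply: contrapT => nH.
pose P (p : V * R) := 0 < p.2 /\ rbox p.1 p.2 `<=` Om.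
have step (m : nat) (p : V * R) : exists q : V * R, P p -> P q /\
    (rbox q.1 q.2 `<=` rbox p.1 p.2 /\ forall w, rbox q.1 q.2 w -> m%:R < normK w).
  have [[p0 pO]|nP] := pselect (P p); last by exists p.
  have : exists2 w, box p.1 p.2 w & m%:R < normK w.
    apply: contrapT => nw; apply: nH; exists p.1, p.2, m%:R; split => //.
      by apply: pO => j; rewrite !subrr normr0 (ltW p0).
    move=> w wp; split; first by apply: pO; exact: box_rbox.
    by rewrite leNgt; apply/negP => h; apply: nw; exists w.
  move=> [w wp mw]; have Ow := pO _ (box_rbox wp).
  have ob : nbhs (w : V) (box p.1 p.2).
    pose e (j : 'I_n) := p.2 - cabs ((w : 'rV[C]_n) ord0 j - (p.1 : 'rV[C]_n) ord0 j).
    apply/nbhs_boxP; exists (\big[Num.min/1]_j e j).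
      by apply: lt_bigmin => // j _; rewrite /e subr_gt0.
    move=> u uw j; apply: le_lt_trans (cabs_distD ((w : 'rV[C]_n) ord0 j) _ _) _.
    have : cabs ((u : 'rV[C]_n) ord0 j - (w : 'rV[C]_n) ord0 j) < e j.
      by apply: lt_le_trans (uw j) _; exact: bigmin_le_cond.
    rewrite /e; lra.
  have := @filterI _ _ (nbhs_filter (w : V)) _ _ ob (normK_lsc Ow (ler0n _ m) mw).
  move=> /(proj1 (nbhs_boxP _ _))[d d0 H].
  exists (w, d / 3) => _; have h u : rbox w (d / 3) u -> box w d u by apply: rbox_box; lra.
  split; first split => /=; first by rewrite divr_gt0.
    by move=> u /h /H[_ []].
  by split=> [u /h /H[/box_rbox]|u /h /H[_ []]].
have [next hnext] := boolp.choice (fun mp : nat * (V * R) => step mp.1 mp.2).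
have [r0 r00 r0O] : exists2 r : R, 0 < r & rbox (0 : V) r `<=` Om.
  have /nbhs_boxP[d d0 H] : nbhs (0 : V) Om.
    by apply: open_nbhs_nbhs; split; [exact: (bt_open hB)|exact: (bt_0 hB)].
  exists (d / 3); first by rewrite divr_gt0.
  by move=> u hu; apply: H; apply: rbox_box hu; lra.
pose s := fix s m : V * R := if m is m'.+1 then next (m', s m') else (0, r0).
have Ps m : P (s m) by elim: m => [//|m IH]; have [] := hnext (m, s m) IH.
have [w hw] : exists w, forall m, rbox (s m).1 (s m).2 w.
  apply: nested_rbox => m; first by have [/ltW] := Ps m.
  by have [_ []] := hnext (m, s m) (Ps m).
have [m hm] : exists m : nat, normK w < m%:R.
  exists (Num.truncn (normK w)).+1; exact: truncnS_gt.
have [_ [_ /(_ _ (hw m.+1))]] := hnext (m, s m) (Ps m).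
by move=> /=; rewrite ltNge (ltW hm).
Qed.

End LocalBound.

(** * Coefficients of polynomials in s and its conjugate *)

Section DoublePolynomials.
Context (R : realType).
Local Notation C := (Cplx R).

(** Separates total degrees. Terms of degree at least N are moved into the bound, which needs s <
    1. *)
Lemma double_poly_coef_eq0 (x : nat -> nat -> C) N (A d : R) : 0 < d -> 0 <= A ->
  (forall s : R, 0 < s -> s < d ->
    cabs (\sum_(m < N) \sum_(k < N) x m k * toC s ^+ (m + k)) <= A * s ^+ N) ->
  forall p, (p < N)%N ->
    \sum_(m < N) \sum_(k < N) (if (m + k)%N == p then x m k else 0) = 0.
Proof.
move=> d0 A0 H.
pose S := \sum_(m < N) \sum_(k < N) cabs (x m k).
have S0 : 0 <= S by apply: sumr_ge0 => m _; apply: sumr_ge0.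
have d'0 : 0 < Num.min d 1 by rewrite lt_min d0 ltr01.
apply: (@poly_coef_eq0 R _ N (A + S) (Num.min d 1) d'0); first by rewrite addr_ge0.
move=> s s0; rewrite lt_min => /andP[sd s1].
have -> : \sum_(p < N) (\sum_(m < N) \sum_(k < N) (if (m + k)%N == p then x m k else 0)) * toC s ^+ p =
  \sum_(m < N) \sum_(k < N) x m k * toC s ^+ (m + k) -
  \sum_(m < N) \sum_(k < N) (if (N <= m + k)%N then x m k * toC s ^+ (m + k) else 0).
  under eq_bigr do rewrite mulr_suml.
  rewrite exchange_big /= -sumrB; apply: eq_bigr => m _.
  under eq_bigr do rewrite mulr_suml.
  rewrite exchange_big /= -sumrB; apply: eq_bigr => k _.
  have [Nmk|mkN] := leqP N (m + k).
    rewrite subrr big1// => p _; rewrite gtn_eqF ?mul0r//; exact: leq_trans (ltn_ord p) Nmk.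
  rewrite subr0 (bigD1 (Ordinal mkN)) //= eqxx big1 ?addr0// => p pmk.
  by rewrite ifN ?mul0r// eq_sym; apply: contra pmk => /eqP h; apply/eqP/val_inj.
apply: le_trans (cabsB _ _) _; rewrite mulrDl; apply: lerD; first exact: H.
rewrite /S mulr_suml; apply: le_trans (cabs_sum _ _ _) _; apply: ler_sum => m _.
rewrite mulr_suml; apply: le_trans (cabs_sum _ _ _) _; apply: ler_sum => k _.
case: ifP => Nmk; last by rewrite cabs0 mulr_ge0// exprn_ge0// ltW.
rewrite cabsM cabsX cabs_toC (ger0_norm (ltW s0)) ler_wpM2l//.
by rewrite ler_wiXn2l ?(ltW s0) ?(ltW s1).
Qed.

(** On the unit circle, multiplication by w^p turns conj(w)^m w^k with m + k = p into w^(2k). The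
    terms become distinct monomials of one polynomial vanishing on the circle; k = p is the
    coefficient wanted. *)
Lemma antidiagonal_coef_eq0 (b : nat -> nat -> C) N p : (p < N)%N ->
  (forall w : C, cabs w = 1 -> \sum_(m < N) \sum_(k < N)
     (if (m + k)%N == p then Num.conj w ^+ m * w ^+ k * b m k else 0) = 0) ->
  b 0 p = 0.
Proof.
move=> pN H.
pose a q := \sum_(m < N) \sum_(k < N)
  (if ((m + k)%N == p) && (2 * k == q)%N then b m k else 0).
have a0 : forall q, (q < 2 * N)%N -> a q = 0.
  apply: circle_poly_eq0 => w w1.
  have ww : Num.conj w * w = 1 by rewrite mulrC mul_conj w1 expr1n.
  suff e : \sum_(q < 2 * N) a q * w ^+ q = (\sum_(m < N) \sum_(k < N)
     (if (m + k)%N == p then Num.conj w ^+ m * w ^+ k * b m k else 0)) * w ^+ p.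
    by rewrite e (H w w1) mul0r.
  rewrite mulr_suml /a.
  under eq_bigr do rewrite mulr_suml.
  rewrite exchange_big /=; apply: eq_bigr => m _.
  under eq_bigr do rewrite mulr_suml.
  rewrite exchange_big /= mulr_suml; apply: eq_bigr => k _.
  have [mkp|mkp] := eqVneq (m + k)%N p; last by rewrite mul0r big1// => q _; rewrite mul0r.
  have k2 : (2 * k < 2 * N)%N by rewrite ltn_mul2l ltn_ord.
  rewrite (bigD1 (Ordinal k2)) //= eqxx big1 ?addr0; last first.
    move=> q qk; rewrite ifN ?mul0r// eq_sym; apply: contra qk => /eqP h; exact/eqP/val_inj.
  rewrite -mkp exprD mulrC mulnC muln2 -addnn exprD.
  have -> : Num.conj w ^+ m * w ^+ k * b m k * (w ^+ m * w ^+ k) =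
    (Num.conj w * w) ^+ m * (w ^+ k * w ^+ k * b m k) by rewrite exprMn; ring.
  by rewrite ww expr1n mul1r.
have N0 : (0 < N)%N by exact: leq_ltn_trans pN.
have := a0 (2 * p)%N; rewrite ltn_mul2l pN => /(_ isT) <-.
rewrite /a (bigD1 (Ordinal N0)) //= (bigD1 (Ordinal pN)) //= add0n !eqxx /=.
rewrite !big1 ?addr0//.
- move=> m m0; apply: big1 => k _; rewrite ifN//; apply/negP => /andP[/eqP mk].
  rewrite eqn_mul2l /= => /eqP kp; move: mk; rewrite kp => h.
  by move/eqP: m0; apply; apply/val_inj => /=; apply/eqP; rewrite -(eqn_add2r p) h.
- move=> k kp; rewrite ifN// add0n; apply/negP => /andP[/eqP h _].
  by move/eqP: kp; apply; exact/val_inj.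
Qed.

End DoublePolynomials.

Lemma ip_sumr (R : realType) (E : lmodType (Cplx R)) (X : set E) nrm ip : prehilbert X nrm ip ->
  forall N (F : nat -> E) z, (forall i, X (F i)) -> X z ->
  ip z (\sum_(i < N) F i) = \sum_(i < N) ip z (F i) :> Cplx R.
Proof.
move=> ph N F z XF Xz; elim: N => [|N IH]; first by rewrite !big_ord0 (ip0r ph).
rewrite !big_ord_recr /= (ipDr ph _ (XF N) Xz) ?IH//.
by apply: (subspace_sum _ (ph_sub ph)).
Qed.

(** * Taylor expansion of the kernels in norm along a complex line *)

Section DiagonalVanishing.
Context (R : realType) (n : nat) (B : bergman_data R n).
Hypothesis hB : bergman_type B.
Local Notation C := (Cplx R).
Local Notation V := (Cspace R n).
Local Notation E := (V -> nat -> C).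
Local Notation Om := (Om B).
Local Notation normK := (normK B).
Local Notation mOm := (mOm hB).

Let ph : prehilbert (L2 B) (normB B) (ipB B).
Proof. exact: L2_prehilbert mOm. Qed.
Let phb : prehilbert (berg B) (normB B) (ipB B).
Proof. exact: berg_prehilbert mOm. Qed.
Let sb : is_subspace (berg B).
Proof. exact: berg_subspace mOm. Qed.

Lemma berg_analytic f k : berg B f -> analytic (W := C) Om (fun z => f z k).
Proof.
move=> [_ H _]; have := H k.
by rewrite (_ : (fun z => ip_l2 (f z) (e_ k)) = (fun z => f z k))//; apply/funext => z; rewrite ip_l2_e.
Qed.

Lemma berg_riesz (l : E -> C) (M : R) :
  (forall (c : C) f g, berg B f -> berg B g -> l (c *: f + g) = c * l f + l g) ->
  (forall f, berg B f -> cabs (l f) <= M * normB B f) ->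
  exists2 p, berg B p & forall f, berg B f -> l f = ipB B f p.
Proof. exact: (riesz ph sb (@berg_L2 _ _ B) (bt_complete hB)). Qed.

Section TaylorVectors.
Variables (z0 v : V) (N : R) (k : nat).
Hypothesis zv : forall t : C, cabs t < 2 -> Om (z0 + t *: v) /\ normK (z0 + t *: v) <= N.

Let sl (f : E) (t : C) : C := f (z0 + t *: v) k.

Let sl_cdiff f t : berg B f -> cabs t < 2 -> cdiff (sl f) t.
Proof.
move=> bf t2; apply: (@slice_cdiff R n (fun z => f z k)); apply: berg_analytic => //.
by have [] := zv t2.
Qed.

Let sl_le f t : berg B f -> cabs t < 2 -> cabs (sl f t) <= N * normB B f.
Proof.
move=> bf t2; have [Oz nz] := zv t2.
apply: le_trans (berg_pointwise hB k bf Oz) _; apply: ler_wpM2r nz; exact: normB_ge0.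
Qed.

(** The m-th Taylor coefficient of t -> f(z0 + tv)_k is a functional of [f] bounded by [N], so Riesz
    represents it by a vector. Conjugates appear because kernels depend anti-analytically on their
    point. *)
Lemma taylor_vectors : exists2 kap : nat -> E, (forall m, berg B (kap m)) &
  forall M (s : C), cabs s <= 1 / 2 ->
    normB B (Ke B (z0 + s *: v) k - \sum_(m < M) Num.conj s ^+ m *: kap m) <= 4 * N * cabs s ^+ M.
Proof.
have circ1 th : cabs (circ 1 th : C) < 2 by rewrite cabs_circ// ltr1n.
have circ1' (t : C) : cabs t = 1 -> cabs t < 2 by move=> ->; rewrite ltr1n.
have N0 : 0 <= N.
  have [Oz nz] := zv (t := 0) ltac:(by rewrite cabs0 ltr0n).
  by apply: le_trans nz; apply/ltW/(normK_gt0 hB).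
have cd f m : berg B f -> forall t : C, cabs t = 1 -> cdiff (fun t => sl f t * t^-1 ^+ m) t.
  move=> bf t t1; apply: cdiffM; first by apply: sl_cdiff => //; exact: circ1'.
  by apply: cdiff_invX; rewrite -cabs_gt0 t1.
have hk m : exists p, berg B p /\ forall f, berg B f -> tcoef (sl f) 1 m = ipB B f p.
  have [||p bp Hp] := @berg_riesz (fun f => tcoef (sl f) 1 m) N.
  - move=> c f g bf bg; rewrite /tcoef.
    rewrite (_ : (fun t => _) = (fun t => c * (sl f t * t^-1 ^+ m) + sl g t * t^-1 ^+ m)); last first.
      apply/funext => t.
      rewrite (_ : sl (c *: f + g) t = c * sl f t + sl g t)//; ring.
    rewrite circintD ?circintZ//; first by ring.
    + by move=> t t1; apply: cd.
    + move=> t t1; apply: cdiffM; [exact: cdiff_cst|exact: cd].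
    + by move=> t t1; apply: cd.
  - move=> f bf.
    have := @cabs_tcoef R _ 2 (fun t => @sl_cdiff f t bf) 1 (N * normB B f) m ltr01.
    rewrite expr1n divr1; apply; first by rewrite ltr1n.
    by move=> th _; apply: sl_le.
  - by exists p.
have [kap hkap] := boolp.choice hk.
have bk m : berg B (kap m) by case: (hkap m).
exists kap => // M s s2.
have s22 : cabs s < 2 by apply: le_lt_trans s2 _; lra.
have [Ow nw] := zv s22; have bK := Ke_berg hB k Ow.
have bS : berg B (\sum_(m < M) Num.conj s ^+ m *: kap m).
  by apply: (subspace_sum _ sb) => m; exact: (subspaceZ _ sb (bk m)).
set dl := _ - _; have bd : berg B dl := subspaceB sb bK bS.
(* Paired with itself, the error of the expansion is the scalar Taylor remainder of [dl] at s. The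
   factor 4 is 2 from M + |g w| times 2 from 1/(1 - |s|). *)
have : cabs (ipB B dl dl) <= 4 * N * cabs s ^+ M * normB B dl.
  rewrite {2}/dl (ipBr phb bK bS bd) -(repro hB k bd Ow).
  rewrite (@ip_sumr _ _ _ _ _ phb M (fun m => Num.conj s ^+ m *: kap m) dl _ bd); last first.
    by move=> m; exact: (subspaceZ _ sb (bk m)).
  rewrite (eq_bigr (fun m : 'I_M => tcoef (sl dl) 1 m * s ^+ m)); last first.
    move=> m _; rewrite (ipZr phb _ (bk m) bd) rmorphXn /= conjCK.
    by have [_ ->//] := hkap m; rewrite mulrC.
  have := @taylor R (sl dl) 2 (fun t => sl_cdiff bd) 1 (N * normB B dl) s M.
  move=> /(_ ltac:(by apply: le_lt_trans s2 _; lra) ltac:(by rewrite ltr1n)).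
  move=> /(_ ltac:(by move=> th _; apply: sl_le)) h; apply: le_trans h _.
  have sd := sl_le bd s22.
  rewrite divr1 mul1r.
  have h2 : (1 - cabs s)^-1 <= 2.
    by rewrite -[leRHS]invrK lef_pV2 ?posrE ?invr_gt0//; lra.
  have h3 : 0 <= cabs s ^+ M by rewrite exprn_ge0.
  have nd : 0 <= N * normB B dl by rewrite mulr_ge0// normB_ge0.
  apply: (@le_trans _ _ ((N * normB B dl + N * normB B dl) * cabs s ^+ M * 2)).
    apply: ler_pM => //.
    - by rewrite mulr_ge0// addr_ge0.
    - by rewrite invr_ge0; lra.
    - by rewrite ler_wpM2r// lerD2l.
  by rewrite le_eqVlt; apply/orP; left; apply/eqP; ring.
rewrite (ph_nrm phb bd) cabs_toC ger0_norm ?sqr_ge0// expr2.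
have [d0|d0] := eqVneq (normB B dl) 0.
  by move=> _; rewrite d0 !mulr_ge0// exprn_ge0.
by rewrite ler_pM2r// lt_def d0 normB_ge0.
Qed.

End TaylorVectors.

End DiagonalVanishing.

(** * From the diagonal to all pairs of kernels *)

Section DiagonalVanishingTheorem.
Context (R : realType) (n : nat) (B : bergman_data R n).
Hypothesis hB : bergman_type B.
Local Notation C := (Cplx R).
Local Notation V := (Cspace R n).
Local Notation E := (V -> nat -> C).
Local Notation Om := (Om B).
Local Notation normK := (normK B).
Local Notation mOm := (mOm hB).

Let phb : prehilbert (berg B) (normB B) (ipB B).
Proof. exact: berg_prehilbert mOm. Qed.
Let sb : is_subspace (berg B).
Proof. exact: berg_subspace mOm. Qed.

Variables (beta : E -> E -> C) (M : R).
Hypothesis M0 : 0 <= M.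
Hypothesis betal : forall (c : C) f g h, berg B f -> berg B g -> berg B h ->
  beta (c *: f + g) h = c * beta f h + beta g h.
Hypothesis betar : forall (c : C) f g h, berg B f -> berg B g -> berg B h ->
  beta h (c *: f + g) = Num.conj c * beta h f + beta h g.
Hypothesis beta_le : forall f g, berg B f -> berg B g ->
  cabs (beta f g) <= M * (normB B f * normB B g).
Variables (k i : nat).
Hypothesis beta_diag : forall a, Om a -> beta (Ke B a k) (Ke B a i) = 0.

Let b0 : berg B 0. Proof. by case: sb. Qed.

Let beta0l h : berg B h -> beta 0 h = 0.
Proof.
move=> bh; have := betal 1 b0 b0 bh; rewrite scaler0 addr0 mul1r => /eqP.
by rewrite -subr_eq0 opprD addrA subrr sub0r oppr_eq0 => /eqP.
Qed.

Let beta0r h : berg B h -> beta h 0 = 0.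
Proof.
move=> bh; have := betar 1 b0 b0 bh; rewrite scaler0 addr0 rmorph1 mul1r => /eqP.
by rewrite -subr_eq0 opprD addrA subrr sub0r oppr_eq0 => /eqP.
Qed.

Let beta_suml N (c : nat -> C) (F : nat -> E) h : (forall m, berg B (F m)) -> berg B h ->
  beta (\sum_(m < N) c m *: F m) h = \sum_(m < N) c m * beta (F m) h.
Proof.
move=> bF bh; elim: N => [|N IH]; first by rewrite !big_ord0 beta0l.
rewrite !big_ord_recr /= addrC (betal _ (bF N) _ bh) ?IH 1?addrC//.
by apply: (subspace_sum _ sb) => m; exact: (subspaceZ _ sb (bF m)).
Qed.

Let beta_sumr N (c : nat -> C) (F : nat -> E) h : (forall m, berg B (F m)) -> berg B h ->
  beta h (\sum_(m < N) c m *: F m) = \sum_(m < N) Num.conj (c m) * beta h (F m).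
Proof.
move=> bF bh; elim: N => [|N IH]; first by rewrite !big_ord0 beta0r.
rewrite !big_ord_recr /= addrC (betar _ (bF N) _ bh) ?IH 1?addrC//.
by apply: (subspace_sum _ sb) => m; exact: (subspaceZ _ sb (bF m)).
Qed.

Let betaBl f g h : berg B f -> berg B g -> berg B h -> beta (f - g) h = beta f h - beta g h.
Proof. by move=> bf bg bh; rewrite addrC -scaleN1r (betal _ bg bf bh) mulN1r addrC. Qed.

Let betaBr f g h : berg B f -> berg B g -> berg B h -> beta h (f - g) = beta h f - beta h g.
Proof.
by move=> bf bg bh; rewrite addrC -scaleN1r (betar _ bg bf bh) rmorphN rmorph1 mulN1r addrC.
Qed.

(** Expanding both kernels along the line turns the vanishing on the diagonal into one of a series
    in s and conj(s). Its pure powers of s are the Taylor coefficients of the form with the first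
    point frozen at [z0]. *)
Let slice_vanish (z0 v : V) (N : R) :
  (forall t : C, cabs t < 2 -> Om (z0 + t *: v) /\ normK (z0 + t *: v) <= N) ->
  beta (Ke B z0 k) (Ke B (z0 + toC (1 / 2) *: v) i) = 0.
Proof.
move=> zv.
have [Oz0 nz0] : Om z0 /\ normK z0 <= N.
  by have := zv 0; rewrite cabs0 scale0r addr0; apply; rewrite ltr0n.
have N0 : 0 <= N by apply: le_trans nz0; apply/ltW/(normK_gt0 hB).
have [kap bk Hk] := taylor_vectors hB k zv.
have [kai bi Hi] := taylor_vectors hB i zv.
have bKz0 := Ke_berg hB k Oz0.
pose A (kp : nat -> E) L (s : C) := \sum_(m < L) Num.conj s ^+ m *: kp m.
have bA kp L s : (forall m, berg B (kp m)) -> berg B (A kp L s).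
  by move=> bp; apply: (subspace_sum _ sb) => m; exact: (subspaceZ _ sb (bp m)).
(* The form vanishes on the exact kernels, so on the truncations only the errors count: 4N times 5N,
   where 5N bounds a truncated kernel, plus N times 4N, which makes 24 N^2. *)
have approx L (s : C) : cabs s <= 1 / 2 ->
    cabs (\sum_(m < L) \sum_(j < L) Num.conj s ^+ m * s ^+ j * beta (kap m) (kai j)) <=
    24 * M * N ^+ 2 * cabs s ^+ L.
  move=> s2; have sL : cabs s ^+ L <= 1.
    by apply: exprn_ile1 => //; apply: le_trans s2 _; lra.
  have [Ow nw] : Om (z0 + s *: v) /\ normK (z0 + s *: v) <= N.
    by apply: zv; apply: le_lt_trans s2 _; lra.
  set w := z0 + s *: v in Ow nw.
  have bKk := Ke_berg hB k Ow; have bKi := Ke_berg hB i Ow.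
  have bAk := bA kap L s bk; have bAi := bA kai L s bi.
  have -> : \sum_(m < L) \sum_(j < L) Num.conj s ^+ m * s ^+ j * beta (kap m) (kai j) =
      beta (A kap L s) (A kai L s).
    rewrite (beta_suml _ (fun m => Num.conj s ^+ m) bk bAi); apply: eq_bigr => m _.
    rewrite (beta_sumr _ (fun m => Num.conj s ^+ m) bi (bk m)) mulr_sumr.
    by apply: eq_bigr => j _; rewrite rmorphXn /= conjCK mulrA.
  have := Hk L s s2; rewrite -/w -/(A kap L s) => ek.
  have := Hi L s s2; rewrite -/w -/(A kai L s) => ei.
  have bdk := subspaceB sb bKk bAk; have bdi := subspaceB sb bKi bAi.
  have nAi : normB B (A kai L s) <= 5 * N.
    have := nrm_triangleB phb bKi bdi; rewrite subKr (normB_Ke B w i).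
    have h2 : 4 * N * cabs s ^+ L <= 4 * N by apply: ler_piMr sL; exact: mulr_ge0.
    move=> h1; apply: le_trans h1 _; apply: le_trans (lerD nw (le_trans ei h2)) _.
    by rewrite le_eqVlt; apply/orP; left; apply/eqP; ring.
  have e : beta (A kap L s) (A kai L s) = - (beta (Ke B w k - A kap L s) (A kai L s) +
      beta (Ke B w k) (Ke B w i - A kai L s)).
    rewrite (betaBl bKk bAk bAi) (betaBr bKi bAi bKk) (beta_diag Ow); ring.
  rewrite e cabsN; apply: le_trans (cabsD _ _) _.
  have s0 : 0 <= 4 * N * cabs s ^+ L by rewrite !mulr_ge0// exprn_ge0.
  have h1 : cabs (beta (Ke B w k - A kap L s) (A kai L s)) <= M * (4 * N * cabs s ^+ L * (5 * N)).
    apply: le_trans (beta_le bdk bAi) _; apply: (ler_wpM2l M0).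
    by apply: (ler_pM _ _ ek nAi); exact: normB_ge0.
  have h2 : cabs (beta (Ke B w k) (Ke B w i - A kai L s)) <= M * (N * (4 * N * cabs s ^+ L)).
    apply: le_trans (beta_le bKk bdi) _; apply: (ler_wpM2l M0).
    by rewrite normB_Ke; apply: (ler_pM _ _ nw ei); [exact/ltW/(normK_gt0 hB)|exact: normB_ge0].
  apply: le_trans (lerD h1 h2) _; rewrite le_eqVlt; apply/orP; left; apply/eqP; ring.
(* The modulus of the parameter separates total degrees, its argument then separates the terms of
   one degree. *)
have coef0 p : beta (kap 0%N) (kai p) = 0.
  apply: (@antidiagonal_coef_eq0 R (fun m j => beta (kap m) (kai j)) p.+1 p (ltnSn p)) => w w1.
  apply: (@double_poly_coef_eq0 R (fun m j => Num.conj w ^+ m * w ^+ j * beta (kap m) (kai j))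
    p.+1 (24 * M * N ^+ 2) (1 / 2)) => //.
  - by rewrite !mulr_ge0 ?sqr_ge0.
  - move=> s s0 s2; have cs : cabs (toC s * w) = s.
      by rewrite cabsM w1 mulr1 cabs_toC ger0_norm// ltW.
    have := approx p.+1 (toC s * w); rewrite cs => /(_ (ltW s2)); apply: le_trans.
    rewrite le_eqVlt; apply/orP; left; apply/eqP; congr cabs.
    apply: eq_bigr => m _; apply: eq_bigr => j _.
    rewrite rmorphM /= conj_toC !exprMn exprD; ring.
(* The expansion with one term, evaluated at s = 0. *)
have kap0 : kap 0%N = Ke B z0 k.
  have := Hk 1%N 0; rewrite cabs0 expr1 mulr0 big_ord1 expr0 scale1r scale0r addr0.
  move=> /(_ ltac:(by lra)) h; apply/esym/eqP; rewrite -subr_eq0; apply/eqP.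
  have bd := subspaceB sb bKz0 (bk 0%N).
  by apply: (berg_definite hB bd); apply/eqP; rewrite eq_le h normB_ge0.
set s : C := toC (1 / 2).
have cs : cabs s = 1 / 2 by rewrite cabs_toC ger0_norm.
have s2 : cabs s <= 1 / 2 by rewrite cs.
have [Ow nw] : Om (z0 + s *: v) /\ normK (z0 + s *: v) <= N by apply: zv; rewrite cs; lra.
have bKi := Ke_berg hB i Ow.
apply: cabs0_eq0; apply/eqP; rewrite eq_le cabs_ge0 andbT.
apply/ler_addgt0Pr => e e0; rewrite add0r.
have A0 : 0 <= M * (N * (4 * N)) by rewrite !mulr_ge0.
have [L hL] := geometric_small (q := 1 / 2) ltac:(by lra) ltac:(by lra) A0 e0.
have bAi := bA kai L s bi; have bdi := subspaceB sb bKi bAi.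
have -> : beta (Ke B z0 k) (Ke B (z0 + s *: v) i) =
    beta (Ke B z0 k) (Ke B (z0 + s *: v) i - A kai L s).
  rewrite (betaBr bKi bAi bKz0) (beta_sumr _ (fun m => Num.conj s ^+ m) bi bKz0).
  by rewrite big1 ?subr0// => m _; rewrite -kap0 coef0 mulr0.
apply: le_trans (beta_le bKz0 bdi) _; apply: le_trans (ltW hL).
rewrite -2!mulrA; apply: (ler_wpM2l M0); rewrite normB_Ke.
have := Hi L s s2; rewrite cs => h.
by apply: (ler_pM _ _ nz0 h); [exact/ltW/(normK_gt0 hB)|exact: normB_ge0].
Qed.

(* [beta (Ke B a k) (Ke B b i)] is anti-analytic in [a] and analytic in [b], hence is
   determined by its values on the diagonal [a = b]. *)
Theorem diagonal_vanishing a b : Om a -> Om b -> beta (Ke B a k) (Ke B b i) = 0.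
Proof.
have [z0 [rho [N [Oz0 rho0 Hb]]]] := locally_bounded hB.
have conj0 (x : C) : Num.conj x = 0 -> x = 0 by move=> /eqP; rewrite conjC_eq0 => /eqP.
(* With v = 2(w - z) the point w is at parameter 1/2, and all parameters below 2 stay in the box
   where [normK] is bounded. *)
have near z w : box z0 (rho / 2) z -> box z (rho / 8) w -> beta (Ke B z k) (Ke B w i) = 0.
  move=> zz0 wz; pose v : V := (toC 2 : C) *: (w - z).
  have -> : w = z + toC (1 / 2) *: v.
    rewrite /v scalerA (_ : _ * _ = 1) ?scale1r ?subrKC//.
    by apply: complexP; rewrite ?cReM ?cImM /=; lra.
  apply: (@slice_vanish _ _ N) => t t2; apply: Hb => j.
  apply: le_lt_trans (cabs_distD ((z : 'rV[C]_n) ord0 j) _ _) _.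
  have h : box z (rho / 2) (z + t *: v).
    apply: (@box_line _ _ _ _ (rho / 4)) => [j'|].
      rewrite !mxE cabsM; have := wz j'.
      rewrite cabs_toC ger0_norm//.
      lra.
    have : cabs t * (rho / 4) < 2 * (rho / 4) by rewrite ltr_pM2r// divr_gt0.
    lra.
  have := h j; have := zz0 j; lra.
(* As a function of the second point the form is a coordinate of the Riesz representative [p] of its
   conjugate, hence analytic on all of [Om]. The first point is released in the same way
   afterwards. *)
have inb z b' : box z0 (rho / 2) z -> Om b' -> beta (Ke B z k) (Ke B b' i) = 0.
  move=> zz0 Ob; have [Oz _] : Om z /\ normK z <= N by apply: Hb => j; have := zz0 j; lra.
  have bKz := Ke_berg hB k Oz.
  have [||p bp Hp] := @berg_riesz R n B hB (fun f => Num.conj (beta (Ke B z k) f)) (M * normB B (Ke B z k)).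
  - by move=> c f g bf bg; rewrite (betar _ bf bg bKz) rmorphD rmorphM /= conjCK.
  - by move=> f bf; rewrite cabs_conj -mulrA; exact: beta_le.
  have e w : Om w -> beta (Ke B z k) (Ke B w i) = p w i.
    move=> Ow; have bKw := Ke_berg hB i Ow; apply: (can_inj (@conjCK _)).
    by rewrite (Hp _ bKw) (repro hB i bp Ow) (ph_conj phb bp bKw).
  rewrite (e _ Ob).
  have rho8 : 0 < rho / 8 by rewrite divr_gt0.
  have H := @identity_theorem R n Om (fun w => p w i) z (rho / 8) (bt_open hB) (bt_connected hB)
    (berg_analytic i bp) Oz rho8.
  apply: (H _ b' Ob) => w wz.
  have [Ow _] : Om w /\ normK w <= N.
    apply: Hb => j; apply: le_lt_trans (cabs_distD ((z : 'rV[C]_n) ord0 j) _ _) _.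
    have := wz j; have := zz0 j; lra.
  by rewrite -(e _ Ow); apply: near.
move=> Oa Ob; have bKb := Ke_berg hB i Ob.
have [||p bp Hp] := @berg_riesz R n B hB (fun f => beta f (Ke B b i)) (M * normB B (Ke B b i)).
- by move=> c f g bf bg; rewrite (betal _ bf bg bKb).
- by move=> f bf; rewrite -mulrA [normB B (Ke _ _ _) * _]mulrC; exact: beta_le.
have e w : Om w -> beta (Ke B w k) (Ke B b i) = Num.conj (p w k).
  move=> Ow; have bKw := Ke_berg hB k Ow.
  by rewrite (Hp _ bKw) (repro hB k bp Ow) (ph_conj phb bp bKw).
rewrite (e _ Oa).
have rho2 : 0 < rho / 2 by rewrite divr_gt0.
rewrite (@identity_theorem R n Om (fun w => p w k) z0 (rho / 2) (bt_open hB) (bt_connected hB)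
    (berg_analytic k bp) Oz0 rho2) ?rmorph0// => w wz.
have [Ow _] : Om w /\ normK w <= N by apply: Hb => j; have := wz j; lra.
by apply: conj0; rewrite -(e _ Ow); apply: inb.
Qed.

End DiagonalVanishingTheorem.

(** * Weak limits of translates *)

Section UltraLimits.
Context (R : realType) (T : Type) (F : set_system T) (UF : UltraFilter F).
Local Notation C := (Cplx R).

(** The limit is the supremum of the numbers below [u] on a set of the filter; an ultrafilter
    contains the complement of whatever set it omits. *)
Lemma ultra_bounded_real (u : T -> R) (M : R) : (forall m, `|u m| <= M) ->
  exists l, forall e : R, 0 < e -> F [set m | `|u m - l| < e].
Proof.
move=> uM; pose S := [set x : R | F [set m | x <= u m]].
have S0 : S !=set0.
  by exists (- M); apply: filterS filterT => m _ /=; have := uM m; rewrite ler_norml => /andP[].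
have Sub : ubound S M.
  move=> x Sx; have [m /= xm] := filter_ex Sx; apply: le_trans xm _.
  by have := uM m; rewrite ler_norml => /andP[].
have hS : has_sup S by split => //; exists M.
exists (sup S) => e e0.
have [x Sx xS] := sup_adherent e0 hS.
have [Fe|Fe] := @in_ultra_setVsetC _ F [set m | sup S + e <= u m] UF.
  have : sup S + e <= sup S by apply: ub_le_sup; [exists M|].
  lra.
apply: filterS (filterI Sx Fe) => m [/= h1 /negP]; rewrite -ltNge => h2.
by rewrite ltr_norml; apply/andP; split; lra.
Qed.

Definition uconv (u : T -> C) (l : C) := forall e : R, 0 < e -> F [set m | cabs (u m - l) < e].

Lemma ultra_bounded (u : T -> C) (M : R) : (forall m, cabs (u m) <= M) ->
  exists l : C, uconv u l.
Proof.
move=> uM.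
have [a Ha] := @ultra_bounded_real (fun m => complex.Re (u m)) M
  (fun m => le_trans (ler_Re_cabs _) (uM m)).
have [b Hb] := @ultra_bounded_real (fun m => complex.Im (u m)) M
  (fun m => le_trans (ler_Im_cabs _) (uM m)).
exists (Complex a b) => e e0; have e2 : 0 < e / 2 by rewrite divr_gt0.
apply: filterS (filterI (Ha _ e2) (Hb _ e2)) => m [/= h1 h2].
apply: le_lt_trans (cabs_le_ReIm _) _; rewrite cReD cReN cImD cImN /=; lra.
Qed.

(** One ultrafilter gives limits to all bounded families at once, so the limits are linear in the
    family and no diagonal extraction is required. The default 0 concerns divergent families
    only. *)
Definition ulim (u : T -> C) : C := xget 0 [set l : C | uconv u l].

Lemma ulimP (u : T -> C) (M : R) : (forall m, cabs (u m) <= M) -> uconv u (ulim u).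
Proof.
move=> uM; have [l Hl] := ultra_bounded uM.
exact: (@xgetPex C 0 [set l : C | uconv u l] (ex_intro _ l Hl)).
Qed.

Lemma ultra_le (u : T -> C) (l : C) (M : R) : (forall m, cabs (u m) <= M) -> uconv u l ->
  cabs l <= M.
Proof.
move=> uM H; apply/ler_addgt0Pr => e e0.
have [m /= hm] := filter_ex (H e e0).
have := cabs_triangle_sub l (u m); rewrite cabsC; have := uM m; lra.
Qed.

Lemma ultra_unique (u : T -> C) (l l' : C) : uconv u l -> uconv u l' -> l = l'.
Proof.
move=> H H'; apply/eqP; rewrite -subr_eq0; apply/eqP.
apply: cabs0_eq0; apply/eqP; rewrite eq_le cabs_ge0 andbT.
apply/ler_addgt0Pr => e e0; have e2 : 0 < e / 2 by rewrite divr_gt0.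
have [m /= [h h']] := filter_ex (filterI (H _ e2) (H' _ e2)).
have := cabs_distD (u m) l l'; rewrite (cabsC l (u m)); lra.
Qed.

Lemma ultra_lin (u v : T -> C) (l l' c : C) : uconv u l -> uconv v l' ->
  uconv (fun m => c * u m + v m) (c * l + l').
Proof.
move=> H H' e e0.
have c0 : 0 < cabs c + 1 by rewrite ltr_wpDl.
have e2 : 0 < e / 2 by rewrite divr_gt0.
have e3 : 0 < e / 2 / (cabs c + 1) by rewrite divr_gt0.
apply: filterS (filterI (H _ e3) (H' _ e2)) => m [/= h h'].
have -> : c * u m + v m - (c * l + l') = c * (u m - l) + (v m - l') by ring.
apply: le_lt_trans (cabsD _ _) _; rewrite cabsM (splitr e); apply: ler_ltD h'.
move: h; rewrite ltr_pdivlMr// => /ltW; apply: le_trans.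
by rewrite mulrC ler_wpM2l// lerDl.
Qed.

End UltraLimits.

(** * Translates of an operator on kernels *)

Section Translations.
Context (R : realType) (n : nat) (B : bergman_data R n).
Hypothesis hB : bergman_type B.
Local Notation C := (Cplx R).
Local Notation V := (Cspace R n).
Local Notation E := (V -> nat -> C).
Local Notation Om := (Om B).
Local Notation K := (K B).
Local Notation normK := (normK B).
Local Notation dist := (dist B).
Local Notation phi := (phi B).
Local Notation mOm := (mOm hB).
Local Notation Uadj := (Uadj B).

Let ph : prehilbert (L2 B) (normB B) (ipB B).
Proof. exact: L2_prehilbert mOm. Qed.
Let phb : prehilbert (berg B) (normB B) (ipB B).
Proof. exact: berg_prehilbert mOm. Qed.
Let sb : is_subspace (berg B).
Proof. exact: berg_subspace mOm. Qed.

Definition vanishes (f : V -> R) := forall e : R, 0 < e -> at_infty B [set z | f z < e].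

Lemma kvec_Ke z k : kvec B z (e_ k) = toC (normK z)^-1 *: Ke B z k.
Proof.
apply/funext => w; apply/funext => j.
change (K z w / toC (normK z) * e_ k j = toC (normK z)^-1 * (K z w * e_ k j)).
by rewrite toCV; ring.
Qed.

Variable T : E -> E.
Hypothesis bT : bounded_on_berg B T.

Let T_berg f : berg B f -> berg B (T f). Proof. by case: bT => h _ _; exact: h. Qed.
Let T_lin c f g : berg B f -> berg B g -> T (c *: f + g) = c *: T f + T g.
Proof. by case: bT => _ h _; exact: h. Qed.

Let T_scale c f : berg B f -> T (c *: f) = c *: T f.
Proof.
move=> bf; have b0 : berg B 0 by case: sb.
have T0 : T 0 = 0.
  have := T_lin 1 b0 b0; rewrite !scale1r addr0 => /eqP.
  by rewrite -subr_eq0 opprD addrA subrr sub0r oppr_eq0 => /eqP.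
by have := T_lin c bf b0; rewrite T0 !addr0.
Qed.

Lemma berezinE z i k : Om z -> ip_l2 (berezin B T z (e_ k)) (e_ i) =
  toC ((normK z)^-1 ^+ 2) * ipB B (T (Ke B z k)) (Ke B z i).
Proof.
move=> Oz; rewrite ip_l2_e /berezin !kvec_Ke.
have bk := Ke_berg hB k Oz; have bi := Ke_berg hB i Oz.
have bTk := T_berg bk.
rewrite (T_scale _ bk) (ipZl phb _ bTk (subspaceZ _ sb bi)) (ipZr phb _ bi bTk) conj_toC.
by rewrite mulrA -toCM expr2.
Qed.

Lemma translate_berg z f : Om z -> berg B f -> berg B (translate B T z f).
Proof.
move=> Oz bf; apply: (U_berg hB Oz); apply: T_berg.
by have [] := UadjP hB Oz bf.
Qed.

Lemma translate_ip z f g : Om z -> berg B f -> berg B g ->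
  ipB B (translate B T z f) g = ipB B (T (Uadj z f)) (Uadj z g).
Proof.
move=> Oz bf bg; have [ba _] := UadjP hB Oz bf.
by have [_ H] := UadjP hB Oz bg; exact: (H _ (T_berg ba)).
Qed.

Lemma translate_Ke z a b k i : Om z -> Om a -> Om b ->
  ipB B (translate B T z (Ke B a k)) (Ke B b i) =
  Num.conj (k_ B z a) * k_ B z b * ipB B (T (Ke B (phi z a) k)) (Ke B (phi z b) i).
Proof.
move=> Oz Oa Ob; have Opa := phiOm hB Oz Oa; have Opb := phiOm hB Oz Ob.
have bpa := Ke_berg hB k Opa; have bpb := Ke_berg hB i Opb.
rewrite (translate_ip Oz (Ke_berg hB k Oa) (Ke_berg hB i Ob)) !(Uadj_Ke hB)//.
rewrite (T_scale _ bpa) (ipZl phb _ (T_berg bpa) (subspaceZ _ sb bpb)).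
by rewrite (ipZr phb _ bpb (T_berg bpa)) conjCK mulrA.
Qed.

Lemma Uadj_lin z c f g : Om z -> berg B f -> berg B g ->
  Uadj z (c *: f + g) = c *: Uadj z f + Uadj z g.
Proof.
move=> Oz bf bg; have bcf := subspaceZ c sb bf; have bcfg := subspaceD sb bcf bg.
have [bUf Hf] := UadjP hB Oz bf; have [bUg Hg] := UadjP hB Oz bg.
have [bU HU] := UadjP hB Oz bcfg.
have bcU := subspaceZ c sb bUf.
apply: (ip_definite ph sb (@berg_L2 _ _ B) (@berg_definite _ _ _ hB) bU (subspaceD sb bcU bUg)) => h bh.
have bUh := U_berg hB Oz bh.
rewrite -(HU _ bh) (ipDr phb bcf bg bUh) (ipZr phb _ bf bUh) (Hf _ bh) (Hg _ bh).
by rewrite (ipDr phb bcU bUg bh) (ipZr phb _ bUf bh).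
Qed.

Lemma translate_lin z c f g : Om z -> berg B f -> berg B g ->
  translate B T z (c *: f + g) = c *: translate B T z f + translate B T z g.
Proof.
move=> Oz bf bg; have [bUf _] := UadjP hB Oz bf; have [bUg _] := UadjP hB Oz bg.
change (U_ B z (T (Uadj z (c *: f + g))) = c *: U_ B z (T (Uadj z f)) + U_ B z (T (Uadj z g))).
by rewrite (Uadj_lin _ Oz bf bg) (T_lin _ bUf bUg) U_lin.
Qed.

Lemma translate_bounded : exists2 c : R, 0 <= c & forall z f, Om z -> berg B f ->
  normB B (translate B T z f) <= c * normB B f.
Proof.
have [c1 c10 H1] := U_bounded hB; have [c2 c20 H2] := Uadj_bounded hB.
have [M M0 HM] := bounded_operator_bound phb bT.
exists (c1 * (M * c2)); first by rewrite !mulr_ge0// ltW.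
move=> z f Oz bf; have [bUf _] := UadjP hB Oz bf; have bTU := T_berg bUf.
have [_ h1] := H1 z _ Oz (berg_L2 bTU); apply: le_trans h1 _.
rewrite -mulrA; apply: (ler_wpM2l (ltW c10)); apply: le_trans (HM _ bUf) _.
by rewrite -mulrA; apply: (ler_wpM2l M0); exact: H2.
Qed.

(** [phi z] sends 0 to z, so by quasi-invariance it sends [a] to within a multiple of d(a, 0) of z:
    when z is far from 0, so is [phi z a], where the Berezin transform will be evaluated. *)
Lemma dist_phi_lower : exists2 c : R, 0 < c & forall z a, Om z -> Om a ->
  dist z 0 <= dist (phi z a) 0 + c * dist a 0.
Proof.
have [c c0 H] := bt_quasi_inv hB; exists c => // z a Oz Oa.
have O0 := bt_0 hB; have [_] := H z a 0 Oz Oa O0; rewrite (bt_phi_0 hB Oz) => h.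
have Op := phiOm hB Oz Oa.
have := dist_tri hB Op Oz O0; have := dist_tri hB Oz Op O0; rewrite (distC hB Oz Op); lra.
Qed.

Theorem translate_weak_limit a b k i : Om a -> Om b ->
  (forall j l, vanishes (fun z => cabs (ip_l2 (berezin B T z (e_ j)) (e_ l)))) ->
  vanishes (fun z => cabs (ipB B (translate B T z (Ke B a k)) (Ke B b i))).
Proof.
move=> Oa Ob hT; apply: contrapT => nvan.
have [e0 e00 bad] : exists2 e0 : R, 0 < e0 & forall m : nat, exists z, [/\ Om z, m%:R < dist z 0 &
    e0 <= cabs (ipB B (translate B T z (Ke B a k)) (Ke B b i))].
  apply: contrapT => H; apply: nvan => e ep; apply: contrapT => nex; apply: H.
  exists e => // m; apply: contrapT => nz; apply: nex; exists m%:R => z Oz mz /=.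
  by rewrite ltNge; apply/negP => h; apply: nz; exists z.
have [zs Hzs] := boolp.choice bad.
have Oz m : Om (zs m) by case: (Hzs m).
(* An ultrafilter finer than convergence to infinity of indices, taken along a sequence of points
   that violates the conclusion. *)
have [F [UF sF]] := @ultraFilterLemma nat \oo _.
have FF : ProperFilter F := @ultra_proper _ F UF.
have [c c0 Hc] := translate_bounded.
have bnd m f g : berg B f -> berg B g ->
    cabs (ipB B (translate B T (zs m) f) g) <= c * (normB B f * normB B g).
  move=> bf bg; apply: le_trans (cauchy_schwarz phb (translate_berg (Oz m) bf) bg) _.
  by rewrite mulrA; apply: ler_wpM2r (Hc _ _ (Oz m) bf); exact: normB_ge0.
pose beta (f g : E) : C := ulim F (fun m => ipB B (translate B T (zs m) f) g).
have betaP f g : berg B f -> berg B g ->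
    uconv F (fun m => ipB B (translate B T (zs m) f) g) (beta f g).
  by move=> bf bg; exact: (ulimP UF (fun m => bnd m f g bf bg)).
have betal (x : C) f g h : berg B f -> berg B g -> berg B h ->
    beta (x *: f + g) h = x * beta f h + beta g h.
  move=> bf bg bh; have bxf := subspaceZ x sb bf.
  refine (ultra_unique UF (betaP _ _ (subspaceD sb bxf bg) bh) _).
  rewrite (_ : (fun m => _) = (fun m => x * ipB B (translate B T (zs m) f) h +
     ipB B (translate B T (zs m) g) h)).
    by apply: (ultra_lin UF); exact: betaP.
  apply/funext => m; rewrite (translate_lin _ (Oz m) bf bg).
  exact: (ph_lin phb _ (translate_berg (Oz m) bf) (translate_berg (Oz m) bg) bh).
have betar (x : C) f g h : berg B f -> berg B g -> berg B h ->
    beta h (x *: f + g) = Num.conj x * beta h f + beta h g.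
  move=> bf bg bh; have bxf := subspaceZ x sb bf.
  refine (ultra_unique UF (betaP _ _ bh (subspaceD sb bxf bg)) _).
  rewrite (_ : (fun m => _) = (fun m => Num.conj x * ipB B (translate B T (zs m) h) f +
     ipB B (translate B T (zs m) h) g)).
    by apply: (ultra_lin UF); exact: betaP.
  apply/funext => m; have bth := translate_berg (Oz m) bh.
  by rewrite (ipDr phb bxf bg bth) (ipZr phb _ bf bth).
have beta_le f g : berg B f -> berg B g -> cabs (beta f g) <= c * (normB B f * normB B g).
  by move=> bf bg; apply: (ultra_le UF (fun m => bnd m f g bf bg)); exact: betaP.
have beta_diag a' : Om a' -> beta (Ke B a' k) (Ke B a' i) = 0.
  move=> Oa'; refine (ultra_unique UF (betaP _ _ (Ke_berg hB k Oa') (Ke_berg hB i Oa')) _).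
  move=> e ep.
  have [ck ck0 Hk] := K_two_sided hB; have [cd cd0 Hd] := dist_phi_lower.
  have na := normK_gt0 hB Oa'.
  (* The entry on the diagonal is |k_z(a')|^2 normK(phi_z a')^2 times a Berezin entry at phi_z a',
     and the kernel estimate bounds that factor by [A] independently of z. *)
  pose A := (ck * normK a') ^+ 2.
  have A0 : 0 < A by rewrite exprn_gt0// mulr_gt0.
  have [r Hr] := hT k i (e / A) (divr_gt0 ep A0).
  have : F [set m : nat | r + cd * dist a' 0 < m%:R].
    apply: sF; exists (Num.truncn (r + cd * dist a' 0)).+1 => //= m hm.
    by apply: lt_le_trans (truncnS_gt _) _; rewrite ler_nat.
  apply: filterS => m rm.
  suff : cabs (ipB B (translate B T (zs m) (Ke B a' k)) (Ke B a' i)) < e by rewrite /mkset subr0.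
  move: rm; rewrite /mkset => rm.
  have [_ mz _] := Hzs m; have Op := phiOm hB (Oz m) Oa'.
  have far : r < dist (phi (zs m) a') 0 by have := Hd _ _ (Oz m) Oa'; lra.
  have : cabs (ip_l2 (berezin B T (phi (zs m) a') (e_ k)) (e_ i)) < e / A := Hr _ Op far.
  rewrite (berezinE _ _ Op) (translate_Ke _ _ (Oz m) Oa' Oa') cabsM
    (cabsM (Num.conj _ * _)) (cabsM (Num.conj _)) cabs_conj.
  rewrite cabs_toC (ger0_norm (sqr_ge0 _)) (cabs_k hB _ (Oz m)).
  have np := normK_gt0 hB Op; have nz := normK_gt0 hB (Oz m).
  have [h1 _] := Hk _ _ (Oz m) Oa'.
  have h2 : cabs (K (zs m) a') / normK (zs m) <= ck * normK a' / normK (phi (zs m) a').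
    rewrite ler_pdivrMr//; apply: le_trans h1 _.
    by rewrite le_eqVlt; apply/orP; left; apply/eqP; ring.
  move: (cabs (ipB _ _ _)) (cabs_ge0 (ipB B (T (Ke B (phi (zs m) a') k)) (Ke B (phi (zs m) a') i))) => X X0 hX.
  have h0 : 0 <= cabs (K (zs m) a') / normK (zs m) by rewrite divr_ge0// ltW.
  have h3 : (cabs (K (zs m) a') / normK (zs m)) * (cabs (K (zs m) a') / normK (zs m)) <=
     (ck * normK a' / normK (phi (zs m) a')) * (ck * normK a' / normK (phi (zs m) a')).
    exact: ler_pM.
  apply: le_lt_trans (ler_wpM2r X0 h3) _.
  move: hX; rewrite ltr_pdivlMr// => hX; apply: le_lt_trans hX.
  by rewrite le_eqVlt; apply/orP; left; apply/eqP; rewrite /A; ring.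
have := diagonal_vanishing hB c0 betal betar beta_le beta_diag Oa Ob => b0.
have := betaP _ _ (Ke_berg hB k Oa) (Ke_berg hB i Ob) e0 e00.
move=> /filter_ex[m /=]; rewrite b0 subr0; have [_ _] := Hzs m.
by rewrite leNgt => /negP.
Qed.

End Translations.

(** * Localization of Toeplitz operators *)

Section JointMeasurability.
Context (R : realType) (n : nat) (B : bergman_data R n).
Hypothesis hB : bergman_type B.
Local Notation C := (Cplx R).
Local Notation V := (Cspace R n).
Local Notation E := (V -> nat -> C).
Local Notation Om := (Om B).
Local Notation sigma := (sigma B).
Local Notation K := (K B).
Local Notation bOm := (Om : set (borel R n)).
Local Notation mOm := (mOm hB).
Implicit Types (f g : E).

Lemma euclidean_dense_seq : exists2 a : nat -> V, (forall i, Om (a i)) &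
  forall z (d : R), Om z -> 0 < d -> exists i, box (a i) d z.
Proof.
pose X := ('rV[(rat * rat)%type]_n : countType).
pose p (x : X) : V := (\row_j (Complex (ratr (x ord0 j).1) (ratr (x ord0 j).2) : C)) : 'rV[C]_n.
pose a i : V := if unpickle i is Some x then (if `[< Om (p x) >] then p x else 0) else 0.
exists a => [i|z d Oz d0].
  rewrite /a; case: unpickle => [x|]; last exact: (bt_0 hB).
  by case: asboolP => [//|_]; exact: (bt_0 hB).
have /nbhs_boxP[e e0 H] : nbhs (z : V) Om by apply: open_nbhs_nbhs; split => //; exact: (bt_open hB).
pose m := Num.min d e / 2; have m0 : 0 < m by rewrite divr_gt0// lt_min d0.
have hr (x : R) : exists q : rat, `|ratr q - x| < m.
  have [q] := @rat_in_itvoo R (x - m) (x + m) ltac:(lra).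
  by rewrite in_itv /= => /andP[q1 q2]; exists q; rewrite ltr_norml; apply/andP; split; lra.
have [qr Hr] := boolp.choice (fun j => hr (complex.Re ((z : 'rV[C]_n) ord0 j))).
have [qi Hi] := boolp.choice (fun j => hr (complex.Im ((z : 'rV[C]_n) ord0 j))).
pose x : X := \row_j (qr j, qi j).
have px j : cabs (((p x : V) : 'rV[C]_n) ord0 j - (z : 'rV[C]_n) ord0 j) < Num.min d e.
  apply: le_lt_trans (cabs_le_ReIm _) _; rewrite !mxE cReD cReN cImD cImN /=.
  by have := Hr j; have := Hi j; rewrite /m; lra.
have Opx : Om (p x) by apply: H => j; apply: lt_le_trans (px j) _; rewrite ge_min lexx orbT.
exists (pickle x) => j; rewrite /a pickleK (asboolT Opx).
by rewrite cabsC; apply: lt_le_trans (px j) _; rewrite ge_min lexx.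
Qed.

Lemma cabsK_continuous w : Om w -> forall z, Om z -> forall e : R, 0 < e ->
  exists2 d : R, 0 < d & forall u, Om u -> box z d u -> `|cabs (K u w) - cabs (K z w)| < e.
Proof.
move=> Ow z Oz e e0; have [_ Ka _] := K_berg hB Ow.
have cK := analytic_continuous Ka Oz.
have hn : nbhs (K w z : C) [set y : C | cabs (y - K w z) < e] by apply/nbhs_cabsP; exists e.
have h1 : nbhs (z : V) [set u : V | cabs (K w u - K w z) < e] := cK _ hn.
have [d d0 H] := proj1 (nbhs_boxP _ _) h1; exists d => // u Ou /H /= h.
rewrite (cabsK_sym hB Ow Ou) (cabsK_sym hB Ow Oz).
by apply: le_lt_trans (cabs_distB _ _) h.
Qed.

Lemma box_sub (z w : V) (d : R) : box z d w -> box w d z.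
Proof. by move=> h j; rewrite cabsC; exact: h. Qed.

Lemma open_box (z : V) (d : R) : open (box z d).
Proof.
suff : open (box z d : set V) by [].
rewrite openE => w wz.
pose e (j : 'I_n) := d - cabs ((w : 'rV[C]_n) ord0 j - (z : 'rV[C]_n) ord0 j).
apply/nbhs_boxP; exists (\big[Num.min/1]_j e j).
  by apply: lt_bigmin => // j _; rewrite /e subr_gt0.
move=> u uw j; apply: le_lt_trans (cabs_distD ((w : 'rV[C]_n) ord0 j) _ _) _.
have : cabs ((u : 'rV[C]_n) ord0 j - (w : 'rV[C]_n) ord0 j) < e j.
  by apply: lt_le_trans (uw j) _; exact: bigmin_le_cond.
rewrite /e; lra.
Qed.

(** A function continuous in one variable and measurable in the other. |K(z, w)| > c holds when, for
    some k and m, all points a_i of a dense sequence within 1/(m + 1) of z satisfy |K(a_i, w)| >= c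
    + 1/(k + 1); this is a countable combination of measurable rectangles. *)
Lemma K_joint_measurable :
  measurable_fun (bOm `*` bOm) (fun p : borel R n * borel R n => cabs (K p.1 p.2)).
Proof.
have [a aOm da] := euclidean_dense_seq.
have mO2 : measurable (bOm `*` bOm) by apply: measurableX; exact: mOm.
apply: measurable_fun_gt => c.
pose P k m i : set (borel R n * borel R n) :=
  (bOm `*` bOm) `&` ([set p | ~ box (a i) m.+1%:R^-1 p.1] `|` [set p | c + k.+1%:R^-1 <= cabs (K (a i) p.2)]).
have -> : (bOm `*` bOm) `&` [set p | c < cabs (K p.1 p.2)] = \bigcup_k \bigcup_m \bigcap_i P k m i.
  apply/seteqP; split => [[z w] [[/= Oz Ow] cK]|[z w] [k _ [m _ H]]].
    have [k ck] : exists k : nat, k.+1%:R^-1 < cabs (K z w) - c.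
      have [k _ Hk] := near_infty_natSinv_lt (PosNum (eqbRL (subr_gt0 _ _) cK)).
      by exists k; apply: Hk => /=.
    have e0 : 0 < cabs (K z w) - c - k.+1%:R^-1 by rewrite subr_gt0.
    have [d d0 Hd] := cabsK_continuous Ow Oz e0.
    have [m _ Hm] := near_infty_natSinv_lt (PosNum d0).
    exists k => //; exists m => // i _; split => //=.
    have [bz|] := pselect (box (a i) m.+1%:R^-1 z); last by left.
    right; have : box z d (a i).
      by move=> j; apply: lt_trans (box_sub bz j) _; apply: (Hm m) => /=.
    by move=> /(Hd _ (aOm i)); rewrite ltr_norml => /andP[h _]; apply: ltW; move: h;
      move: (_ ^-1) (cabs (K (a i) w)) (cabs (K z w)) => q x y; lra.
  have [[Oz Ow] _] := H 0%N I; split => //=.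
  rewrite ltNge; apply/negP => Kc.
  have k0 : 0 < (k.+1%:R^-1 : R) by rewrite invr_gt0 ltr0n.
  have [d d0 Hd] := cabsK_continuous Ow Oz k0.
  have md : 0 < Num.min d m.+1%:R^-1 by rewrite lt_min d0 invr_gt0 ltr0n.
  have [i bi] := da z _ Oz md.
  have [_ [/= nb|/= h]] := H i I.
    by apply: nb => j; apply: lt_le_trans (bi j) _; rewrite ge_min lexx orbT.
  have : box z d (a i).
    by apply: box_sub => j; apply: lt_le_trans (bi j) _; rewrite ge_min lexx.
  by move=> /(Hd _ (aOm i)); rewrite ltr_norml => /andP[_ h2]; move: h h2 Kc;
    move: (_ ^-1) (cabs (K (a i) w)) (cabs (K z w)) => q x y; lra.
apply: bigcup_measurable => k _; apply: bigcup_measurable => m _.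
apply: bigcapT_measurable => i; rewrite /P setIUr; apply: measurableU.
  have -> : (bOm `*` bOm) `&` [set p | ~ box (a i) m.+1%:R^-1 p.1] =
     (bOm `\` (box (a i) m.+1%:R^-1 : set (borel R n))) `*` bOm.
    by apply/seteqP; split => [[z w] [[/= ? ?] ?]|[z w] [[/= ? ?] ?]].
  apply: measurableX; last exact: mOm.
  by apply: measurableD; [exact: mOm|apply: open_borel; exact: open_box].
have -> : (bOm `*` bOm) `&` [set p | c + k.+1%:R^-1 <= cabs (K (a i) p.2)] =
     bOm `*` (bOm `&` [set w | c + k.+1%:R^-1 <= cabs (K (a i) w)]).
  by apply/seteqP; split => [[z w] [[/= ? ?] ?]|[z w] [/= ? [? ?]]].
apply: measurableX; first exact: mOm.
have := measurable_cabs (K_cmeas hB (aOm i)).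
move=> /(_ mOm _ (measurable_itv `[c + k.+1%:R^-1, +oo[)).
by rewrite set_itvE.
Qed.

(** Extended by zero off Om x Om, so as to be measurable on the whole product. *)
Definition K2 (p : borel R n * borel R n) : R :=
  ((fun p : borel R n * borel R n => cabs (K p.1 p.2)) \_ (bOm `*` bOm)) p.

Lemma K2E z w : Om z -> Om w -> K2 (z, w) = cabs (K z w).
Proof. by move=> Oz Ow; rewrite /K2 patchE mem_set. Qed.

Lemma K2_ge0 p : 0 <= K2 p.
Proof. by rewrite /K2 patchE; case: ifP. Qed.

Lemma K2_measurable : measurable_fun setT K2.
Proof.
apply/(measurable_restrict _ _ _) => //; first by apply: measurableX; exact: mOm.
by rewrite setTI; exact: K_joint_measurable.
Qed.

Lemma tonelli_Om (g : V * V -> R) : (forall p, 0 <= g p) ->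
  measurable_fun setT (g : borel R n * borel R n -> R) ->
  (\int[sigma]_(z in Om) \int[sigma]_(w in Om) (g (z, w))%:E =
   \int[sigma]_(w in Om) \int[sigma]_(z in Om) (g (z, w))%:E)%E.
Proof.
move=> g0 mg.
pose G := ((fun p : borel R n * borel R n => (g p)%:E) \_ (bOm `*` bOm)).
have G0 p : (0 <= G p)%E by rewrite /G patchE; case: ifP => _; rewrite ?lee_fin.
have mG : measurable_fun setT G.
  apply/(measurable_restrict _ _ _) => //; first by apply: measurableX; exact: mOm.
  by rewrite setTI; apply: measurable_funTS; exact/measurable_EFinP.
have GE z w : G (z, w) = if z \in bOm then (if w \in bOm then (g (z, w))%:E else 0%E) else 0%E.
  rewrite /G patchE in_setX /=; by case: (z \in bOm); case: (w \in bOm).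
have h := @fubini_tonelli _ _ (borel R n) (borel R n) R sigma sigma G mG G0.
transitivity (\int[sigma]_z \int[sigma]_w G (z, w))%E.
  rewrite [LHS](@integral_mkcond _ (borel R n)).
  apply: eq_integral => z _; rewrite patchE [in RHS]integral_mkcond.
  case: ifPn => zO; last by apply/esym/integral0_eq => w _; rewrite patchT ?GE ?(negbTE zO)// in_setT.
  rewrite [LHS](@integral_mkcond _ (borel R n)).
  by apply: eq_integral => w _; rewrite [RHS]patchT ?in_setT// GE zO patchE.
rewrite h [RHS](@integral_mkcond _ (borel R n)).
apply: eq_integral => w _; rewrite patchE.
case: ifPn => wO; last by apply/integral0_eq => z _; rewrite GE (negbTE wO) if_same.
rewrite [RHS](@integral_mkcond _ (borel R n)).
by apply: eq_integral => z _; rewrite GE wO patchE; case: ifP.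
Qed.

Lemma inner_integral_measurable (g : V * V -> R) : (forall p, 0 <= g p) ->
  measurable_fun setT (g : borel R n * borel R n -> R) ->
  measurable_fun bOm ((fun z => \int[sigma]_(w in Om) (g (z, w))%:E)%E : borel R n -> \bar R).
Proof.
move=> g0 mg.
pose G (p : borel R n * borel R n) := (g p * \1_bOm p.2)%:E.
have G0 p : (0 <= G p)%E by rewrite lee_fin mulr_ge0.
have mG : measurable_fun setT G.
  apply/measurable_EFinP; apply: measurable_funM => //.
  by apply: measurableT_comp => //; apply: measurable_indic; exact: mOm.
have := @measurable_fun_fubini_tonelli_F _ _ (borel R n) (borel R n) R sigma G mG G0.
move=> h; apply: measurable_funTS; rewrite (_ : (fun _ => _) = fubini_F sigma G) //.
apply/funext => z; rewrite /fubini_F [LHS](@integral_mkcond _ (borel R n)).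
apply: (@eq_integral _ (borel R n) R sigma setT) => w _.
by rewrite patchE /G /= indicE; case: ifP => _; rewrite ?mulr1// mulr0.
Qed.

End JointMeasurability.

(** Only the factor k^eta of k is estimated by k <= uxy; the rest k^(1 - eta) stays for the
    Rudin-Forelli integral, and u^eta is the gain. *)
Lemma powR_split_le (R : realType) (k x y u eta s : R) : 0 <= k -> 0 < x -> 0 < y -> 0 < u ->
  0 < eta -> k <= u * (x * y) ->
  k * y `^ s <= u `^ eta * x `^ eta * (k `^ (1 - eta) * y `^ (s + eta)).
Proof.
move=> k0 x0 y0 u0 e0 h.
have Ke1 : k = k `^ (1 - eta) * k `^ eta.
  by rewrite -powRD ?subrK ?powRr1// oner_eq0.
have Ke2 : k `^ eta <= u `^ eta * x `^ eta * y `^ eta.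
  rewrite -mulrA -!powRM ?mulr_ge0 ?(ltW u0) ?(ltW x0) ?(ltW y0)//.
  apply: ge0_ler_powR; rewrite ?nnegrE ?(ltW e0)//.
  by rewrite !mulr_ge0// ltW.
rewrite powRD; last by rewrite (gt_eqF y0) implybT.
rewrite {1}Ke1.
apply: le_trans (_ : k `^ (1 - eta) * (u `^ eta * x `^ eta * y `^ eta) * y `^ s <= _).
  by rewrite ler_wpM2r ?powR_ge0// ler_wpM2l ?powR_ge0.
by rewrite le_eqVlt; apply/orP; left; apply/eqP; ring.
Qed.

(** * Weighted kernel integrals *)

Section SchurTest.
Context (R : realType) (n : nat) (B : bergman_data R n).
Hypothesis hB : bergman_type B.
Local Notation C := (Cplx R).
Local Notation V := (Cspace R n).
Local Notation E := (V -> nat -> C).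
Local Notation Om := (Om B).
Local Notation sigma := (sigma B).
Local Notation K := (K B).
Local Notation dist := (dist B).
Local Notation phi := (phi B).
Local Notation normK := (normK B).
Local Notation bOm := (Om : set (borel R n)).
Local Notation mOm := (mOm hB).
Implicit Types (f g : E).

Lemma normK_powR_measurable (s : R) : measurable_fun bOm ((fun w => normK w `^ s) : borel R n -> R).
Proof. exact: (measurableT_comp (@measurable_powR R s) (normK_measurable hB)). Qed.

Lemma cabsK_measurable z : Om z -> measurable_fun bOm ((fun w => cabs (K z w)) : borel R n -> R).
Proof. by move=> Oz; exact: (measurable_cabs (K_cmeas hB Oz)). Qed.

Lemma cabsK_powR_measurable (p : R) z : Om z ->
  measurable_fun bOm ((fun w => cabs (K z w) `^ p) : borel R n -> R).
Proof. by move=> Oz; exact: (measurableT_comp (@measurable_powR R p) (cabsK_measurable Oz)). Qed.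

Lemma rudin_forelli_integral (r s : R) : rudin_forelli_bounded B r s -> exists2 M : R, 0 <= M &
  forall z, Om z -> (\int[sigma]_(w in Om) (cabs (K z w) `^ ((r + s) / 2) * normK w `^ (2 - r))%:E <=
    (M * normK z `^ s)%:E)%E.
Proof.
move=> [M HM]; exists (Num.max M 0); first by rewrite le_max lexx orbT.
move=> z Oz; have nz := normK_gt0 hB Oz; have nzs := powR_gt0 s nz.
pose g w := cabs (ipC B (K z) (K w)) `^ ((r + s) / 2) / (normK z `^ s * normK w `^ r) * normK w ^+ 2.
have e w : Om w -> cabs (K z w) `^ ((r + s) / 2) * normK w `^ (2 - r) = normK z `^ s * g w.
  move=> Ow; have nw := normK_gt0 hB Ow; have nwr := powR_gt0 r nw.
  rewrite /g (ipC_K hB Oz Ow) powRB; last by rewrite (gt_eqF nw) implybT.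
  rewrite (powR_mulrn 2 (ltW nw)).
  move: (_ `^ _) (normK w ^+ 2) (normK z `^ s) nzs (normK w `^ r) nwr => x y a /gt_eqF a0 b /gt_eqF b0.
  by field; rewrite a0 b0.
rewrite (eq_integral (fun w : borel R n => ((normK z `^ s)%:E * (g w)%:E)%E)); last first.
  by move=> w /set_mem Ow; rewrite (e w Ow) EFinM.
have g0 w : 0 <= g w by rewrite /g mulr_ge0 ?sqr_ge0// divr_ge0 ?mulr_ge0 ?powR_ge0.
have mg : measurable_fun bOm (g : borel R n -> R).
  have : measurable_fun bOm ((fun w => (normK z `^ s)^-1 * (cabs (K z w) `^ ((r + s) / 2) * normK w `^ (2 - r))) : borel R n -> R).
    apply: measurable_funM => //; apply: measurable_funM; first exact: cabsK_powR_measurable.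
    exact: normK_powR_measurable.
  apply: eq_measurable_fun => w /set_mem Ow; rewrite (e w Ow) mulKf// gt_eqF//.
rewrite (@ge0_integralZl_EFin _ (borel R n) R sigma bOm mOm); first last.
- exact: powR_ge0.
- exact/measurable_EFinP.
- by move=> w _; rewrite lee_fin.
rewrite EFinM muleC; apply: lee_wpmul2r; first by rewrite lee_fin powR_ge0.
by apply: le_trans (HM z Oz) _; rewrite lee_fin le_max lexx.
Qed.

Definition far_set (rho : R) (z : V) : set V := Om `&` [set w | rho < dist z w].

Lemma far_set_measurable rho z : Om z -> measurable (far_set rho z : set (borel R n)).
Proof.
move=> Oz; have := dist_measurable hB Oz mOm (measurable_itv `]rho, +oo[).
by rewrite preimage_itvoy.
Qed.

Definition far_ind (rho : R) (z w : V) : R := (`[< far_set rho z w >])%:R.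

Lemma far_ind_in rho z w : far_set rho z w -> far_ind rho z w = 1.
Proof. by move=> h; rewrite /far_ind asboolT. Qed.

Lemma far_ind_out rho z w : ~ far_set rho z w -> far_ind rho z w = 0.
Proof. by move=> h; rewrite /far_ind asboolF. Qed.

Lemma far_ind_ge0 rho z w : 0 <= far_ind rho z w.
Proof. exact: ler0n. Qed.

Lemma far_ind_measurable rho z : Om z -> measurable_fun bOm (far_ind rho z : borel R n -> R).
Proof.
move=> Oz; rewrite (_ : far_ind rho z = \1_(far_set rho z : set (borel R n))).
  by apply: measurable_indic; exact: far_set_measurable.
by apply/funext => w; rewrite indicE.
Qed.

(** If w is far from z, then [phi z w] is far from 0 and its kernel norm exceeds L, which gains a
    factor 1/L over the Cauchy-Schwarz bound for the kernel. *)
Lemma cabsK_far : exists2 c : R, 0 < c & forall L : R, 0 < L -> exists2 rho : R, 0 <= rho &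
  forall z w, Om z -> far_set rho z w -> L * cabs (K z w) <= c * (normK z * normK w).
Proof.
have [c c0 Hc] := K_two_sided hB; exists c => // L L0.
have [q q0 Hq] := bt_quasi_inv hB.
have [r Hr] := bt_normK_infty hB L.
exists (q * Num.max r 0); first by rewrite mulr_ge0 ?(ltW q0)// le_max lexx orbT.
move=> z w Oz [Ow /= far]; have Op := phiOm hB Oz Ow; have O0 := bt_0 hB.
have nz := normK_gt0 hB Oz; have nw := normK_gt0 hB Ow; have np := normK_gt0 hB Op.
have Lp : L < normK (phi z w).
  apply: (Hr _ Op); rewrite (distC hB Op O0).
  have [h _] := Hq z z w Oz Oz Ow; rewrite (phi_self hB Oz) in h.
  have : q * Num.max r 0 < q * dist 0 (phi z w) by apply: lt_le_trans far h.
  by rewrite ltr_pM2l// gt_max => /andP[].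
have [h _] := Hc z w Oz Ow.
apply: (@le_trans _ _ (L * (c * (normK z * normK w / normK (phi z w))))).
  by rewrite ler_wpM2l// ltW.
have -> : L * (c * (normK z * normK w / normK (phi z w))) =
  (c * (normK z * normK w)) * (L / normK (phi z w)) by ring.
rewrite ler_piMr//; first by rewrite !mulr_ge0// ltW.
by rewrite ler_pdivrMr// mul1r ltW.
Qed.

(** The pair (2 - s, s) puts the kernel to the power 1, the pair (2 - s - eta, s - eta) to the power
    1 - eta. With [kappa] in (0, 2), small s and eta leave both pairs on the two sides of [kappa];
    when equal exponents are allowed, s = 1 and eta = 1/2 give (1, 1) and (1/2, 1/2). *)
Lemma rudin_forelli_exponents : exists s eta : R, [/\ 0 < s, 0 < eta, eta < 1,
  rudin_forelli_bounded B (2 - s) s & rudin_forelli_bounded B (2 - s - eta) (s - eta)].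
Proof.
have [[kappa [k0 k2 H]]|H] := bt_rudin_forelli hB; last first.
  exists 1, (1 / 2); split => //; try lra.
    by rewrite (_ : 2 - 1 = 1); [exact: H|lra].
  by rewrite (_ : 2 - 1 - 1 / 2 = 1 - 1 / 2); [apply: H; lra|lra].
pose m := Num.min kappa (2 - kappa).
have m0 : 0 < m by rewrite lt_min k0 subr_gt0.
have mk : m <= kappa by rewrite ge_min lexx.
have mk2 : m <= 2 - kappa by rewrite ge_min lexx orbT.
clearbody m; exists (m / 2), (m / 4); split; try lra; apply: H; lra.
Qed.

(* The weight is a power of [normK]; the second bound trades part of the kernel against
   the growth of [normK] to gain a factor tending to [0] far from the diagonal. *)
Theorem schur_test : exists s : R, [/\ 0 < s,
  exists2 A : R, 0 <= A & forall z, Om z ->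
    (\int[sigma]_(w in Om) (cabs (K z w) * normK w `^ s)%:E <= (A * normK z `^ s)%:E)%E &
  forall e : R, 0 < e -> exists2 rho : R, 0 <= rho & forall z, Om z ->
    (\int[sigma]_(w in Om) (cabs (K z w) * normK w `^ s * far_ind rho z w)%:E <=
     (e * normK z `^ s)%:E)%E].
Proof.
have [s [eta [s0 eta0 eta1 H1 H2]]] := rudin_forelli_exponents.
exists s; split => //.
  have [A A0 HA] := rudin_forelli_integral H1; exists A => // z Oz.
  apply: le_trans (HA z Oz); rewrite le_eqVlt; apply/orP; left; apply/eqP.
  apply: eq_integral => w _; rewrite (_ : (2 - s + s) / 2 = 1); last lra.
  by rewrite powRr1// subKr.
move=> e e0; have [M M0 HM] := rudin_forelli_integral H2.
have [c c0 Hc] := cabsK_far.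
have eM : 0 < e / (M + 1) by rewrite divr_gt0// ltr_wpDl.
(* The smallness required of the far kernel: only the power u^eta enters the integral, and it has to
   absorb the constant [M]. *)
pose u := (e / (M + 1)) `^ eta^-1; have u0 : 0 < u by exact: powR_gt0.
have ueta : u `^ eta = e / (M + 1).
  by rewrite /u -powRrM mulVf ?gt_eqF// powRr1// ltW.
have [rho rho0 Hrho] := Hc (c / u) (divr_gt0 c0 u0); exists rho => // z Oz.
have nz := normK_gt0 hB Oz.
have farK w : far_set rho z w -> cabs (K z w) <= u * (normK z * normK w).
  move=> /(Hrho _ _ Oz); rewrite mulrAC ler_pdivrMr// -mulrA ler_pM2l//.
  by rewrite mulrC.
pose q w := cabs (K z w) `^ ((2 - s - eta + (s - eta)) / 2) * normK w `^ (2 - (2 - s - eta)).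
have q0 w : 0 <= q w by rewrite mulr_ge0// powR_ge0.
have qE w : q w = cabs (K z w) `^ (1 - eta) * normK w `^ (s + eta).
  by rewrite /q; congr (_ `^ _ * _ `^ _); lra.
have mq : measurable_fun bOm (q : borel R n -> R).
  by apply: measurable_funM; [exact: cabsK_powR_measurable|exact: normK_powR_measurable].
have HMq : (\int[sigma]_(w in Om) (q w)%:E <= (M * normK z `^ (s - eta))%:E)%E := HM z Oz.
clearbody q.
have k0 : 0 <= e / (M + 1) * normK z `^ eta by apply: mulr_ge0; [exact: ltW|exact: powR_ge0].
have pw (w : V) : Om w -> cabs (K z w) * normK w `^ s * far_ind rho z w <=
    e / (M + 1) * normK z `^ eta * q w.
  have g0 (x y b : R) : b = 0 -> 0 <= y -> x * b <= y by move=> -> y0; rewrite mulr0.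
  have g1 (x y b : R) : b = 1 -> x <= y -> x * b <= y by move=> -> y0; rewrite mulr1.
  move=> Ow; have [fw|nfw] := pselect (far_set rho z w); last first.
    exact: (g0 _ _ _ (far_ind_out nfw) (mulr_ge0 k0 (q0 w))).
  have nw := normK_gt0 hB Ow; apply: (g1 _ _ _ (far_ind_in fw)).
  by rewrite qE -ueta; exact: powR_split_le (cabs_ge0 _) nz nw u0 eta0 (farK _ fw).
apply: (@le_trans _ _ (\int[sigma]_(w in Om) ((e / (M + 1) * normK z `^ eta)%:E * (q w)%:E))%E).
  apply: (@ge0_le_integral _ (borel R n) R sigma bOm mOm).
  - move=> w _; rewrite lee_fin; exact: (mulr_ge0 (mulr_ge0 (cabs_ge0 _) (powR_ge0 _ _)) (far_ind_ge0 _ _ _)).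
  - apply/measurable_EFinP; apply: measurable_funM.
      by apply: measurable_funM; [exact: cabsK_measurable|exact: normK_powR_measurable].
    exact: far_ind_measurable.
  - by apply: measurable_funeM; exact/measurable_EFinP.
  - by move=> w Ow; rewrite -EFinM lee_fin; exact: pw.
rewrite (@ge0_integralZl_EFin _ (borel R n) R sigma bOm mOm); first last.
- exact: k0.
- exact/measurable_EFinP.
- by move=> w _; rewrite lee_fin.
apply: le_trans (lee_wpmul2l _ HMq) _; first by rewrite lee_fin.
rewrite -EFinM lee_fin powRB; last by rewrite (gt_eqF nz) implybT.
have ne := powR_gt0 eta nz; have ns := powR_ge0 (normK z) s.
have M1 : 0 < M + 1 by rewrite ltr_wpDl.
have -> : e / (M + 1) * normK z `^ eta * (M * (normK z `^ s / normK z `^ eta)) =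
   e * normK z `^ s * (M / (M + 1)).
  move: (normK z `^ eta) ne (normK z `^ s) => x x0 y; field.
  by rewrite (gt_eqF x0) (gt_eqF M1).
rewrite ler_piMr ?mulr_ge0 ?(ltW e0)//.
by rewrite ler_pdivrMr// mul1r lerDl.
Qed.

End SchurTest.

(** The Cauchy-Schwarz inequality for integrals, with the pointwise bound r^2 <= uv expressed by a
    parameter t instead of square roots, and with the integral of [v] possibly infinite. *)
Lemma am_gm_integral d (T : measurableType d) (R : realType) (mu : {measure set T -> \bar R})
    (D : set T) (mD : measurable D) (r u v : T -> R) (c p : R) :
  measurable_fun D r -> measurable_fun D u -> measurable_fun D v ->
  (forall x, D x -> 0 <= r x) -> (forall x, D x -> 0 <= u x) -> (forall x, D x -> 0 <= v x) ->
  (forall x t, D x -> 0 < t -> r x <= t / 2 * u x + (2 * t)^-1 * v x) ->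
  0 <= c -> 0 < p -> (c%:E <= \int[mu]_(x in D) (r x)%:E)%E ->
  (\int[mu]_(x in D) (u x)%:E <= p%:E)%E ->
  ((c ^+ 2)%:E <= p%:E * \int[mu]_(x in D) (v x)%:E)%E.
Proof.
move=> mr mu' mv r0 u0 v0 H c0 p0 cr up.
have v0' : (0 <= \int[mu]_(x in D) (v x)%:E)%E by apply: integral_ge0 => x Dx; rewrite lee_fin v0.
have [->|cn0] := eqVneq c 0; first by rewrite expr0n mule_ge0// lee_fin ltW.
have cp : 0 < c by rewrite lt_def cn0.
(* For this t the first term is at most c/2 and can be absorbed on the left. *)
pose t := c / p; have t0 : 0 < t by rewrite divr_gt0.
have t2 : 0 <= t / 2 by rewrite divr_ge0// ltW.
have t2' : 0 <= (2 * t)^-1 by rewrite invr_ge0 mulr_ge0// ltW.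
have mE (q : T -> R) : measurable_fun D q -> measurable_fun D (EFin \o q).
  by move=> mq; apply/measurable_EFinP.
have : (c%:E <= (t / 2)%:E * p%:E + ((2 * t)^-1)%:E * \int[mu]_(x in D) (v x)%:E)%E.
  apply: le_trans cr _.
  apply: (@le_trans _ _ (\int[mu]_(x in D) ((t / 2)%:E * (u x)%:E + ((2 * t)^-1)%:E * (v x)%:E))%E).
    apply: ge0_le_integral => //.
    - exact: mE.
    - by apply: emeasurable_funD; apply: measurable_funeM; exact: mE.
    - by move=> x Dx; rewrite -!EFinM -EFinD lee_fin; exact: H.
  rewrite ge0_integralD//; first last.
  - by apply: measurable_funeM; exact: mE.
  - by move=> x Dx; rewrite -EFinM lee_fin mulr_ge0// v0.
  - by apply: measurable_funeM; exact: mE.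
  - by move=> x Dx; rewrite -EFinM lee_fin mulr_ge0// u0.
  rewrite !ge0_integralZl_EFin//; try exact: mE.
  by apply: leeD => //; apply: lee_wpmul2l.
case: (\int[mu]_(x in D) _)%E v0' => [q|_ _|//].
  rewrite lee_fin => q0; rewrite -!EFinM -EFinD !lee_fin => h.
  have e1 : t / 2 * p = c / 2 by rewrite /t; field; rewrite gt_eqF.
  have e2 : (2 * t)^-1 * q = p * q / (2 * c).
    by rewrite /t; field; rewrite !gt_eqF.
  rewrite e1 e2 in h; have : c / 2 <= p * q / (2 * c) by lra.
  by rewrite ler_pdivlMr ?mulr_gt0// expr2; lra.
by rewrite gt0_muley ?lte_fin// leey.
Qed.

Lemma cabs_cint_integral d (T : measurableType d) (R : realType) (mu : {measure set T -> \bar R})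
    (D : set T) (mD : measurable D) (h : T -> Cplx R) : cintegrable mu D h ->
  ((cabs (cint mu D h))%:E <= \int[mu]_(x in D) (cabs (h x))%:E)%E.
Proof.
move=> ih; have ic := integrable_cabs mD ih.
have := @cabs_cint _ _ _ _ _ mD h (fun x => cabs (h x)) (cintegrable_meas ih) ic (fun x _ => lexx _).
rewrite -lee_fin => h1; apply: le_trans h1 _.
rewrite /Rintegral fineK// ; exact: integrable_fin_num.
Qed.

(** * Almost commutation with slowly varying functions *)

Section Localization.
Context (R : realType) (n : nat) (B : bergman_data R n).
Hypothesis hB : bergman_type B.
Local Notation C := (Cplx R).
Local Notation V := (Cspace R n).
Local Notation E := (V -> nat -> C).
Local Notation Om := (Om B).
Local Notation sigma := (sigma B).
Local Notation K := (K B).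
Local Notation dist := (dist B).
Local Notation bOm := (Om : set (borel R n)).
Local Notation mOm := (mOm hB).
Implicit Types (f g : E).

Definition smul (p : V -> R) f : E := fun z k => toC (p z) * f z k.

(** Size and variation are bounded in square sum over the members, so the constants can be
    independent of [m] for families with bounded overlap. A small [L] means slow variation for
    [dist]. *)
Definition loc_family (m : nat) (psi : nat -> V -> R) (N L : R) : Prop :=
  [/\ forall j, measurable_fun bOm (psi j : borel R n -> R),
      forall z, Om z -> \sum_(j < m) psi j z ^+ 2 <= N &
      forall z w, Om z -> Om w -> \sum_(j < m) (psi j z - psi j w) ^+ 2 <= L * dist z w ^+ 2].

(* Multiplication by a slowly varying family almost commutes with [A], in square sum
   and uniformly in the number of members. *)
Definition localizable (A : E -> E) := forall N, 0 <= N -> forall e, 0 < e ->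
  exists2 L, 0 < L & forall m psi, loc_family m psi N L -> forall f, L2 B f ->
    \sum_(j < m) normB B (smul (psi j) (A f) - A (smul (psi j) f)) ^+ 2 <= e * normB B f ^+ 2.

Lemma sqnorm_smul p f z : sqnorm_l2 (smul p f z) = ((p z ^+ 2)%:E * sqnorm_l2 (f z))%E.
Proof.
rewrite /sqnorm_l2 -nneseriesZl; last by move=> k _; rewrite lee_fin sqr_ge0.
apply: eq_eseriesr => k _.
by rewrite /smul cabsM cabs_toC exprMn real_normK ?num_real.
Qed.

Lemma smul_L2 (p : V -> R) (M : R) f : measurable_fun bOm (p : borel R n -> R) -> 0 <= M ->
  (forall z, Om z -> `|p z| <= M) -> L2 B f ->
  L2 B (smul p f) /\ normB B (smul p f) <= M * normB B f.
Proof.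
move=> mp M0 pM Lf; have /L2P[_ mf _] := Lf; apply: (L2_scale mOm Lf _ M0).
  by move=> k; apply: cmeasM; [exact: cmeas_toC|exact: mf].
move=> z Oz; rewrite sqnorm_smul; apply: lee_wpmul2r; first exact: sqnorm_l2_ge0.
by rewrite lee_fin -[p z ^+ 2]real_normK ?num_real// lerXn2r ?nnegrE// pM.
Qed.

Lemma loc_family_norm m psi N L j z : loc_family m psi N L -> Om z -> (j < m)%N ->
  `|psi j z| <= Num.sqrt N.
Proof.
move=> [_ h _] Oz jm; have N0 : 0 <= N.
  by apply: le_trans (h z Oz); apply: sumr_ge0 => i _; exact: sqr_ge0.
rewrite -(@ler_pXn2r _ 2)// ?nnegrE ?sqrtr_ge0// real_normK ?num_real// sqr_sqrtr//.
apply: le_trans (h z Oz); rewrite (bigD1 (Ordinal jm)) //= lerDl.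
by apply: sumr_ge0 => i _; exact: sqr_ge0.
Qed.

Lemma loc_family_L2 m psi N L j f : loc_family m psi N L -> (j < m)%N -> L2 B f ->
  L2 B (smul (psi j) f) /\ normB B (smul (psi j) f) <= Num.sqrt N * normB B f.
Proof.
move=> lf jm Lf; apply: smul_L2 => //; first by case: lf.
by move=> z Oz; exact: loc_family_norm lf Oz jm.
Qed.

Section Commutator.
Variables (h : V -> R) (A : R).
Hypothesis h0 : forall z, Om z -> 0 < h z.
Hypothesis mh : measurable_fun bOm (h : borel R n -> R).
Hypothesis mhV : measurable_fun bOm ((fun w => (h w)^-1) : borel R n -> R).
Hypothesis A0 : 0 < A.
Hypothesis hA : forall z, Om z ->
  (\int[sigma]_(w in Om) (cabs (K z w) * h w)%:E <= (A * h z)%:E)%E.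

Let kernel_integrable f z k : L2 B f -> Om z ->
  @cintegrable _ (borel R n) R sigma bOm (fun w => f w k * Num.conj (K z w)).
Proof.
move=> Lf Oz; have := L2_ip_integrable mOm Lf (berg_L2 (Ke_berg hB k Oz)).
by apply: (eq_cintegrable mOm) => w _; rewrite /Ke /embed ip_l2_scale_e.
Qed.

Lemma commutator_kernel (p : V -> R) (M : R) f z k : measurable_fun bOm (p : borel R n -> R) -> 0 <= M ->
  (forall z, Om z -> `|p z| <= M) -> L2 B f -> Om z ->
  (smul p (bproj B f) - bproj B (smul p f)) z k =
    @cint _ (borel R n) R sigma bOm (fun w => toC (p z - p w) * (f w k * Num.conj (K z w))) /\
  @cintegrable _ (borel R n) R sigma bOm (fun w => toC (p z - p w) * (f w k * Num.conj (K z w))).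
Proof.
move=> mp M0 pM Lf Oz; have [Lpf _] := smul_L2 mp M0 pM Lf.
have i1 := cintegrableZ mOm (toC (p z)) (kernel_integrable k Lf Oz).
have i2 := kernel_integrable k Lpf Oz.
have e w : toC (p z - p w) * (f w k * Num.conj (K z w)) =
    toC (p z) * (f w k * Num.conj (K z w)) - smul p f w k * Num.conj (K z w).
  by rewrite toCD toCN /smul; ring.
split; last by apply: (eq_cintegrable mOm) (cintegrableB mOm i1 i2) => w _; rewrite e.
rewrite (_ : (fun w => _) = (fun w => toC (p z) * (f w k * Num.conj (K z w)) - smul p f w k * Num.conj (K z w))); last first.
  by apply/funext => w; exact: e.
rewrite (cintB mOm i1 i2) (cintZ mOm _ (kernel_integrable k Lf Oz)).
change (toC (p z) * bproj B f z k - bproj B (smul p f) z k = toC (p z) *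
  cint sigma bOm (fun w => f w k * (K z w)^*) - cint sigma bOm (fun w => smul p f w k * (K z w)^*)).
by rewrite !(bproj_kernel hB)// !ipB_embed.
Qed.

(** Schur's splitting |K| = (|K| h)^(1/2) (|K| / h)^(1/2), applied in each coordinate. The increment
    of [p] goes entirely into the second factor, where it appears squared and can be summed over a
    family. *)
Lemma commutator_sqnorm (p : V -> R) (M : R) f z : measurable_fun bOm (p : borel R n -> R) -> 0 <= M ->
  (forall z, Om z -> `|p z| <= M) -> L2 B f -> Om z ->
  (sqnorm_l2 ((smul p (bproj B f) - bproj B (smul p f))%R z) <= (A * h z)%:E *
    \int[sigma]_(w in Om) (cabs (K z w) * (p z - p w) ^+ 2 * (h w)^-1 * norm_l2 (f w) ^+ 2)%:E)%E.
Proof.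
move=> mp M0 pM Lf Oz; have /L2P[l2f mf _] := Lf.
have mK := cabsK_measurable hB Oz.
have mpz : measurable_fun bOm ((fun w => p z - p w) : borel R n -> R) by apply: measurable_funB.
pose a w := cabs (K z w) * (p z - p w) ^+ 2 * (h w)^-1.
have a0 w : Om w -> 0 <= a w.
  by move=> Ow; apply: mulr_ge0 (mulr_ge0 (cabs_ge0 _) (sqr_ge0 _)) _; rewrite invr_ge0; exact/ltW/h0.
have ma : measurable_fun bOm (a : borel R n -> R).
  by apply: measurable_funM => //; apply: measurable_funM => //; exact: measurable_funX.
have Ah : 0 < A * h z by rewrite mulr_gt0// h0.
have step k : ((cabs ((smul p (bproj B f) - bproj B (smul p f)) z k) ^+ 2)%:E <=
    (A * h z)%:E * \int[sigma]_(w in Om) (a w * cabs (f w k) ^+ 2)%:E)%E.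
  have [-> ig] := commutator_kernel k mp M0 pM Lf Oz.
  have mfk := measurable_cabs (mf k).
  apply: (@am_gm_integral _ (borel R n) R sigma bOm mOm
    (fun w => cabs (toC (p z - p w) * (f w k * Num.conj (K z w)))) (fun w => cabs (K z w) * h w)
    (fun w => a w * cabs (f w k) ^+ 2)) => //.
  - exact: measurable_cabs (cintegrable_meas ig).
  - exact: measurable_funM.
  - by apply: measurable_funM => //; exact: measurable_funX.
  - by move=> w Ow; rewrite mulr_ge0// ltW// h0.
  - by move=> w Ow; rewrite mulr_ge0 ?sqr_ge0// a0.
  - move=> w t Ow t0; have hw := h0 Ow.
    rewrite !cabsM cabs_toC cabs_conj /a -[(p z - p w) ^+ 2]real_normK ?num_real//.
    move: (cabs (K z w)) (cabs_ge0 (K z w)) (cabs (f w k)) (`|p z - p w|) (h w) hw => x x0 y q H H0.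
    have -> : q * (y * x) = x * (q * y) by ring.
    have -> : t / 2 * (x * H) + (2 * t)^-1 * (x * q ^+ 2 * H^-1 * y ^+ 2) =
      x * (t / 2 * H + (2 * t)^-1 * H^-1 * (q * y) ^+ 2) by ring.
    apply: ler_wpM2l => //; move: (q * y) => X.
    rewrite -subr_ge0 (_ : _ - _ = (t * H - X) ^+ 2 * (2 * t * H)^-1).
      by rewrite mulr_ge0 ?sqr_ge0// invr_ge0 !mulr_ge0// ltW.
    by field; rewrite !gt_eqF.
  - exact: (cabs_cint_integral mOm ig).
  - exact: hA.
apply: (@le_trans _ _ (\sum_(k <oo) ((A * h z)%:E * \int[sigma]_(w in Om) (a w * cabs (f w k) ^+ 2)%:E))%E).
  by apply: lee_nneseries => [k _ _|k _]; [rewrite lee_fin sqr_ge0|exact: step].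
have i0 k : (0 <= \int[sigma]_(w in Om) (a w * cabs (f w k) ^+ 2)%:E)%E.
  by apply: integral_ge0 => w Ow; rewrite lee_fin mulr_ge0 ?sqr_ge0// a0.
rewrite nneseriesZl; last by move=> k _; exact: i0.
apply: lee_wpmul2l; first by rewrite lee_fin ltW.
rewrite -(@integral_nneseries _ (borel R n) R sigma bOm mOm
  (fun k w => (a w * cabs (f w k) ^+ 2)%:E)); first last.
- by move=> k w Ow; rewrite lee_fin mulr_ge0 ?sqr_ge0// a0.
- move=> k; apply/measurable_EFinP; apply: measurable_funM => //.
  by apply: measurable_funX; exact: measurable_cabs (mf k).
rewrite le_eqVlt; apply/orP; left; apply/eqP; apply: eq_integral => w /set_mem Ow.
rewrite EFinM (norm_l2_sqr (l2f w Ow)) /sqnorm_l2 -nneseriesZl//.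
by move=> k _; rewrite lee_fin sqr_ge0.
Qed.

End Commutator.

End Localization.

Section LocalizationBproj.
Context (R : realType) (n : nat) (B : bergman_data R n).
Hypothesis hB : bergman_type B.
Local Notation C := (Cplx R).
Local Notation V := (Cspace R n).
Local Notation E := (V -> nat -> C).
Local Notation Om := (Om B).
Local Notation sigma := (sigma B).
Local Notation K := (K B).
Local Notation normK := (normK B).
Local Notation bOm := (Om : set (borel R n)).
Local Notation mOm := (mOm hB).
Implicit Types (f g : E).

Let ph : prehilbert (L2 B) (normB B) (ipB B).
Proof. exact: L2_prehilbert mOm. Qed.

Lemma patch_measurable (q : V -> R) : measurable_fun bOm (q : borel R n -> R) ->
  measurable_fun setT ((q \_ Om) : borel R n -> R).
Proof.
move=> mq; apply/(measurable_restrict _ _ _) => //; first exact: mOm.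
by rewrite setTI.
Qed.

Lemma patch_in (q : V -> R) z : Om z -> (q \_ Om) z = q z.
Proof. by move=> Oz; rewrite patchE mem_set. Qed.

Lemma patch_ge0 (q : V -> R) z : (forall z, Om z -> 0 <= q z) -> 0 <= (q \_ Om) z.
Proof. by move=> q0; rewrite patchE; case: ifPn => // /set_mem; exact: q0. Qed.

Theorem bproj_localizable : localizable B (bproj B).
Proof.
have [s [s0 [A A0 HA] tail]] := schur_test hB.
move=> N N0 e e0.
pose h z := normK z `^ s.
have h0 z : Om z -> 0 < h z by move=> Oz; apply/powR_gt0/(normK_gt0 hB).
have mh : measurable_fun bOm (h : borel R n -> R) by exact: normK_powR_measurable.
have mhV : measurable_fun bOm ((fun w => (h w)^-1) : borel R n -> R).
  rewrite (_ : (fun _ => _) = (fun w => normK w `^ (- s))); first exact: normK_powR_measurable.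
  by apply/funext => w; rewrite powRN.
have {}HA z : Om z -> (\int[sigma]_(w in Om) (cabs (K z w) * h w)%:E <= (A * h z)%:E)%E.
  exact: HA.
have {}tail : forall e : R, 0 < e -> exists2 rho : R, 0 <= rho & forall z, Om z ->
    (\int[sigma]_(w in Om) (cabs (K z w) * h w * far_ind B rho z w)%:E <=
     (e * h z)%:E)%E by exact: tail.
clearbody h.
pose A1 := A + 1; have A10 : 0 < A1 by rewrite ltr_wpDl.
have HA1 z : Om z -> (\int[sigma]_(w in Om) (cabs (K z w) * h w)%:E <= (A1 * h z)%:E)%E.
  by move=> Oz; apply: le_trans (HA z Oz) _; rewrite lee_fin ler_wpM2r ?(ltW (h0 z Oz))// lerDl.
have N10 : 0 < N + 1 by rewrite ltr_wpDl.
(* [e'] bounds the far part and [L] below bounds the near part; each then contributes at most e/(2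
   A1), and the outer Schur constant [A1] restores e. *)
pose e' := e / (8 * (N + 1) * A1).
have e'0 : 0 < e' by rewrite divr_gt0// !mulr_gt0.
have [rho rho0 Hrho] := tail e' e'0.
pose L := e / (2 * A1 * A1 * (rho ^+ 2 + 1)).
have rho1 : 0 < rho ^+ 2 + 1 by rewrite ltr_wpDl// sqr_ge0.
have L0 : 0 < L by rewrite divr_gt0// !mulr_gt0.
exists L => // m psi lf f Lf; have [mpsi Npsi Lpsi] := lf.
have /L2P[l2f mf _] := Lf.
pose F w := norm_l2 (f w) ^+ 2.
have F0 w : 0 <= F w by exact: sqr_ge0.
have mF : measurable_fun bOm (F : borel R n -> R).
  by have /integrableP[/measurable_EFinP] := integrable_norm_l2 mOm Lf.
pose psi' j := psi j \_ Om.
(* The family enters the estimate only through this square sum of increments. The members are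
   extended by zero off [Om] for measurability on the product. *)
pose Phi (p : V * V) := \sum_(j < m) (psi' j p.1 - psi' j p.2) ^+ 2.
have Phi0 p : 0 <= Phi p by apply: sumr_ge0 => j _; exact: sqr_ge0.
pose g (p : V * V) := K2 B p * Phi p * (h \_ Om) p.1 * ((fun w => (h w)^-1 * F w) \_ Om) p.2.
have g0 p : 0 <= g p.
  apply: mulr_ge0; first apply: mulr_ge0; first exact: mulr_ge0 (K2_ge0 _ _) (Phi0 _).
    by apply: patch_ge0 => z Oz; exact/ltW/h0.
  apply: patch_ge0 => z Oz; apply: mulr_ge0 (F0 _); rewrite invr_ge0; exact/ltW/h0.
have mg : measurable_fun setT (g : borel R n * borel R n -> R).
  apply: measurable_funM; first apply: measurable_funM; first apply: measurable_funM.
  - exact: K2_measurable.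
  - apply: measurable_sum => j; apply: measurable_funX; apply: measurable_funB.
      by apply: (measurableT_comp (patch_measurable (mpsi j))) measurable_fst.
    by apply: (measurableT_comp (patch_measurable (mpsi j))) measurable_snd.
  - by apply: (measurableT_comp (patch_measurable mh)) measurable_fst.
  - have mhF : measurable_fun bOm ((fun w => (h w)^-1 * F w) : borel R n -> R) by exact: measurable_funM.
    by apply: (measurableT_comp (patch_measurable mhF)) measurable_snd.
have PhiE z w : Om z -> Om w -> Phi (z, w) = \sum_(j < m) (psi j z - psi j w) ^+ 2.
  by move=> Oz Ow; apply: eq_bigr => j _; rewrite /psi' !patch_in.
have gE z w : Om z -> Om w -> g (z, w) = cabs (K z w) * Phi (z, w) * h z * ((h w)^-1 * F w).
  by move=> Oz Ow; rewrite /g (K2E Oz Ow) !patch_in.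
have cL2 j : (j < m)%N -> L2 B (smul (psi j) (bproj B f) - bproj B (smul (psi j) f)).
  move=> jm; have bpf := berg_L2 (bproj_berg hB Lf).
  have [Ls _] := loc_family_L2 hB lf jm Lf.
  have [Lsp _] := loc_family_L2 hB lf jm bpf.
  exact: (subspaceB (ph_sub ph) Lsp (berg_L2 (bproj_berg hB Ls))).
rewrite -lee_fin -sumEFin.
have -> : (\sum_(j < m) (normB B (smul (psi j) (bproj B f) - bproj B (smul (psi j) f))%R ^+ 2)%:E)%E =
   (\sum_(j < m) \int[sigma]_(z in Om) sqnorm_l2 ((smul (psi j) (bproj B f) - bproj B (smul (psi j) f))%R z))%E.
  by apply: eq_bigr => j _; rewrite (normB_sqr (cL2 j (ltn_ord j))).
have bound z : Om z -> (\sum_(j < m) sqnorm_l2 ((smul (psi j) (bproj B f) - bproj B (smul (psi j) f))%R z) <=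
    A1%:E * \int[sigma]_(w in Om) (g (z, w))%:E)%E.
  move=> Oz; have hz := h0 z Oz.
  pose v j w := cabs (K z w) * (psi j z - psi j w) ^+ 2 * (h w)^-1 * F w.
  have v0 j w : Om w -> 0 <= v j w.
    move=> Ow; apply: mulr_ge0 (mulr_ge0 (mulr_ge0 (cabs_ge0 _) (sqr_ge0 _)) _) (F0 _).
    by rewrite invr_ge0; exact/ltW/h0.
  have mv j : measurable_fun bOm (v j : borel R n -> R).
    apply: measurable_funM => //; apply: measurable_funM => //; apply: measurable_funM.
      exact: cabsK_measurable.
    by apply: measurable_funX; apply: measurable_funB => //; exact: measurable_cst.
  have mvE j : measurable_fun bOm ((fun w => (v j w)%:E) : borel R n -> \bar R) by exact/measurable_EFinP.
  apply: (@le_trans _ _ (\sum_(j < m) (A1 * h z)%:E * \int[sigma]_(w in Om) (v j w)%:E)%E).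
    apply: lee_sum => j _.
    apply: (commutator_sqnorm hB h0 mh mhV A10 HA1 (mpsi j) (sqrtr_ge0 N) _ Lf Oz) => z' Oz'.
    exact: loc_family_norm lf Oz' (ltn_ord j).
  rewrite -ge0_sume_distrr; last first.
    by move=> j _; apply: integral_ge0 => w Ow; rewrite lee_fin; exact: v0.
  rewrite EFinM -muleA; apply: lee_wpmul2l; first by rewrite lee_fin ltW.
  rewrite -(@ge0_integral_sum _ (borel R n) R sigma bOm mOm _ (fun (j : 'I_m) w => (v j w)%:E)); first last.
  - by move=> j w Ow; rewrite lee_fin; exact: v0.
  - by move=> j; exact: mvE.
  rewrite -(@ge0_integralZl_EFin _ (borel R n) R sigma bOm mOm); first last.
  - exact: ltW.
  - by apply: emeasurable_sum => j; exact: mvE.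
  - by move=> w Ow; apply: sume_ge0 => j _; rewrite lee_fin; exact: v0.
  rewrite le_eqVlt; apply/orP; left; apply/eqP; apply: eq_integral => w /set_mem Ow.
  rewrite (gE _ _ Oz Ow) (PhiE _ _ Oz Ow) sumEFin -EFinM; congr EFin.
  rewrite -!mulr_suml -mulr_sumr; ring.
rewrite -(@ge0_integral_sum _ (borel R n) R sigma bOm mOm _ (fun (j : 'I_m) z =>
  sqnorm_l2 ((smul (psi j) (bproj B f) - bproj B (smul (psi j) f))%R z))); first last.
- by move=> j z _; exact: sqnorm_l2_ge0.
- by move=> j; have /L2P[_ mc _] := cL2 j (ltn_ord j); exact: (measurable_sqnorm mc).
have mI := inner_integral_measurable hB g0 mg.
apply: (@le_trans _ _ (\int[sigma]_(z in Om) (A1%:E * \int[sigma]_(w in Om) (g (z, w))%:E))%E).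
  apply: (@ge0_le_integral _ (borel R n) R sigma bOm mOm) => //.
  - by move=> z _; apply: sume_ge0 => j _; exact: sqnorm_l2_ge0.
  - apply: emeasurable_sum => j; have /L2P[_ mc _] := cL2 j (ltn_ord j); exact: (measurable_sqnorm mc).
  - exact: measurable_funeM.
rewrite (@ge0_integralZl_EFin _ (borel R n) R sigma bOm mOm) //; first last.
- exact: ltW.
- by move=> z _; apply: integral_ge0 => w _; rewrite lee_fin.
rewrite (tonelli_Om hB g0 mg).
have inner w : Om w -> (\int[sigma]_(z in Om) (g (z, w))%:E <= (e / A1)%:E * (F w)%:E)%E.
  move=> Ow; have hw := h0 w Ow.
  pose c1 := L * rho ^+ 2 * ((h w)^-1 * F w); pose c2 := 4 * N * ((h w)^-1 * F w).
  have hF0 : 0 <= (h w)^-1 * F w by apply: mulr_ge0 (F0 w); rewrite invr_ge0 ltW.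
  have c10 : 0 <= c1 by apply: mulr_ge0 hF0; apply: mulr_ge0 (sqr_ge0 _); exact: ltW.
  have c20 : 0 <= c2 by apply: mulr_ge0 hF0; exact: mulr_ge0.
  pose u z := cabs (K w z) * h z; pose u' z := cabs (K w z) * h z * far_ind B rho w z.
  have u0 z : Om z -> 0 <= u z by move=> Oz; apply: mulr_ge0 (cabs_ge0 _) _; exact/ltW/h0.
  have u'0 z : Om z -> 0 <= u' z by move=> Oz; apply: mulr_ge0 (u0 z Oz) (far_ind_ge0 _ _ _ _).
  have mu' : measurable_fun bOm ((fun z => (u z)%:E) : borel R n -> \bar R).
    by apply/measurable_EFinP; apply: measurable_funM => //; exact: cabsK_measurable.
  have mu2 : measurable_fun bOm ((fun z => (u' z)%:E) : borel R n -> \bar R).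
    apply/measurable_EFinP; apply: measurable_funM; last exact: far_ind_measurable.
    by apply: measurable_funM => //; exact: cabsK_measurable.
  apply: (@le_trans _ _ (\int[sigma]_(z in Om) (c1%:E * (u z)%:E + c2%:E * (u' z)%:E))%E).
    apply: (@ge0_le_integral _ (borel R n) R sigma bOm mOm).
    - by move=> z _; rewrite lee_fin.
    - apply/measurable_EFinP; apply: measurable_funTS.
      by apply: (measurableT_comp mg); apply: measurable_fun_pair.
    - by apply: emeasurable_funD; exact: measurable_funeM.
    - move=> z Oz; rewrite -!EFinM -EFinD lee_fin (gE _ _ Oz Ow) (cabsK_sym hB Ow Oz).
      (* Slow variation is used up to distance [rho]; beyond it the crude bound 4N is paid for by
         the small far mass of the kernel. *)
      have PhiL : Phi (z, w) <= L * rho ^+ 2 + 4 * N * far_ind B rho w z.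
        have [fz|nf] := pselect (far_set B rho w z).
          rewrite (far_ind_in fz) mulr1; apply: (@le_trans _ _ (4 * N)).
            rewrite (PhiE _ _ Oz Ow); apply: (@le_trans _ _ (\sum_(j < m) (2 * psi j z ^+ 2 + 2 * psi j w ^+ 2))).
              apply: ler_sum => j _; have := sqr_ge0 (psi j z + psi j w).
              rewrite sqrrD sqrrB; lra.
            rewrite big_split /= -!mulr_sumr.
            have := Npsi z Oz; have := Npsi w Ow; lra.
          by rewrite lerDr mulr_ge0 ?sqr_ge0// ltW.
        rewrite (far_ind_out nf) mulr0 addr0 (PhiE _ _ Oz Ow).
        apply: le_trans (Lpsi z w Oz Ow) _; apply: ler_wpM2l; first exact: ltW.
        rewrite lerXn2r ?nnegrE//; first exact: (dist_ge0 hB).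
        rewrite leNgt (distC hB Oz Ow); apply/negP => hd; exact: nf.
      apply: (@le_trans _ _ (u z * ((h w)^-1 * F w) * (L * rho ^+ 2 + 4 * N * far_ind B rho w z))).
        rewrite /u; move: (cabs (K w z)) (cabs_ge0 (K w z)) (Phi (z, w)) PhiL (h z) (h0 z Oz) ((h w)^-1 * F w) hF0.
        move=> x x0 P PL y y0 q q0; have -> : x * P * y * q = x * y * q * P by ring.
        by apply: ler_wpM2l => //; rewrite !mulr_ge0// ltW.
      by rewrite /u' /c1 /c2 /u le_eqVlt; apply/orP; left; apply/eqP; ring.
  rewrite (@ge0_integralD _ (borel R n) R sigma bOm mOm); first last.
  - exact: measurable_funeM.
  - by move=> z Oz; rewrite -EFinM lee_fin; exact: mulr_ge0 c20 (u'0 z Oz).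
  - exact: measurable_funeM.
  - by move=> z Oz; rewrite -EFinM lee_fin; exact: mulr_ge0 c10 (u0 z Oz).
  rewrite (@ge0_integralZl_EFin _ (borel R n) R sigma bOm mOm _ _ mu' _ c10); last first.
    by move=> z Oz; rewrite lee_fin; exact: u0.
  rewrite (@ge0_integralZl_EFin _ (borel R n) R sigma bOm mOm _ _ mu2 _ c20); last first.
    by move=> z Oz; rewrite lee_fin; exact: u'0.
  apply: (@le_trans _ _ (c1%:E * (A1 * h w)%:E + c2%:E * (e' * h w)%:E)%E).
    by apply: leeD; apply: lee_wpmul2l; rewrite ?lee_fin//; [exact: HA1|exact: Hrho].
  rewrite -!EFinM -EFinD lee_fin /c1 /c2.
  have hw1 : h w != 0 by rewrite gt_eqF.
  have -> : L * rho ^+ 2 * ((h w)^-1 * F w) * (A1 * h w) + 4 * N * ((h w)^-1 * F w) * (e' * h w) =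
     (L * rho ^+ 2 * A1 + 4 * N * e') * F w.
    by move: (h w) hw1 => x x1; field.
  apply: ler_wpM2r => //.
  have h1 : L * rho ^+ 2 * A1 <= e / A1 / 2.
    have -> : L * rho ^+ 2 * A1 = e / A1 / 2 * (rho ^+ 2 / (rho ^+ 2 + 1)).
      by rewrite /L; field; rewrite !gt_eqF.
    rewrite ler_piMr ?divr_ge0 ?(ltW e0) ?(ltW A10)//.
    by rewrite ler_pdivrMr// mul1r lerDl.
  have h2 : 4 * N * e' <= e / A1 / 2.
    have -> : 4 * N * e' = e / A1 / 2 * (N / (N + 1)).
      by rewrite /e'; field; rewrite !gt_eqF.
    rewrite ler_piMr ?divr_ge0 ?(ltW e0) ?(ltW A10)//.
    by rewrite ler_pdivrMr// mul1r lerDl.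
  lra.
apply: (@le_trans _ _ (A1%:E * \int[sigma]_(w in Om) ((e / A1)%:E * (F w)%:E))%E).
  apply: lee_wpmul2l; first by rewrite lee_fin ltW.
  apply: (@ge0_le_integral _ (borel R n) R sigma bOm mOm).
  - by move=> w _; apply: integral_ge0 => z _; rewrite lee_fin.
  - have mgs : measurable_fun setT ((fun p => g (p.2, p.1)) : borel R n * borel R n -> R).
      by apply: (measurableT_comp mg); apply: measurable_fun_pair; [exact: measurable_snd|exact: measurable_fst].
    exact: (inner_integral_measurable hB (g := fun p => g (p.2, p.1)) (fun p => g0 _) mgs).
  - by apply: measurable_funeM; exact/measurable_EFinP.
  - exact: inner.
rewrite (@ge0_integralZl_EFin _ (borel R n) R sigma bOm mOm); first last.
- by rewrite divr_ge0// ltW.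
- exact/measurable_EFinP.
- by move=> w _; rewrite lee_fin.
rewrite muleA -EFinM mulrC divfK ?gt_eqF// EFinM; apply: lee_wpmul2l; first by rewrite lee_fin ltW.
rewrite (normB_sqr Lf) le_eqVlt; apply/orP; left; apply/eqP; apply: eq_integral => w /set_mem Ow.
by rewrite /F (norm_l2_sqr (l2f w Ow)).
Qed.

End LocalizationBproj.

(** * Truncation of sequences *)

Section EllTwoTruncation.
Context (R : realType).
Local Notation C := (Cplx R).
Implicit Types (a : nat -> C).

Definition trunc (N : nat) a : nat -> C := fun i => if (i < N)%N then a i else 0.

Lemma trunc_sum N a : trunc N a = \sum_(i < N) a i *: e_ i.
Proof.
apply/funext => j; rewrite fct_sumE /trunc; case: ifPn => jN.
  rewrite (bigD1 (Ordinal jN)) //= big1 => [|i ij].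
    by rewrite addr0 -[RHS]/(a j * e_ j j) /e_ eqxx mulr1.
  rewrite -[LHS]/(a i * e_ i j) /e_ (_ : (j == i) = false) ?mulr0//.
  by apply/eqP => ji; move/eqP: ij; apply; exact/val_inj.
rewrite big1// => i _; rewrite -[LHS]/(a i * e_ i j) /e_ gtn_eqF ?mulr0//.
by rewrite (leq_trans (ltn_ord i))// leqNgt.
Qed.

Lemma l2_trunc N a : l2 (trunc N a).
Proof. by apply: (@l2_finite _ _ N) => k Nk; rewrite /trunc ltnNge Nk. Qed.

Lemma trunc_cvg a (e : R) : l2 a -> 0 < e -> exists N, forall m, (N <= m)%N ->
  norm_l2 (a - trunc m a) < e.
Proof.
move=> la e0; pose S N := \sum_(0 <= i < N) cabs (a i) ^+ 2.
have key N : norm_l2 (a - trunc N a) ^+ 2 = norm_l2 a ^+ 2 - S N.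
  have ph := l2_prehilbert R; have lt := l2_trunc N a.
  have tS : norm_l2 (trunc N a) ^+ 2 = S N.
    apply: EFin_inj; rewrite norm_l2_sqr// (@sqnorm_l2_finite _ _ N); last first.
      by move=> k Nk; rewrite /trunc ltnNge Nk.
    by congr EFin; rewrite /S big_mkord; apply: eq_bigr => i _; rewrite /trunc ltn_ord.
  have aS : ip_l2 a (trunc N a) = toC (S N).
    rewrite trunc_sum (@ip_sumr _ _ _ _ _ ph N (fun i => a i *: e_ i) a _ la); last first.
      by move=> i; apply: (subspaceZ _ (ph_sub ph)); exact: l2_e.
    rewrite /S big_mkord toC_sum; apply: eq_bigr => i _.
    by rewrite (ipZr ph _ (l2_e _ i) la) ip_l2_e mulrC mul_conj.
  by rewrite (sqnrmB ph la lt) aS tS /=; lra.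
have /cvgrPdist_lt/(_ (e ^+ 2) (exprn_gt0 2 e0))[N _ HN] := l2_series_cvg la.
exists N => m Nm; have := HN m Nm.
rewrite /series /= -/(S m) -key ger0_norm ?sqr_ge0// => h.
by rewrite -(@ltr_pXn2r _ 2)// ?nnegrE ?norm_l2_ge0// ltW.
Qed.

End EllTwoTruncation.

Lemma mulr_frac_le (R : realType) (t x : R) : 0 <= t -> 0 <= x -> t * (x / (x + 1)) <= t.
Proof.
move=> t0 x0; have x1 : 0 < x + 1 by rewrite ltr_wpDl.
by rewrite ler_piMr// ler_pdivrMr// mul1r lerDl.
Qed.

Lemma sum_le_halves (R : realType) m (w x y : nat -> R) (a b t : R) :
  (forall j, (j < m)%N -> w j <= a * x j + b * y j) -> a * \sum_(j < m) x j <= t / 2 ->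
  b * \sum_(j < m) y j <= t / 2 -> \sum_(j < m) w j <= t.
Proof.
move=> h hx hy; apply: (@le_trans _ _ (\sum_(j < m) (a * x j + b * y j))).
  by apply: ler_sum => j _; exact: h.
rewrite big_split /= -!mulr_sumr; lra.
Qed.

(** * The class of almost commuting operators *)

Section GoodOperators.
Context (R : realType) (n : nat) (B : bergman_data R n).
Hypothesis hB : bergman_type B.
Local Notation C := (Cplx R).
Local Notation V := (Cspace R n).
Local Notation E := (V -> nat -> C).
Local Notation mOm := (mOm hB).
Implicit Types (f g : E).

Let ph : prehilbert (L2 B) (normB B) (ipB B).
Proof. exact: L2_prehilbert mOm. Qed.
Let sL : is_subspace (L2 B).
Proof. exact: ph_sub ph. Qed.

(** These operators act on all of [L2 B], since multiplication by a cutoff does not preserve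
    analyticity. *)
Definition good (A : E -> E) : Prop :=
  [/\ forall f, L2 B f -> L2 B (A f),
      forall (c : C) f g, L2 B f -> L2 B g -> A (c *: f + g) = c *: A f + A g,
      exists2 M : R, 0 <= M & forall f, L2 B f -> normB B (A f) <= M * normB B f &
      localizable B A].

Lemma linear_sub (A : E -> E) : (forall (c : C) f g, L2 B f -> L2 B g -> A (c *: f + g) = c *: A f + A g) ->
  forall f g, L2 B f -> L2 B g -> A (f - g) = A f - A g.
Proof. by move=> Al f g Lf Lg; rewrite addrC -scaleN1r (Al _ _ _ Lg Lf) scaleN1r addrC. Qed.

Lemma bproj_lin (c : C) f g : L2 B f -> L2 B g -> bproj B (c *: f + g) = c *: bproj B f + bproj B g.
Proof.
move=> Lf Lg; have Lcf := subspaceZ c sL Lf; have Lcfg := subspaceD sL Lcf Lg.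
have sb := berg_subspace mOm.
have bf := bproj_berg hB Lf; have bg := bproj_berg hB Lg.
apply: berg_ext; first exact: (bproj_berg hB).
  by apply: (subspaceD sb) bg; exact: (subspaceZ c sb bf).
move=> z k Oz; have LK := berg_L2 (Ke_berg hB k Oz).
rewrite -[RHS]/(c * bproj B f z k + bproj B g z k) !(bproj_kernel hB)//.
exact: (ph_lin ph c Lf Lg LK).
Qed.

Lemma smulB p f g : smul p (f - g) = smul p f - smul p g.
Proof.
apply/funext => z; apply/funext => k.
by rewrite -[LHS]/(toC (p z) * (f z k - g z k)) mulrBr.
Qed.

Lemma smulD p f g : smul p (f + g) = smul p f + smul p g.
Proof.
apply/funext => z; apply/funext => k.
by rewrite -[LHS]/(toC (p z) * (f z k + g z k)) mulrDr.
Qed.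

Lemma good_ext A A' : (forall f, L2 B f -> A f = A' f) -> good A -> good A'.
Proof.
move=> AA' [AL Asub [M M0 HM] lA]; split.
- by move=> f Lf; rewrite -AA'//; exact: AL.
- move=> c f g Lf Lg; have Lcf := subspaceD sL (subspaceZ c sL Lf) Lg.
  by rewrite -(AA' _ Lf) -(AA' _ Lg) -(AA' _ Lcf); exact: Asub.
- by exists M => // f Lf; rewrite -AA'//; exact: HM.
- move=> N N0 e e0; have [L L0 HL] := lA N N0 e e0; exists L; first exact: L0.
  move=> m psi lf f Lf.
  apply: le_trans (HL m psi lf f Lf); rewrite le_eqVlt; apply/orP; left; apply/eqP.
  apply: eq_bigr => j _; have [Ls _] := loc_family_L2 hB lf (ltn_ord j) Lf.
  by rewrite !AA'.
Qed.

Lemma good_bproj : good (bproj B).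
Proof.
split.
- by move=> f Lf; exact/berg_L2/(bproj_berg hB).
- by move=> c f g; exact: bproj_lin.
- by exists 1 => // f Lf; rewrite mul1r; exact: (bproj_norm hB).
- exact: bproj_localizable.
Qed.

(** Leibniz rule for commutators: [psi, AA'] = [psi, A]A' + A[psi, A'], each term controlled in
    square sum. *)
Lemma good_comp A A' : good A -> good A' -> good (A \o A').
Proof.
move=> [AL Alin [M M0 HM] lA] [AL' Alin' [M' M'0 HM'] lA'].
have Asub := linear_sub Alin; split.
- by move=> f Lf; exact/AL/AL'.
- move=> c f g Lf Lg /=; rewrite (Alin' _ _ _ Lf Lg); exact: (Alin _ _ _ (AL' _ Lf) (AL' _ Lg)).
- exists (M * M'); first exact: mulr_ge0.
  move=> f Lf; apply: le_trans (HM _ (AL' _ Lf)) _.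
  by rewrite -mulrA; apply: ler_wpM2l => //; exact: HM'.
move=> N N0 e e0.
have M1 : 0 < M ^+ 2 + 1 by rewrite ltr_wpDl// sqr_ge0.
have M'1 : 0 < M' ^+ 2 + 1 by rewrite ltr_wpDl// sqr_ge0.
have e1 : 0 < e / (4 * (M' ^+ 2 + 1)) by rewrite divr_gt0// mulr_gt0.
have e2 : 0 < e / (4 * (M ^+ 2 + 1)) by rewrite divr_gt0// mulr_gt0.
have [L1 L10 H1] := lA N N0 _ e1; have [L2' L20 H2] := lA' N N0 _ e2.
exists (Num.min L1 L2'); first by rewrite lt_min L10.
move=> m psi lf f Lf.
have lf1 : loc_family B m psi N L1.
  case: lf => a b c; split => // z w Oz Ow; apply: le_trans (c z w Oz Ow) _.
  by rewrite ler_wpM2r ?sqr_ge0// ge_min lexx.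
have lf2 : loc_family B m psi N L2'.
  case: lf => a b c; split => // z w Oz Ow; apply: le_trans (c z w Oz Ow) _.
  by rewrite ler_wpM2r ?sqr_ge0// ge_min lexx orbT.
have LA'f := AL' _ Lf.
have := H1 m psi lf1 _ LA'f; have := H2 m psi lf2 _ Lf => h2 h1.
pose x j := normB B (smul (psi j) (A (A' f)) - A (smul (psi j) (A' f))).
pose y j := normB B (smul (psi j) (A' f) - A' (smul (psi j) f)).
have f0 : 0 <= normB B f ^+ 2 by exact: sqr_ge0.
have hf : normB B (A' f) ^+ 2 <= M' ^+ 2 * normB B f ^+ 2.
  by rewrite -exprMn lerXn2r ?nnegrE ?mulr_ge0 ?normB_ge0//; exact: HM'.
apply: (@sum_le_halves R m (fun j => normB B (smul (psi j) ((A \o A') f) - (A \o A') (smul (psi j) f)) ^+ 2) (fun j => x j ^+ 2) (fun j => y j ^+ 2) 2 (2 * M ^+ 2)).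
- move=> j jm.
  have [Ls _] := loc_family_L2 hB lf jm Lf.
  have [LsA' _] := loc_family_L2 hB lf jm LA'f.
  have [LsA _] := loc_family_L2 hB lf jm (AL _ LA'f).
  have LA's := AL' _ Ls.
  have LAsA' := AL _ LsA'.
  have -> : smul (psi j) ((A \o A') f) - (A \o A') (smul (psi j) f) =
     (smul (psi j) (A (A' f)) - A (smul (psi j) (A' f))) + A (smul (psi j) (A' f) - A' (smul (psi j) f)).
    by rewrite Asub// subrKA.
  have Ly := subspaceB sL LsA' LA's.
  apply: le_trans (sqnrmD_le ph (subspaceB sL LsA LAsA') (AL _ Ly)) _.
  rewrite lerD2l -mulrA; apply: (ler_wpM2l (ler0n R 2)); rewrite -exprMn.
  by rewrite lerXn2r ?nnegrE ?normB_ge0 ?mulr_ge0 ?normB_ge0//; exact: HM.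
- have h3 : \sum_(j < m) x j ^+ 2 <= e / (4 * (M' ^+ 2 + 1)) * (M' ^+ 2 * normB B f ^+ 2).
    by apply: le_trans h1 _; apply: ler_wpM2l (ltW e1) _ _ hf.
  have h4 : e / (4 * (M' ^+ 2 + 1)) * (M' ^+ 2 * normB B f ^+ 2) = e / 4 * normB B f ^+ 2 * (M' ^+ 2 / (M' ^+ 2 + 1)).
    by field; rewrite gt_eqF.
  have h5 : e / 4 * normB B f ^+ 2 * (M' ^+ 2 / (M' ^+ 2 + 1)) <= e / 4 * normB B f ^+ 2.
    by apply: mulr_frac_le (sqr_ge0 _); apply: mulr_ge0 f0; rewrite divr_ge0// ltW.
  move: (\sum_(j < m) x j ^+ 2) h3 => X h3; move: h3 h4 h5; clear; lra.
- apply: le_trans (ler_wpM2l _ h2) _; first by rewrite mulr_ge0// sqr_ge0.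
  have -> : 2 * M ^+ 2 * (e / (4 * (M ^+ 2 + 1)) * normB B f ^+ 2) =
      e * normB B f ^+ 2 / 2 * (M ^+ 2 / (M ^+ 2 + 1)) by field; rewrite gt_eqF.
  by apply: mulr_frac_le (sqr_ge0 _); apply: mulr_ge0; [exact: mulr_ge0 (ltW e0) f0|rewrite invr_ge0].
Qed.

Lemma good_add A A' : good A -> good A' -> good (fun f => A f + A' f).
Proof.
move=> [AL Asub [M M0 HM] lA] [AL' Asub' [M' M'0 HM'] lA']; split.
- by move=> f Lf; apply: (subspaceD sL); [exact: AL|exact: AL'].
- move=> c f g Lf Lg; rewrite (Asub _ _ _ Lf Lg) (Asub' _ _ _ Lf Lg).
  by rewrite scalerDr addrACA.
- exists (M + M'); first exact: addr_ge0.
  move=> f Lf; apply: le_trans (nrm_triangle ph (AL _ Lf) (AL' _ Lf)) _.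
  by rewrite mulrDl; apply: lerD; [exact: HM|exact: HM'].
move=> N N0 e e0; have e4 : 0 < e / 4 by rewrite divr_gt0.
have [L1 L10 H1] := lA N N0 _ e4; have [L2' L20 H2] := lA' N N0 _ e4.
exists (Num.min L1 L2'); first by rewrite lt_min L10.
move=> m psi lf f Lf.
have lf1 : loc_family B m psi N L1.
  case: lf => a b c; split => // z w Oz Ow; apply: le_trans (c z w Oz Ow) _.
  by rewrite ler_wpM2r ?sqr_ge0// ge_min lexx.
have lf2 : loc_family B m psi N L2'.
  case: lf => a b c; split => // z w Oz Ow; apply: le_trans (c z w Oz Ow) _.
  by rewrite ler_wpM2r ?sqr_ge0// ge_min lexx orbT.
have h1 := H1 m psi lf1 _ Lf; have h2 := H2 m psi lf2 _ Lf.
apply: (@sum_le_halves R m (fun j => normB B (smul (psi j) (A f + A' f) - (A (smul (psi j) f) + A' (smul (psi j) f))) ^+ 2)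
   (fun j => normB B (smul (psi j) (A f) - A (smul (psi j) f)) ^+ 2)
   (fun j => normB B (smul (psi j) (A' f) - A' (smul (psi j) f)) ^+ 2) 2 2).
- move=> j jm.
  have [Ls _] := loc_family_L2 hB lf jm Lf.
  have [LsA _] := loc_family_L2 hB lf jm (AL _ Lf).
  have [LsA' _] := loc_family_L2 hB lf jm (AL' _ Lf).
  rewrite smulD opprD addrACA.
  exact: (sqnrmD_le ph (subspaceB sL LsA (AL _ Ls)) (subspaceB sL LsA' (AL' _ Ls))).
- by move: (\sum_(j < m) _) (normB B f ^+ 2) h1; clear; move=> *; lra.
- by move: (\sum_(j < m) _) (normB B f ^+ 2) h2; clear; move=> *; lra.
Qed.

End GoodOperators.

(** * Toeplitz operators almost commute *)

Section ToeplitzLocalization.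
Context (R : realType) (n : nat) (B : bergman_data R n).
Hypothesis hB : bergman_type B.
Local Notation C := (Cplx R).
Local Notation V := (Cspace R n).
Local Notation E := (V -> nat -> C).
Local Notation Om := (Om B).
Local Notation sigma := (sigma B).
Local Notation dist := (dist B).
Local Notation bOm := (Om : set (borel R n)).
Local Notation bcmeas h := (@cmeas _ (borel R n) R bOm h).
Local Notation mOm := (mOm hB).
Implicit Types (f g : E).

Let ph : prehilbert (L2 B) (normB B) (ipB B).
Proof. exact: L2_prehilbert mOm. Qed.
Let ph2 := l2_prehilbert R.

Section Multiplication.
Variable u : V -> (nat -> C) -> (nat -> C).
Hypothesis hu : BUCO B u.

Let u_l2 z a : Om z -> l2 a -> l2 (u z a).
Proof. by move=> Oz la; case: hu => /(_ z Oz)[h _ _] _ _ _; exact: h. Qed.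

Let u_lin z c a b : Om z -> l2 a -> l2 b -> u z (c *: a + b) = c *: u z a + u z b.
Proof. by move=> Oz la lb; case: hu => /(_ z Oz)[_ h _] _ _ _; exact: h. Qed.

Let u0 z : Om z -> u z 0 = 0.
Proof.
move=> Oz; have l0 := l2_0 R; have := u_lin 1 Oz l0 l0; rewrite !scale1r addr0 => /eqP.
by rewrite -subr_eq0 opprD addrA subrr sub0r oppr_eq0 => /eqP.
Qed.

Let uB z a b : Om z -> l2 a -> l2 b -> u z (a - b) = u z a - u z b.
Proof. by move=> Oz la lb; rewrite addrC -scaleN1r (u_lin _ Oz lb la) scaleN1r addrC. Qed.

Let uZ z c a : Om z -> l2 a -> u z (c *: a) = c *: u z a.
Proof. by move=> Oz la; have := u_lin c Oz la (l2_0 R); rewrite (u0 Oz) !addr0. Qed.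

Let u_bound : exists2 M : R, 0 <= M & forall z a, Om z -> l2 a -> norm_l2 (u z a) <= M * norm_l2 a.
Proof.
case: (hu) => _ [M HM] _ _; exists (Num.max M 0); first by rewrite le_max lexx orbT.
move=> z a Oz la; apply: (@opnorm_le_bound _ _ _ _ _ ph2 (u z)) => //.
- by move=> b lb; exact: u_l2.
- by move=> c b b' lb lb'; exact: u_lin.
- by apply: le_trans (HM z Oz) _; rewrite lee_fin le_max lexx.
Qed.

(** Finiteness is given on basis vectors only. Boundedness of [u z] and convergence of truncations
    extend it, so that [u z] acts as a d x d matrix on every square summable sequence. *)
Let u_coord : exists d : nat, (forall z i k, Om z -> (d <= i)%N || (d <= k)%N -> u z (e_ i) k = 0) /\
  forall z a k, Om z -> l2 a -> u z a k = \sum_(i < d) a i * u z (e_ i) k.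
Proof.
case: (hu) => _ _ _ [d Hd]; exists d.
have H0 z i k : Om z -> (d <= i)%N || (d <= k)%N -> u z (e_ i) k = 0.
  by move=> Oz h; have := Hd z i k Oz h; rewrite ip_l2_e.
split => // z a k Oz la; have [M M0 HM] := u_bound.
have tr m : u z (trunc m a) k = \sum_(i < m) a i * u z (e_ i) k.
  rewrite trunc_sum; elim: m => [|m IH]; first by rewrite !big_ord0 (u0 Oz).
  rewrite !big_ord_recr /= addrC (u_lin _ Oz (l2_e R m)); last by rewrite -trunc_sum; exact: l2_trunc.
  by rewrite -IH addrC.
apply/eqP; rewrite -subr_eq0; apply/eqP; apply: cabs0_eq0; apply/eqP.
rewrite eq_le cabs_ge0 andbT; apply/ler_addgt0Pr => e e0; rewrite add0r.
have M1 : 0 < M + 1 by rewrite ltr_wpDl.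
have [N HN] := trunc_cvg la (divr_gt0 e0 M1).
pose m := (maxn N d); have := HN m (leq_maxl _ _) => hm.
have lt := l2_trunc m a.
have -> : \sum_(i < d) a i * u z (e_ i) k = u z (trunc m a) k.
  rewrite tr (big_ord_widen _ (fun i => a i * u z (e_ i) k) (leq_maxr N d)) big_mkcond /=.
  apply: eq_bigr => i _; case: ltnP => // di.
  by rewrite (H0 _ _ _ Oz) ?mulr0// di.
have -> : u z a k - u z (trunc m a) k = u z (a - trunc m a) k by rewrite (uB Oz la lt).
have lat := subspaceB (l2_subspace R) la lt.
apply: le_trans (l2_cabs_le k (u_l2 Oz lat)) _.
apply: le_trans (HM _ _ Oz lat) _.
move: hm; rewrite ltr_pdivlMr// => /ltW; apply: le_trans.
by rewrite mulrC; apply: ler_wpM2l; rewrite ?norm_l2_ge0// lerDl.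
Qed.

(** Uniform continuity of [u] for [dist] makes the entries continuous for [dist], hence Borel. *)
Let u_coord_measurable i k : bcmeas (fun z => u z (e_ i) k).
Proof.
case: (hu) => _ _ Hc _.
have near z (e : R) : Om z -> 0 < e -> exists2 r : R, 0 < r & forall w, Om w -> dist z w < r ->
    cabs (u z (e_ i) k - u w (e_ i) k) < e.
  move=> Oz e0; have e2 : 0 < e / 2 by rewrite divr_gt0.
  have [r r0 Hr] := Hc (e / 2) e2; exists r => // w Ow zw.
  have le := l2_e R i.
  apply: (@le_lt_trans _ _ (e / 2)); last by rewrite ltr_pdivrMr// ltr_pMr// ltr1n.
  have dl2 b : l2 b -> l2 (u z b - u w b).
    by move=> lb; exact: (subspaceB (l2_subspace R) (u_l2 Oz lb) (u_l2 Ow lb)).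
  have dlin (c : C) b b' : l2 b -> l2 b' -> u z (c *: b + b') - u w (c *: b + b') =
      c *: (u z b - u w b) + (u z b' - u w b').
    by move=> lb lb'; rewrite (u_lin _ Oz lb lb') (u_lin _ Ow lb lb') scalerBr opprD addrACA.
  have := @opnorm_le_bound _ _ _ _ _ ph2 (fun a => u z a - u w a) (e / 2) dl2 dlin (ltW (Hr z w Oz Ow zw)) _ le.
  have -> : norm_l2 (e_ i : nat -> C) = 1.
    rewrite /norm_l2 (@sqnorm_l2_finite _ _ i.+1); last by move=> j ij; rewrite /e_ gtn_eqF.
    rewrite big_ord_recr /= big1 ?add0r; first by rewrite /e_ eqxx cabs1 expr1n sqrtr1.
    by move=> j _; rewrite /e_ ltn_eqF ?cabs0 ?expr0n.
  rewrite mulr1; apply: le_trans.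
  exact: (l2_cabs_le k (subspaceB (l2_subspace R) (u_l2 Oz le) (u_l2 Ow le))).
split; apply: (metric_continuous_measurable hB) => z e Oz e0.
  have [r r0 Hr] := near z e Oz e0; exists r => // w Ow zw.
  by apply: le_lt_trans (Hr w Ow zw); rewrite -cReN -cReD; exact: ler_Re_cabs.
have [r r0 Hr] := near z e Oz e0; exists r => // w Ow zw.
by apply: le_lt_trans (Hr w Ow zw); rewrite -cImN -cImD; exact: ler_Im_cabs.
Qed.

(** Cut off outside [Om], where nothing is known of [u], so that linearity and commutation hold as
    equalities of functions on C^n. *)
Definition mult f : E := fun z => if `[< Om z >] then u z (f z) else 0.

Let multE f z : Om z -> mult f z = u z (f z).
Proof. by move=> Oz; rewrite /mult asboolT. Qed.

Let mult_out f z : ~ Om z -> mult f z = 0.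
Proof. by move=> nOz; rewrite /mult asboolF. Qed.

Lemma mult_L2 : exists2 M : R, 0 <= M & forall f, L2 B f ->
  L2 B (mult f) /\ normB B (mult f) <= M * normB B f.
Proof.
have [M M0 HM] := u_bound; have [d [Hd0 Hd]] := u_coord.
exists M => // f Lf; have /L2P[l2f mf _] := Lf.
apply: (L2_scale mOm Lf _ M0) => [k|z Oz].
  apply: (@eq_cmeas _ (borel R n) R bOm (fun z => \sum_(i < d) f z i * u z (e_ i) k)).
    by move=> z /set_mem Oz; rewrite (multE f Oz) (Hd z (f z) k Oz (l2f z Oz)).
  by apply: cmeas_sum => i; apply: cmeasM; [exact: mf|exact: u_coord_measurable].
rewrite (multE f Oz) -(norm_l2_sqr (l2f z Oz)) -(norm_l2_sqr (u_l2 Oz (l2f z Oz))).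
rewrite -EFinM lee_fin -exprMn lerXn2r ?nnegrE ?mulr_ge0 ?norm_l2_ge0//.
exact: (HM z (f z) Oz (l2f z Oz)).
Qed.

Lemma mult_coord0 d f z k : (forall z i k, Om z -> (d <= i)%N || (d <= k)%N ->
    ip_l2 (u z (e_ i)) (e_ k) = 0) -> L2 B f -> Om z -> (d <= k)%N -> mult f z k = 0.
Proof.
move=> Hd /L2P[l2f _ _] Oz dk; have [d' [_ H]] := u_coord.
rewrite (multE f Oz) (H z (f z) k Oz (l2f z Oz)) big1// => i _.
by have := Hd z i k Oz; rewrite ip_l2_e dk orbT => ->//; rewrite mulr0.
Qed.

Lemma mult_input0 d f z : (forall z i k, Om z -> (d <= i)%N || (d <= k)%N ->
    ip_l2 (u z (e_ i)) (e_ k) = 0) -> L2 B f -> Om z -> (forall k, (k < d)%N -> f z k = 0) -> mult f z = 0.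
Proof.
move=> Hd /L2P[l2f _ _] Oz f0; have [d' [_ H]] := u_coord.
apply/funext => k; rewrite (multE f Oz) (H z (f z) k Oz (l2f z Oz)) big1// => i _.
case: (ltnP i d) => id; first by rewrite f0 ?mul0r.
by have := Hd z i k Oz; rewrite ip_l2_e id => ->//; rewrite mulr0.
Qed.

(** Multiplication by [u] acts pointwise and commutes exactly with scalar functions; any [L]
    serves. *)
Lemma good_mult : good B mult.
Proof.
have [M M0 HM] := mult_L2.
split.
- by move=> f /HM[].
- move=> c f g /L2P[l2f _ _] /L2P[l2g _ _]; apply/funext => z.
  rewrite -[RHS]/(c *: mult f z + mult g z).
  have [Oz|nOz] := pselect (Om z); last by rewrite !(mult_out _ nOz) scaler0 addr0.
  by rewrite !(multE _ Oz) -(u_lin _ Oz (l2f z Oz) (l2g z Oz)).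
- by exists M => // f /HM[].
- move=> N N0 e e0; exists 1; first exact: ltr01.
  move=> m psi lf f Lf; have /L2P[l2f _ _] := Lf; rewrite big1.
    by rewrite mulr_ge0 ?sqr_ge0// ltW.
  move=> j _; rewrite (_ : smul (psi j) (mult f) - mult (smul (psi j) f) = 0).
    by rewrite (nrm0 ph) expr0n.
  apply/eqP; rewrite subr_eq0; apply/eqP/funext => z.
  rewrite -[LHS]/(toC (psi j z) *: mult f z).
  have [Oz|nOz] := pselect (Om z); last by rewrite !(mult_out _ nOz) scaler0.
  by rewrite !(multE _ Oz) -(uZ _ Oz (l2f z Oz)).
Qed.

Lemma good_toeplitz : good B (toeplitz B u).
Proof.
have gm := good_mult; apply: (good_ext hB _ (good_comp hB (good_bproj hB) gm)) => f Lf.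
have [Lm _ _ _] := gm.
by apply: (bproj_ext hB (Lm _ Lf)) => z Oz; rewrite multE.
Qed.

End Multiplication.

Lemma good_toeplitz_polynomial S : toeplitz_polynomial B S -> good B S.
Proof.
have gp S' : toeplitz_product B S' -> good B S'.
  elim=> [u hu|u S'' hu _ IH]; first exact: good_toeplitz.
  exact: (good_comp hB (good_toeplitz hu) IH).
elim=> [S' hS'|S' S'' hS' _ IH]; first exact: gp.
exact: (good_add hB (gp _ hS') IH).
Qed.

Lemma sum_smul m psi N L f : loc_family B m psi N L -> 0 <= N -> L2 B f ->
  \sum_(j < m) normB B (smul (psi j) f) ^+ 2 <= N * normB B f ^+ 2.
Proof.
move=> lf N0 Lf; have [mpsi hN _] := lf; have /L2P[_ mf _] := Lf.
rewrite -lee_fin -sumEFin EFinM (normB_sqr Lf).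
have Ls (j : 'I_m) := (loc_family_L2 hB lf (ltn_ord j) Lf).1.
rewrite (eq_bigr (fun j : 'I_m => \int[sigma]_(z in Om) sqnorm_l2 (smul (psi j) f z))%E); last first.
  by move=> j _; rewrite (normB_sqr (Ls j)).
rewrite -(@ge0_integral_sum _ (borel R n) R sigma bOm mOm _ (fun (j : 'I_m) z => sqnorm_l2 (smul (psi j) f z))); first last.
- by move=> j z _; exact: sqnorm_l2_ge0.
- by move=> j; have /L2P[_ mc _] := Ls j; exact: (measurable_sqnorm mc).
have ms := measurable_sqnorm mf.
rewrite -(@ge0_integralZl_EFin _ (borel R n) R sigma bOm mOm _ _ ms _ N0); last first.
  by move=> z _; exact: sqnorm_l2_ge0.
apply: (@ge0_le_integral _ (borel R n) R sigma bOm mOm).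
- by move=> z _; apply: sume_ge0 => j _; exact: sqnorm_l2_ge0.
- by apply: emeasurable_sum => j; have /L2P[_ mc _] := Ls j; exact: (measurable_sqnorm mc).
- exact: measurable_funeM.
move=> z Oz; under eq_bigr do rewrite sqnorm_smul.
rewrite -ge0_sume_distrl; last by move=> j _; rewrite lee_fin sqr_ge0.
by apply: lee_wpmul2r; [exact: sqnorm_l2_ge0|rewrite sumEFin lee_fin; exact: hN].
Qed.

End ToeplitzLocalization.

Lemma sub_regroup (G : zmodType) (a b c d : G) : a - c = (b - d) + ((a - b) - (c - d)).
Proof. by rewrite addrA (addrC (b - d)) subrKA opprB subrKA. Qed.

Lemma ler_sqr_ge0 (R : realType) (a b : R) : 0 <= a -> a <= b -> a ^+ 2 <= b ^+ 2.
Proof. by move=> a0 ab; rewrite lerXn2r ?nnegrE// (le_trans a0). Qed.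

Lemma ler_chain3 (R : realType) (p q r s t x : R) :
  p <= 2 * x + 2 * q -> q <= 2 * r + 2 * s -> s <= t -> p <= 2 * x + 4 * (r + t).
Proof. lra. Qed.

Lemma double_quarter (R : realType) (s e x : R) : s <= e / 4 * x -> 2 * s <= e * x / 2.
Proof. lra. Qed.

Lemma error_terms_le (R : realType) (a b c N d e : R) : a <= N * (d * c) ->
  d * b <= d * (N * c) -> 8 * (d * (N * c)) <= e * c / 2 -> 4 * (a + d * b) <= e * c / 2.
Proof.
rewrite (_ : N * (d * c) = d * (N * c)); last by ring.
move: (d * (N * c)) (d * b) => p q; lra.
Qed.

(** * Almost commutation passes to norm limits *)

Section ApproximationLocalization.
Context (R : realType) (n : nat) (B : bergman_data R n).
Hypothesis hB : bergman_type B.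
Local Notation C := (Cplx R).
Local Notation V := (Cspace R n).
Local Notation E := (V -> nat -> C).
Local Notation mOm := (mOm hB).
Implicit Types (f g : E).

Let ph : prehilbert (L2 B) (normB B) (ipB B).
Proof. exact: L2_prehilbert mOm. Qed.
Let phb : prehilbert (berg B) (normB B) (ipB B).
Proof. exact: berg_prehilbert mOm. Qed.
Let sL : is_subspace (L2 B).
Proof. exact: ph_sub ph. Qed.

Lemma toeplitz_polynomial_berg S f : toeplitz_polynomial B S -> berg B f -> berg B (S f).
Proof.
move=> hS bf.
have tb u g : BUCO B u -> berg B g -> berg B (toeplitz B u g).
  move=> hu bg; have [M M0 HM] := mult_L2 hB hu; have [Lm _] := HM g (berg_L2 bg).
  rewrite (_ : toeplitz B u g = bproj B (mult B u g)); first exact: (bproj_berg hB Lm).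
  by apply/esym; apply: (bproj_ext hB Lm) => z Oz; rewrite /mult asboolT.
have gp S' : toeplitz_product B S' -> forall g, berg B g -> berg B (S' g).
  elim=> [u hu g bg|u S'' hu _ IH g bg]; first exact: tb.
  exact: (tb _ _ hu (IH g bg)).
elim: hS f bf => [S' hS' f bf|S' S'' hS' _ IH f bf]; first exact: gp.
by apply: (subspaceD (berg_subspace mOm)); [exact: gp|exact: IH].
Qed.

Theorem good_T_BUCO T : T_BUCO B T -> good B (T \o bproj B).
Proof.
move=> [bT apT]; have bT' := bT; have [T_berg T_lin _] := bT'.
have [M M0 HM] := bounded_operator_bound phb bT.
split.
- by move=> f Lf; apply/berg_L2/T_berg; exact: (bproj_berg hB).
- move=> c f g Lf Lg /=; rewrite (bproj_lin hB c Lf Lg).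
  by apply: T_lin; exact: (bproj_berg hB).
- exists M; first exact: M0.
  move=> f Lf; apply: le_trans (HM _ (bproj_berg hB Lf)) _.
  by apply: ler_wpM2l M0 _ _ _; exact: (bproj_norm hB).
move=> N N0 e e0; have N10 : 0 < N + 1 by rewrite ltr_wpDl.
(* The error D = T - S enters as psi D and as D psi; by [sum_smul] each has square sum at most dd N
   |f|^2, and 8 dd N is at most e/2. *)
pose dd := e / (16 * (N + 1)); have dd0 : 0 < dd by rewrite divr_gt0// mulr_gt0.
pose dl := Num.sqrt dd; have dl0 : 0 < dl by rewrite sqrtr_gt0.
have dl2 : dl ^+ 2 = dd by rewrite sqr_sqrtr// ltW.
have [S hS TS] := apT dl dl0.
have S_berg f (bf : berg B f) := toeplitz_polynomial_berg hS bf.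
have gS := good_toeplitz_polynomial hB hS; have [_ S_lin _ _] := gS.
have TSb f : berg B f -> normB B (T f - S f) <= dl * normB B f.
  have D1 g : berg B g -> berg B (T g - S g).
    by move=> bg; exact: (subspaceB (berg_subspace mOm) (T_berg _ bg) (S_berg _ bg)).
  have D2 (c : C) g g' : berg B g -> berg B g' ->
      T (c *: g + g') - S (c *: g + g') = c *: (T g - S g) + (T g' - S g').
    move=> bg bg'; rewrite (T_lin _ _ _ bg bg') (S_lin _ _ _ (berg_L2 bg) (berg_L2 bg')).
    by rewrite scalerBr opprD addrACA.
  by move=> bf; exact: (@opnorm_le_bound _ _ _ _ _ phb (fun f => T f - S f) dl D1 D2 (ltW TS) f bf).
have [_ _ _ lSP] := good_comp hB gS (good_bproj hB).
have e4 : 0 < e / 4 by rewrite divr_gt0.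
have [L L0 HL] := lSP N N0 _ e4; exists L; first exact: L0.
move=> m psi lf f Lf.
have h1 := HL m psi lf f Lf.
have bPf := bproj_berg hB Lf.
have LD : L2 B (T (bproj B f) - S (bproj B f)).
  exact: (subspaceB sL (berg_L2 (T_berg _ bPf)) (berg_L2 (S_berg _ bPf))).
have h2 := sum_smul hB lf N0 LD.
have h3 := sum_smul hB lf N0 Lf.
have hD : normB B (T (bproj B f) - S (bproj B f)) <= dl * normB B f.
  apply: le_trans (TSb _ bPf) _; apply: ler_wpM2l (ltW dl0) _ _ _; exact: (bproj_norm hB).
pose x j := normB B (smul (psi j) ((S \o bproj B) f) - (S \o bproj B) (smul (psi j) f)) ^+ 2.
pose y j := normB B (smul (psi j) (T (bproj B f) - S (bproj B f))) ^+ 2 + dd * normB B (smul (psi j) f) ^+ 2.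
have f0 : 0 <= normB B f ^+ 2 by exact: sqr_ge0.
apply: (@sum_le_halves R m (fun j => normB B (smul (psi j) ((T \o bproj B) f) - (T \o bproj B) (smul (psi j) f)) ^+ 2) x y 2 4).
- move=> j jm; have [Ls _] := loc_family_L2 hB lf jm Lf.
  have bPs := bproj_berg hB Ls.
  have [LsD _] := loc_family_L2 hB lf jm LD.
  have LSP := berg_L2 (S_berg _ bPf).
  have [LsS _] := loc_family_L2 hB lf jm LSP.
  have LSs := berg_L2 (S_berg _ bPs).
  have LTs := berg_L2 (T_berg _ bPs).
  have LDs := subspaceB sL LTs LSs.
  have e1 : smul (psi j) ((T \o bproj B) f) - (T \o bproj B) (smul (psi j) f) =
    (smul (psi j) ((S \o bproj B) f) - (S \o bproj B) (smul (psi j) f)) +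
    (smul (psi j) (T (bproj B f) - S (bproj B f)) - (T (bproj B (smul (psi j) f)) - S (bproj B (smul (psi j) f)))).
    by rewrite smulB; exact: sub_regroup.
  rewrite e1.
  have Lx := subspaceB sL LsS LSs; have Ly := subspaceB sL LsD LDs.
  have q1 := sqnrmD_le ph Lx Ly.
  have q2 := sqnrmD_le ph LsD (subspaceN sL LDs).
  rewrite (nrmN ph LDs) in q2.
  have q3 : normB B (T (bproj B (smul (psi j) f)) - S (bproj B (smul (psi j) f))) ^+ 2 <=
     dd * normB B (smul (psi j) f) ^+ 2.
    rewrite -dl2 -exprMn; apply: (ler_sqr_ge0 (normB_ge0 _ _)).
    apply: le_trans (TSb _ bPs) _; apply: ler_wpM2l (ltW dl0) _ _ _; exact: (bproj_norm hB).
  exact: (ler_chain3 q1 q2 q3).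
- exact: (double_quarter h1).
rewrite /y big_split /= -mulr_sumr.
have hD2 : normB B (T (bproj B f) - S (bproj B f)) ^+ 2 <= dd * normB B f ^+ 2.
  by rewrite -dl2 -exprMn; exact: (ler_sqr_ge0 (normB_ge0 _ _)).
have e8 : 8 * (dd * (N * normB B f ^+ 2)) <= e * normB B f ^+ 2 / 2.
  have -> : 8 * (dd * (N * normB B f ^+ 2)) = e * normB B f ^+ 2 / 2 * (N / (N + 1)).
    by rewrite /dd; field; rewrite gt_eqF.
  by apply: mulr_frac_le N0; apply: mulr_ge0; [exact: mulr_ge0 (ltW e0) f0|rewrite invr_ge0].
have h2' := le_trans h2 (ler_wpM2l N0 hD2).
have h3' := ler_wpM2l (ltW dd0) h3.
exact: (error_terms_le h2' h3' e8).
Qed.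

End ApproximationLocalization.

Lemma dominated_vanish d (T : measurableType d) (R : realType) (mu : {measure set T -> \bar R})
    (D : set T) (mD : measurable D) (F : nat -> T -> R) (g : T -> R) :
  (forall m, measurable_fun D (F m)) -> mu.-integrable D (EFin \o g) ->
  (forall m x, D x -> 0 <= F m x <= g x) ->
  (forall x, D x -> forall e : R, 0 < e -> \forall m \near \oo, F m x < e) ->
  forall e : R, 0 < e -> \forall m \near \oo, (\int[mu]_(x in D) (F m x)%:E < e%:E)%E.
Proof.
move=> mF ig Fg Fv e e0.
have [] := @dominated_convergence _ T R mu D mD (fun m x => (F m x)%:E) (cst 0%E) (fun x => (g x)%:E).
- by move=> m; apply/measurable_EFinP; exact: mF.
- exact: measurable_cst.
- apply: aeW => x Dx; apply/fine_cvgP; split; first exact: nearW.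
  apply/cvgr0Pnorm_lt => e' e'0; apply: filterS (Fv x Dx e' e'0) => m /=.
  by have /andP[h _] := Fg m x Dx; rewrite ger0_norm.
- exact: ig.
- apply: aeW => x m Dx; have /andP[h1 h2] := Fg m x Dx.
  by rewrite abse_EFin lee_fin ger0_norm.
move=> _ _; rewrite integral0 => /fine_cvgP[H1 /cvgr0Pnorm_lt H] .
apply: filterS (filterI H1 (H e e0)) => m [/= h1 h2].
rewrite -(fineK h1) lte_fin; apply: le_lt_trans h2; exact: ler_norm.
Qed.

(** * Strong limits of translates *)

Section TranslateNorm.
Context (R : realType) (n : nat) (B : bergman_data R n).
Hypothesis hB : bergman_type B.
Local Notation C := (Cplx R).
Local Notation V := (Cspace R n).
Local Notation E := (V -> nat -> C).
Local Notation Om := (Om B).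
Local Notation sigma := (sigma B).
Local Notation K := (K B).
Local Notation dist := (dist B).
Local Notation phi := (phi B).
Local Notation normK := (normK B).
Local Notation bOm := (Om : set (borel R n)).
Local Notation mOm := (mOm hB).
Implicit Types (f g : E).

(** Closed balls are compact for [dist], and the sets normK < m form an increasing open cover. *)
Lemma normK_bounded z (r : R) : Om z -> exists2 M : R, 0 <= M &
  forall w, Om w -> dist z w <= r -> normK w <= M.
Proof.
move=> Oz; have [_ H] := bt_proper hB r Oz.
pose F : set (set V) := [set U | exists m : nat, U = [set w | Om w /\ normK w < m%:R]].
have [||G [fG GF cover]] := H F.
- move=> _ [m ->]; split; first by move=> w [].
  move=> w [Ow hw]; have e0 : 0 < m%:R - normK w by rewrite subr_gt0.
  have [r' r'0 Hr] := bt_normK_cont hB Ow e0; exists r' => // v [Ov wv]; split => //.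
  by have := Hr v Ov wv; rewrite distrC ltr_norml => /andP[_]; lra.
- move=> w [Ow _]; exists [set v | Om v /\ normK v < (Num.truncn (normK w)).+1%:R].
    by exists (Num.truncn (normK w)).+1.
  by split => //; exact: truncnS_gt.
have [s Gs] := proj1 (finite_seqP G) fG.
have : exists2 M : R, 0 <= M & forall U, U \in s -> forall w, U w -> normK w <= M.
  have : forall U, U \in s -> F U by move=> U Us; apply: GF; rewrite Gs.
  elim: s {Gs} => [|U s IH] hs; first by exists 0.
  have [M M0 HM] := IH (fun U' h => hs U' (mem_behead (s := U :: s) h)).
  have [m Um] := hs U (mem_head _ _).
  exists (Num.max M m%:R); first by rewrite le_max M0.
  move=> U'; rewrite inE => /orP[/eqP -> w|Us w Uw].
    by rewrite Um => -[_ h]; rewrite le_max (ltW h) orbT.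
  by rewrite le_max (HM U' Us w Uw).
move=> [M M0 HM]; exists M => // w Ow zw.
have [U GU Uw] := cover w (conj Ow zw).
by apply: (HM U) => //; rewrite Gs in GU.
Qed.

Lemma integrable_cst_Om (c : R) : sigma.-integrable bOm (EFin \o (cst c : borel R n -> R)).
Proof.
by apply: finite_measure_integrable_cst; exact: mOm.
Qed.

Lemma min_ratio_measurable b (rho : R) : Om b ->
  measurable_fun bOm ((fun v => Num.min 1 (dist b v / rho)) : borel R n -> R).
Proof.
move=> Ob; apply: measurable_minr; first exact: measurable_cst.
by apply: measurable_funM; [exact: dist_measurable|exact: measurable_cst].
Qed.

(** The integrand decreases to 0 as [rho] grows and is at most 1, and [sigma] is finite. *)
Lemma min_dist_integral (c e : R) : 0 < c -> 0 < e -> exists2 rho : R, 0 < rho &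
  forall rho', rho <= rho' ->
  (\int[sigma]_(w in Om) ((Num.min 1 (c * dist 0 w / rho')) ^+ 2)%:E < e%:E)%E.
Proof.
move=> c0 e0; have O0 := bt_0 hB.
pose F m w : R := Num.min 1 (c * dist 0 w / m.+1%:R) ^+ 2.
have mq rho : measurable_fun bOm ((fun w => Num.min 1 (c * dist 0 w / rho) ^+ 2) : borel R n -> R).
  apply: measurable_funX; apply: measurable_minr; first exact: measurable_cst.
  apply: measurable_funM; last exact: measurable_cst.
  by apply: measurable_funM; [exact: measurable_cst|exact: dist_measurable].
have d0 rho w : 0 < rho -> Om w -> 0 <= c * dist 0 w / rho.
  by move=> r0 Ow; rewrite divr_ge0 ?(ltW r0)// mulr_ge0 ?(ltW c0)// (dist_ge0 hB).
have q0 rho w : 0 < rho -> Om w -> 0 <= Num.min 1 (c * dist 0 w / rho).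
  by move=> r0 Ow; rewrite le_min ler01 d0.
have [m _ Hm] : \forall m \near \oo, (\int[sigma]_(w in Om) (F m w)%:E < e%:E)%E.
  apply: (@dominated_vanish _ (borel R n) R sigma bOm mOm F (cst 1)) => //.
  - by move=> m; exact: mq.
  - exact: integrable_cst_Om.
  - move=> m w Ow; rewrite /F sqr_ge0 /= expr_le1//; last exact: q0.
    by rewrite ge_min lexx.
  - move=> w Ow e' e'0.
    pose M := c * dist 0 w; have M0 : 0 <= M by rewrite mulr_ge0 ?(ltW c0)// (dist_ge0 hB).
    exists (Num.truncn (M / Num.min 1 e')).+1 => // m /= hm.
    have me : 0 < Num.min 1 e' by rewrite lt_min ltr01.
    have h1 : M / m.+1%:R < Num.min 1 e'.
      rewrite ltr_pdivrMr ?ltr0n// mulrC -ltr_pdivrMr//.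
      apply: lt_trans (truncnS_gt _) _; rewrite ltr_nat; exact: leq_ltn_trans hm _.
    have h2 : 0 <= M / m.+1%:R by rewrite divr_ge0.
    rewrite /F -/M; have := h1; rewrite lt_min => /andP[h3 h4].
    rewrite min_r ?(ltW h3)//; apply: le_lt_trans h4; rewrite expr2; exact: ler_piMr h2 (ltW h3).
exists m.+1%:R; first by rewrite ltr0n.
move=> rho' hr; have r'0 : 0 < rho' by apply: lt_le_trans hr; rewrite ltr0n.
apply: le_lt_trans (Hm m (leqnn m)).
apply: (@ge0_le_integral _ (borel R n) R sigma bOm mOm).
- by move=> w _; rewrite lee_fin sqr_ge0.
- apply/measurable_EFinP; exact: mq.
- apply/measurable_EFinP; exact: mq.
- move=> w Ow; rewrite lee_fin; apply: (ler_sqr_ge0 (q0 _ _ r'0 Ow)).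
  rewrite le_min ge_min lexx /= ge_min; apply/orP; right.
  apply: ler_wpM2l; first by rewrite mulr_ge0 ?(ltW c0)// (dist_ge0 hB).
  by rewrite lef_pV2 ?posrE ?ltr0n.
Qed.

(** The weight is 0 at [b] and 1 beyond distance rho'. Substituting phi_b moves [b] to 0, where a
    single integral for the finite measure [sigma] is small; hence the uniformity in [b]. *)
Lemma kernel_concentration (e : R) : 0 < e -> exists2 rho : R, 0 < rho &
  forall rho' b k, rho <= rho' -> Om b ->
  normB B (smul (fun v => Num.min 1 (dist b v / rho')) (Ke B b k)) <= e * normK b.
Proof.
move=> e0; have [c c0 Hc] := translated_integral hB.
have [q q0 Hq] := bt_quasi_inv hB; have O0 := bt_0 hB.
have e2 : 0 < e ^+ 2 / c by rewrite divr_gt0// exprn_gt0.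
have [rho rho0 Hrho] := min_dist_integral q0 e2; exists rho => // rho' b k hr Ob.
have r'0 : 0 < rho' by exact: lt_le_trans hr.
have nb := normK_gt0 hB Ob.
pose psi v := Num.min 1 (dist b v / rho').
have psi0 v : Om v -> 0 <= psi v.
  by move=> Ov; rewrite le_min ler01 divr_ge0 ?(ltW r'0)// (dist_ge0 hB).
have LK := berg_L2 (Ke_berg hB k Ob).
have [Ls _] : L2 B (smul psi (Ke B b k)) /\ normB B (smul psi (Ke B b k)) <= 1 * normB B (Ke B b k).
  apply: (smul_L2 hB) => //; first exact: min_ratio_measurable.
  by move=> v Ov; rewrite ger0_norm ?psi0// ge_min lexx.
rewrite -(@ler_pXn2r _ 2)// ?nnegrE ?normB_ge0 ?mulr_ge0 ?(ltW e0) ?(ltW nb)//.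
rewrite -lee_fin (normB_sqr Ls).
pose Q w : \bar R := ((Num.min 1 (q * dist 0 w / rho')) ^+ 2)%:E.
have mQ : measurable_fun bOm (Q : borel R n -> \bar R).
  apply/measurable_EFinP; apply: measurable_funX; apply: measurable_minr; first exact: measurable_cst.
  apply: measurable_funM; last exact: measurable_cst.
  by apply: measurable_funM; [exact: measurable_cst|exact: dist_measurable].
have Q0 w : (0 <= Q w)%E by rewrite lee_fin sqr_ge0.
have mQk : measurable_fun bOm ((fun w => Q (phi b w) * ((cabs (k_ B b w)) ^+ 2)%:E)%E : borel R n -> \bar R).
  apply: emeasurable_funM; first exact: (comp_phi_measurable hB Ob mQ).
  by apply/measurable_EFinP; apply: measurable_funX; apply: measurable_cabs; exact: (k_cmeas hB Ob).
apply: (@le_trans _ _ (\int[sigma]_(w in Om) ((normK b ^+ 2)%:E * (Q (phi b w) * ((cabs (k_ B b w)) ^+ 2)%:E)))%E).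
  have /L2P[_ ms _] := Ls.
  apply: (@ge0_le_integral _ (borel R n) R sigma bOm mOm).
  - by move=> w _; exact: sqnorm_l2_ge0.
  - exact: measurable_sqnorm ms.
  - by apply: measurable_funeM.
  - move=> w Ow; rewrite sqnorm_smul sqnorm_embed (cabs_k hB w Ob) /Q -!EFinM lee_fin.
    have -> : normK b ^+ 2 * (Num.min 1 (q * dist 0 (phi b w) / rho') ^+ 2 * (cabs (K b w) / normK b) ^+ 2) =
      Num.min 1 (q * dist 0 (phi b w) / rho') ^+ 2 * cabs (K b w) ^+ 2.
      by move: (normK b) nb (cabs (K b w)) (Num.min _ _) => x /gt_eqF x0 y t; field; rewrite x0.
    apply: ler_wpM2r; first exact: sqr_ge0.
    apply: (ler_sqr_ge0 (psi0 _ Ow)).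
    rewrite /psi le_min ge_min lexx /= ge_min; apply/orP; right.
    rewrite ler_wpM2r ?invr_ge0 ?(ltW r'0)//.
    by have [h _] := Hq b b w Ob Ob Ow; rewrite (phi_self hB Ob) in h.
rewrite (@ge0_integralZl_EFin _ (borel R n) R sigma bOm mOm _ _ mQk _ (sqr_ge0 _)); last first.
  by move=> w _; rewrite mule_ge0// lee_fin sqr_ge0.
have -> : ((e * normK b) ^+ 2)%:E = ((normK b ^+ 2)%:E * (e ^+ 2)%:E)%E.
  by rewrite -EFinM mulrC exprMn.
apply: lee_wpmul2l; first by rewrite lee_fin sqr_ge0.
apply: le_trans (Hc b Q Ob (fun w _ => Q0 w) mQ) _.
apply: le_trans (lee_wpmul2l _ (ltW (Hrho rho' hr))) _; first by rewrite lee_fin ltW.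
by rewrite -EFinM lee_fin mulrCA divff ?mulr1// gt_eqF.
Qed.

End TranslateNorm.

(** * Where the mass of a translate of T sits *)

Section StrongLimit.
Context (R : realType) (n : nat) (B : bergman_data R n).
Hypothesis hB : bergman_type B.
Local Notation C := (Cplx R).
Local Notation V := (Cspace R n).
Local Notation E := (V -> nat -> C).
Local Notation Om := (Om B).
Local Notation sigma := (sigma B).
Local Notation K := (K B).
Local Notation dist := (dist B).
Local Notation phi := (phi B).
Local Notation normK := (normK B).
Local Notation bOm := (Om : set (borel R n)).
Local Notation mOm := (mOm hB).
Implicit Types (f g : E).

Let ph : prehilbert (L2 B) (normB B) (ipB B).
Proof. exact: L2_prehilbert mOm. Qed.
Let phb : prehilbert (berg B) (normB B) (ipB B).
Proof. exact: berg_prehilbert mOm. Qed.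
Let sL : is_subspace (L2 B).
Proof. exact: ph_sub ph. Qed.

Definition coord_tail (d : nat) f : E := fun z k => if (k < d)%N then 0 else f z k.

Lemma coord_tail_L2 d f : L2 B f -> L2 B (coord_tail d f) /\ normB B (coord_tail d f) <= normB B f.
Proof.
move=> Lf; have /L2P[_ mf _] := Lf.
rewrite -[X in _ <= X]mul1r; apply: (L2_scale mOm Lf _ ler01).
  move=> k; rewrite (_ : (fun z => _) = if (k < d)%N then cst 0 else (fun z => f z k)).
    by case: ifP => _; [exact: cmeas_cst|exact: mf].
  by apply/funext => z; rewrite /coord_tail; case: ifP.
move=> z Oz; apply: sqnorm_l2_le => k; rewrite mul1r /coord_tail.
by case: ifP => // _; rewrite cabs0.
Qed.

Lemma sqnorm_coord_tail d f z : sqnorm_l2 (f z) =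
  ((\sum_(k < d) cabs (f z k) ^+ 2)%:E + sqnorm_l2 (coord_tail d f z))%E.
Proof.
pose hd k : C := if (k < d)%N then f z k else 0.
have -> : \sum_(k < d) cabs (f z k) ^+ 2 = \sum_(k < d) cabs (hd k) ^+ 2.
  by apply: eq_bigr => k _; rewrite /hd ltn_ord.
rewrite -(@sqnorm_l2_finite _ hd d); last by move=> k dk; rewrite /hd ltnNge dk.
rewrite /sqnorm_l2 -nneseriesD; [|by move=> k _ _; rewrite lee_fin sqr_ge0..].
apply: eq_eseriesr => k _; rewrite /hd /coord_tail -EFinD; congr EFin.
by case: ifP => _; rewrite cabs0 expr0n ?addr0 ?add0r.
Qed.

(** Only the outermost factor of each product matters, because its symbol has finitely many nonzero
    rows. *)
Lemma toeplitz_polynomial_coord S : toeplitz_polynomial B S -> exists d : nat,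
  forall f z k, berg B f -> Om z -> (d <= k)%N -> S f z k = 0.
Proof.
have tc u : BUCO B u -> exists d : nat, forall f z k, berg B f -> Om z -> (d <= k)%N ->
    toeplitz B u f z k = 0.
  move=> hu; have [M M0 HM] := mult_L2 hB hu; have [_ _ _ [d Hd]] := hu.
  exists d => f z k bf Oz dk; have Lf := berg_L2 bf; have [Lm _] := HM f Lf.
  have -> : toeplitz B u f = bproj B (mult B u f).
    by apply/esym; apply: (bproj_ext hB Lm) => w Ow; rewrite /mult asboolT.
  rewrite (bproj_kernel hB _ Lm Oz) ipB_embed.
  have e0 w : Om w -> mult B u f w k * Num.conj (K z w) = 0.
    move=> Ow; rewrite (_ : mult B u f w k = 0) ?mul0r//.
    exact: (mult_coord0 hu Hd Lf Ow dk).
  rewrite -[cintegral _ _]/(@cint _ (borel R n) R sigma bOm (fun w => mult B u f w k * Num.conj (K z w))).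
  by rewrite (@eq_cint _ (borel R n) R sigma bOm _ (fun=> 0) e0) cint0.
have gp S' : toeplitz_product B S' -> exists d : nat, forall f z k, berg B f -> Om z -> (d <= k)%N ->
    S' f z k = 0.
  case=> [u hu|u S'' hu hS'']; first exact: tc.
  have [d Hd] := tc u hu; exists d => f z k bf Oz dk; apply: Hd => //.
  exact: (toeplitz_polynomial_berg hB (ToeplitzPolynomial1 hS'') bf).
elim=> [S' hS'|S' S'' hS' _ [d'' IH]]; first exact: gp.
have [d' Hd'] := gp _ hS'; exists (maxn d' d'') => f z k bf Oz.
rewrite geq_max => /andP[h1 h2].
by rewrite -[LHS]/(S' f z k + S'' f z k) Hd'// IH// addr0.
Qed.

Section FixedOperator.
Variable T : E -> E.
Hypothesis hT : T_BUCO B T.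

Let bT : bounded_on_berg B T. Proof. by case: hT. Qed.
Let T_berg f : berg B f -> berg B (T f). Proof. by case: bT => h _ _; exact: h. Qed.

Lemma T_approx (e : R) : 0 < e -> exists2 S, toeplitz_polynomial B S &
  forall f, berg B f -> normB B (T f - S f) <= e * normB B f.
Proof.
move=> e0; have [_ apT] := hT; have [S hS TS] := apT e e0; exists S; first exact: hS.
have S_berg f (bf : berg B f) := toeplitz_polynomial_berg hB hS bf.
have [_ S_lin _ _] := good_toeplitz_polynomial hB hS.
have [_ T_lin _] := bT.
have D1 g : berg B g -> berg B (T g - S g).
  by move=> bg; exact: (subspaceB (berg_subspace mOm) (T_berg bg) (S_berg _ bg)).
have D2 (c : C) g g' : berg B g -> berg B g' ->
    T (c *: g + g') - S (c *: g + g') = c *: (T g - S g) + (T g' - S g').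
  move=> bg bg'; rewrite (T_lin _ _ _ bg bg') (S_lin _ _ _ (berg_L2 bg) (berg_L2 bg')).
  by rewrite scalerBr opprD addrACA.
by move=> f bf; exact: (@opnorm_le_bound _ _ _ _ _ phb (fun f => T f - S f) e D1 D2 (ltW TS) f bf).
Qed.

Lemma T_coord_tail (e : R) : 0 < e -> exists d, forall f, berg B f ->
  normB B (coord_tail d (T f)) <= e * normB B f.
Proof.
move=> e0; have [S hS TS] := T_approx e0.
have [d Hd] := toeplitz_polynomial_coord hS; exists d => f bf.
have LD := subspaceB sL (berg_L2 (T_berg bf)) (berg_L2 (toeplitz_polynomial_berg hB hS bf)).
have [_ h] := coord_tail_L2 d LD.
apply: le_trans (TS f bf); apply: le_trans h.
rewrite (normB_ext (g := coord_tail d (T f - S f))) // => z Oz.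
apply/funext => k; rewrite /coord_tail; case: ifPn => // kd.
by rewrite -[RHS]/(T f z k - S f z k) (Hd f z k bf Oz) ?subr0// leqNgt.
Qed.

Lemma min_lipschitz (x y : R) : (Num.min 1 x - Num.min 1 y) ^+ 2 <= (x - y) ^+ 2.
Proof.
rewrite -[X in X <= _]real_normK ?num_real// -[X in _ <= X]real_normK ?num_real//.
apply: ler_sqr_ge0 => //; rewrite !minEle.
case: (leP 1 x) => h1; case: (leP 1 y) => h2; rewrite ?subrr ?normr0//;
  rewrite ler_norml; apply/andP; split; have := ler_norm (x - y); have := ler_norm (y - x);
  rewrite distrC; lra.
Qed.

Lemma min_ratio_family b (rho : R) : Om b -> 0 < rho ->
  loc_family B 1 (fun=> fun v => Num.min 1 (dist b v / rho)) 1 (rho ^- 2).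
Proof.
move=> Ob r0; split.
- by move=> _; exact: (min_ratio_measurable hB).
- move=> z Oz; rewrite big_ord1 expr_le1// ?ge_min ?lexx// le_min ler01.
  by rewrite divr_ge0 ?(ltW r0)// (dist_ge0 hB).
- move=> z w Oz Ow; rewrite big_ord1; apply: le_trans (min_lipschitz _ _) _.
  rewrite -mulrBl expr_div_n mulrC; apply: ler_wpM2l; first by rewrite invr_ge0 sqr_ge0.
  rewrite -[X in X <= _]real_normK ?num_real//; apply: ler_sqr_ge0 => //.
  rewrite ler_norml; apply/andP; split.
    by have := dist_tri hB Ob Oz Ow; lra.
  by have := dist_tri hB Ob Ow Oz; rewrite (distC hB Ow Oz); lra.
Qed.

Lemma cabs_k_mul : exists2 c : R, 0 < c & forall z a, Om z -> Om a ->
  cabs (k_ B z a) * normK (phi z a) <= c * normK a.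
Proof.
have [c c0 Hc] := K_two_sided hB; exists c => // z a Oz Oa.
have [h _] := Hc z a Oz Oa; have Op := phiOm hB Oz Oa.
have nz := normK_gt0 hB Oz; have np := normK_gt0 hB Op.
rewrite (cabs_k hB a Oz).
have := ler_wpM2r (ltW np) h; have -> : c * (normK z * normK a / normK (phi z a)) * normK (phi z a) = c * normK a * normK z.
  by move: (normK (phi z a)) np => x /gt_eqF x0; field; rewrite x0.
by rewrite -ler_pdivrMr// mulrAC.
Qed.

(** The weight measuring the distance from [b] almost commutes with T, and the weighted kernel is
    already small. *)
Lemma T_kernel_concentration (e : R) : 0 < e -> exists2 rho : R, 0 < rho &
  forall b k, Om b ->
  normB B (smul (fun v => Num.min 1 (dist b v / rho)) (T (Ke B b k))) ^+ 2 <= e * normK b ^+ 2.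
Proof.
move=> e0; have [_ _ [M M0 HM] lT] := good_T_BUCO hB hT.
have e4 : 0 < e / 4 by rewrite divr_gt0.
have [L L0 HL] := lT 1 ler01 _ e4.
have M1 : 0 < M + 1 by rewrite ltr_wpDl.
have s0 : 0 < Num.sqrt (e / 4) by rewrite sqrtr_gt0.
pose e1 := Num.sqrt (e / 4) / (M + 1); have e10 : 0 < e1 by rewrite divr_gt0.
have [rho0 r00 Hk] := kernel_concentration hB e10.
pose rho := Num.max rho0 (1 + L^-1).
have r1 : 1 + L^-1 <= rho by rewrite le_max lexx orbT.
have rr : rho0 <= rho by rewrite le_max lexx.
have r0 : 0 < rho by exact: lt_le_trans rr.
clearbody rho; exists rho; first exact: r0.
move=> b k Ob; have bK := Ke_berg hB k Ob; have LK := berg_L2 bK.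
have fam := min_ratio_family Ob r0.
(* As rho is at least 1 and at least 1/L, its square is at least 1/L. *)
have fam' : loc_family B 1 (fun=> fun v => Num.min 1 (dist b v / rho)) 1 L.
  case: fam => h1 h2 h3; split => // z w Oz Ow; apply: le_trans (h3 z w Oz Ow) _.
  apply: ler_wpM2r; first exact: sqr_ge0.
  rewrite -[L]invrK lef_pV2 ?posrE ?invr_gt0 ?exprn_gt0//.
  have Lv : 0 < L^-1 by rewrite invr_gt0.
  apply: le_trans (_ : rho <= _); first lra.
  by rewrite expr2 ler_peMr ?(ltW r0)//; lra.
have := HL 1%N _ fam' (Ke B b k) LK; rewrite big_ord1 /= (bproj_id hB bK) normB_Ke => h1.
have := Hk rho b k rr Ob => h2.
set psi := (fun v => Num.min 1 (dist b v / rho)) in h1 h2 *.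
have [Ls _] := loc_family_L2 hB fam' (j := 0%N) (ltn0Sn 0) LK.
have [LsT _] := loc_family_L2 hB fam' (j := 0%N) (ltn0Sn 0) (berg_L2 (T_berg bK)).
have bPs := bproj_berg hB Ls; have LTP := berg_L2 (T_berg bPs).
have h3 : normB B (T (bproj B (smul psi (Ke B b k)))) <= Num.sqrt (e / 4) * normK b.
  apply: le_trans (HM _ Ls) _.
  apply: le_trans (ler_wpM2l M0 h2) _.
  have -> : M * (e1 * normK b) = (M / (M + 1)) * (Num.sqrt (e / 4) * normK b) by rewrite /e1; ring.
  apply: ler_piMl; first exact: mulr_ge0 (ltW s0) (ltW (normK_gt0 hB Ob)).
  by rewrite ler_pdivrMr// mul1r lerDl.
have h4 : normB B (T (bproj B (smul psi (Ke B b k)))) ^+ 2 <= e / 4 * normK b ^+ 2.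
  have -> : e / 4 * normK b ^+ 2 = (Num.sqrt (e / 4) * normK b) ^+ 2.
    by rewrite exprMn (sqr_sqrtr (ltW e4)).
  exact: ler_sqr_ge0 (normB_ge0 _ _) h3.
have h5 := sqnrmD_le ph (subspaceB sL LsT LTP) LTP.
rewrite subrK in h5; apply: le_trans h5 _.
have hh (x y z : R) : x <= e / 4 * z -> y <= e / 4 * z -> 2 * x + 2 * y <= e * z by lra.
exact: hh h1 h4.
Qed.

(** The translate of K_a is conj(k_z(a)) [U_ B z] applied to T K_b with b = phi_z(a). The
    substitution phi_z turns distance from 0 into distance from [b], and |k_z(a)| normK(b) is
    bounded in z. *)
Lemma translate_far a k (e : R) : Om a -> 0 < e -> exists2 r : R, 0 <= r & forall z, Om z ->
  (\int[sigma]_(w in Om) ((far_ind B r 0 w)%:E * sqnorm_l2 (translate B T z (Ke B a k) w)) <= e%:E)%E.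
Proof.
move=> Oa e0; have [c c0 Hc] := translated_integral hB.
have [q q0 Hq] := bt_quasi_inv hB; have O0 := bt_0 hB.
have [ck ck0 Hk] := cabs_k_mul; have na := normK_gt0 hB Oa.
pose N2 := c * (ck * normK a) ^+ 2.
have N20 : 0 < N2 by rewrite mulr_gt0// exprn_gt0// mulr_gt0.
have [rho r0 Hrho] := T_kernel_concentration (divr_gt0 e0 N20).
exists (q * rho + dist 0 a).
  by rewrite addr_ge0 ?mulr_ge0 ?(ltW q0) ?(ltW r0)// (dist_ge0 hB).
move=> z Oz; have Ob := phiOm hB Oz Oa; have nb := normK_gt0 hB Ob.
pose b := phi z a; pose psi v := Num.min 1 (dist b v / rho).
have bK := Ke_berg hB k Ob; have bTK := T_berg bK.
have fam := min_ratio_family Ob r0.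
have [LsT _] := loc_family_L2 hB fam (j := 0%N) (ltn0Sn 0) (berg_L2 bTK).
pose h := Uadj B z (Ke B a k).
have hE : T h = Num.conj (k_ B z a) *: T (Ke B b k).
  rewrite /h (Uadj_Ke hB k Oz Oa); have [_ T_lin _] := bT.
  have b0 : berg B 0 by case: (berg_subspace mOm).
  have T0 : T 0 = 0.
    have := T_lin 1 0 0 b0 b0; rewrite !scale1r addr0 => /eqP.
    by rewrite -subr_eq0 opprD addrA subrr sub0r oppr_eq0 => /eqP.
  by have := T_lin (Num.conj (k_ B z a)) _ 0 bK b0; rewrite T0 !addr0.
pose Q v := (((cabs (k_ B z a)) ^+ 2)%:E * sqnorm_l2 (smul psi (T (Ke B b k)) v))%E.
have /L2P[_ ms _] := LsT; have mS := measurable_sqnorm ms.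
have mQ : measurable_fun bOm (Q : borel R n -> \bar R) by exact: measurable_funeM.
have Q0 v : (0 <= Q v)%E by rewrite mule_ge0 ?sqnorm_l2_ge0// lee_fin sqr_ge0.
have btr := translate_berg hB bT Oz (Ke_berg hB k Oa).
have /L2P[_ mtr _] := berg_L2 btr.
apply: (@le_trans _ _ (\int[sigma]_(w in Om) (Q (phi z w) * ((cabs (k_ B z w)) ^+ 2)%:E))%E).
  apply: (@ge0_le_integral _ (borel R n) R sigma bOm mOm).
  - by move=> w _; rewrite mule_ge0 ?sqnorm_l2_ge0// lee_fin far_ind_ge0.
  - apply: emeasurable_funM; last exact: measurable_sqnorm mtr.
    by apply/measurable_EFinP; exact: far_ind_measurable.
  - apply: emeasurable_funM; first exact: (comp_phi_measurable hB Oz mQ).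
    by apply/measurable_EFinP; apply: measurable_funX; apply: measurable_cabs; exact: (k_cmeas hB Oz).
  move=> w Ow; have [fw|nf] := pselect (far_set B (q * rho + dist 0 a) 0 w); last first.
    rewrite (far_ind_out nf) mul0e; apply: mule_ge0; first exact: Q0.
    by rewrite lee_fin; exact: sqr_ge0.
  rewrite (far_ind_in fw) mul1e; have Opw := phiOm hB Oz Ow.
  (* If w is beyond q rho + d(0, a) from 0, it is beyond q rho from [a], and quasi-invariance leaves
     phi_z(w) at least rho away from [b]. *)
  have ps1 : psi (phi z w) = 1.
    rewrite /psi min_l// ler_pdivlMr// mul1r.
    have [_] := Hq z a w Oz Oa Ow; have [hq _] := Hq z a w Oz Oa Ow => _.
    have := dist_tri hB O0 Oa Ow; have [_ /= fw'] := fw.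
    move: hq fw'; rewrite -/b => hq fw' ht.
    by rewrite -(ler_pM2l q0); lra.
  have lT : l2 (T h (phi z w)).
    rewrite hE; have /L2P[H _ _] := berg_L2 (subspaceZ (Num.conj (k_ B z a)) (berg_subspace mOm) bTK).
    exact: H.
  have lTb : l2 (T (Ke B b k) (phi z w)) by have /L2P[H _ _] := berg_L2 bTK; exact: H.
  rewrite (_ : translate B T z (Ke B a k) w = fun j => T h (phi z w) j * k_ B z w)//.
  rewrite (sqnorm_l2Zr _ lT); apply: lee_wpmul2r; first by rewrite lee_fin sqr_ge0.
  rewrite /Q sqnorm_smul ps1 expr1n mul1e hE.
  rewrite (_ : (Num.conj (k_ B z a) *: T (Ke B b k)) (phi z w) =
     fun j => T (Ke B b k) (phi z w) j * Num.conj (k_ B z a)); last first.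
    by apply/funext => j; exact: mulrC.
  by rewrite (sqnorm_l2Zr _ lTb) cabs_conj muleC.
apply: le_trans (Hc z Q Oz (fun w _ => Q0 w) mQ) _.
rewrite /Q (@ge0_integralZl_EFin _ (borel R n) R sigma bOm mOm _ _ mS _ (sqr_ge0 _)); last first.
  by move=> w _; exact: sqnorm_l2_ge0.
rewrite -(normB_sqr LsT) -!EFinM lee_fin.
apply: (@le_trans _ _ (c * (cabs (k_ B z a) ^+ 2 * (e / N2 * normK b ^+ 2)))).
  by apply: ler_wpM2l (ltW c0) _ _ _; apply: ler_wpM2l (sqr_ge0 _) _ _ _; exact: Hrho.
have h1 : (cabs (k_ B z a) * normK b) ^+ 2 <= (ck * normK a) ^+ 2.
  by apply: ler_sqr_ge0 (Hk z a Oz Oa); apply: mulr_ge0 => //; exact: ltW.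
have -> : c * (cabs (k_ B z a) ^+ 2 * (e / N2 * normK b ^+ 2)) =
  (c * e / N2) * (cabs (k_ B z a) * normK b) ^+ 2 by ring.
have ce : 0 <= c * e / N2 by rewrite divr_ge0 ?mulr_ge0// ltW.
apply: le_trans (ler_wpM2l ce h1) _.
have -> : c * e / N2 * (ck * normK a) ^+ 2 = e * (N2 / N2) by rewrite {2}/N2; ring.
by rewrite divff ?mulr1// gt_eqF.
Qed.

End FixedOperator.

End StrongLimit.

(** * From weak to strong convergence of the translates *)

Section StrongLimitTheorem.
Context (R : realType) (n : nat) (B : bergman_data R n).
Hypothesis hB : bergman_type B.
Local Notation C := (Cplx R).
Local Notation V := (Cspace R n).
Local Notation E := (V -> nat -> C).
Local Notation Om := (Om B).
Local Notation sigma := (sigma B).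
Local Notation dist := (dist B).
Local Notation normK := (normK B).
Local Notation bOm := (Om : set (borel R n)).
Local Notation mOm := (mOm hB).
Implicit Types (f g : E).

Lemma at_inftyI (P Q : set V) : at_infty B P -> at_infty B Q -> at_infty B (P `&` Q).
Proof.
move=> [r1 H1] [r2 H2]; exists (Num.max r1 r2) => z Oz.
by rewrite gt_max => /andP[h1 h2]; split; [exact: H1|exact: H2].
Qed.

Lemma at_inftyS (P Q : set V) : (forall z, Om z -> P z -> Q z) -> at_infty B P -> at_infty B Q.
Proof. by move=> PQ [r H]; exists r => z Oz rz; apply: PQ => //; exact: H. Qed.

Lemma at_infty_ord d (P : nat -> set V) : (forall i, at_infty B (P i)) ->
  at_infty B [set z | forall i, (i < d)%N -> P i z].
Proof.
move=> H; elim: d => [|d IH]; first by exists 0.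
apply: at_inftyS (at_inftyI IH (H d)) => z Oz [h1 h2] i.
by rewrite ltnS leq_eqVlt => /orP[/eqP ->//|]; exact: h1.
Qed.

Lemma at_infty_seq (P : set V) : ~ at_infty B P -> exists zs : nat -> V,
  forall m, [/\ Om (zs m), m%:R < dist (zs m) 0 & ~ P (zs m)].
Proof.
move=> nP; have H (m : nat) : exists z, [/\ Om z, m%:R < dist z 0 & ~ P z].
  apply: contrapT => H; apply: nP; exists m%:R => z Oz mz; apply: contrapT => nz.
  by apply: H; exists z.
by have [zs Hz] := boolp.choice H; exists zs.
Qed.

Lemma vanishes_seq (f : V -> R) (zs : nat -> V) (e : R) : vanishes B f ->
  (forall m, Om (zs m) /\ m%:R < dist (zs m) 0) -> 0 < e -> \forall m \near \oo, f (zs m) < e.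
Proof.
move=> fv Hz e0; have [r Hr] := fv e e0.
exists (Num.truncn r).+1 => // m /= hm; have [Oz mz] := Hz m; apply: Hr => //.
by apply: lt_trans mz; apply: lt_le_trans (truncnS_gt _) _; rewrite ler_nat.
Qed.

Section FixedOperator.
Variable T : E -> E.
Hypothesis hT : T_BUCO B T.

Let bT : bounded_on_berg B T. Proof. by case: hT. Qed.
Let T_berg f : berg B f -> berg B (T f). Proof. by case: bT => h _ _; exact: h. Qed.

Definition near_sq (r : R) (g : E) i w : R := (1 - far_ind B r 0 w) * cabs (g w i) ^+ 2.

Lemma far_ind_le1 r z w : far_ind B r z w <= 1.
Proof. by rewrite /far_ind lern1; case: asbool. Qed.

Lemma near_sq_ge0 r g i w : 0 <= near_sq r g i w.
Proof. by apply: mulr_ge0 (sqr_ge0 _); rewrite subr_ge0; exact: far_ind_le1. Qed.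

Lemma near_sq_measurable r g i : L2 B g -> measurable_fun bOm (near_sq r g i : borel R n -> R).
Proof.
move=> /L2P[_ mg _]; apply: measurable_funM.
  apply: measurable_funB; first exact: measurable_cst.
  exact: (far_ind_measurable hB r (bt_0 hB)).
exact: measurable_cabs_sqr (mg i).
Qed.

(** On a ball [normK] is bounded, so point evaluations dominate the functions by a constant and
    pointwise convergence suffices. *)
Lemma near_sq_vanish (g : nat -> E) (r M : R) i : 0 <= M -> (forall m, berg B (g m)) ->
  (forall m, normB B (g m) <= M) ->
  (forall w, Om w -> forall e : R, 0 < e -> \forall m \near \oo, cabs (g m w i) < e) ->
  forall e : R, 0 < e -> \forall m \near \oo, (\int[sigma]_(w in Om) (near_sq r (g m) i w)%:E < e%:E)%E.
Proof.
move=> M0 bg gM gv; have O0 := bt_0 hB.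
have [N N0 HN] := normK_bounded hB r O0.
apply: (@dominated_vanish _ (borel R n) R sigma bOm mOm (fun m => near_sq r (g m) i) (cst ((N * M) ^+ 2))).
- by move=> m; exact: near_sq_measurable (berg_L2 (bg m)).
- exact: integrable_cst_Om.
- move=> m w Ow; rewrite near_sq_ge0 /= /near_sq.
  have [fw|nf] := pselect (far_set B r 0 w).
    by rewrite (far_ind_in fw) subrr mul0r; exact: sqr_ge0.
  rewrite (far_ind_out nf) subr0 mul1r; apply: ler_sqr_ge0 (cabs_ge0 _) _.
  apply: le_trans (berg_pointwise hB i (bg m) Ow) _.
  apply: ler_pM (gM m); [exact/ltW/(normK_gt0 hB)|exact: normB_ge0|].
  by apply: (HN w Ow); rewrite leNgt; apply/negP => h; exact: nf.
- move=> w Ow e e0; have s0 : 0 < Num.sqrt e by rewrite sqrtr_gt0.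
  apply: filterS (gv w Ow _ s0) => m h.
  have h2 : cabs (g m w i) ^+ 2 < e.
    rewrite -[X in _ < X]sqr_sqrtr ?(ltW e0)//.
    by rewrite ltr_pXn2r ?nnegrE ?sqrtr_ge0.
  apply: le_lt_trans h2; rewrite /near_sq ler_piMl ?sqr_ge0//.
  by rewrite gerDl oppr_le0; exact: far_ind_ge0.
Qed.

(** Three parts: far from 0, coordinates from [d] on, and the finitely many remaining coordinates on
    a ball. An inequality suffices, so the first two may overlap. *)
Lemma norm_split_le d r g : L2 B g -> ((normB B g ^+ 2)%:E <=
  \int[sigma]_(w in Om) ((far_ind B r 0 w)%:E * sqnorm_l2 (g w)) +
  ((normB B (coord_tail d g) ^+ 2)%:E +
   \sum_(i < d) \int[sigma]_(w in Om) (near_sq r g i w)%:E))%E.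
Proof.
move=> Lg; have [Lt _] := coord_tail_L2 hB d Lg.
have /L2P[_ mg _] := Lg; have /L2P[_ mt _] := Lt.
have mn i : measurable_fun bOm ((fun w => (near_sq r g i w)%:E) : borel R n -> \bar R).
  by apply/measurable_EFinP; exact: near_sq_measurable.
have mfar : measurable_fun bOm ((fun w => (far_ind B r 0 w)%:E * sqnorm_l2 (g w))%E : borel R n -> \bar R).
  apply: emeasurable_funM; last exact: measurable_sqnorm mg.
  by apply/measurable_EFinP; exact: (far_ind_measurable hB r (bt_0 hB)).
have mtail := measurable_sqnorm mt.
have msum : measurable_fun bOm ((fun w => (\sum_(i < d) (near_sq r g i w)%:E)%E) : borel R n -> \bar R).
  by apply: emeasurable_sum => i; exact: mn.
have s0 w : (0 <= \sum_(i < d) (near_sq r g i w)%:E)%E.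
  by apply: sume_ge0 => i _; rewrite lee_fin near_sq_ge0.
have f0 w : (0 <= (far_ind B r 0 w)%:E * sqnorm_l2 (g w))%E.
  by apply: mule_ge0; [rewrite lee_fin far_ind_ge0|exact: sqnorm_l2_ge0].
rewrite (normB_sqr Lg) (normB_sqr Lt).
rewrite -(@ge0_integral_sum _ (borel R n) R sigma bOm mOm _ (fun (i : 'I_d) w => (near_sq r g i w)%:E)); first last.
- by move=> i w _; rewrite lee_fin near_sq_ge0.
- by move=> i; exact: mn.
rewrite -(@ge0_integralD _ (borel R n) R sigma bOm mOm _ _ (fun w _ => sqnorm_l2_ge0 _) mtail (fun w _ => s0 w) msum).
rewrite -(@ge0_integralD _ (borel R n) R sigma bOm mOm _ _ (fun w _ => f0 w) mfar
  (fun w _ => adde_ge0 (sqnorm_l2_ge0 _) (s0 w)) (emeasurable_funD mtail msum)).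
apply: (@ge0_le_integral _ (borel R n) R sigma bOm mOm).
- by move=> w _; exact: sqnorm_l2_ge0.
- exact: measurable_sqnorm mg.
- by apply: emeasurable_funD => //; exact: emeasurable_funD.
move=> w Ow; have [fw|nf] := pselect (far_set B r 0 w).
  rewrite (far_ind_in fw) mul1e leeDl//.
  by apply: adde_ge0; [exact: sqnorm_l2_ge0|exact: s0].
rewrite (far_ind_out nf) mul0e add0e (sqnorm_coord_tail d) addeC sumEFin.
apply: leeD => //; rewrite lee_fin le_eqVlt; apply/orP; left; apply/eqP.
by apply: eq_bigr => i _; rewrite /near_sq (far_ind_out nf) subr0 mul1r.
Qed.

Theorem translate_strong_limit a k : Om a ->
  (forall b i, Om b -> vanishes B (fun z => cabs (ipB B (translate B T z (Ke B a k)) (Ke B b i)))) ->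
  vanishes B (fun z => normB B (translate B T z (Ke B a k))).
Proof.
move=> Oa weak e e0; have bK := Ke_berg hB k Oa; have LK := berg_L2 bK.
have e2 : 0 < e ^+ 2 / 4 by rewrite divr_gt0// exprn_gt0.
have [r r0 Hr] := translate_far hB hT k Oa e2.
have [cU cU0 HU] := U_bounded hB; have [cA cA0 HA] := Uadj_bounded hB.
have na := normK_gt0 hB Oa.
pose dl := (e / 2) / (cU * cA * normK a).
have dl0 : 0 < dl by rewrite !divr_gt0// !mulr_gt0.
have [d Hd] := T_coord_tail hB hT dl0.
have tail z : Om z -> normB B (coord_tail d (translate B T z (Ke B a k))) ^+ 2 <= e ^+ 2 / 4.
  move=> Oz; have [bA _] := UadjP hB Oz bK; have bTA := T_berg bA.
  have [Lt _] := coord_tail_L2 hB d (berg_L2 bTA).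
  (* [U_ B z] acts alike on all coordinates, so the tail estimate for T passes to its translates
     uniformly in z. *)
  have -> : coord_tail d (translate B T z (Ke B a k)) = U_ B z (coord_tail d (T (Uadj B z (Ke B a k)))).
    apply/funext => w; apply/funext => j; rewrite /U_ /coord_tail.
    by case: ifP => //; rewrite mul0r.
  have [_ h1] := HU z _ Oz Lt.
  have -> : e ^+ 2 / 4 = (e / 2) ^+ 2 by rewrite expr_div_n -natrX.
  apply: ler_sqr_ge0 (normB_ge0 _ _) _; apply: le_trans h1 _.
  have h2 : normB B (coord_tail d (T (Uadj B z (Ke B a k)))) <= dl * (cA * normK a).
    apply: le_trans (Hd _ bA) _; apply: ler_wpM2l (ltW dl0) _ _ _.
    by have := HA z _ Oz bK; rewrite normB_Ke.
  apply: le_trans (ler_wpM2l (ltW cU0) h2) _.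
  rewrite le_eqVlt; apply/orP; left; apply/eqP; rewrite /dl; field.
  by rewrite !gt_eqF.
have d1 : 0 < d%:R + 1 :> R by rewrite ltr_wpDl.
pose e3 := e ^+ 2 / 4 / (d%:R + 1); have e30 : 0 < e3 by rewrite divr_gt0.
have [c c0 Hc] := translate_bounded hB bT.
have nearv i : at_infty B [set z | (\int[sigma]_(w in Om) (near_sq r (translate B T z (Ke B a k)) i w)%:E < e3%:E)%E].
  (* Dominated convergence is sequential, hence the passage to a sequence of offending points. *)
  apply: contrapT => /at_infty_seq[zs Hz].
  have Oz m : Om (zs m) by case: (Hz m).
  have bg m := translate_berg hB bT (Oz m) bK.
  have gM m : normB B (translate B T (zs m) (Ke B a k)) <= c * normK a.
    by have := Hc _ _ (Oz m) bK; rewrite normB_Ke.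
  have gv w : Om w -> forall e : R, 0 < e -> \forall m \near \oo, cabs (translate B T (zs m) (Ke B a k) w i) < e.
    move=> Ow e' e'0.
    have := vanishes_seq (weak w i Ow) (fun m => conj (Oz m) (let: And3 _ h _ := Hz m in h)) e'0.
    by apply: filterS => m; rewrite -(repro hB i (bg m) Ow).
  have cn : 0 <= c * normK a by rewrite mulr_ge0// ltW.
  have [m _ Hm] := near_sq_vanish (g := fun m => translate B T (zs m) (Ke B a k)) r cn bg gM gv e30.
  by have [_ _] := Hz m; apply; exact: Hm (leqnn m).
apply: at_inftyS (at_infty_ord d nearv) => z Oz hz.
have bg := translate_berg hB bT Oz bK; have Lg := berg_L2 bg.
have h1 := norm_split_le d r Lg.
have h2 : ((normB B (translate B T z (Ke B a k)) ^+ 2)%:E <= (e ^+ 2 / 4)%:E + ((e ^+ 2 / 4)%:E + (e ^+ 2 / 4)%:E))%E.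
  apply: le_trans h1 _; apply: leeD; first exact: Hr.
  apply: leeD; first by rewrite lee_fin; exact: tail.
  apply: (@le_trans _ _ (\sum_(i < d) e3%:E)%E).
    by apply: lee_sum => i _; apply: ltW; exact: hz.
  rewrite sumEFin lee_fin sumr_const card_ord /e3.
  have -> : e ^+ 2 / 4 / (d%:R + 1) *+ d = e ^+ 2 / 4 * (d%:R / (d%:R + 1)).
    by rewrite -mulr_natr -mulrA; congr (_ * _); rewrite mulrC.
  exact: mulr_frac_le (ltW e2) (ler0n _ _).
have h3 : normB B (translate B T z (Ke B a k)) ^+ 2 < e ^+ 2.
  move: h2; rewrite -!EFinD lee_fin; have := e2; lra.
by move: h3; rewrite ltr_pXn2r ?nnegrE ?normB_ge0 ?(ltW e0).
Qed.

End FixedOperator.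

End StrongLimitTheorem.

(** * Kernels, general vectors, and the Berezin transform *)

Section Equivalence.
Context (R : realType) (n : nat) (B : bergman_data R n).
Hypothesis hB : bergman_type B.
Local Notation C := (Cplx R).
Local Notation V := (Cspace R n).
Local Notation E := (V -> nat -> C).
Local Notation Om := (Om B).
Local Notation K := (K B).
Local Notation dist := (dist B).
Local Notation normK := (normK B).
Local Notation mOm := (mOm hB).
Implicit Types (f g : E).

Let ph : prehilbert (L2 B) (normB B) (ipB B).
Proof. exact: L2_prehilbert mOm. Qed.
Let phb : prehilbert (berg B) (normB B) (ipB B).
Proof. exact: berg_prehilbert mOm. Qed.
Let sb : is_subspace (berg B).
Proof. exact: berg_subspace mOm. Qed.

(* The first clause says that [at_infty B] is a proper filter; otherwise the upper
   limit is [-oo]. *)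
Lemma limf_esup_at_infty (f : V -> R) : (forall z, 0 <= f z) ->
  limf_esup (fun z => (f z)%:E) (at_infty B) = 0%E <->
  (forall r : R, exists2 z, Om z & r < dist z 0) /\ vanishes B f.
Proof.
move=> f0; split.
- move=> h; split.
    move=> r; apply: contrapT => nr.
    have : at_infty B set0 by exists r => z Oz rz; apply: nr; exists z.
    move=> F0; have : (limf_esup (fun z => (f z)%:E) (at_infty B) <= -oo)%E.
      rewrite /limf_esup; apply: ereal_inf_lbound; exists set0 => //.
      by rewrite image_set0 ereal_sup0.
    by rewrite h.
  move=> e e0; apply: contrapT => nv.
  have : (e%:E <= limf_esup (fun z => (f z)%:E) (at_infty B))%E.
    apply: le_ereal_inf_tmp => _ [A FA <-]; apply: contrapT => /negP; rewrite -ltNge => hA.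
    apply: nv; apply: (at_inftyS _ FA) => z Oz Az.
    have : ((f z)%:E <= ereal_sup [set (f z)%:E | z in A])%E.
      by apply: ereal_sup_ubound; exists z.
    by move=> /le_lt_trans /(_ hA); rewrite lte_fin.
  by rewrite h lee_fin leNgt e0.
- move=> [ne fv]; apply/eqP; rewrite eq_le; apply/andP; split.
    apply/lee_addgt0Pr => e e0; rewrite add0e.
    have FA := fv e e0.
    apply: (@le_trans _ _ (ereal_sup [set (f z)%:E | z in [set z | f z < e]])).
      by apply: ereal_inf_lbound; exists [set z | f z < e].
    by apply: ge_ereal_sup => _ [z /= fz <-]; rewrite lee_fin ltW.
  apply: le_ereal_inf_tmp => _ [A [r HA] <-].
  have [z Oz rz] := ne r.
  apply: (@le_trans _ _ (f z)%:E); first by rewrite lee_fin.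
  by apply: ereal_sup_ubound; exists z => //; exact: HA.
Qed.

Lemma vanishesD (f g : V -> R) : vanishes B f -> vanishes B g -> vanishes B (fun z => f z + g z).
Proof.
move=> fv gv e e0; have e2 : 0 < e / 2 by rewrite divr_gt0.
apply: at_inftyS (at_inftyI (fv _ e2) (gv _ e2)) => z _ [/= h1 h2]; lra.
Qed.

Lemma vanishes_le (f g : V -> R) (c : R) : 0 <= c -> (forall z, Om z -> f z <= c * g z) ->
  vanishes B g -> vanishes B f.
Proof.
move=> c0 fg gv e e0; have c1 : 0 < c + 1 by rewrite ltr_wpDl.
have ec : 0 < e / (c + 1) by rewrite divr_gt0.
apply: at_inftyS (gv _ ec) => z Oz /= h.
apply: le_lt_trans (fg z Oz) _; apply: le_lt_trans (ler_wpM2l c0 (ltW h)) _.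
by rewrite mulrA ltr_pdivrMr// mulrC ltr_pM2l// ltrDl.
Qed.

Lemma vanishes_cvg (f : V -> C) : f @ at_infty B --> (0 : C) -> vanishes B (fun z => cabs (f z)).
Proof.
move=> H e e0.
have hn : nbhs (0 : C) [set y : C | cabs (y - 0) < e] by apply/nbhs_cabsP; exists e.
have : at_infty B (f @^-1` [set y : C | cabs (y - 0) < e]) := H _ hn.
by apply: at_inftyS => z _; rewrite /preimage /mkset subr0.
Qed.

Section FixedOperator.
Variable T : E -> E.
Hypothesis bT : bounded_on_berg B T.

(** Uniform boundedness of the translates makes the vectors with vanishing translates a closed
    subspace; a vector orthogonal to all kernels is 0. *)
Theorem translate_dense : (forall a k, Om a -> vanishes B (fun z => normB B (translate B T z (Ke B a k)))) ->
  forall f, berg B f -> vanishes B (fun z => normB B (translate B T z f)).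
Proof.
move=> HK; have [c c0 Hc] := translate_bounded hB bT.
pose Y : set E := [set f | berg B f /\ vanishes B (fun z => normB B (translate B T z f))].
suff YH : berg B `<=` Y by move=> f /YH[].
have b0 : berg B 0 by case: sb.
apply: (dense_of_trivial_perp ph sb (@berg_L2 _ _ B) (bt_complete hB)).
- split.
    split=> // e e0; exists 0 => z Oz _ /=.
    by have := Hc z 0 Oz b0; rewrite (nrm0 ph) mulr0 => h; exact: le_lt_trans h e0.
  move=> x f g [bf fv] [bg gv]; have bxf := subspaceZ x sb bf.
  split; first exact: (subspaceD sb bxf bg).
  apply: (vanishes_le (c := 1) (g := fun z => cabs x * normB B (translate B T z f) + normB B (translate B T z g))) => //.
    move=> z Oz; rewrite mul1r (translate_lin hB bT _ Oz bf bg).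
    have btf := translate_berg hB bT Oz bf; have btg := translate_berg hB bT Oz bg.
    by rewrite -(nrmZ phb _ btf); exact: (nrm_triangle phb (subspaceZ x sb btf) btg).
  apply: vanishesD => //; apply: (vanishes_le (c := cabs x) (g := fun z => normB B (translate B T z f))) => //.
- by move=> f [].
- move=> f bf Hf; split => // e e0.
  have c1 : 0 < c + 1 by rewrite ltr_wpDl.
  have ec : 0 < e / 2 / (c + 1) by rewrite !divr_gt0.
  have [g [bg gv] fg] := Hf _ ec.
  have e2 : 0 < e / 2 by rewrite divr_gt0.
  apply: at_inftyS (gv _ e2) => z Oz /= h.
  have bfg := subspaceB sb bf bg.
  have : translate B T z f = 1 *: translate B T z (f - g) + translate B T z g.
    by rewrite -(translate_lin hB bT _ Oz bfg bg) scale1r subrK.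
  rewrite scale1r => ->.
  apply: le_lt_trans (nrm_triangle phb (translate_berg hB bT Oz bfg) (translate_berg hB bT Oz bg)) _.
  have h1 : normB B (translate B T z (f - g)) <= e / 2.
    apply: le_trans (Hc z _ Oz bfg) _; apply: le_trans (ler_wpM2l c0 (ltW fg)) _.
    rewrite (_ : c * (e / 2 / (c + 1)) = e / 2 * (c / (c + 1))); last by ring.
    exact: mulr_frac_le (ltW e2) c0.
  by rewrite (splitr e); apply: ler_ltD h1 h.
- move=> f bf Hf; apply: (berg_ext bf b0) => a k Oa.
  have bK := Ke_berg hB k Oa.
  rewrite (repro hB k bf Oa) (ph_conj phb bK bf) (Hf (Ke B a k)) ?rmorph0//.
  by split => //; exact: HK.
Qed.

(** Since phi_z(0) = z, the pairing of the translate of K_0 e_k with K_0 e_i is |k_z(0)|^2 <T K_z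
    e_k, K_z e_i>. The kernel estimate at (z, 0) bounds |K(z, 0)| away from 0, so that this controls
    the Berezin entry. *)
Theorem berezin_vanish : (forall f, berg B f -> vanishes B (fun z => normB B (translate B T z f))) ->
  forall i k, vanishes B (fun z => cabs (ip_l2 (berezin B T z (e_ k)) (e_ i))).
Proof.
move=> HT i k; have O0 := bt_0 hB; have n0 := normK_gt0 hB O0.
have [c c0 Hc] := K_two_sided hB.
have bk := Ke_berg hB k O0; have bi := Ke_berg hB i O0.
apply: (vanishes_le (c := (c / normK 0) ^+ 2 * normK 0) (g := fun z => normB B (translate B T z (Ke B 0 k)))).
- by rewrite mulr_ge0 ?sqr_ge0// ltW.
- move=> z Oz; have nz := normK_gt0 hB Oz; have btr := translate_berg hB bT Oz bk.
  have h1 := cauchy_schwarz phb btr bi; rewrite normB_Ke in h1.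
  rewrite (translate_Ke hB bT k i Oz O0 O0) (bt_phi_0 hB Oz) cabsM (cabsM (Num.conj _)) cabs_conj (cabs_k hB 0 Oz) in h1.
  rewrite (berezinE hB bT i k Oz) cabsM cabs_toC (ger0_norm (sqr_ge0 _)).
  have [_ h2] := Hc z 0 Oz O0; rewrite (bt_phi_0 hB Oz) in h2.
  have h3 : normK 0 <= c * cabs (K z 0).
    by apply: le_trans h2; rewrite mulrAC divff ?mul1r// gt_eqF.
  have K0 : 0 < cabs (K z 0) by rewrite -(pmulr_rgt0 _ c0); exact: lt_le_trans h3.
  move: h1 h3 K0; move: (cabs (ipB B (T _) _)) (cabs_ge0 (ipB B (T (Ke B z k)) (Ke B z i))) => X X0.
  move: (cabs (K z 0)) (normB B (translate B T z (Ke B 0 k))) (normB_ge0 B (translate B T z (Ke B 0 k))) (normK z) nz (normK 0) n0 => x y y0 N N0 N1 N10 h1 h3 x0.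
  have e1 : X * N^-1 ^+ 2 = x^-1 ^+ 2 * (x / N * (x / N) * X) by field; rewrite !gt_eqF.
  rewrite mulrC e1; apply: le_trans (ler_wpM2l (sqr_ge0 _) h1) _.
  have h4 : x^-1 <= c / N1.
    by rewrite -[x^-1]mul1r ler_pdivrMr// mulrAC ler_pdivlMr// mul1r.
  have -> : (c / N1) ^+ 2 * N1 * y = (c / N1) ^+ 2 * (y * N1) by ring.
  apply: ler_wpM2r; first by rewrite mulr_ge0// ltW.
  by apply: ler_sqr_ge0 h4; rewrite invr_ge0 ltW.
- exact: HT.
Qed.

(** The translate of K_0 e_k is conj(k_z(0)) [U_ B z] applied to T K_z e_k, and both the scalar
    times normK(z) and the operator [U_ B z] are bounded below. *)
Lemma kernel_image_vanish k : vanishes B (fun z => normB B (translate B T z (Ke B 0 k))) ->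
  vanishes B (fun z => normB B (T (Ke B z k)) / normK z).
Proof.
move=> Hv; have O0 := bt_0 hB; have n0 := normK_gt0 hB O0.
have [c c0 Hc] := K_two_sided hB; have [cl cl0 Hl] := U_lower hB.
have bk := Ke_berg hB k O0.
apply: (vanishes_le (c := c / normK 0 * cl) (g := fun z => normB B (translate B T z (Ke B 0 k)))) => //.
- by rewrite mulr_ge0 ?divr_ge0// ltW.
move=> z Oz; have nz := normK_gt0 hB Oz; have bz := Ke_berg hB k Oz.
have [T_berg T_lin _] := bT; have bTz := T_berg _ bz.
have b0 : berg B 0 by case: sb.
have T0 : T 0 = 0.
  have := T_lin 1 0 0 b0 b0; rewrite !scale1r addr0 => /eqP.
  by rewrite -subr_eq0 opprD addrA subrr sub0r oppr_eq0 => /eqP.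
have [bA _] := UadjP hB Oz bk.
have h1 := Hl z _ Oz (T_berg _ bA).
have TA : T (Uadj B z (Ke B 0 k)) = Num.conj (k_ B z 0) *: T (Ke B z k).
  rewrite (Uadj_Ke hB k Oz O0) (bt_phi_0 hB Oz).
  by have := T_lin (Num.conj (k_ B z 0)) _ 0 bz b0; rewrite T0 !addr0.
rewrite {1}TA (nrmZ phb _ bTz) cabs_conj (cabs_k hB 0 Oz) in h1.
have h1' : cabs (K z 0) / normK z * normB B (T (Ke B z k)) <= cl * normB B (translate B T z (Ke B 0 k)) := h1.
have [_ h2] := Hc z 0 Oz O0; rewrite (bt_phi_0 hB Oz) in h2.
have h3 : normK 0 <= c * cabs (K z 0).
  by apply: le_trans h2; rewrite mulrAC divff ?mul1r// gt_eqF.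
have T0' := normB_ge0 B (T (Ke B z k)).
move: h1' h3 T0'; move: (normB B (T (Ke B z k))) (normB B (translate B T z (Ke B 0 k))) (cabs (K z 0)) (normK z) nz (normK 0) n0 => X Y x N N0 N1 N10 h1' h3 X0.
have cN : 0 <= c / N1 by rewrite divr_ge0// ltW.
apply: (@le_trans _ _ (c / N1 * (x / N * X))); last first.
  by rewrite -[X in _ <= X]mulrA; exact: ler_wpM2l cN _ _ h1'.
have -> : c / N1 * (x / N * X) = X / N * (c * x / N1) by ring.
rewrite ler_peMr ?divr_ge0 ?(ltW N0)//.
by rewrite ler_pdivlMr// mul1r.
Qed.

End FixedOperator.

End Equivalence.

(** * Compactness *)

Section GreedyNet.
Variable ok : rel nat.

(** An index is kept when it is compatible with all those kept before it. Applied to a dense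
    sequence this gives a maximal separated subset. *)
Fixpoint greedy m : seq nat :=
  if m is m'.+1 then
    (if all (ok m') (greedy m') then m' :: greedy m' else greedy m')
  else [::].

Definition accepted i := all (ok i) (greedy i).

Lemma mem_greedy i m : (i \in greedy m) = (i < m)%N && accepted i.
Proof.
elim: m => [|m IH] //=; rewrite ltnS leq_eqVlt; case: (eqVneq i m) => [im|im] /=.
  rewrite im in IH *; case: ifP => am; first by rewrite inE eqxx /accepted am.
  by rewrite IH ltnn /accepted am.
by case: ifP => _; rewrite ?inE ?(negbTE im) /= IH.
Qed.

Lemma accepted_ok i j : accepted i -> accepted j -> (j < i)%N -> ok i j.
Proof. by move=> /allP h aj ji; apply: h; rewrite mem_greedy ji. Qed.

Lemma not_accepted i : ~~ accepted i -> exists j, [/\ (j < i)%N, accepted j & ~~ ok i j].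
Proof. by move=> /allPn[j]; rewrite mem_greedy => /andP[ji aj] nok; exists j. Qed.

End GreedyNet.

(** * Measures of metric balls *)

Section LambdaBalls.
Context (R : realType) (n : nat) (B : bergman_data R n).
Hypothesis hB : bergman_type B.
Local Notation C := (Cplx R).
Local Notation V := (Cspace R n).
Local Notation E := (V -> nat -> C).
Local Notation Om := (Om B).
Local Notation sigma := (sigma B).
Local Notation K := (K B).
Local Notation dist := (dist B).
Local Notation phi := (phi B).
Local Notation normK := (normK B).
Local Notation D := (D B).
Local Notation bOm := (Om : set (borel R n)).
Local Notation mOm := (mOm hB).
Implicit Types (f g : E).

Definition ball_ind (r : R) (z w : V) : R := (`[< D z r w >])%:R.

Lemma ball_ind_in r z w : D z r w -> ball_ind r z w = 1.
Proof. by move=> h; rewrite /ball_ind asboolT. Qed.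

Lemma ball_ind_out r z w : ~ D z r w -> ball_ind r z w = 0.
Proof. by move=> h; rewrite /ball_ind asboolF. Qed.

Lemma ball_ind_ge0 r z w : 0 <= ball_ind r z w.
Proof. exact: ler0n. Qed.

Lemma ball_ind_le1 r z w : ball_ind r z w <= 1.
Proof. by rewrite /ball_ind lern1; case: asbool. Qed.

Lemma ball_ind_measurable r z : Om z -> measurable_fun bOm (ball_ind r z : borel R n -> R).
Proof.
move=> Oz; rewrite (_ : ball_ind r z = \1_(D z r : set (borel R n))).
  by apply: measurable_indic; exact: (bt_ball_measurable hB).
by apply/funext => w; rewrite indicE.
Qed.

(** The measure [lambda] of a ball, written over the fixed domain [Om] so that balls can be compared
    and summed under one integral. *)
Definition lam z r : \bar R := (\int[sigma]_(w in Om) (ball_ind r z w * normK w ^+ 2)%:E)%E.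

Let lam_int0 r z w : 0 <= ball_ind r z w * normK w ^+ 2.
Proof. exact: mulr_ge0 (ball_ind_ge0 _ _ _) (sqr_ge0 _). Qed.

Let mnK2 : measurable_fun bOm ((fun w => normK w ^+ 2) : borel R n -> R).
Proof. by apply: measurable_funX; exact: normK_measurable. Qed.

Let lam_meas r z : Om z -> measurable_fun bOm ((fun w => (ball_ind r z w * normK w ^+ 2)%:E) : borel R n -> \bar R).
Proof.
by move=> Oz; apply/measurable_EFinP; apply: measurable_funM => //; exact: ball_ind_measurable.
Qed.

Lemma lambda_ball z r : Om z -> lambda B (D z r) = lam z r.
Proof.
move=> Oz; rewrite /lambda /lam [LHS](@integral_mkcond _ (borel R n)) [RHS](@integral_mkcond _ (borel R n)).
apply: eq_integral => w _; rewrite !patchE.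
have [dw|nd] := pselect (D z r w).
  have Ow : Om w by case: dw.
  by rewrite (mem_set dw) (mem_set Ow) (ball_ind_in dw) mul1r.
by rewrite (memNset nd) (ball_ind_out nd); case: ifP => // _; rewrite mul0r.
Qed.

Lemma lam_ge0 z r : (0 <= lam z r)%E.
Proof. by apply: integral_ge0 => w _; rewrite lee_fin. Qed.

Lemma lam_le z r z' r' : Om z -> Om z' -> D z r `<=` D z' r' -> (lam z r <= lam z' r')%E.
Proof.
move=> Oz Oz' h; apply: (@ge0_le_integral _ (borel R n) R sigma bOm mOm).
- by move=> w _; rewrite lee_fin.
- exact: lam_meas.
- exact: lam_meas.
- move=> w Ow; rewrite lee_fin; apply: ler_wpM2r; first exact: sqr_ge0.
  have [dw|nd] := pselect (D z r w); last by rewrite (ball_ind_out nd) ball_ind_ge0.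
  by rewrite (ball_ind_in dw) (ball_ind_in (h _ dw)).
Qed.

Lemma lam_fin z r : Om z -> (lam z r < +oo)%E.
Proof.
move=> Oz; have [M M0 HM] := normK_bounded hB r Oz.
have /integrableP[_ h] := integrable_cst_Om hB (M ^+ 2).
apply: le_lt_trans h; apply: (@ge0_le_integral _ (borel R n) R sigma bOm mOm).
- by move=> w _; rewrite lee_fin.
- exact: lam_meas.
- by apply: measurableT_comp => //; apply/measurable_EFinP; exact: measurable_cst.
- move=> w Ow; rewrite /= lee_fin ger0_norm ?sqr_ge0//.
  have [dw|nd] := pselect (D z r w); last by rewrite (ball_ind_out nd) mul0r sqr_ge0.
  rewrite (ball_ind_in dw) mul1r; apply: ler_sqr_ge0; first exact/ltW/(normK_gt0 hB).
  by apply: HM => //; case: dw => _ /ltW.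
Qed.

Lemma doubling : exists2 c : R, 1 < c & forall z r, Om z -> 0 < r -> (lam z (2 * r) <= c%:E * lam z r)%E.
Proof.
have [c c1 H] := bt_doubling hB; exists c => // z r Oz r0.
by rewrite -!lambda_ball//; exact: H.
Qed.

(** A null ball would make all its dilates null by doubling; then K_z would have no mass on any of
    them, against [normK] being positive at z. *)
Lemma lam_gt0 z r : Om z -> 0 < r -> (0 < lam z r)%E.
Proof.
move=> Oz r0; rewrite lt_neqAle lam_ge0 andbT; apply/negP => /eqP l0.
have [c c1 Hc] := doubling; have c0 : 0 <= c by apply/ltW/(lt_trans ltr01).
have lm m : lam z (2 ^+ m * r) = 0%E.
  elim: m => [|m IH]; first by rewrite expr0 mul1r -l0.
  apply/eqP; rewrite eq_le lam_ge0 andbT exprS -mulrA.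
  apply: le_trans (Hc z _ Oz _) _; first by rewrite mulr_gt0// exprn_gt0.
  by rewrite IH mule0.
have nz := normK_gt0 hB Oz; have LK := berg_L2 (Ke_berg hB 0 Oz).
(* The mass of K_z outside the dilated ball tends to 0, while inside |K_z(w)|^2 is at most
   normK(z)^2 normK(w)^2, whose integral is 0. *)
pose F m w := far_ind B (2 ^+ m * r) z w * cabs (K z w) ^+ 2.
have mK2 : measurable_fun bOm ((fun w => cabs (K z w) ^+ 2) : borel R n -> R).
  by apply: measurable_funX; exact: cabsK_measurable.
have mF m : measurable_fun bOm (F m : borel R n -> R).
  by apply: measurable_funM => //; exact: far_ind_measurable.
have iK : sigma.-integrable bOm (EFin \o ((fun w => cabs (K z w) ^+ 2) : borel R n -> R)).
  have := integrable_norm_l2 mOm LK; apply: (eq_integrable mOm) => w /set_mem Ow /=.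
  have lK : l2 (Ke B z 0 w) by have /L2P[h _ _] := LK; exact: h.
  by rewrite (norm_l2_sqr lK) sqnorm_embed.
have nz2 : 0 < normK z ^+ 2 by rewrite exprn_gt0.
have [m _ Hm] : \forall m \near \oo, (\int[sigma]_(w in Om) (F m w)%:E < (normK z ^+ 2)%:E)%E.
  apply: (@dominated_vanish _ (borel R n) R sigma bOm mOm F (fun w => cabs (K z w) ^+ 2)) => //.
  - move=> m w Ow; apply/andP; split; first exact: mulr_ge0 (far_ind_ge0 _ _ _ _) (sqr_ge0 _).
    by rewrite /F; apply: ler_piMl; [exact: sqr_ge0|exact: far_ind_le1].
  - move=> w Ow e e0; exists (Num.truncn (dist z w / r)).+1 => // m /= hm.
    rewrite /F far_ind_out ?mul0r// => -[_ /= h].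
    move: h; rewrite ltNge -ler_pdivrMr// => /negP; apply.
    apply: le_trans (ltW (truncnS_gt _)) _; rewrite -natrX ler_nat.
    by apply: leq_trans hm _; apply/ltnW/ltn_expl.
have := Hm m (leqnn m); rewrite ltNge => /negP; apply.
rewrite -(normB_Ke B z 0) (normB_sqr LK).
apply: (@le_trans _ _ (\int[sigma]_(w in Om) ((F m w)%:E + (normK z ^+ 2)%:E * (ball_ind (2 ^+ m.+1 * r) z w * normK w ^+ 2)%:E))%E).
  have /L2P[_ mKe _] := LK.
  apply: (@ge0_le_integral _ (borel R n) R sigma bOm mOm).
  - by move=> w _; exact: sqnorm_l2_ge0.
  - exact: measurable_sqnorm mKe.
  - by apply: emeasurable_funD; [apply/measurable_EFinP|apply: measurable_funeM; exact: lam_meas].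
  - move=> w Ow; rewrite sqnorm_embed -EFinM -EFinD lee_fin /F.
    have [fw|nf] := pselect (far_set B (2 ^+ m * r) z w).
      rewrite (far_ind_in fw) mul1r lerDl; exact: mulr_ge0 (sqr_ge0 _) (lam_int0 _ _ _).
    rewrite (far_ind_out nf) mul0r add0r ball_ind_in ?mul1r; last first.
      split=> //; rewrite exprS -mulrA; apply: (@le_lt_trans _ _ (2 ^+ m * r)).
        by rewrite leNgt; apply/negP => h; apply: nf.
      by rewrite ltr_pMl ?ltr1n// mulr_gt0// exprn_gt0.
    rewrite -exprMn; exact: ler_sqr_ge0 (cabs_ge0 _) (cabsK_le hB Oz Ow).
rewrite (@ge0_integralD _ (borel R n) R sigma bOm mOm); first last.
- by apply: measurable_funeM; exact: lam_meas.
- by move=> w _; rewrite -EFinM lee_fin; exact: mulr_ge0 (sqr_ge0 _) (lam_int0 _ _ _).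
- exact/measurable_EFinP.
- by move=> w _; rewrite lee_fin; exact: mulr_ge0 (far_ind_ge0 _ _ _ _) (sqr_ge0 _).
rewrite (@ge0_integralZl_EFin _ (borel R n) R sigma bOm mOm); first last.
- exact: sqr_ge0.
- exact: lam_meas.
- by move=> w _; rewrite lee_fin.
by rewrite -/(lam z (2 ^+ m.+1 * r)) lm mule0 adde0.
Qed.

(** [phi z] carries the ball at z into the ball of radius qr at 0, with comparable measure. *)
Lemma lam_uniform (r : R) : exists2 M : R, 0 <= M & forall z, Om z -> (lam z r <= M%:E)%E.
Proof.
have [c c0 Hc] := bt_lambda_inv hB; have [q q0 Hq] := bt_quasi_inv hB; have O0 := bt_0 hB.
have l0 := lam_ge0 0 (q * r); have lf := lam_fin (q * r) O0.
have fin : lam 0 (q * r) \is a fin_num by rewrite ge0_fin_numE.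
exists (c * fine (lam 0 (q * r))); first by rewrite mulr_ge0 ?fine_ge0// ltW.
move=> z Oz; rewrite -lambda_ball// EFinM fineK//.
have mD := bt_ball_measurable hB r Oz.
have DO : (D z r : set V) `<=` Om by move=> w [].
have [h _] := Hc z (D z r) Oz mD DO.
apply: le_trans h _; apply: lee_wpmul2l; first by rewrite lee_fin ltW.
rewrite -lambda_ball//.
have e : [set phi z w | w in D z r] = Om `&` (phi z) @^-1` (D z r).
  apply/seteqP; split => [_ [w [Ow zw] <-]|w [Ow hw]].
    by split; [exact: phiOm|rewrite /preimage /= (bt_phi_invol hB)].
  by exists (phi z w) => //; rewrite (bt_phi_invol hB).
apply: ge0_subset_integral.
- by rewrite e; exact: (phi_measurable hB Oz mD).
- exact: (bt_ball_measurable hB).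
- apply/measurable_EFinP; apply: measurable_funS mnK2; first exact: mOm.
  by move=> w [].
- by move=> w _; rewrite lee_fin sqr_ge0.
- move=> _ [w [Ow zw] <-]; split; first exact: phiOm.
  have [_ h2] := Hq z z w Oz Oz Ow; rewrite (phi_self hB Oz) in h2.
  by apply: le_lt_trans h2 _; rewrite ltr_pM2l.
Qed.

End LambdaBalls.

(** * Nets with bounded overlap and their cutoffs *)

Section NetFamily.
Context (R : realType) (n : nat) (B : bergman_data R n).
Hypothesis hB : bergman_type B.
Local Notation C := (Cplx R).
Local Notation V := (Cspace R n).
Local Notation E := (V -> nat -> C).
Local Notation Om := (Om B).
Local Notation sigma := (sigma B).
Local Notation dist := (dist B).
Local Notation normK := (normK B).
Local Notation D := (D B).
Local Notation bOm := (Om : set (borel R n)).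
Local Notation mOm := (mOm hB).
Implicit Types (f g : E).

(** Packing: the balls of radius r/2 at the selected points near w are disjoint and lie in D(w, 4r),
    which lies in each D(x_i, 8r). Since 8r = 2^4 (r/2), four doublings bound their number by
    c^4. *)
Lemma overlap_bound : exists2 c : R, 0 <= c & forall (r : R) (x : nat -> V) (J : pred nat) w m,
  0 < r -> (forall i, Om (x i)) ->
  (forall i j, J i -> J j -> (j < i)%N -> r <= dist (x i) (x j)) -> Om w ->
  \sum_(i < m | J i && (dist (x i) w < 3 * r)) 1 <= c.
Proof.
have [c c1 Hc] := doubling hB; have c0 : 0 < c by exact: lt_trans ltr01 c1.
exists (c ^+ 4); first by rewrite exprn_ge0// ltW.
move=> r x J w m r0 xO sep Ow.
pose s (i : 'I_m) := J i && (dist (x i) w < 3 * r).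
have lf z t := lam_fin hB t (z := z); have lp z t := lam_gt0 hB (z := z) (r := t).
have r2 : 0 < r / 2 by rewrite divr_gt0.
have fin z t : Om z -> lam B z t \is a fin_num by move=> Oz; rewrite ge0_fin_numE ?lam_ge0// lf.
pose L := fine (lam B w (4 * r)).
have L0 : 0 < L by apply: fine_gt0; rewrite lp ?lf// mulr_gt0.
pose l i := fine (lam B (x i) (r / 2)).
have lL (i : 'I_m) : s i -> L <= c ^+ 4 * l i.
  move=> /andP[_ wi]; rewrite -lee_fin /L fineK ?fin// EFinM /l fineK ?fin//.
  have h1 : (lam B w (4 * r) <= lam B (x i) (8 * r))%E.
    apply: (lam_le hB Ow (xO i)) => v [Ov wv]; split => //.
    have := dist_tri hB (xO i) Ow Ov; lra.
  apply: le_trans h1 _.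
  have dd t k : 0 < t -> (lam B (x i) (2 ^+ k * t) <= (c ^+ k)%:E * lam B (x i) t)%E.
    move=> t0; elim: k => [|k IH]; first by rewrite !expr0 mul1r mul1e.
    rewrite exprS -mulrA; apply: le_trans (Hc _ _ (xO i) _) _; first by rewrite mulr_gt0// exprn_gt0.
    rewrite exprS EFinM -muleA; apply: lee_wpmul2l => //; first by rewrite lee_fin ltW.
  have := dd (r / 2) 4 r2; rewrite (_ : 2 ^+ 4 * (r / 2) = 8 * r)//.
  by rewrite -natrX; field.
have sumL : \sum_(i < m | s i) l i <= L.
  rewrite -lee_fin -sumEFin /L fineK ?fin//.
  rewrite (eq_bigr (fun i : 'I_m => lam B (x i) (r / 2))); last by move=> i _; rewrite /l fineK ?fin.
  rewrite big_mkcond /=.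
  pose G (i : 'I_m) v : \bar R := if s i then (ball_ind B (r / 2) (x i) v * normK v ^+ 2)%:E else 0%E.
  have G0 (i : 'I_m) v : (0 <= G i v)%E.
    by rewrite /G; case: ifP => // _; rewrite lee_fin; exact: mulr_ge0 (ball_ind_ge0 _ _ _ _) (sqr_ge0 _).
  have mG (i : 'I_m) : measurable_fun bOm (G i : borel R n -> \bar R).
    rewrite /G; case: (s i); last exact: measurable_cst.
    apply/measurable_EFinP; apply: measurable_funM; first exact: ball_ind_measurable.
    by apply: measurable_funX; exact: normK_measurable.
  rewrite (eq_bigr (fun i : 'I_m => \int[sigma]_(v in Om) G i v)%E); last first.
    move=> i _; rewrite /G; case: (s i) => //; by rewrite integral0.
  rewrite -(@ge0_integral_sum _ (borel R n) R sigma bOm mOm _ G mG (fun i v _ => G0 i v)).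
  apply: (@ge0_le_integral _ (borel R n) R sigma bOm mOm).
  - by move=> v _; apply: sume_ge0 => i _; exact: G0.
  - by apply: emeasurable_sum => i; exact: mG.
  - apply/measurable_EFinP; apply: measurable_funM; first exact: ball_ind_measurable.
    by apply: measurable_funX; exact: normK_measurable.
  move=> v Ov; have [[i [si vi]]|none] := pselect (exists i : 'I_m, s i /\ D (x i) (r / 2) v).
    rewrite (bigD1 i) //= big1 ?adde0.
      rewrite /G si lee_fin (ball_ind_in vi) ball_ind_in//; split => //.
      case/andP: si => _ wi; case: vi => _ vi.
      have := dist_tri hB Ow (xO i) Ov; rewrite (distC hB Ow (xO i)); lra.
    move=> j ji; rewrite /G; case: ifP => // sj; rewrite ball_ind_out ?mul0r// => -[_ vj].
    case/andP: si => Ji _; case/andP: sj => Jj _; case: vi => _ vi.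
    have h : r <= dist (x i) (x j).
      have [ij|ij|ij] := ltngtP i j; [|exact: (sep i j)|by move/eqP: ji; case; exact/val_inj].
      by rewrite (distC hB (xO i) (xO j)); apply: (sep j i).
    have := dist_tri hB (xO i) Ov (xO j); rewrite (distC hB Ov (xO j)); lra.
  rewrite big1 => [|i _].
    by rewrite lee_fin; exact: mulr_ge0 (ball_ind_ge0 _ _ _ _) (sqr_ge0 _).
  rewrite /G; case: ifP => // si; rewrite ball_ind_out ?mul0r// => vi.
  by apply: none; exists i.
have h : L * \sum_(i < m | s i) 1 <= c ^+ 4 * L.
  rewrite mulr_sumr; apply: (@le_trans _ _ (\sum_(i < m | s i) c ^+ 4 * l i)).
    by apply: ler_sum => i si; rewrite mulr1; exact: lL.
  by rewrite -mulr_sumr; apply: ler_wpM2l => //; rewrite exprn_ge0// ltW.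
by move: h; rewrite mulrC ler_pM2r.
Qed.

(** At least 1 up to distance 2r and 0 from distance 3r on, with Lipschitz constant 1/r: slow
    variation is obtained by enlarging r. *)
Definition tent (r : R) (x : V) (w : V) : R := Num.max 0 (3 - dist x w / r).

Lemma tent_ge0 r x w : 0 <= tent r x w.
Proof. by rewrite /tent le_max lexx. Qed.

Lemma tent_le3 r x w : 0 < r -> Om x -> Om w -> tent r x w <= 3.
Proof.
move=> r0 Ox Ow; rewrite /tent ge_max ler0n /= gerBl.
by rewrite divr_ge0 ?(ltW r0)// (dist_ge0 hB).
Qed.

Lemma tent_out r x w : 0 < r -> 3 * r <= dist x w -> tent r x w = 0.
Proof.
move=> r0 h; rewrite /tent max_l// subr_le0 ler_pdivlMr//.
Qed.

Lemma tent_lipschitz r x z w : 0 < r -> Om x -> Om z -> Om w ->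
  (tent r x z - tent r x w) ^+ 2 <= (dist z w / r) ^+ 2.
Proof.
move=> r0 Ox Oz Ow.
have h1 : dist x z / r <= dist x w / r + dist z w / r.
  rewrite -mulrDl ler_wpM2r ?invr_ge0 ?(ltW r0)//.
  by rewrite (distC hB Oz Ow); exact: dist_tri.
have h2 : dist x w / r <= dist x z / r + dist z w / r.
  by rewrite -mulrDl ler_wpM2r ?invr_ge0 ?(ltW r0)//; exact: dist_tri.
have h0 : 0 <= dist z w / r by rewrite divr_ge0 ?(ltW r0)// (dist_ge0 hB).
rewrite -[X in X <= _]real_normK ?num_real//; apply: ler_sqr_ge0 => //.
rewrite /tent !maxEle; move: h1 h2 h0; move: (dist x z / r) (dist x w / r) (dist z w / r) => a b d h1 h2 h0.
by case: (leP 0 (3 - a)) => ha; case: (leP 0 (3 - b)) => hb; rewrite ler_norml; apply/andP; split; lra.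
Qed.

Lemma tent_measurable r x : Om x -> measurable_fun bOm (tent r x : borel R n -> R).
Proof.
move=> Ox; apply: measurable_maxr; first exact: measurable_cst.
apply: measurable_funB; first exact: measurable_cst.
by apply: measurable_funM; [exact: dist_measurable|exact: measurable_cst].
Qed.

(** A dense point lies within r of w, and a rejected point lies within r of an accepted one, so
    every w is within 2r of the net. Tents are at most 3 and at most c of them overlap, hence the
    constant 9c, which is independent of r. *)
Theorem net_family : exists2 N : R, 0 <= N & forall r : R, 0 < r ->
  exists x : nat -> V, exists J : pred nat, [/\ forall i, Om (x i),
    forall w, Om w -> exists i, J i /\ 1 <= tent r (x i) w &
    forall m, loc_family B m (fun i w => if J i then tent r (x i) w else 0) N (N / r ^+ 2)].
Proof.
have [c c0 Hc] := overlap_bound; exists (9 * c); first exact: mulr_ge0.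
move=> r r0; have [x xO xd] := dense_seq hB.
pose ok : rel nat := fun i j => r <= dist (x i) (x j).
pose J := accepted ok; exists x; exists J.
have sep i j : J i -> J j -> (j < i)%N -> r <= dist (x i) (x j) by move=> Ji Jj ji; exact: (@accepted_ok ok i j Ji Jj ji).
split => //.
- move=> w Ow; have [i wi] := xd w r Ow r0.
  have [j Jj wj] : exists2 j, J j & dist (x j) w <= 2 * r.
    case: (boolP (J i)) => [Ji|nJ].
      by exists i => //; rewrite (distC hB (xO i) Ow); lra.
    have [j [ji Jj]] := not_accepted nJ; rewrite /ok -ltNge => hij; exists j => //.
    have := dist_tri hB (xO j) (xO i) Ow; rewrite (distC hB (xO i) Ow) (distC hB (xO j) (xO i)); lra.
  exists j; split => //; rewrite /tent le_max; apply/orP; right.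
  have : dist (x j) w / r <= 2 by rewrite ler_pdivrMr.
  lra.
move=> m; split.
- move=> j; case: (J j); [exact: tent_measurable|exact: measurable_cst].
- move=> z Oz; apply: (@le_trans _ _ (\sum_(i < m | J i && (dist (x i) z < 3 * r)) 9)).
    rewrite [X in _ <= X]big_mkcond /=; apply: ler_sum => i _.
    case: (J i) => /=; last by rewrite expr0n.
    case: ltP => h; last by rewrite (tent_out r0 h) expr0n.
    rewrite (_ : 9 = 3 ^+ 2 :> R); last by rewrite -natrX.
    exact: ler_sqr_ge0 (tent_ge0 _ _ _) (tent_le3 r0 (xO i) Oz).
  rewrite (eq_bigr (fun=> 9 * 1)); last by move=> i _; rewrite mulr1.
  by rewrite -mulr_sumr; apply: ler_wpM2l => //; exact: Hc.
- move=> z w Oz Ow.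
  apply: (@le_trans _ _ (\sum_(i < m) ((if J i && (dist (x i) z < 3 * r) then (dist z w / r) ^+ 2 else 0) +
     (if J i && (dist (x i) w < 3 * r) then (dist z w / r) ^+ 2 else 0)))).
    apply: ler_sum => i _; case: (J i) => /=; last by rewrite subrr expr0n addr0.
    have L := tent_lipschitz r0 (xO i) Oz Ow; have d0 := sqr_ge0 (dist z w / r).
    case: ltP => hz; case: ltP => hw.
    - by apply: le_trans L _; rewrite lerDl.
    - by rewrite addr0.
    - by rewrite add0r.
    - by rewrite (tent_out r0 hz) (tent_out r0 hw) subrr expr0n addr0.
  rewrite big_split /= -!big_mkcond /=.
  have hs v : Om v -> \sum_(i < m | J i && (dist (x i) v < 3 * r)) (dist z w / r) ^+ 2 <= (dist z w / r) ^+ 2 * c.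
    move=> Ov; rewrite (eq_bigr (fun=> (dist z w / r) ^+ 2 * 1)); last by move=> i _; rewrite mulr1.
    by rewrite -mulr_sumr; apply: ler_wpM2l; [exact: sqr_ge0|exact: Hc].
  apply: le_trans (lerD (hs z Oz) (hs w Ow)) _.
  rewrite expr_div_n; have -> : 9 * c / r ^+ 2 * dist z w ^+ 2 = 9 * (dist z w ^+ 2 / r ^+ 2 * c) by ring.
  have : 0 <= dist z w ^+ 2 / r ^+ 2 * c by rewrite mulr_ge0// divr_ge0// sqr_ge0.
  lra.
Qed.

End NetFamily.

(** * Images of functions supported far away *)

Section Compactness.
Context (R : realType) (n : nat) (B : bergman_data R n).
Hypothesis hB : bergman_type B.
Local Notation C := (Cplx R).
Local Notation V := (Cspace R n).
Local Notation E := (V -> nat -> C).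
Local Notation Om := (Om B).
Local Notation sigma := (sigma B).
Local Notation K := (K B).
Local Notation normK := (normK B).
Local Notation D := (D B).
Local Notation bOm := (Om : set (borel R n)).
Local Notation mOm := (mOm hB).
Implicit Types (f g : E).

Let ph := L2_prehilbert mOm.
Let sL : is_subspace (L2 B) := L2_subspace mOm.
Let sb : is_subspace (berg B) := berg_subspace mOm.
Let phb : prehilbert (berg B) (normB B) (ipB B) := berg_prehilbert mOm.

Definition coord_head (d : nat) f : E := fun z k => if (k < d)%N then f z k else 0.

Lemma coord_headE d f : coord_head d f = f - coord_tail d f.
Proof.
apply/funext => z; apply/funext => k; rewrite -[RHS]/(f z k - coord_tail d f z k).
by rewrite /coord_head /coord_tail; case: ifP => _; rewrite ?subr0 ?subrr.
Qed.

Lemma coord_head_L2 d f : L2 B f -> L2 B (coord_head d f).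
Proof. by move=> Lf; rewrite coord_headE; exact: (subspaceB sL Lf (coord_tail_L2 hB d Lf).1). Qed.

Lemma sqnorm_coord_head d f z : sqnorm_l2 (coord_head d f z) = (\sum_(k < d) cabs (f z k) ^+ 2)%:E.
Proof.
rewrite (@sqnorm_l2_finite _ _ d); last by move=> k dk; rewrite /coord_head ltnNge dk.
by congr EFin; apply: eq_bigr => k _; rewrite /coord_head ltn_ord.
Qed.

Lemma sqnorm_coord_head_le d f z : (sqnorm_l2 (coord_head d f z) <= sqnorm_l2 (f z))%E.
Proof. by rewrite sqnorm_coord_head (sqnorm_coord_tail d) leeDl// sqnorm_l2_ge0. Qed.

(** Here the innermost factor of each product decides: its symbol ignores the coordinates from some
    [d] on. *)
Lemma toeplitz_polynomial_input S : toeplitz_polynomial B S -> exists d : nat,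
  forall f, berg B f -> (forall z k, Om z -> (k < d)%N -> f z k = 0) -> S f = 0.
Proof.
have P0 : bproj B 0 = 0 by apply: (bproj_id hB); case: sb.
have tc u : BUCO B u -> exists d : nat, forall f, berg B f ->
    (forall z k, Om z -> (k < d)%N -> f z k = 0) -> toeplitz B u f = 0.
  move=> hu; have [M M0 HM] := mult_L2 hB hu; have [_ _ _ [d Hd]] := hu.
  exists d => f bf f0; have Lf := berg_L2 bf; have [Lm _] := HM f Lf.
  have -> : toeplitz B u f = bproj B (mult B u f).
    by apply/esym; apply: (bproj_ext hB Lm) => w Ow; rewrite /mult asboolT.
  rewrite (bproj_ext hB (g := 0) Lm) ?P0// => z Oz.
  by apply: (mult_input0 hu Hd Lf Oz) => k kd; exact: f0.
have gp S' : toeplitz_product B S' -> exists d : nat, forall f, berg B f ->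
    (forall z k, Om z -> (k < d)%N -> f z k = 0) -> S' f = 0.
  elim=> [u hu|u S'' hu hS'' [d IH]]; first exact: tc.
  have [d' Hd'] := tc u hu; exists d => f bf f0.
  rewrite /= (IH f bf f0); apply: Hd' => //; by case: sb.
elim=> [S' hS'|S' S'' hS' _ [d'' IH]]; first exact: gp.
have [d' Hd'] := gp _ hS'; exists (maxn d' d'') => f bf f0.
rewrite (Hd' f bf) ?(IH f bf) ?addr0// => z k Oz kd; apply: f0 => //.
  by rewrite leq_max kd orbT.
by rewrite leq_max kd.
Qed.

Section FixedOperator.
Variable T : E -> E.
Hypothesis hT : T_BUCO B T.

Let bT : bounded_on_berg B T. Proof. by case: hT. Qed.
Let T_berg f : berg B f -> berg B (T f). Proof. by case: bT => h _ _; exact: h. Qed.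

Lemma T_input_tail (e : R) : 0 < e -> exists d, forall g, L2 B g ->
  normB B (T (bproj B (coord_tail d g))) <= e * normB B g.
Proof.
move=> e0; have [S hS TS] := T_approx hB hT e0.
have [d Hd] := toeplitz_polynomial_input hS; exists d => g Lg.
have [Lt nt] := coord_tail_L2 hB d Lg; have bP := bproj_berg hB Lt.
have S0 : S (bproj B (coord_tail d g)) = 0.
  apply: Hd => // z k Oz kd; rewrite (bproj_kernel hB _ Lt Oz) ipB_embed.
  rewrite -[cintegral _ _]/(@cint _ (borel R n) R sigma bOm (fun w => coord_tail d g w k * Num.conj (K z w))).
  have e1 w : Om w -> coord_tail d g w k * Num.conj (K z w) = 0.
    by move=> _; rewrite /coord_tail kd mul0r.
  by rewrite (@eq_cint _ (borel R n) R sigma bOm _ (fun=> 0) e1) cint0.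
have := TS _ bP; rewrite S0 subr0 => h; apply: le_trans h _.
apply: ler_wpM2l; first exact: ltW.
exact: le_trans (bproj_norm hB Lt) nt.
Qed.

(* By duality, [<T P h, v>] pairs [h] with [T^* v], whose [k]-th coordinate at [w] is the
   conjugate of [<T (K_w e_k), v>]. *)
Lemma far_estimate (x : V) (t : R) (d : nat) (eta Lam : R) (h : E) : Om x -> 0 <= eta -> 0 <= Lam ->
  (lam B x t <= Lam%:E)%E ->
  (forall w k, D x t w -> (k < d)%N -> normB B (T (Ke B w k)) <= eta * normK w) ->
  L2 B h -> (forall w k, Om w -> ~ (D x t w /\ (k < d)%N) -> h w k = 0) ->
  normB B (T (bproj B h)) ^+ 2 <= d%:R * eta ^+ 2 * Lam * normB B h ^+ 2.
Proof.
move=> Ox eta0 Lam0 lamL HT Lh h0.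
have bP := bproj_berg hB Lh; have bv := T_berg bP.
set v := T (bproj B h) in bv *.
have [ba Ha] := adjointP ph sb (@berg_L2 _ _ B) (bt_complete hB) bT bv.
set a := adjoint _ _ _ _ in ba Ha.
have La := berg_L2 ba.
(* [h] lives on the ball and in the first [d] coordinates, so against it [a], the image of [v] under
   the adjoint of T, may be cut down to [g]. *)
pose g := coord_head d (smul (ball_ind B t x) a).
have [Ls _] : L2 B (smul (ball_ind B t x) a) /\ normB B (smul (ball_ind B t x) a) <= 1 * normB B a.
  apply: (smul_L2 hB (ball_ind_measurable hB _ Ox) ler01 _ La) => z Oz.
  by rewrite ger0_norm ?ball_ind_ge0// ball_ind_le1.
have Lg : L2 B g := coord_head_L2 d Ls.
have v0 := normB_ge0 B v; have hn0 := normB_ge0 B h.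
have ak w k : D x t w -> (k < d)%N -> cabs (a w k) <= eta * normK w * normB B v.
  move=> wD kd; have [Ow _] := wD; have bK := Ke_berg hB k Ow.
  rewrite (repro hB k ba Ow) (ph_conj phb bK ba) cabs_conj -(Ha _ bK).
  apply: le_trans (cauchy_schwarz phb (T_berg bK) bv) _.
  by apply: ler_wpM2r => //; exact: HT.
have ng : normB B g ^+ 2 <= d%:R * eta ^+ 2 * Lam * normB B v ^+ 2.
  rewrite -lee_fin (normB_sqr Lg).
  pose c := d%:R * eta ^+ 2 * normB B v ^+ 2.
  have c0 : 0 <= c by rewrite mulr_ge0 ?sqr_ge0// mulr_ge0 ?sqr_ge0.
  apply: (@le_trans _ _ (c%:E * lam B x t)%E); last first.
    rewrite (_ : d%:R * eta ^+ 2 * Lam * normB B v ^+ 2 = c * Lam); last by rewrite /c; ring.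
    by rewrite (EFinM c Lam); apply: lee_wpmul2l; rewrite ?lee_fin.
  have mb : measurable_fun bOm ((fun w => (ball_ind B t x w * normK w ^+ 2)%:E) : borel R n -> \bar R).
    apply/measurable_EFinP; apply: measurable_funM; first exact: ball_ind_measurable.
    by apply: measurable_funX; exact: normK_measurable.
  have b0 w : Om w -> (0 <= (ball_ind B t x w * normK w ^+ 2)%:E)%E.
    by move=> _; rewrite lee_fin; exact: mulr_ge0 (ball_ind_ge0 _ _ _ _) (sqr_ge0 _).
  rewrite -(@ge0_integralZl_EFin _ (borel R n) R sigma bOm mOm _ b0 mb _ c0).
  apply: (@ge0_le_integral _ (borel R n) R sigma bOm mOm).
  - by move=> w _; exact: sqnorm_l2_ge0.
  - by have /L2P[_ mg _] := Lg; exact: (measurable_sqnorm mg).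
  - exact: measurable_funeM.
  move=> w Ow; rewrite sqnorm_coord_head -EFinM lee_fin.
  have [wD|nD] := pselect (D x t w); last first.
    rewrite (ball_ind_out nD) mul0r mulr0 big1// => k _.
    by rewrite /smul (ball_ind_out nD) toC0 mul0r cabs0 expr0n.
  apply: (@le_trans _ _ (\sum_(k < d) (eta * normK w * normB B v) ^+ 2)).
    apply: ler_sum => k _; rewrite /smul (ball_ind_in wD) toC1 mul1r.
    exact: ler_sqr_ge0 (cabs_ge0 _) (ak w k wD (ltn_ord k)).
  rewrite sumr_const card_ord (ball_ind_in wD) mul1r -mulr_natl.
  rewrite le_eqVlt; apply/orP; left; apply/eqP; rewrite /c; ring.
have hg : normB B v ^+ 2 <= normB B h * normB B g.
  have e1 : ipB B v v = ipB B h g.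
    rewrite {1}/v (Ha _ bP) (ph_conj phb ba bP) ((bprojP hB Lh).2 _ ba) (ph_conj ph Lh La) conjCK !ipBE.
    apply: (@eq_cint _ (borel R n) R sigma bOm) => w Ow; congr (limn (series _)); apply/funext => k.
    have [[wD kd]|nD] := pselect (D x t w /\ (k < d)%N); last by rewrite (h0 w k Ow nD) !mul0r.
    by rewrite /g /coord_head kd /smul (ball_ind_in wD) toC1 mul1r.
  rewrite (ph_nrm phb bv) in e1; have := cauchy_schwarz ph Lh Lg.
  by rewrite -e1 cabs_toC (ger0_norm (sqr_ge0 _)).
(* The bound for [g] involves the norm of [v] itself, which cancels against the left side. *)
have gen (p q r c : R) : 0 <= p -> 0 <= q -> 0 <= r -> 0 <= c -> p ^+ 2 <= q * r -> r ^+ 2 <= c * p ^+ 2 ->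
    p ^+ 2 <= c * q ^+ 2.
  move=> p0 q0 r0 c0 h1 h2; have [->|pn] := eqVneq p 0.
    by rewrite expr0n mulr_ge0// sqr_ge0.
  have pp : 0 < p ^+ 2 by rewrite exprn_gt0// lt_def pn.
  rewrite -(ler_pM2r pp).
  apply: (@le_trans _ _ ((q * r) ^+ 2)).
    by rewrite -expr2; apply: ler_sqr_ge0 => //; exact: sqr_ge0.
  rewrite exprMn (_ : c * q ^+ 2 * p ^+ 2 = q ^+ 2 * (c * p ^+ 2)); last by ring.
  by apply: ler_wpM2l => //; exact: sqr_ge0.
apply: (gen _ _ (normB B g)) => //; first exact: normB_ge0.
by rewrite mulr_ge0// mulr_ge0 ?sqr_ge0.
Qed.

End FixedOperator.

End Compactness.

Lemma weighted_pieces_le (R : realType) (e N M s1 s2 s3 F Q : R) : 0 <= e -> 0 <= N -> 0 <= M -> 0 <= F ->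
  s1 <= e / 4 * F -> s2 <= N * F -> s3 <= N * Q ->
  2 * s1 + (2 * (e / (8 * (N + 1))) * s2 + 2 * M * s3) <= e * F + 2 * M * N * Q.
Proof.
move=> e0 N0 M0 F0 h1 h2 h3.
have N1 : 0 < N + 1 by rewrite ltr_wpDl.
have h4 : 2 * M * s3 <= 2 * M * N * Q.
  by rewrite -[leRHS]mulrA; apply: ler_wpM2l => //; exact: mulr_ge0.
have h5 : 2 * (e / (8 * (N + 1))) * s2 <= e / 4 * F.
  apply: (@le_trans _ _ (2 * (e / (8 * (N + 1))) * (N * F))).
    by apply: ler_wpM2l => //; rewrite mulr_ge0// divr_ge0// mulr_ge0// ltW.
  have -> : 2 * (e / (8 * (N + 1))) * (N * F) = (e / 4 * F) * (N / (N + 1)).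
    by field; rewrite gt_eqF.
  apply: ler_piMr; first by rewrite mulr_ge0// divr_ge0.
  by rewrite ler_pdivrMr// mul1r lerDl.
have h6 : 0 <= e * F by exact: mulr_ge0.
lra.
Qed.

Lemma double_sum_le (R : realType) (p q A m Q : R) :
  p <= A / 4 + m * Q -> q <= A / 4 -> 2 * p + 2 * q <= A + 2 * m * Q.
Proof.
move=> h1 h2; lra.
Qed.

Lemma piece_sum_le (R : realType) (u v w y z a b : R) : u <= 2 * v + 2 * w -> w <= a * y + b * z ->
  u <= 2 * v + (2 * a * y + 2 * b * z).
Proof.
move=> h1 h2; rewrite -!mulrA; lra.
Qed.

(** * Reduction to finitely many coordinates on one ball *)

Section CompactnessEstimate.
Context (R : realType) (n : nat) (B : bergman_data R n).
Hypothesis hB : bergman_type B.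
Local Notation C := (Cplx R).
Local Notation V := (Cspace R n).
Local Notation E := (V -> nat -> C).
Local Notation Om := (Om B).
Local Notation sigma := (sigma B).
Local Notation dist := (dist B).
Local Notation normK := (normK B).
Local Notation D := (D B).
Local Notation bOm := (Om : set (borel R n)).
Local Notation mOm := (mOm hB).
Implicit Types (f g : E).

Let ph := L2_prehilbert mOm.
Let sL : is_subspace (L2 B) := L2_subspace mOm.

Definition near_part (d : nat) (rho : R) f : E :=
  coord_head d (smul (fun w => 1 - far_ind B rho 0 w) f).

Lemma near_part_L2 d rho f : L2 B f -> L2 B (near_part d rho f).
Proof.
move=> Lf; apply: (coord_head_L2 hB).
have [] // := smul_L2 hB (p := fun w => 1 - far_ind B rho 0 w) _ ler01 _ Lf.
  apply: measurable_funB; first exact: measurable_cst.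
  exact: (far_ind_measurable hB _ (bt_0 hB)).
move=> z Oz; have := far_ind_ge0 B rho 0 z; have := far_ind_le1 B rho 0 z => h1 h2.
by rewrite ler_norml; apply/andP; split; lra.
Qed.

Lemma near_part_smul d rho p f : near_part d rho (smul p f) = smul p (near_part d rho f).
Proof.
apply/funext => w; apply/funext => k; rewrite /near_part /coord_head /smul.
by case: ifP => _; [rewrite mulrCA|rewrite mulr0].
Qed.

Lemma sum_near_part d rho m psi N L f : loc_family B m psi N L -> 0 <= N -> L2 B f ->
  \sum_(j < m) normB B (near_part d rho (smul (psi j) f)) ^+ 2 <= N * normB B (near_part d rho f) ^+ 2.
Proof.
move=> lf N0 Lf; rewrite (eq_bigr (fun j : 'I_m => normB B (smul (psi j) (near_part d rho f)) ^+ 2)).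
  exact: (sum_smul hB lf N0 (near_part_L2 d rho Lf)).
by move=> j _; rewrite near_part_smul.
Qed.

(** Some member is at least 1 at each point, so |f|^2 is at most the infinite sum of the |psi_j
    f|^2; bounds on finite sums, uniform in [m], pass to it. *)
Lemma norm_le_of_pieces (psi : nat -> V -> R) f (X : R) :
  (forall w, Om w -> exists j, 1 <= psi j w) -> (forall j, L2 B (smul (psi j) f)) -> L2 B f ->
  (forall m, \sum_(j < m) normB B (smul (psi j) f) ^+ 2 <= X) -> normB B f ^+ 2 <= X.
Proof.
move=> cov Ls Lf HX; rewrite -lee_fin (normB_sqr Lf).
have ms j : measurable_fun bOm ((fun w => sqnorm_l2 (smul (psi j) f w)) : borel R n -> \bar R).
  by have /L2P[_ mc _] := Ls j; exact: (measurable_sqnorm mc).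
apply: (@le_trans _ _ (\int[sigma]_(w in Om) (\sum_(j <oo) sqnorm_l2 (smul (psi j) f w)))%E).
  apply: (@ge0_le_integral _ (borel R n) R sigma bOm mOm).
  - by move=> w _; exact: sqnorm_l2_ge0.
  - by have /L2P[_ mf _] := Lf; exact: (measurable_sqnorm mf).
  - by apply: (@ge0_emeasurable_sum _ (borel R n)) => [j w _ _|j _]; [exact: sqnorm_l2_ge0|exact: ms].
  move=> w Ow; have [j hj] := cov w Ow.
  apply: (@le_trans _ _ (sqnorm_l2 (smul (psi j) f w))).
    rewrite sqnorm_smul -[leLHS]mul1e; apply: lee_wpmul2r; first exact: sqnorm_l2_ge0.
    by rewrite lee_fin -(expr1n R 2); apply: ler_sqr_ge0.
  apply: le_trans (nneseries_lim_ge j.+1 _); last by move=> i _ _; exact: sqnorm_l2_ge0.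
  rewrite big_nat_recr //= leeDr//; apply: sume_ge0 => i _; exact: sqnorm_l2_ge0.
rewrite (@integral_nneseries _ (borel R n) R sigma bOm mOm _ ms); last first.
  by move=> j w _; exact: sqnorm_l2_ge0.
apply: lime_le.
  by apply: is_cvg_nneseries => j _ _; exact: int_sqnorm_ge0.
near=> m; rewrite big_mkord; under eq_bigr do rewrite -(normB_sqr (Ls _)).
by rewrite sumEFin lee_fin.
Unshelve. all: by end_near.
Qed.

Section FixedOperator.
Variable T : E -> E.
Hypothesis hT : T_BUCO B T.
Hypothesis hv : forall k, vanishes B (fun z => normB B (T (Ke B z k)) / normK z).

Let bT : bounded_on_berg B T. Proof. by case: hT. Qed.
Let T_berg f : berg B f -> berg B (T f). Proof. by case: bT => h _ _; exact: h. Qed.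

(** A piece centred far away is small by [far_estimate]; a piece centred near 0 is supported in the
    ball of radius [rho], so its first [d] coordinates equal its near part. The high coordinates are
    negligible in both cases. *)
Lemma piece_estimate (a r : R) : 0 < a -> 0 < r -> exists d : nat, exists rho : R,
  exists2 M : R, 0 <= M & forall x h, Om x -> L2 B h ->
    (forall w k, Om w -> 3 * r <= dist x w -> h w k = 0) ->
    normB B (T (bproj B h)) ^+ 2 <= a * normB B h ^+ 2 + M * normB B (near_part d rho h) ^+ 2.
Proof.
move=> a0 r0; have a4 : 0 < a / 4 by rewrite divr_gt0.
have s0 : 0 < Num.sqrt (a / 4) by rewrite sqrtr_gt0.
have [d Hd] := T_input_tail hB hT s0.
have [Lam Lam0 HLam] := lam_uniform hB (3 * r).
have q0 : 0 < d%:R * Lam + 1 :> R by rewrite ltr_wpDl// mulr_ge0.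
pose eta := Num.sqrt (a / 4 / (d%:R * Lam + 1)).
have eta0 : 0 < eta by rewrite sqrtr_gt0 divr_gt0.
have eta2 : d%:R * eta ^+ 2 * Lam <= a / 4.
  rewrite /eta sqr_sqrtr; last exact: ltW (divr_gt0 a4 q0).
  move: (a / 4) (d%:R : R) a4 q0 => b D b0 q0.
  rewrite (_ : D * (b / (D * Lam + 1)) * Lam = b * ((D * Lam) / (D * Lam + 1))); last by field; rewrite gt_eqF.
  by apply: ler_piMr (ltW b0) _; rewrite ler_pdivrMr// mul1r lerDl.
clearbody eta.
have [R0 HR0] := @at_infty_ord _ _ B d (fun k z => normB B (T (Ke B z k)) / normK z < eta) (fun k => hv k eta0).
have [_ Alin [M0 M00 HM] _] := good_T_BUCO hB hT.
(* Centres are split at distance R0 + 3r from 0. Beyond it the support of radius 3r stays where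
   kernel images are small; within it the support stays in radius R0 + 6r. *)
exists d; exists (R0 + 6 * r); exists (2 * M0 ^+ 2); first by rewrite mulr_ge0// sqr_ge0.
move=> x h Ox Lh h0.
have Lhd := coord_head_L2 hB d Lh; have [Ltl _] := coord_tail_L2 hB d Lh.
have LA f : L2 B f -> L2 B (T (bproj B f)).
  by move=> Lf; exact: berg_L2 (T_berg (bproj_berg hB Lf)).
have split : T (bproj B h) = T (bproj B (coord_head d h)) + T (bproj B (coord_tail d h)).
  have := Alin 1 _ _ Lhd Ltl; rewrite !scale1r /= => <-.
  by rewrite coord_headE subrK.
have tail : normB B (T (bproj B (coord_tail d h))) ^+ 2 <= a / 4 * normB B h ^+ 2.
  have -> : a / 4 * normB B h ^+ 2 = (Num.sqrt (a / 4) * normB B h) ^+ 2.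
    by rewrite exprMn (sqr_sqrtr (ltW a4)).
  exact: ler_sqr_ge0 (normB_ge0 _ _) (Hd h Lh).
have hdh : normB B (coord_head d h) <= normB B h.
  rewrite -[leRHS]mul1r; apply: (L2_scale mOm Lh _ ler01 _).2.
    by have /L2P[_ mh _] := Lhd.
  by move=> z _; rewrite expr1n mul1e; exact: sqnorm_coord_head_le.
have key : normB B (T (bproj B (coord_head d h))) ^+ 2 <=
    a / 4 * normB B h ^+ 2 + M0 ^+ 2 * normB B (near_part d (R0 + 6 * r) h) ^+ 2.
  have [far|near] := ltP (R0 + 3 * r) (dist x 0).
    apply: (@le_trans _ _ (a / 4 * normB B h ^+ 2)); last first.
      by rewrite lerDl mulr_ge0 ?sqr_ge0.
    apply: (@le_trans _ _ (d%:R * eta ^+ 2 * Lam * normB B (coord_head d h) ^+ 2)).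
      apply: (far_estimate hB hT Ox (ltW eta0) Lam0 (HLam x Ox) _ Lhd).
        move=> w k [Ow xw] kd; have nw := normK_gt0 hB Ow.
        have Rw : R0 < dist w 0.
          have := dist_tri hB Ox Ow (bt_0 hB); lra.
        by have := HR0 w Ow Rw k kd => /ltW; rewrite ler_pdivrMr.
      move=> w k Ow nD; rewrite /coord_head; case: ifPn => // kd; apply: h0 => //.
      by rewrite leNgt; apply/negP => xw; apply: nD; split; [split|].
    apply: ler_pM; [by rewrite mulr_ge0// mulr_ge0 ?sqr_ge0|exact: sqr_ge0|exact: eta2|].
    exact: ler_sqr_ge0 (normB_ge0 _ _) hdh.
  have -> : normB B (near_part d (R0 + 6 * r) h) = normB B (coord_head d h).
    apply: normB_ext => z Oz; apply/funext => k; rewrite /near_part /coord_head.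
    case: ifP => // _; rewrite /smul; have [hz|hz] := leP (3 * r) (dist x z).
      by rewrite (h0 z k Oz hz) mulr0.
    rewrite far_ind_out ?subr0 ?toC1 ?mul1r// => -[_ /=].
    have := dist_tri hB (bt_0 hB) Ox Oz; rewrite (distC hB (bt_0 hB) Ox); lra.
  apply: (@le_trans _ _ ((M0 * normB B (coord_head d h)) ^+ 2)).
    exact: ler_sqr_ge0 (normB_ge0 _ _) (HM _ Lhd).
  by rewrite exprMn lerDr mulr_ge0 ?sqr_ge0// ltW.
rewrite split; apply: le_trans (sqnrmD_le ph (LA _ Lhd) (LA _ Ltl)) _.
apply: double_sum_le; first by rewrite mulrAC.
by rewrite mulrAC.
Qed.

Theorem compactness_estimate (e : R) : 0 < e -> exists d : nat, exists rho : R,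
  exists2 M : R, 0 <= M & forall f, berg B f ->
    normB B (T f) ^+ 2 <= e * normB B f ^+ 2 + M * normB B (near_part d rho f) ^+ 2.
Proof.
move=> e0; have [N N0 HN] := net_family hB.
have e4 : 0 < e / 4 by rewrite divr_gt0.
have [_ _ _ lT] := good_T_BUCO hB hT.
have [L L0 HL] := lT N N0 _ e4.
have N1 : 0 < N + 1 by rewrite ltr_wpDl.
(* Since r is at least 1 and at least N/L, the variation constant N/r^2 of the net family is at most
   L. *)
pose r := 1 + N / L; have r0 : 0 < r by rewrite ltr_wpDr// divr_ge0// ltW.
have NrL : N / r ^+ 2 <= L.
  rewrite ler_pdivrMr ?exprn_gt0// -ler_pdivrMl// mulrC.
  have h : 0 <= N / L by rewrite divr_ge0// ltW.
  rewrite /r; move: (N / L) h => q q0; nra.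
clearbody r; have [x [J [xO cov fam]]] := HN r r0.
set psi := (fun i w => if J i then tent B r (x i) w else 0) in fam.
have fam' m : loc_family B m psi N L.
  have [h1 h2 h3] := fam m; split => // z w Oz Ow; apply: le_trans (h3 z w Oz Ow) _.
  by apply: ler_wpM2r; [exact: sqr_ge0|].
have a0 : 0 < e / (8 * (N + 1)) by rewrite divr_gt0// mulr_gt0.
have [d [rho [M M0 HM]]] := piece_estimate a0 r0.
exists d; exists rho; exists (2 * M * N); first by rewrite mulr_ge0// mulr_ge0.
move=> f bf; have Lf := berg_L2 bf; have LT := berg_L2 (T_berg bf).
have Ls g j : L2 B g -> L2 B (smul (psi j) g).
  by move=> Lg; exact: (loc_family_L2 hB (fam' j.+1) (ltnSn j) Lg).1.
apply: (norm_le_of_pieces (psi := psi) _ _ LT) => [w Ow|j|m]; last first.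
- have hc := HL m psi (fam' m) f Lf; rewrite /= (bproj_id hB bf) in hc.
  have hs := sum_smul hB (fam' m) N0 Lf.
  have hn := sum_near_part d rho (fam' m) N0 Lf.
  have pw (j : 'I_m) : normB B (smul (psi j) (T f)) ^+ 2 <=
      2 * normB B (smul (psi j) (T f) - T (bproj B (smul (psi j) f))) ^+ 2 +
      (2 * (e / (8 * (N + 1))) * normB B (smul (psi j) f) ^+ 2 +
       2 * M * normB B (near_part d rho (smul (psi j) f)) ^+ 2).
    have Lp := Ls f j Lf; have LTp := berg_L2 (T_berg (bproj_berg hB Lp)).
    have h1 := sqnrmD_le ph (subspaceB sL (Ls _ j LT) LTp) LTp; rewrite subrK in h1.
    have h2 : normB B (T (bproj B (smul (psi j) f))) ^+ 2 <=
       e / (8 * (N + 1)) * normB B (smul (psi j) f) ^+ 2 +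
       M * normB B (near_part d rho (smul (psi j) f)) ^+ 2.
      apply: (HM (x j) _ (xO j) Lp) => w k Ow hw.
      by rewrite /smul /psi; case: (J j); rewrite ?(tent_out r0 hw) toC0 mul0r.
    exact: piece_sum_le h1 h2.
  apply: (@le_trans _ _ (\sum_(j < m) (2 * normB B (smul (psi j) (T f) - T (bproj B (smul (psi j) f))) ^+ 2 +
      (2 * (e / (8 * (N + 1))) * normB B (smul (psi j) f) ^+ 2 +
       2 * M * normB B (near_part d rho (smul (psi j) f)) ^+ 2)))).
    by apply: ler_sum => j _; exact: pw.
  rewrite !big_split /= -!mulr_sumr.
  exact: weighted_pieces_le (ltW e0) N0 M0 (sqr_ge0 _) hc hs hn.
- exact: Ls.
- by have [j [Jj hj]] := cov w Ow; exists j; rewrite /psi Jj.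
Qed.

End FixedOperator.

End CompactnessEstimate.

(** * Complete, closed and totally bounded sets *)

Section TotallyBounded.
Context (R : realType) (X : Type) (S A : set X) (d : X -> X -> R).
Hypotheses (hd : is_metric S d) (hc : mcomplete S d) (AS : A `<=` S).
Hypothesis Aclosed : forall x, S x -> (forall e : R, 0 < e -> exists2 y, A y & d y x < e) -> A x.
Hypothesis Atb : forall e : R, 0 < e -> exists N : nat, exists2 c : nat -> X, (forall i, S (c i)) &
  forall y, A y -> exists2 i, (i < N)%N & d (c i) y < e.

Let invS_small (e : R) : 0 < e -> exists N, forall k, (N <= k)%N -> (k.+1%:R : R)^-1 < e.
Proof.
move=> e0; have [N _ HN] := near_infty_natSinv_lt (PosNum e0).
by exists N => k Nk; exact: HN.
Qed.

(* A set without finite subcover can be cut down to one of small diameter; the centres of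
   the successive cuts form a Cauchy sequence. *)
Theorem totally_bounded_mcompact : mcompact S d A.
Proof.
have [d0 _ dC dT] := hd; split => // F Fo Fcov; apply: contrapT => nfin.
pose bad P := ~ exists G : set (set X), [/\ finite_set G, G `<=` F & P `<=` \bigcup_(U in G) U].
have bad_ex P : bad P -> exists y, P y.
  move=> bP; apply: contrapT => nP; apply: bP; exists set0; split => //.
  by move=> y Py; case: nP; exists y.
have [a0 Aa0] := bad_ex A nfin.
(* If every cell of a finite net had a finite subcover, so would the whole set. The conditions on
   the set are premises inside, so that choice gives a total function of the index and the set. *)
have shrink (kP : nat * set X) : exists c, kP.2 `<=` A -> bad kP.2 ->
    S c /\ bad (kP.2 `&` [set y | d c y < (kP.1.+1%:R)^-1]).
  case: kP => k P /=; apply: contrapT => nc.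
  have [PA bP] : P `<=` A /\ bad P.
    by split; apply: contrapT => h; apply: nc; exists a0 => // h'.
  have [N [c cS Hc]] := @Atb (k.+1%:R)^-1 ltac:(by rewrite invr_gt0).
  have fin i : exists G : set (set X), [/\ finite_set G, G `<=` F &
      P `&` [set y | d (c i) y < (k.+1%:R)^-1] `<=` \bigcup_(U in G) U].
    apply: contrapT => h; apply: nc; exists (c i) => _ _; split; [exact: cS|exact: h].
  have [G HG] := boolp.choice fin; apply: bP; exists (\bigcup_(i in `I_N) G i); split.
  - by apply: bigcup_finite => [|i _]; [exact: finite_II|have [] := HG i].
  - by move=> U [i _ GU]; have [_ h _] := HG i; exact: h.
  move=> y Py; have [i iN yi] := Hc y (PA y Py); have [_ _ h] := HG i.
  have [U GU Uy] := h y (conj Py yi); by exists U => //; exists i.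
have [c Hc] := boolp.choice shrink.
pose P := fix P k := if k is k'.+1 then P k' `&` [set y | d (c (k', P k')) y < (k'.+1%:R)^-1] else A.
have HP k : P k `<=` A /\ bad (P k).
  elim: k => [|k [PA bP]]; first by split.
  split; first by move=> y [Py _]; exact: PA.
  by have [] := Hc (k, P k) PA bP.
pose u k := c (k, P k).
have uS k : S (u k) by have [PA bP] := HP k; have [] := Hc (k, P k) PA bP.
have Pdec k m : (k <= m)%N -> P m `<=` P k.
  by elim: m => [|m IH]; [rewrite leqn0 => /eqP -> |rewrite leq_eqVlt => /predU1P[->//|/IH h] y [/h]].
have Pu k m y : (k < m)%N -> P m y -> d (u k) y < (k.+1%:R)^-1.
  by move=> km Py; have [_] := Pdec _ _ km y Py.
have cu e : 0 < e -> exists N, forall i j, (N <= i)%N -> (N <= j)%N -> d (u i) (u j) < e.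
  move=> e0; have e2 : 0 < e / 2 by rewrite divr_gt0.
  have [N HN] := invS_small e2; exists N => i j Ni Nj.
  have [PA bP] := HP (maxn i j).+1; have [y Py] := bad_ex _ bP.
  have Sy := AS (PA y Py).
  have h1 := Pu i _ y (leq_maxl i j : (i < (maxn i j).+1)%N) Py.
  have h2 := Pu j _ y (leq_maxr i j : (j < (maxn i j).+1)%N) Py.
  have := dT _ _ _ (uS i) Sy (uS j); rewrite (dC _ _ Sy (uS j)).
  have := lt_trans h1 (HN i Ni); have := lt_trans h2 (HN j Nj); lra.
have [x Sx ux] := hc uS cu.
have close e : 0 < e -> exists k, P k.+1 `<=` [set y | d x y < e].
  move=> e0; have e2 : 0 < e / 2 by rewrite divr_gt0.
  have [N HN] := invS_small e2; have [N' HN'] := ux _ e2.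
  exists (maxn N N') => y Py; have [PA _] := HP (maxn N N').+1; have Sy := AS (PA y Py).
  have h1 := Pu (maxn N N') _ y (ltnSn _) Py.
  have := dT _ _ _ Sx (uS (maxn N N')) Sy; rewrite (dC _ _ Sx (uS _)).
  have := HN' _ (leq_maxr N N'); have := lt_trans h1 (HN _ (leq_maxl N N')) => /=; lra.
have Ax : A x.
  apply: Aclosed => // e e0; have [k Pk] := close e e0; have [PA bP] := HP k.+1.
  have [y Py] := bad_ex _ bP; exists y; first exact: PA.
  by rewrite (dC _ _ (AS (PA y Py)) Sx); exact: Pk.
have [U FU Ux] := Fcov x Ax; have [US Uo] := Fo U FU; have [r r0 Ur] := Uo x Ux.
have [k Pk] := close r r0; have [PA bP] := HP k.+1; apply: bP; exists [set U]; split.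
- exact: finite_set1.
- by move=> _ ->.
- by move=> y Py; exists U => //; apply: Ur; split; [exact: AS (PA y Py)|exact: Pk].
Qed.

End TotallyBounded.

(** Each new point depends on all previous ones, so the recursion builds the finite list of points
    chosen so far and the sequence is read off from it. *)
Lemma separated_sequence (R : realType) (X : Type) (S : set X) (d : X -> X -> R) (e : R) x0 : S x0 ->
  (forall N (c : nat -> X), (forall i, S (c i)) ->
    exists2 x, S x & forall i, (i < N)%N -> e <= d x (c i)) ->
  exists2 c : nat -> X, (forall i, S (c i)) & forall i j, (i < j)%N -> e <= d (c j) (c i).
Proof.
move=> S0 H.
have ex (l : seq X) : exists x, (forall i, S (nth x0 l i)) ->
    S x /\ forall i, (i < size l)%N -> e <= d x (nth x0 l i).
  have [h|h] := pselect (forall i, S (nth x0 l i)); last by exists x0.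
  by have [x Sx xl] := H (size l) _ h; exists x.
have [F HF] := boolp.choice ex.
pose L := fix L k := if k is k'.+1 then rcons (L k') (F (L k')) else [::].
have sL k : size (L k) = k by elim: k => [|k IH] //=; rewrite size_rcons IH.
have SL k i : S (nth x0 (L k) i).
  elim: k i => [|k IH] i; first by rewrite nth_nil.
  rewrite /= nth_rcons; case: ifP => _; first exact: IH.
  by case: ifP => _ //; have [] := HF (L k) (IH).
have nL i j : (i < j)%N -> nth x0 (L j) i = F (L i).
  elim: j => [//|j IH]; rewrite ltnS leq_eqVlt /= nth_rcons sL => /predU1P[->|ij].
    by rewrite ltnn eqxx.
  by rewrite ij IH.
exists (fun k => F (L k)) => [i|i j ij]; first by have [] := HF (L i) (SL i).
have [_ h] := HF (L j) (SL j); rewrite -(nL i j ij); apply: h; by rewrite sL.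
Qed.

Lemma filter_ord T (F : set_system T) (FF : Filter F) (Q : nat -> set T) (d : nat) :
  (forall i, F (Q i)) -> F [set m | forall i, (i < d)%N -> Q i m].
Proof.
move=> FQ; elim: d => [|d IH]; first by apply: filterS filterT.
apply: filterS (filterI IH (FQ d)) => m [/= h1 h2] i.
by rewrite ltnS leq_eqVlt => /predU1P[->|/h1].
Qed.

(** * Compactness of the closed image of the unit ball *)

Section ImageOfBall.
Context (R : realType) (n : nat) (B : bergman_data R n).
Hypothesis hB : bergman_type B.
Local Notation C := (Cplx R).
Local Notation V := (Cspace R n).
Local Notation E := (V -> nat -> C).
Local Notation Om := (Om B).
Local Notation sigma := (sigma B).
Local Notation normK := (normK B).
Local Notation bOm := (Om : set (borel R n)).
Local Notation mOm := (mOm hB).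
Implicit Types (f g : E).

Let ph := L2_prehilbert mOm.
Let sb : is_subspace (berg B) := berg_subspace mOm.
Let phb : prehilbert (berg B) (normB B) (ipB B) := berg_prehilbert mOm.

Definition null_seq (u : nat -> C) := forall e : R, 0 < e -> \forall s \near \oo, cabs (u s) < e.

Lemma null_seq_lin (u v : nat -> C) (c : C) : null_seq u -> null_seq v -> null_seq (fun s => c * u s + v s).
Proof.
move=> hu hv e e0; have e2 : 0 < e / 2 by rewrite divr_gt0.
have c1 : 0 < cabs c + 1 by rewrite ltr_wpDl// cabs_ge0.
have ec : 0 < e / 2 / (cabs c + 1) by rewrite divr_gt0.
near=> s; apply: le_lt_trans (cabsD _ _) _; rewrite cabsM (splitr e); apply: ler_ltD; last first.
  by near: s; exact: hv.
apply: le_trans (mulr_frac_le (ltW e2) (cabs_ge0 c)).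
rewrite mulrCA; apply: ler_wpM2l; first exact: cabs_ge0.
by rewrite ltW//; near: s; exact: hu.
Unshelve. all: by end_near.
Qed.

Lemma berg_dense_zero (a : nat -> V) h k :
  (forall z (d : R), Om z -> 0 < d -> exists i, box (a i) d z) -> (forall i, Om (a i)) ->
  berg B h -> (forall i, h (a i) k = 0) -> forall z, Om z -> h z k = 0.
Proof.
move=> da aO [_ ha _] h0 z Oz; apply: contrapT => /eqP; rewrite -cabs_eq0 => n0.
have p0 : 0 < cabs (h z k) by rewrite lt_def n0 cabs_ge0.
have hk : (fun z => ip_l2 (h z) (e_ k)) = (fun z => h z k) by apply/funext => u; rewrite ip_l2_e.
have hc : {for z, continuous ((fun u => h u k) : V -> C)}.
  by apply: (@analytic_continuous R n B C (fun u => h u k)) => //; rewrite -hk; exact: ha.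
have hn : nbhs (h z k : C) [set y : C | cabs (y - h z k) < cabs (h z k)] by apply/nbhs_cabsP; exists (cabs (h z k)).
have h1 : nbhs (z : V) [set u : V | cabs (h u k - h z k) < cabs (h z k)] := hc _ hn.
have [d d0 H] := proj1 (nbhs_boxP _ _) h1; have [i zi] := da z d Oz d0.
by have := H _ (box_sub zi); rewrite /= h0 sub0r cabsN ltxx.
Qed.

(** For a bounded sequence the vectors against which it tends weakly to 0 form a closed subspace. It
    contains the kernels at a dense set of points, and a continuous function orthogonal to these
    vanishes. *)
Lemma differences_weakly_null (g : nat -> E) (M : R) (a : nat -> V) : 0 <= M ->
  (forall z (d : R), Om z -> 0 < d -> exists i, box (a i) d z) -> (forall i, Om (a i)) ->
  (forall s, berg B (g s)) -> (forall s, normB B (g s) <= M) ->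
  (forall i k, null_seq (fun s => g s (a i) k)) -> forall z k, Om z -> null_seq (fun s => g s z k).
Proof.
move=> M0 da aO bg gM ga.
pose Y : set E := [set h | berg B h /\ null_seq (fun s => ipB B (g s) h)].
have b0 : berg B 0 by case: sb.
suff YH : berg B `<=` Y.
  move=> z k Oz; have [_] := YH _ (Ke_berg hB k Oz).
  by rewrite (_ : (fun s => ipB _ _ _) = (fun s => g s z k))//; apply/funext => s; rewrite -(repro hB k (bg s) Oz).
apply: (dense_of_trivial_perp ph sb (@berg_L2 _ _ B) (bt_complete hB)).
- split.
    by split=> // e e0; near=> s; rewrite (ip0r phb (bg s)) cabs0.
  move=> x f h [bf fv] [bh hv]; have bxf := subspaceZ x sb bf.
  split; first exact: (subspaceD sb bxf bh).
  rewrite (_ : (fun s => _) = (fun s => Num.conj x * ipB B (g s) f + ipB B (g s) h)).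
    exact: null_seq_lin.
  by apply/funext => s; rewrite (ipDr phb bxf bh (bg s)) (ipZr phb _ bf (bg s)).
- by move=> f [].
- move=> f bf Hf; split => // e e0.
  have e2 : 0 < e / 2 by rewrite divr_gt0.
  have M1 : 0 < M + 1 by rewrite ltr_wpDl.
  have ec : 0 < e / 2 / (M + 1) by rewrite divr_gt0.
  have [h [bh hv] fh] := Hf _ ec; have bfh := subspaceB sb bf bh.
  near=> s; rewrite -(subrK h f) (ipDr phb bfh bh (bg s)).
  apply: le_lt_trans (cabsD _ _) _; rewrite (splitr e); apply: ler_ltD; last by near: s; exact: hv.
  apply: le_trans (cauchy_schwarz phb (bg s) bfh) _.
  apply: le_trans (mulr_frac_le (ltW e2) M0); rewrite mulrCA.
  by apply: ler_pM; rewrite ?normB_ge0 ?(ltW fh).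
- move=> f bf Hf; apply: (berg_ext bf b0) => z k Oz.
  apply: (berg_dense_zero da aO bf) => // i.
  have bK := Ke_berg hB k (aO i).
  rewrite (repro hB k bf (aO i)) (ph_conj phb bK bf) (Hf (Ke B (a i) k)) ?rmorph0//.
  split => //; rewrite (_ : (fun s => ipB _ _ _) = (fun s => g s (a i) k))//.
  by apply/funext => s; rewrite -(repro hB k (bg s) (aO i)).
Unshelve. all: by end_near.
Qed.

(** Pairs of terms with pointwise vanishing differences take the place of a weakly convergent
    subsequence, so that no weak limit vector has to be constructed. *)
Lemma weakly_null_differences (f : nat -> E) (M : R) : 0 <= M ->
  (forall m, berg B (f m)) -> (forall m, normB B (f m) <= M) ->
  exists p q : nat -> nat, (forall s, (p s < q s)%N) /\
    forall z k, Om z -> null_seq (fun s => (f (p s) - f (q s)) z k).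
Proof.
move=> M0 bf fM; have [a aO da] := euclidean_dense_seq hB.
have [F [UF sF]] := @ultraFilterLemma nat \oo _.
have FF : ProperFilter F := @ultra_proper _ F UF.
pose l i k := ulim F (fun m => f m (a i) k).
have Hl i k : uconv F (fun m => f m (a i) k) (l i k).
  apply: (@ulimP _ _ F UF _ (normK (a i) * M)) => m.
  apply: le_trans (berg_pointwise hB k (bf m) (aO i)) _.
  by apply: ler_wpM2l => //; exact: ltW (normK_gt0 hB (aO i)).
(* At stage [s] only the first [s] points and coordinates are tested: finitely many conditions, each
   holding on a set of the ultrafilter. *)
pose Q s m := forall i, (i < s)%N -> forall k, (k < s)%N -> cabs (f m (a i) k - l i k) < (s.+1%:R)^-1.
have FQ s : F (Q s).
  apply: (@filter_ord _ F _ (fun i m => forall k, (k < s)%N -> cabs (f m (a i) k - l i k) < (s.+1%:R)^-1)) => i.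
  by apply: (@filter_ord _ F _ (fun k m => cabs (f m (a i) k - l i k) < (s.+1%:R)^-1)) => k; apply: Hl; rewrite invr_gt0.
have ex s : exists pq : nat * nat, [/\ (pq.1 < pq.2)%N, Q s pq.1 & Q s pq.2].
  have [p Qp] := filter_ex (FQ s).
  have Fp : F [set m | (p < m)%N] by apply: sF; exact: nbhs_infty_gt.
  by have [q [Qq pq]] := filter_ex (filterI (FQ s) Fp); exists (p, q).
have [pq Hpq] := boolp.choice ex.
exists (fun s => (pq s).1); exists (fun s => (pq s).2).
split; first by move=> s; have [] := Hpq s.
apply: (@differences_weakly_null _ (M + M) a) => //.
- exact: addr_ge0.
- by move=> s; exact: subspaceB sb (bf _) (bf _).
- move=> s; apply: le_trans (nrm_triangleB phb (bf _) (bf _)) _; exact: lerD.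
move=> i k e e0; have e2 : 0 < e / 2 by rewrite divr_gt0.
near=> s; have [_ h1 h2] := Hpq s.
have si : (i < s)%N by near: s; exact: nbhs_infty_gt.
have sk : (k < s)%N by near: s; exact: nbhs_infty_gt.
have hs : (s.+1%:R)^-1 < e / 2 by near: s; exact: near_infty_natSinv_lt (PosNum e2).
have := lt_trans (h1 i si k sk) hs; have := lt_trans (h2 i si k sk) hs.
rewrite -[(_ - _) _ _]/(f (pq s).1 (a i) k - f (pq s).2 (a i) k).
have := cabs_distD (l i k) (f (pq s).1 (a i) k) (f (pq s).2 (a i) k).
rewrite [cabs (l i k - _)]cabsC; lra.
Unshelve. all: by end_near.
Qed.

Lemma near_part_vanish d rho (g : nat -> E) (M : R) : 0 <= M -> (forall m, berg B (g m)) ->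
  (forall m, normB B (g m) <= M) -> (forall z k, Om z -> null_seq (fun s => g s z k)) ->
  forall e, 0 < e -> \forall s \near \oo, normB B (near_part B d rho (g s)) ^+ 2 < e.
Proof.
move=> M0 bg gM gn e e0.
have d1 : 0 < d%:R + 1 :> R by rewrite ltr_wpDl.
have ed : 0 < e / (d%:R + 1) by rewrite divr_gt0.
have H := @filter_ord _ \oo eventually_filter (fun k s =>
  (\int[sigma]_(w in Om) (near_sq B rho (g s) k w)%:E < (e / (d%:R + 1))%:E)%E) d.
apply: filterS (H _) => [s Hs|k]; last first.
  by apply: (@near_sq_vanish _ _ _ hB g rho M k) => // w Ow e' e'0; exact: gn.
rewrite -lte_fin (normB_sqr (near_part_L2 hB d rho (berg_L2 (bg s)))).
have -> : (\int[sigma]_(w in Om) sqnorm_l2 (near_part B d rho (g s) w) =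
  \sum_(k < d) \int[sigma]_(w in Om) (near_sq B rho (g s) k w)%:E)%E.
  rewrite -(@ge0_integral_sum _ (borel R n) R sigma bOm mOm _ (fun (k : 'I_d) w => (near_sq B rho (g s) k w)%:E)).
  - apply: eq_integral => w _; rewrite sqnorm_coord_head sumEFin; congr EFin; apply: eq_bigr => k _.
    rewrite /smul /near_sq cabsM cabs_toC exprMn; congr (_ * _).
    by rewrite /far_ind; case: asbool; rewrite ?subrr ?subr0 ?normr0 ?normr1 ?expr0n ?expr1n.
  - by move=> k; apply/measurable_EFinP; exact: (near_sq_measurable hB _ _ (berg_L2 (bg s))).
  - by move=> k w _; rewrite lee_fin; exact: near_sq_ge0.
apply: (@le_lt_trans _ _ (\sum_(k < d) (e / (d%:R + 1))%:E)%E).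
  by apply: lee_sum => k _; exact: ltW (Hs k (ltn_ord k)).
rewrite sumEFin lte_fin sumr_const card_ord -[_ *+ d](@mulr_natl R _ d).
rewrite mulrCA -[ltRHS]mulr1 ltr_pM2l//.
by rewrite ltr_pdivrMr// mul1r ltrDl.
Qed.

Section FixedOperator.
Variable T : E -> E.
Hypothesis hT : T_BUCO B T.
Hypothesis hv : forall k, vanishes B (fun z => normB B (T (Ke B z k)) / normK z).

Let bT : bounded_on_berg B T. Proof. by case: hT. Qed.
Let T_berg f : berg B f -> berg B (T f). Proof. by case: bT => h _ _; exact: h. Qed.

(** The compactness estimate is applied to differences of norm at most 2 whose near part tends to 0:
    the two terms are at most 4 e^2/16 and e^2/4, together e^2/2. *)
Lemma image_separated (e : R) (c : nat -> E) : 0 < e -> (forall i, berg B (c i)) ->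
  (forall i, normB B (c i) <= 1) -> exists i j, (i < j)%N /\ normB B (T (c j) - T (c i)) < e.
Proof.
move=> e0 bc c1; have e16 : 0 < e ^+ 2 / 16 by rewrite divr_gt0// exprn_gt0.
have [d [rho [M M0 HM]]] := compactness_estimate hB hT hv e16.
have [p [q [pq Hpq]]] := weakly_null_differences ler01 bc c1.
have M1 : 0 < M + 1 by rewrite ltr_wpDl.
have eM : 0 < e ^+ 2 / 4 / (M + 1) by rewrite !divr_gt0// exprn_gt0.
have bg s := subspaceB sb (bc (p s)) (bc (q s)).
have ng s : normB B (c (p s) - c (q s)) <= 2.
  apply: le_trans (nrm_triangleB phb (bc _) (bc _)) _.
  by rewrite (_ : 2 = 1 + 1 :> R)//; exact: lerD.
have [s Hs] := filter_ex (near_part_vanish d rho (ler0n R 2) bg ng Hpq eM).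
exists (p s); exists (q s); split; first exact: pq.
have Tsub : T (c (p s) - c (q s)) = T (c (p s)) - T (c (q s)).
  have [_ Tl _] := bT; have := Tl (-1) _ _ (bc (q s)) (bc (p s)).
  by rewrite !scaleN1r addrC => ->; rewrite addrC.
have h := HM _ (bg s); rewrite Tsub in h.
rewrite (nrm_distC phb (T_berg (bc _)) (T_berg (bc _))) -(ltr_pXn2r (n := 2)) ?nnegrE ?normB_ge0 ?(ltW e0)//.
apply: le_lt_trans h _.
have h1 : e ^+ 2 / 16 * normB B (c (p s) - c (q s)) ^+ 2 <= e ^+ 2 / 16 * 2 ^+ 2.
  apply: ler_wpM2l; [exact: ltW e16|exact: ler_sqr_ge0 (normB_ge0 _ _) (ng s)].
have h2 : M * normB B (near_part B d rho (c (p s) - c (q s))) ^+ 2 <= e ^+ 2 / 4.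
  apply: le_trans (ler_wpM2l M0 (ltW Hs)) _.
  rewrite mulrCA; apply: ler_piMr; first by rewrite divr_ge0// sqr_ge0.
  by rewrite ler_pdivrMr// mul1r lerDl.
apply: le_lt_trans (lerD h1 h2) _.
have e2 : 0 < e ^+ 2 by rewrite exprn_gt0.
rewrite (_ : 2 ^+ 2 = 4 :> R); last by rewrite -natrX.
move: e2; move: (e ^+ 2) => x x0; lra.
Qed.

Theorem kernel_image_compact : compact_on_berg B T.
Proof.
pose d (f g : E) := normB B (f - g).
have dC f g : berg B f -> berg B g -> d f g = d g f by exact: (nrm_distC phb).
have dT f g h : berg B f -> berg B g -> berg B h -> d f h <= d f g + d g h.
  by move=> bf bg bh; exact: (nrm_dist phb).
have b0 : berg B 0 by case: sb.
apply: totally_bounded_mcompact.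
- split.
  + by move=> f g _ _; exact: normB_ge0.
  + move=> f g bf bg; split => [h|->]; last by rewrite subrr (nrm0 phb).
    by apply/eqP; rewrite -subr_eq0; apply/eqP; exact: berg_definite hB _ (subspaceB sb bf bg) h.
  + exact: dC.
  + exact: dT.
- exact: bt_complete.
- by move=> y [].
- move=> x bx Hx; split => // e e0; have e2 : 0 < e / 2 by rewrite divr_gt0.
  have [y [by_ Hy] yx] := Hx _ e2; have [w [bw w1 yw]] := Hy _ e2.
  exists w; split => //; apply: le_lt_trans (dT _ y _ bx by_ (T_berg bw)) _.
  by rewrite (splitr e); apply: ltrD => //; rewrite dC.
(* The set is the closure of the image of the ball. If it had no finite e-net, the image would have
   no finite e/2-net and would contain an e/2-separated sequence. *)
move=> e e0; have e2 : 0 < e / 2 by rewrite divr_gt0.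
apply: contrapT => nnet.
have [c [c1 c2]] : exists c : nat -> E, (forall i, berg B (c i) /\ normB B (c i) <= 1) /\
    forall i j, (i < j)%N -> e / 2 <= d (T (c j)) (T (c i)).
  have [||c h1 h2] := @separated_sequence R E [set f | berg B f /\ normB B f <= 1]
      (fun f g => d (T f) (T g)) (e / 2) 0; last by exists c.
    by split => //; rewrite (nrm0 phb).
  move=> N c cS; apply: contrapT => nx; apply: nnet; exists N; exists (fun i => T (c i)).
    by move=> i; have [bci _] := cS i; exact: T_berg.
  move=> y [by_ Hy]; have [x [bx x1 yx]] := Hy _ e2.
  apply: contrapT => ni; apply: nx; exists x => // i iN; rewrite leNgt; apply/negP => hi.
  have [bci _] := cS i; apply: ni; exists i => //.
  apply: le_lt_trans (dT _ (T x) _ (T_berg bci) (T_berg bx) by_) _.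
  by rewrite (splitr e); apply: ltrD; rewrite dC //; exact: T_berg.
have [i [j [ij h]]] := image_separated e2 (fun i => (c1 i).1) (fun i => (c1 i).2).
by have := c2 i j ij; rewrite leNgt => /negP; apply.
Qed.

End FixedOperator.

End ImageOfBall.

Theorem theorem4p6 (R : realType) (n : nat) (n_gt0 : (0 < n)%N)
    (B : bergman_data R n) (hB : bergman_type B)
    (T : (Cspace R n -> nat -> Cplx R) -> (Cspace R n -> nat -> Cplx R))
    (hT : T_BUCO B T) :
  ((forall i k : nat,
      limf_esup (fun z => (cabs (ip_l2 (berezin B T z (e_ k)) (e_ i)))%:E)
        (at_infty B) = 0%E)
   <->
   (forall f, berg B f ->
      limf_esup (fun z => (normB B (translate B T z f))%:E)
        (at_infty B) = 0%E))
  /\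
  ((forall i k : nat,
      (fun z => ip_l2 (berezin B T z (e_ k)) (e_ i)) @ at_infty B --> (0 : Cplx R))
   -> compact_on_berg B T).
Proof.
have bT : bounded_on_berg B T by case: hT.
have [b0 _] := berg_subspace (mOm hB); have O0 := bt_0 hB.
have strong : (forall i k, vanishes B (fun z => cabs (ip_l2 (berezin B T z (e_ k)) (e_ i)))) ->
    forall a k, Om B a -> vanishes B (fun z => normB B (translate B T z (Ke B a k))).
  move=> bz a k Oa; apply: (translate_strong_limit hB hT Oa) => b i Ob.
  by apply: (translate_weak_limit hB bT _ _ Oa Ob) => j l; exact: bz.
split.
  split=> [bz f bf|tz i k].
    have bz' i k := proj1 (limf_esup_at_infty B (fun z => cabs_ge0 _)) (bz i k).
    apply/(limf_esup_at_infty B (fun z => normB_ge0 B _)); split; first by have [] := bz' 0%N 0%N.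
    by apply: (translate_dense hB bT _ bf); apply: strong => i k; have [] := bz' i k.
  have tz' f bf := proj1 (limf_esup_at_infty B (fun z => normB_ge0 B _)) (tz f bf).
  (* An upper limit equal to 0 contains the fact that [Om] has points arbitrarily far from 0; the
     hypothesis for the zero function already supplies it. *)
  apply/(limf_esup_at_infty B (fun z => cabs_ge0 _)); split; first by have [] := tz' 0 b0.
  by apply: (berezin_vanish hB bT) => f bf; have [] := tz' f bf.
move=> bz; apply: (kernel_image_compact hB hT) => k.
apply: (kernel_image_vanish hB bT); apply: strong => // i j.
exact: vanishes_cvg (bz i j).
Qed.
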